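(* Let $F$ be a sequentially complete locally convex space. Then the space $\dot{\mathcal{B}}^*_\eta(\mathbb{R}^d;F)$ is isomorphic to $\dot{\mathcal{B}}^*_\eta\,\varepsilon\,F$ as a locally convex space (in both the Beurling case $*=(M_p)$ and the Roumieu case $*=\{M_p\}$).
   Context: $\mathbb{N}=\{0,1,2,\dots\}$, $\mathbb{Z}_+=\{1,2,\dots\}$. $\{M_p\}_{p\in\mathbb{N}}$ and $\{A_p\}_{p\in\mathbb{N}}$ are sequences of positive numbers with $M_0=M_1=A_0=A_1=1$. Both satisfy (M.1) $M_p^2\leq M_{p-1}M_{p+1}$ for $p\in\mathbb{Z}_+$, and (M.2) there are $c_0,H\geq 1$ with $M_p\leq c_0H^p\min_{0\leq q\leq p}\{M_{p-q}M_q\}$ for $p\in\mathbb{N}$ (and likewise for $A_p$, with the same constants). $M_p$ satisfies (M.5): there exists $q>0$ and $c_0\geq1$ such that $\sum_{j=p+1}^{\infty}M_{j-1}^q/M_j^q\leq c_0\,p\,M_p^q/M_{p+1}^q$ for all $p\in\mathbb{Z}_+$. $A_p$ satisfies (M.6): there are $c_0,L_0\geq1$ with $p!\leq c_0L_0^pA_p$ for all $p\in\mathbb{N}$. For a multi-index $\alpha$, $M_\alpha=M_{|\alpha|}$, $D^\alpha=(-i)^{|\alpha|}\partial^\alpha$. $A(\rho)=\sup_{p\in\mathbb{N}}\log_+(\rho^p/A_p)$. $\mathfrak{R}$ is the set of positive sequences $(r_p)_{p\in\mathbb{Z}_+}$ increasing to $\infty$; $R_\alpha=\prod_{j=1}^{|\alpha|}r_j$.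 $\eta$ is an ultrapolynomially bounded weight function of class $\dagger$: a continuous $\eta:\mathbb{R}^d\to(0,\infty)$ such that there exist $C,\tau>0$ (Beurling case), resp. for every $\tau>0$ there exists $C>0$ (Roumieu case), with $\eta(x+h)\leq C\eta(x)e^{A(\tau|h|)}$ for all $x,h\in\mathbb{R}^d$. $C_\eta=\{\varphi\in C(\mathbb{R}^d)\mid\lim_{|x|\to\infty}\varphi(x)/\eta(x)=0\}$ with norm $\|\varphi\|_{\infty,\eta}=\|\varphi/\eta\|_{L^\infty}$. For $m>0$, $\mathcal{D}^{M_p,m}_{C_\eta}$ is the space of $\varphi$ with $D^\alpha\varphi\in C_\eta$ for all $\alpha$ and $\sup_\alpha m^{|\alpha|}\|D^\alpha\varphi\|_{\infty,\eta}/M_\alpha<\infty$. $\dot{\mathcal{B}}^{(M_p)}_\eta=\varprojlim_{m\to\infty}\mathcal{D}^{M_p,m}_{C_\eta}$ and $\dot{\mathcal{B}}^{\{M_p\}}_\eta=\varinjlim_{m\to0}\mathcal{D}^{M_p,m}_{C_\eta}$ (the latter coincides topologically with the projective limit over $(r_p)\in\mathfrak{R}$ of the Banach spaces defined by the norms $\sup_\alpha\|D^\alpha\varphi\|_{\infty,\eta}/(M_\alpha R_\alpha)$). $\dot{\mathcal{B}}^*_\eta(\mathbb{R}^d;F)$ is the space of all smooth $F$-valued functions $\boldsymbol{\varphi}$ on $\mathbb{R}^d$ such that: (i) for each $r>0$ (resp. $(r_p)\in\mathfrak{R}$) and each continuous seminorm $q$ on $F$, $q_r(\boldsymbol\varphi)=\sup_{x,\alpha}q\big(r^{|\alpha|}D^\alpha\boldsymbol\varphi(x)/(\eta(x)M_\alpha)\big)<\infty$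 (resp. $q_{(r_p)}(\boldsymbol\varphi)=\sup_{x,\alpha}q\big(D^\alpha\boldsymbol\varphi(x)/(\eta(x)M_\alpha R_\alpha)\big)<\infty$); (ii) for every $\varepsilon>0$, continuous seminorm $q$ on $F$ and $r>0$ (resp. $(r_p)\in\mathfrak{R}$) there is a compact $K\subseteq\mathbb{R}^d$ with $\sup_{\alpha}\sup_{x\in\mathbb{R}^d\setminus K}q\big(r^{|\alpha|}D^\alpha\boldsymbol\varphi(x)/(\eta(x)M_\alpha)\big)\leq\varepsilon$ (resp. $\sup_{\alpha}\sup_{x\in\mathbb{R}^d\setminus K}q\big(D^\alpha\boldsymbol\varphi(x)/(\eta(x)M_\alpha R_\alpha)\big)\leq\varepsilon$). It carries the topology given by the seminorms $q_r$ (resp. $q_{(r_p)}$). For locally convex spaces $X,Y$, $X'_c$ is the dual of $X$ with the topology of uniform convergence on compact convex circled sets; $X\varepsilon Y$ is the space of bilinear functionals on $X'_c\times Y'_c$ that are hypocontinuous with respect to the equicontinuous subsets of $X'$ and $Y'$, with the topology of uniform convergence on products of equicontinuous subsets. Canonically $X\varepsilon Y\cong\mathcal{L}_\epsilon(Y'_c,X)$, the space of continuous linear maps $Y'_c\to X$ with the topology of uniform convergence on equicontinuous subsets of $Y'$. *)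

(* Defs.v *)
From HB Require Import structures.
From mathcomp Require Import all_boot all_order all_algebra.
From mathcomp Require Import complex.
From mathcomp Require Import all_classical all_reals all_analysis.

Set Implicit Arguments.
Unset Strict Implicit.
Unset Printing Implicit Defensive.

Import Order.TTheory GRing.Theory Num.Theory.
Import numFieldTopology.Exports numFieldNormedType.Exports.

Local Open Scope classical_set_scope.
Local Open Scope ring_scope.
Local Open Scope complex_scope.

(** * Locally convex spaces *)

(* The library's [tvsType] is locally convex but need not be separated. *)
HB.mixin Record isHausdorff T & Topological T := {
  hausdorffP : hausdorff_space T
}.

#[short(type="lcsType")]
HB.structure Definition Lcs (K : numDomainType) := {E of Tvs K E & isHausdorff E}.

Notation normc := ComplexField.Normc.normc.

Section complex_norm.
Variable R : realType.
Implicit Types z : R[i].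

Lemma normcC z : `|z| = (normc z)%:C. Proof. by case: z. Qed.

Lemma normc_ge0 z : 0 <= normc z.
Proof. by case: z => a b; exact: sqrtr_ge0. Qed.

Lemma normc_le_real z : 0 <= z -> (normc z)%:C = z.
Proof. by move=> z0; rewrite -normcC ger0_norm. Qed.

Lemma normc_real (x : R) : normc x%:C = `|x|.
Proof. by rewrite /= expr0n addr0 sqrtr_sqr. Qed.

HB.instance Definition _ :=
  isHausdorff.Build R[i]^o (@norm_hausdorff R[i] R[i]^o).

End complex_norm.

Lemma finite_ub (R : realType) (T : Type) (Q : set T) (g : T -> R) : finite_set Q ->
  exists2 m, 0 < m & forall p, Q p -> g p < m.
Proof.
move=> /finite_setP[n]; elim: n Q => [|n IH] Q.
  by rewrite II0 card_eq0 => /eqP ->; exists 1.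
move=> /eq_cardSP[q Qq /IH[m m0 hm]].
exists (Num.max m (g q + 1)); first by rewrite lt_max m0.
move=> p Qp; rewrite lt_max; have [->|pq] := pselect (p = q).
  by rewrite ltrDl ltr01 orbT.
by rewrite hm.
Qed.

Section seminorm.
Variables (R : realType) (V : lmodType R[i]).

Definition seminorm (p : V -> R) : Prop :=
  (forall x y, p (x + y) <= p x + p y) /\
  (forall a x, p (a *: x) = normc a * p x).

Lemma seminorm0 p : seminorm p -> p 0 = 0.
Proof.
by move=> [_ pZ]; rewrite -(scale0r (0 : V)) pZ ComplexField.Normc.normc0 mul0r.
Qed.

Lemma seminormN p x : seminorm p -> p (- x) = p x.
Proof.
by move=> [_ pZ]; rewrite -scaleN1r pZ -rmorphN normc_real normrN normr1 mul1r.
Qed.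

Lemma seminorm_ge0 p x : seminorm p -> 0 <= p x.
Proof.
move=> sp; have [pD _] := sp; have := pD x (- x).
by rewrite subrr seminorm0// (seminormN _ sp) -mulr2n pmulrn_lge0.
Qed.

Lemma seminorm_scale (a b : R) p : 0 <= a -> 0 <= b -> seminorm p ->
  seminorm (fun v => a * p v / b).
Proof.
move=> a0 b0 [pD pZ]; split=> [x y|c x].
  by rewrite -mulrDl -mulrDr ler_wpM2r ?invr_ge0// ler_wpM2l.
by rewrite pZ (mulrCA a) -(mulrA (normc c)).
Qed.

Lemma seminorm_sup (I : Type) (S : set I) (p : I -> V -> R) :
  (forall i, S i -> seminorm (p i)) ->
  (forall v, has_ubound [set p i v | i in S]) ->
  seminorm (fun v => sup [set p i v | i in S]).
Proof.
move=> sp bp; have [->|S0] := eqVneq S set0.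
  by split=> [x y|a x]; rewrite !image_set0 sup0 ?addr0 ?mulr0.
have neS v : [set p i v | i in S] !=set0 by apply/image_nonempty/set0P.
have hs v : has_sup [set p i v | i in S] by split.
have ub i v : S i -> p i v <= sup [set p i v | i in S].
  by move=> Si; apply: sup_upper_bound => //; exists i.
have ge0 v : 0 <= sup [set p i v | i in S].
  case/set0P: S0 => i Si; apply: le_trans (ub i v Si).
  by apply: seminorm_ge0; exact: sp.
split=> [x y|a x].
  apply: ge_sup => // _ [i Si <-]; have [pD _] := sp i Si.
  by apply: le_trans (pD _ _) _; rewrite lerD// ub.
have le a' x' : sup [set p i (a' *: x') | i in S]
    <= normc a' * sup [set p i x' | i in S].
  apply: ge_sup => // _ [i Si <-]; have [_ ->] := sp i Si.
  by rewrite ler_wpM2l ?normc_ge0// ub.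
apply/eqP; rewrite eq_le le/=.
have [->|a0] := eqVneq a 0; first by rewrite ComplexField.Normc.normc0 mul0r.
have na : 0 < normc a.
  rewrite lt_def normc_ge0 andbT; apply: contra a0 => /eqP.
  by move/ComplexField.Normc.eq0_normc ->.
rewrite -ler_pdivlMl// -ComplexField.Normc.normcV.
by rewrite -[in leLHS](scale1r x) -(mulVf a0) -scalerA le.
Qed.

End seminorm.

(* The space [V] with the locally convex topology generated by [P]. *)
Definition seminormed (R : realType) (V : lmodType R[i]) (P : set (V -> R))
  (hP : P `<=` @seminorm R V) : Type := V.

Section seminormed_topology.
Variables (R : realType) (V : lmodType R[i]) (P : set (V -> R)).
Variable hP : P `<=` @seminorm R V.
Notation E := (seminormed hP).

HB.instance Definition _ := GRing.Lmodule.copy E V.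

Definition seminorm_ball (Q : set (V -> R)) (e : R) (x : V) : set V :=
  [set y | forall p, Q p -> p (y - x) < e].

Definition seminormed_nbhs (x : E) : set_system E :=
  [set U | exists Q : set (V -> R), exists e : R,
    [/\ finite_set Q, Q `<=` P, 0 < e & seminorm_ball Q e x `<=` U]].

HB.instance Definition _ := hasNbhs.Build E seminormed_nbhs.

Let ballxx Q e x : Q `<=` P -> 0 < e -> seminorm_ball Q e x x.
Proof.
by move=> QP e0 p Qp; rewrite subrr seminorm0//; exact/hP/QP.
Qed.

Let finite_gap Q e x y : finite_set Q -> seminorm_ball Q e x y ->
  exists2 e', 0 < e' & forall p, Q p -> p (y - x) + e' <= e.
Proof.
move=> finQ yx; have [m m0 hm] := finite_ub (fun p => (e - p (y - x))^-1) finQ.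
exists m^-1; first by rewrite invr_gt0.
move=> p Qp; rewrite addrC -lerBrDr.
have g0 : 0 < e - p (y - x) by rewrite subr_gt0 yx.
by rewrite -[leRHS]invrK lef_pV2 ?posrE ?invr_gt0// ltW// hm.
Qed.

Let nbhs_filter (x : E) : ProperFilter (nbhs x).
Proof.
apply: Build_ProperFilter_ex.
  by move=> U [Q [e [finQ QP e0 sub]]]; exists x; apply: sub; exact: ballxx.
split.
- by exists set0, 1; split.
- move=> U W [Q [e [finQ QP e0 sub]]] [Q' [e' [finQ' QP' e0' sub']]].
  exists (Q `|` Q'), (Num.min e e'); split => //.
  + by rewrite finite_setU.
  + by move=> p [/QP|/QP'].
  + by rewrite lt_min e0 e0'.
  + move=> y yx; split; [apply: sub|apply: sub'] => p Qp.
      by have /= := yx p (or_introl Qp); rewrite lt_min => /andP[].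
    by have /= := yx p (or_intror Qp); rewrite lt_min => /andP[].
- move=> U W UW [Q [e [finQ QP e0 sub]]]; exists Q, e; split => //.
  exact: subset_trans UW.
Qed.

Let nbhs_singleton (x : E) (U : set E) : nbhs x U -> U x.
Proof.
by move=> [Q [e [finQ QP e0 sub]]]; apply: sub; exact: ballxx.
Qed.

Let ball_nbhs Q e x y : finite_set Q -> Q `<=` P ->
  seminorm_ball Q e x y -> nbhs (y : E) (seminorm_ball Q e x).
Proof.
move=> finQ QP yx; have [e' e'0 he'] := finite_gap finQ yx.
exists Q, e'; split => // z zy p Qp; have [pD _] := hP (QP _ Qp).
rewrite -(subrKA y z); apply: le_lt_trans (pD _ _) _.
by apply: lt_le_trans (he' _ Qp); rewrite addrC ltrD2l zy.
Qed.

Let nbhs_nbhs (x : E) (U : set E) : nbhs x U -> nbhs x (nbhs^~ U).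
Proof.
move=> [Q [e [finQ QP e0 sub]]]; exists Q, e; split => // y yx.
have [Q' [e' [? ? ? sub']]] := ball_nbhs finQ QP yx.
by exists Q', e'; split => //; exact: subset_trans sub.
Qed.

HB.instance Definition _ :=
  Nbhs_isNbhsTopological.Build E nbhs_filter nbhs_singleton nbhs_nbhs.

Let add_continuous : continuous (fun x : E * E => x.1 + x.2).
Proof.
move=> [x y] U [Q [e [finQ QP e0 sub]]].
exists (seminorm_ball Q (e / 2) x, seminorm_ball Q (e / 2) y).
  by split; exists Q, (e / 2); split => //; rewrite divr_gt0.
move=> [x' y'] [/= xx yy]; apply: sub => p Qp; have [pD _] := hP (QP _ Qp).
rewrite opprD addrACA; apply: le_lt_trans (pD _ _) _.
by rewrite [ltRHS]splitr ltrD// ?xx ?yy.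
Qed.

Let scale_continuous : continuous (fun z : R[i]^o * E => z.1 *: z.2).
Proof.
move=> [a x] U [Q [e [finQ QP e0 sub]]].
have [m m0 hm] := finite_ub (fun p => p x) finQ.
pose e1 := Num.min 1 (e / 2 / (normc a + 1)).
have na1 : 0 < normc a + 1 by rewrite ltr_pwDr// normc_ge0.
have e10 : 0 < e1 by rewrite lt_min ltr01 !divr_gt0.
pose d := e / 2 / (m + 1).
have m1 : 0 < m + 1 by rewrite addr_gt0.
have d0 : 0 < d by rewrite !divr_gt0.
exists (ball (a : R[i]^o) d%:C, seminorm_ball Q e1 x).
  split; last by exists Q, e1; split.
  by apply: nbhsx_ballx; rewrite ltcR.
move=> [b y] [/=]; rewrite -ball_normE /= => ab yx; apply: sub => p Qp.
have sp := hP (QP _ Qp); have [pD pZ] := sp.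
have -> : b *: y - a *: x = (b - a) *: y + a *: (y - x).
  by rewrite scalerBl scalerBr addrA subrK.
apply: le_lt_trans (pD _ _) _; rewrite !pZ [ltRHS]splitr.
have ab' : normc (b - a) < d by rewrite -ltcR -normcC distrC.
have py : p y < m + 1.
  rewrite -(subrK x y); apply: le_lt_trans (pD _ _) _; rewrite addrC.
  by rewrite ltrD ?hm//; apply: lt_le_trans (yx _ Qp) _; rewrite ge_min lexx.
apply: ltr_leD.
  apply: (@le_lt_trans _ _ (normc (b - a) * (m + 1))).
    by rewrite ler_wpM2l ?normc_ge0// ltW.
  by rewrite -ltr_pdivlMr.
apply: (@le_trans _ _ (normc a * (e / 2 / (normc a + 1)))).
  rewrite ler_wpM2l ?normc_ge0// ltW//.
  by apply: lt_le_trans (yx _ Qp) _; rewrite ge_min lexx orbT.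
by rewrite mulrCA ler_piMr ?divr_ge0 ?(ltW e0)// ler_pdivrMr// mul1r lerDl.
Qed.

Let locally_convex :
  exists2 B : set_system E, (forall b, b \in B -> convex_set b) & basis B.
Proof.
exists [set B | exists Q e x,
    [/\ finite_set Q, Q `<=` P & B = seminorm_ball Q e x]].
  move=> B; rewrite inE => -[Q [e [x [finQ QP ->]]]] y z l.
  rewrite !inE => yx zx p Qp; have sp := hP (QP _ Qp); have [pD pZ] := sp.
  have [t0 t1] : 0 <= l%:num /\ 0 <= 1 - l%:num by rewrite subr_ge0.
  set t := l%:num in t0 t1.
  change (p (t *: (y : V) + (1 - t) *: (z : V) - x) < e).
  have -> : t *: (y : V) + (1 - t) *: (z : V) - x =
      t *: ((y : V) - x) + (1 - t) *: ((z : V) - x).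
    rewrite !scalerBr addrACA -opprD -scalerDl.
    by rewrite (addrC t) subrK scale1r.
  apply: le_lt_trans (pD _ _) _; rewrite !pZ.
  have nt : normc t + normc (1 - t) = 1.
    by apply: complexI; rewrite rmorphD/= !normc_le_real// addrC subrK.
  rewrite -[ltRHS]mul1r -nt mulrDl.
  have [t00|t00] := eqVneq (normc t) 0.
    move: nt; rewrite t00 add0r => ->.
    by rewrite !mul0r !add0r !mul1r; exact: zx.
  rewrite ltr_leD// ?ltr_pM2l ?yx//.
    by rewrite lt_def t00 normc_ge0.
  by rewrite ler_wpM2l ?normc_ge0// ltW// zx.
split.
  move=> _ [Q [e [x [finQ QP ->]]]]; rewrite openE => y yx.
  exact: ball_nbhs.
move=> x U [Q [e [finQ QP e0 sub]]]; exists (seminorm_ball Q e x) => //.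
by split; [exists Q, e, x|exact: ballxx].
Qed.

(* This factory only provides the uniform structure. *)
HB.instance Definition _ := PreTopologicalLmod_isTvs.Build R[i] E
  add_continuous scale_continuous locally_convex.
HB.instance Definition _ :=
  PreTopologicalNmodule_isTopologicalNmodule.Build E add_continuous.
HB.instance Definition _ :=
  TopologicalNmodule_isTopologicalLmodule.Build R[i] E scale_continuous.
HB.instance Definition _ := Uniform_isTvs.Build R[i] E locally_convex.

End seminormed_topology.

Section subspace.
Variables (R : realType) (V : lmodType R[i]).

Definition is_subspace (S : set V) : Prop :=
  S 0 /\ forall a u v, S u -> S v -> S (a *: u + v).

Record subspace (S : set V) (hS : is_subspace S) :=
  Subspace { subval : V; subvalP : S subval }.

Variables (S : set V) (hS : is_subspace S).

HB.instance Definition _ := gen_eqMixin (subspace hS).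
HB.instance Definition _ := gen_choiceMixin (subspace hS).

Lemma subval_inj : injective (@subval S hS).
Proof. by move=> [u Su] [v Sv] /= uv; subst v; congr Subspace. Qed.

Let subD u v : S u -> S v -> S (u + v).
Proof. by move=> Su Sv; have := hS.2 1 u v Su Sv; rewrite scale1r. Qed.

Let subZ a u : S u -> S (a *: u).
Proof. by move=> Su; have := hS.2 a u 0 Su hS.1; rewrite addr0. Qed.

Let subN u : S u -> S (- u).
Proof. by move=> /(subZ (-1)); rewrite scaleN1r. Qed.

Definition sub0 : subspace hS := Subspace hS hS.1.
Definition subadd (u v : subspace hS) : subspace hS :=
  Subspace hS (subD (subvalP u) (subvalP v)).
Definition subopp (u : subspace hS) : subspace hS := Subspace hS (subN (subvalP u)).
Definition subscale a (u : subspace hS) : subspace hS :=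
  Subspace hS (subZ a (subvalP u)).

Let addA : associative subadd.
Proof. by move=> u v w; apply: subval_inj => /=; rewrite addrA. Qed.
Let addC : commutative subadd.
Proof. by move=> u v; apply: subval_inj => /=; rewrite addrC. Qed.
Let add0 : left_id sub0 subadd.
Proof. by move=> u; apply: subval_inj => /=; rewrite add0r. Qed.
Let addN : left_inverse sub0 subopp subadd.
Proof. by move=> u; apply: subval_inj => /=; rewrite addNr. Qed.

HB.instance Definition _ :=
  GRing.isZmodule.Build (subspace hS) addA addC add0 addN.

Let scaleA a b u : subscale a (subscale b u) = subscale (a * b) u.
Proof. by apply: subval_inj => /=; rewrite scalerA. Qed.
Let scale1 : left_id 1 subscale.
Proof. by move=> u; apply: subval_inj => /=; rewrite scale1r. Qed.
Let scaleDr : right_distributive subscale +%R.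
Proof. by move=> a u v; apply: subval_inj => /=; rewrite scalerDr. Qed.
Let scaleDl u : {morph subscale^~ u : a b / a + b}.
Proof. by move=> a b; apply: subval_inj => /=; rewrite scalerDl. Qed.

HB.instance Definition _ := GRing.Zmodule_isLmodule.Build R[i] (subspace hS)
  scaleA scale1 scaleDr scaleDl.

Lemma subval0 : subval (0 : subspace hS) = 0. Proof. by []. Qed.
Lemma subvalD (u v : subspace hS) : subval (u + v) = subval u + subval v.
Proof. by []. Qed.
Lemma subvalZ a (u : subspace hS) : subval (a *: u) = a *: subval u.
Proof. by []. Qed.

End subspace.

(** * Duals and the epsilon-product *)

Section equicontinuity.
Variable R : realType.

Lemma entourage_normc (e : R) : 0 < e ->
  entourage [set xy : R[i]^o * R[i]^o | normc (xy.1 - xy.2) < e].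
Proof.
move=> e0; rewrite -entourage_ballE; exists e%:C; first by rewrite /= ltcR.
move=> [x y]; rewrite /= -ball_normE /ball_/= normcC ltcR.
by [].
Qed.

Lemma compact_ub (X : topologicalType) (I : Type) (S : set I)
    (g : I -> X -> R[i]^o) (K : set X) : compact K -> equicontinuous S g ->
    (forall x, K x -> exists m : R, forall i, S i -> normc (g i x) <= m) ->
  exists m : R, forall i x, S i -> K x -> normc (g i x) <= m.
Proof.
move=> /compact_near_coveringP cK eqS ptb.
have : \forall m \near +oo, K `<=` (fun x => forall i, S i -> normc (g i x) <= m).
  apply: cK => x Kx; have [m hm] := ptb x Kx.
  have := eqS x _ (entourage_normc (@ltr01 R)); rewrite /= => eqx.
  exists ([set y | forall i, S i -> normc (g i x - g i y) < 1], [set t | m + 1 < t]).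
    split => //=; exists (m + 1); split => //; exact: num_real.
  move=> [y t] [/= yx mt] i Si.
  rewrite -[g i y](subKr (g i x)).
  apply: le_trans (le_normcD _ _) _; rewrite normcN.
  by apply: ltW; apply: le_lt_trans mt; rewrite lerD ?hm// ltW// yx.
move=> [m [_ hm]]; exists (m + 1) => i x Si Kx.
by apply: (hm (m + 1)) => //; rewrite ltrDl.
Qed.

End equicontinuity.

Section dual.
Variables (R : realType) (X : tvsType R[i]).

Definition is_dual : set (X -> R[i]^o) :=
  [set f : X -> R[i]^o | linear f /\ continuous f].

Lemma is_dual_subspace : is_subspace is_dual.
Proof.
split.
  by split; [move=> a x y; rewrite /= scaler0 addr0|exact: cst_continuous].
move=> a f g [lf cf] [lg cg]; split.
  move=> b x y; rewrite !fctE lf lg !scalerDr !scalerA (mulrC a) -!addrA.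
  by congr (_ + _); rewrite addrCA.
move=> x; apply: (@cvgD _ R[i]^o); last exact: cg.
by apply: (@cvgZr _ R[i]^o); exact: cf.
Qed.

Definition dual := subspace is_dual_subspace.

HB.instance Definition _ := GRing.Lmodule.on dual.

Definition dual_fun (f : dual) : X -> R[i]^o := subval f.

Lemma dual_funD (f g : dual) x : dual_fun (f + g) x = dual_fun f x + dual_fun g x.
Proof. by rewrite /dual_fun subvalD. Qed.

Lemma dual_funZ a (f : dual) x : dual_fun (a *: f) x = a *: dual_fun f x.
Proof. by rewrite /dual_fun subvalZ. Qed.

Lemma dual_linear (f : dual) : linear (dual_fun f).
Proof. by case: f => f []. Qed.

Lemma dual_continuous (f : dual) : continuous (dual_fun f).
Proof. by case: f => f []. Qed.

Lemma dualZ (f : dual) a x : dual_fun f (a *: x) = a *: dual_fun f x.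
Proof.
have f0 : dual_fun f 0 = 0.
  have := dual_linear f 1 0 0; rewrite !scale1r addr0 => /eqP.
  by rewrite -subr_eq subrr eq_sym => /eqP.
by rewrite -[a *: x]addr0 dual_linear f0 addr0.
Qed.

Definition equicontinuous_dual (S : set dual) : Prop :=
  equicontinuous S (@dual_fun).

Definition circled (K : set X) : Prop :=
  forall (a : R[i]) x, normc a <= 1 -> K x -> K (a *: x).

Lemma equicontinuous_ptb (S : set dual) x : equicontinuous_dual S ->
  exists m : R, forall f, S f -> normc (dual_fun f x) <= m.
Proof.
move=> eqS; have := eqS 0 _ (entourage_normc (@ltr01 R)) => /= h.
have := @scale_continuous _ X (0, x) _; rewrite /= scale0r => /(_ _ h).
move=> [[/= U W] [/= U0 Wx] UW].
have [e /= e0 eU] : exists2 e : R, 0 < e & U e%:C.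
  have [e /= e0 eU] := (nbhs_ballP _ _).1 U0.
  exists (complex.Re e / 2); first by move: e0; rewrite ltcE /= => /andP[_ ?]; rewrite divr_gt0.
  apply: eU; rewrite -ball_normE /= sub0r normrN normcC normc_real.
  move: e0; rewrite !ltcE /= => /andP[/eqP -> e0]; rewrite eqxx /=.
  by rewrite ger0_norm ?divr_ge0 ?(ltW e0)// ltr_pdivrMr// ltr_pMr// ltr1n.
exists e^-1 => f Sf.
have /= := UW (e%:C, x) (conj eU (nbhs_singleton Wx)) f Sf.
rewrite -[in dual_fun f 0](scale0r x) !dualZ scale0r sub0r normcN.
rewrite ComplexField.Normc.normcM normc_real gtr0_norm// => /ltW.
by rewrite -[e^-1]mulr1 ler_pdivlMl.
Qed.

Lemma equicontinuous_set1 (f : dual) : equicontinuous_dual [set f].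
Proof.
move=> x E entE; have := @dual_continuous f x _ (@nbhs_entourage _ (dual_fun f x) _ entE).
by apply: (@filterS _ (nbhs x)) => y /xsectionP Ey _ ->.
Qed.

Lemma equicontinuous_compact_ub (S : set dual) (K : set X) :
  equicontinuous_dual S -> compact K ->
  exists m : R, forall f x, S f -> K x -> normc (dual_fun f x) <= m.
Proof.
move=> eqS cK; apply: (compact_ub cK eqS) => x _; exact: equicontinuous_ptb.
Qed.

(* Uniform convergence on the compact convex circled subsets of [X]. *)
Definition dual_c_seminorms : set (dual -> R) :=
  [set p | exists K : set X, [/\ compact K, convex_set K, circled K &
     p = fun f : dual => sup [set normc (dual_fun f x) | x in K]]].

Lemma dual_c_seminormsP : dual_c_seminorms `<=` @seminorm R dual.
Proof.
move=> _ [K [cK _ _ ->]]; apply: (@seminorm_sup _ _ _ K (fun x (f : dual) => normc (dual_fun f x))).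
  move=> x Kx; split=> [f g|a f]; first by rewrite dual_funD le_normcD.
  by rewrite dual_funZ ComplexField.Normc.normcM.
move=> f; have [m hm] := equicontinuous_compact_ub (@equicontinuous_set1 f) cK.
by exists m => _ [x Kx <-]; exact: hm.
Qed.

Definition dual_c : Type := seminormed dual_c_seminormsP.

HB.instance Definition _ := Tvs.copy dual_c (seminormed dual_c_seminormsP).

End dual.

Section epsilon_product.
Variables (R : realType) (X Y : tvsType R[i]).

Definition hypocontinuous (b : dual_c X -> dual_c Y -> R[i]^o) : Prop :=
  (forall A : set (dual X), equicontinuous_dual A ->
     forall W : set R[i]^o, nbhs 0 W ->
     \forall y \near (0 : dual_c Y), forall x, A x -> W (b x y)) /\
  (forall B : set (dual Y), equicontinuous_dual B ->
     forall W : set R[i]^o, nbhs 0 W ->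
     \forall x \near (0 : dual_c X), forall y, B y -> W (b x y)).

Definition is_eps : set (dual_c X -> dual_c Y -> R[i]^o) :=
  [set b : dual_c X -> dual_c Y -> R[i]^o |
    [/\ forall x, linear (b x), forall y, linear (b^~ y) & hypocontinuous b]].

Lemma is_eps_subspace : is_subspace is_eps.
Proof.
have lin (V : lmodType R[i]) (a : R[i]) (f g : V -> R[i]^o) :
    linear f -> linear g -> linear (a *: f + g).
  move=> lf lg b x y; rewrite !fctE lf lg !scalerDr !scalerA (mulrC a) -!addrA.
  by congr (_ + _); rewrite addrCA.
have hyp (I : Type) (T : topologicalType) (t : T) (S : set I) (a : R[i])
    (f g : I -> T -> R[i]^o) :
    (forall W, nbhs 0 W -> \forall y \near t, forall x, S x -> W (f x y)) ->
    (forall W, nbhs 0 W -> \forall y \near t, forall x, S x -> W (g x y)) ->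
    forall W, nbhs 0 W ->
      \forall y \near t, forall x, S x -> W (a *: f x y + g x y).
  move=> hf hg W W0.
  have := @add_continuous R[i]^o (0, 0) W; rewrite /= addr0 => /(_ W0).
  move=> [[/= W1 W2] [/= W10 W20] sW].
  have := @scale_continuous _ R[i]^o (a, 0) W1; rewrite /= scaler0 => /(_ W10).
  move=> [[/= U1 U2] [/= U10 U20] sU].
  apply: (@filterS2 _ (nbhs t) _ _ _ _ _ (hf _ U20) (hg _ W20)) => y fy gy x Sx.
  apply: (sW (_, _)); split => /=; last exact: gy.
  by apply: (sU (_, _)); split => /=; [exact: nbhs_singleton U10|exact: fy].
split.
  split.
  - by move=> x a y z; rewrite /= scaler0 addr0.
  - by move=> x a y z; rewrite /= scaler0 addr0.
  - have hyp0 (I : Type) (T : topologicalType) (t : T) (S : set I)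
      (W : set R[i]^o) : nbhs 0 W -> \forall y \near t, forall x, S x -> W 0.
      by move=> W0; apply: nearW => y x _; exact: nbhs_singleton W0.
    by split=> A eqA W W0; exact: hyp0.
move=> a f g [lf1 lf2 [hf1 hf2]] [lg1 lg2 [hg1 hg2]]; split.
- by move=> x; apply: lin.
- by move=> x; apply: (lin _ a (f^~ x) (g^~ x)).
- split=> A eqA; first by apply: hyp; [exact: hf1|exact: hg1].
  by apply: (hyp _ _ _ _ a (fun y x => f x y) (fun y x => g x y));
    [exact: hf2|exact: hg2].
Qed.

Definition eps_carrier := subspace is_eps_subspace.

HB.instance Definition _ := GRing.Lmodule.on eps_carrier.

Definition eps_fun (b : eps_carrier) : dual_c X -> dual_c Y -> R[i]^o := subval b.

Lemma eps_funD (b c : eps_carrier) x y : eps_fun (b + c) x y = eps_fun b x y + eps_fun c x y.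
Proof. by rewrite /eps_fun subvalD. Qed.

Lemma eps_funZ a (b : eps_carrier) x y : eps_fun (a *: b) x y = a *: eps_fun b x y.
Proof. by rewrite /eps_fun subvalZ. Qed.

(* Uniform convergence on the products of equicontinuous sets. *)
Definition eps_seminorms : set (eps_carrier -> R) :=
  [set p | exists (A : set (dual X)) (B : set (dual Y)),
    [/\ equicontinuous_dual A, equicontinuous_dual B &
     p = fun b : eps_carrier => sup [set normc (eps_fun b z.1 z.2) | z in A `*` B]]].

Lemma eps_seminormsP : eps_seminorms `<=` @seminorm R eps_carrier.
Proof.
move=> _ [A [B [eqA eqB ->]]].
apply: (@seminorm_sup _ _ _ (A `*` B)
  (fun z (b : eps_carrier) => normc (eps_fun b z.1 z.2))).
  move=> x _; split=> [f g|a f]; first by rewrite eps_funD le_normcD.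
  by rewrite eps_funZ ComplexField.Normc.normcM.
move=> b; have [lb _ [hb _]] : is_eps (eps_fun b) := subvalP b.
have W0 : nbhs (0 : R[i]^o) [set z : R[i]^o | normc z < 1].
  apply/nbhs_ballP; exists 1 => //= z; rewrite -ball_normE /= sub0r normrN.
  by rewrite normcC -[1]/(1%:C) ltcR.
have [Q [e [finQ QP e0 sub]]] := hb A eqA _ W0.
have [m m0 hm] := finite_ub (fun p => sup [set p f | f in B]) finQ.
have QB p f : Q p -> B f -> p f <= sup [set p f | f in B].
  move=> Qp Bf; apply: ub_le_sup; last by exists f.
  have [K [cK _ _ ->]] := QP p Qp.
  have [n hn] := equicontinuous_compact_ub eqB cK.
  exists (Num.max 0 n) => _ [g Bg <-]; have [->|K0] := eqVneq K set0.
    by rewrite image_set0 sup0 le_max lexx.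
  apply: ge_sup; first by apply/image_nonempty/set0P.
  by move=> _ [x Kx <-]; rewrite le_max hn ?orbT.
exists (m / e) => _ [[x y] [/= Ax By] <-].
pose t : R := e / m.
have t0 : 0 < t by rewrite divr_gt0.
have /= := sub (t%:C *: (y : dual_c Y)) _ x Ax.
have bZ : eps_fun b x (t%:C *: (y : dual_c Y)) = t%:C *: eps_fun b x y.
  have b0 : eps_fun b x 0 = 0.
    have := lb x 1 0 0; rewrite !scale1r addr0 => /eqP.
    by rewrite -subr_eq subrr eq_sym => /eqP.
  by rewrite -[t%:C *: (y : dual_c Y)]addr0 lb b0 addr0.
rewrite bZ ComplexField.Normc.normcM normc_real gtr0_norm// => h.
suff /h : seminorm_ball Q e 0 (t%:C *: (y : dual Y)).
  move=> /ltW; rewrite -ler_pdivlMl// mulr1.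
  by rewrite /t invf_div.
move=> p Qp; have [_ pZ] := dual_c_seminormsP (QP p Qp).
rewrite subr0 pZ normc_real gtr0_norm// /t mulrAC ltr_pdivrMr// ltr_pM2l//.
by apply: le_lt_trans (hm _ Qp); exact: QB.
Qed.

Definition eps_product : Type := seminormed eps_seminormsP.

HB.instance Definition _ := Tvs.copy eps_product (seminormed eps_seminormsP).

End epsilon_product.

(** * Smooth functions on R^d with values in a locally convex space *)

Lemma tvs_cvg_lin (R : realType) (F : tvsType R[i]) (T : Type) (G : set_system T)
    (FG : Filter G) (u v : T -> F) (a : R[i]) (l m : F) :
  u @ G --> l -> v @ G --> m -> (fun t => a *: u t + v t) @ G --> a *: l + m.
Proof.
move=> ul vm.
have aul : (fun t => a *: u t) @ G --> a *: l.
  apply: (@cvg_comp _ _ _ (fun t => (a : R[i]^o, u t))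
    (fun z : R[i]^o * F => z.1 *: z.2) G (nbhs (a : R[i]^o, l))).
    by apply: (@cvg_pair _ _ _ G (nbhs (a : R[i]^o)) (nbhs l)) => //;
      exact: cvg_cst.
  exact: (@scale_continuous _ F (a, l)).
apply: (@cvg_comp _ _ _ (fun t => (a *: u t, v t))
  (fun z : F * F => z.1 + z.2) G (nbhs (a *: l, m))).
  exact: (@cvg_pair _ _ _ G (nbhs (a *: l)) (nbhs m)).
exact: (@add_continuous F (a *: l, m)).
Qed.

Section smooth.
Variables (R : realType) (d : nat) (F : lcsType R[i]).
Implicit Types f g : 'rV[R]_d -> F.

Definition diff_quot f (j : 'I_d) (x : 'rV[R]_d) (t : R) : F :=
  (t^-1)%:C *: (f (x + t *: delta_mx 0 j) - f x).

(* Junk value 0 when the limit does not exist. *)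
Definition pderiv (j : 'I_d) f : 'rV[R]_d -> F :=
  fun x => xget 0 [set l : F | diff_quot f j x @ 0^' --> l].

Definition pderivs (s : seq 'I_d) f : 'rV[R]_d -> F := foldr pderiv f s.

Definition smooth f : Prop :=
  (forall s, continuous (pderivs s f)) /\
  (forall s j x, exists l : F, diff_quot (pderivs s f) j x @ 0^' --> l).

Definition mdeg (alpha : 'I_d -> nat) : nat := (\sum_j alpha j)%N.

Definition mseq (alpha : 'I_d -> nat) : seq 'I_d :=
  flatten [seq nseq (alpha j) j | j <- enum 'I_d].

(* D^alpha = (-i)^|alpha| partial^alpha. *)
Definition mderiv (alpha : 'I_d -> nat) f : 'rV[R]_d -> F :=
  fun x => (- 'i%C) ^+ mdeg alpha *: pderivs (mseq alpha) f x.

Lemma pderivE f j x l : diff_quot f j x @ 0^' --> l -> pderiv j f x = l.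
Proof.
move=> fl; apply: (cvg_unique hausdorffP _ fl).
have h := @xgetI F 0 [set l : F | diff_quot f j x @ 0^' --> l] l fl.
exact: h.
Qed.

Lemma diff_quot_lin a f g j x l m : diff_quot f j x @ 0^' --> l ->
  diff_quot g j x @ 0^' --> m ->
  diff_quot (a *: f + g) j x @ 0^' --> a *: l + m.
Proof.
move=> fl gm.
have -> : diff_quot (a *: f + g) j x =
    (fun t => a *: diff_quot f j x t + diff_quot g j x t).
  apply/funext => t; rewrite /diff_quot !fctE opprD addrACA -scalerBr scalerDr.
  by rewrite !scalerA (mulrC a).
exact: tvs_cvg_lin.
Qed.

Lemma pderivs_lin a f g s : smooth f -> smooth g ->
  pderivs s (a *: f + g) = a *: pderivs s f + pderivs s g.
Proof.
move=> [_ sf] [_ sg]; elim: s => // j s IH; rewrite /= -!/(pderivs _ _) IH.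
apply/funext => x; have [l fl] := sf s j x; have [m gm] := sg s j x.
by rewrite !fctE (pderivE fl) (pderivE gm); exact/pderivE/diff_quot_lin.
Qed.

Lemma smooth_lin a f g : smooth f -> smooth g -> smooth (a *: f + g).
Proof.
move=> sf sg; split=> s.
  rewrite pderivs_lin// => x.
  exact: (@tvs_cvg_lin _ F _ (nbhs x) _ (pderivs s f) (pderivs s g) a _ _
    (sf.1 s x) (sg.1 s x)).
move=> j x; have [l fl] := sf.2 s j x; have [m gm] := sg.2 s j x.
by exists (a *: l + m); rewrite pderivs_lin//; exact: diff_quot_lin.
Qed.

Lemma smooth0 : smooth (0 : 'rV[R]_d -> F).
Proof.
have dq0 j x : diff_quot 0 j x @ 0^' --> (0 : F).
  rewrite (_ : diff_quot 0 j x = fun=> 0); first exact: cvg_cst.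
  by apply/funext => t; rewrite /diff_quot subrr scaler0.
have p0 s : pderivs s 0 = 0.
  elim: s => // j s IH; rewrite /= -/(pderivs _ _) IH.
  by apply/funext => x; exact/pderivE/dq0.
split=> s; first by rewrite p0; exact: cst_continuous.
by move=> j x; exists 0; rewrite p0; exact: dq0.
Qed.

Lemma mderiv_lin a f g alpha x : smooth f -> smooth g ->
  mderiv alpha (a *: f + g) x = a *: mderiv alpha f x + mderiv alpha g x.
Proof.
by move=> sf sg; rewrite /mderiv pderivs_lin// fctE scalerDr !scalerA (mulrC a).
Qed.

Lemma mderiv0 alpha x : mderiv alpha (0 : 'rV[R]_d -> F) x = 0.
Proof.
have := mderiv_lin (-1) alpha x smooth0 smooth0.
by rewrite scaler0 addr0 scaleN1r addNr.
Qed.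

End smooth.

(** * Weight sequences and weight functions *)

Section weights.
Variable R : realType.
Implicit Types M A : nat -> {posnum R}.

Definition cond_M1 M : Prop := forall p, (0 < p)%N ->
  (M p)%:num ^+ 2 <= (M p.-1)%:num * (M p.+1)%:num.

Definition cond_M2 (c0 H : R) M : Prop := forall p,
  (M p)%:num <= c0 * H ^+ p *
    \big[Num.min/(M p)%:num * (M 0)%:num]_(q < p.+1)
       ((M (p - q)%N)%:num * (M q)%:num).

Definition cond_M5 M : Prop := exists q c0 : R, [/\ 0 < q, 1 <= c0 &
  forall p, (0 < p)%N ->
    (\sum_(p.+1 <= j <oo) ((M j.-1)%:num `^ q / (M j)%:num `^ q)%:E <=
     (c0 * p%:R * ((M p)%:num `^ q / (M p.+1)%:num `^ q))%:E)%E].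

Definition cond_M6 A : Prop := exists c0 L0 : R, [/\ 1 <= c0, 1 <= L0 &
  forall p, p`!%:R <= c0 * L0 ^+ p * (A p)%:num].

(* [ln] is 0 on nonpositive numbers, so that log_+ 0 = 0. *)
Definition assoc_fun A (rho : R) : R :=
  sup [set Num.max 0 (ln (rho ^+ p / (A p)%:num)) | p in [set: nat]].

(* Positive sequences (r_p), p >= 1, increasing to infinity; r 0 is unused. *)
Definition frakR : set (nat -> {posnum R}) := [set r |
  (forall p, (0 < p)%N -> (r p)%:num <= (r p.+1)%:num) /\
  (fun p => (r p)%:num) @ \oo --> +oo].

Inductive um_class := Beurling | Roumieu.

(* The sequences of factors of |D^alpha| in the seminorms: r^p / M_p with r > 0,
   resp. 1 / (M_p R_p) with (r_p) in frakR. *)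
Definition factors (c : um_class) M : set (nat -> R) :=
  match c with
  | Beurling => [set w | exists r : R, 0 < r /\
                   w = fun p => r ^+ p / (M p)%:num]
  | Roumieu => [set w | exists r, frakR r /\
                  w = fun p => ((M p)%:num * \prod_(1 <= j < p.+1) (r j)%:num)^-1]
  end.

Lemma factors_ge0 c M w p : factors c M w -> 0 <= w p.
Proof.
case: c => /= -[r [r0 ->]]; first by rewrite divr_ge0// exprn_ge0// ltW.
by rewrite invr_ge0 mulr_ge0// prodr_ge0.
Qed.

Definition enorm d (x : 'rV[R]_d) : R := Num.sqrt (\sum_i x 0 i ^+ 2).

Record cweight (d : nat) := CWeight {
  cweight_fun :> 'rV[R]_d -> R;
  cweight_gt0 : forall x, 0 < cweight_fun x;
  cweight_continuous : continuous cweight_fun }.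

Definition class_dagger (c : um_class) A d (eta : cweight d) : Prop :=
  match c with
  | Beurling => exists C tau : R, [/\ 0 < C, 0 < tau & forall x h,
      eta (x + h) <= C * eta x * expR (assoc_fun A (tau * enorm h))]
  | Roumieu => forall tau : R, 0 < tau -> exists C : R, 0 < C /\ forall x h,
      eta (x + h) <= C * eta x * expR (assoc_fun A (tau * enorm h))
  end.

End weights.

(** * The scalar spaces *)

Section scalar_spaces.
Variables (R : realType) (d : nat) (M : nat -> {posnum R}) (eta : cweight R d).
Implicit Types f g : 'rV[R]_d -> R[i]^o.

Definition wnorm f : R := sup [set normc (f x) / eta x | x in [set: 'rV[R]_d]].

Definition C_eta f : Prop := continuous f /\
  forall e : R, 0 < e ->
    exists rho : R, forall x, rho < enorm x -> normc (f x) / eta x < e.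

Definition step_norm (m : R) f : R :=
  sup [set m ^+ mdeg alpha * wnorm (mderiv alpha f) / (M (mdeg alpha))%:num
      | alpha in [set: 'I_d -> nat]].

(* The space D^{M_p,m}_{C_eta}, normed by [step_norm m]. *)
Definition step (m : R) f : Prop :=
  [/\ smooth f, forall alpha, C_eta (mderiv alpha f) &
   has_ubound [set m ^+ mdeg alpha * wnorm (mderiv alpha f) / (M (mdeg alpha))%:num
              | alpha in [set: 'I_d -> nat]]].

Lemma normc_continuous : continuous (@ComplexField.Normc.normc R : R[i]^o -> R).
Proof.
move=> z U /nbhs_ballP[e /= e0 eU].
apply: (@filterS _ (nbhs z) _ (ball z e%:C)); last first.
  by apply: nbhsx_ballx; rewrite ltcR.
move=> y; rewrite -ball_normE /ball_/= normcC ltcR => zy; apply: eU.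
rewrite -ball_normE /ball_/=; apply: le_lt_trans zy.
have tri (u v : R[i]) : normc u <= normc v + normc (u - v).
  by have := le_normcD (u - v) v; rewrite subrK addrC.
rewrite ler_distl lerBlDr tri andbT -(normcN (z - y)) opprB.
exact: tri.
Qed.

Lemma C_eta_ubound f : C_eta f ->
  has_ubound [set normc (f x) / eta x | x in [set: 'rV[R]_d]].
Proof.
move=> [cf /(_ 1 ltr01)[rho hrho]].
pose K := [set v : 'rV[R]_d | forall i, `[- rho, rho]%classic (v ord0 i)].
have cK : compact K.
  by apply: (@rV_compact _ _ (fun=> `[- rho, rho]%classic)) => _;
    exact: segment_compact.
have out x : ~ K x -> rho < enorm x.
  move=> /existsNP[i /= /negP]; rewrite in_itv /= -ler_norml -ltNge => h.
  apply: lt_le_trans h _; rewrite -sqrtr_sqr ler_wsqrtr//.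
  by rewrite (bigD1 i)//= lerDl sumr_ge0// => j _; rewrite sqr_ge0.
have ch : continuous (fun x => normc (f x) / eta x).
  move=> x.
  have cn : (fun y => normc (f y)) @ x --> normc (f x).
    exact: (@continuous_comp _ _ _ f (@ComplexField.Normc.normc R) x (cf x)
      (@normc_continuous (f x))).
  have ce : (fun y => (eta y)^-1) @ x --> (eta x)^-1.
    have ex : eta x != 0 by rewrite gt_eqF// cweight_gt0.
    exact: (cvgV ex (@cweight_continuous _ _ eta x)).
  exact: cvgM cn ce.
have [K0|K0] := eqVneq K set0.
  exists 1 => _ [x _ <-]; apply/ltW/hrho/out; rewrite K0.
  by [].
have [x0 _ hx0] := compact_EVT_max ((set0P _).1 K0) cK (continuous_subspaceT ch).
exists (Num.max 1 (normc (f x0) / eta x0)) => _ [x _ <-]; rewrite le_max.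
have [Kx|nKx] := pselect (K x); first by rewrite hx0 ?orbT ?inE.
by rewrite ltW// hrho// out.
Qed.

Lemma C_eta_lin a f g : C_eta f -> C_eta g -> C_eta (a *: f + g).
Proof.
move=> [cf hf] [cg hg]; split.
  move=> x; exact: (@tvs_cvg_lin _ R[i]^o _ (nbhs x) _ f g a _ _ (cf x) (cg x)).
move=> e e0; have na1 : 0 < normc a + 1 by rewrite ltr_pwDr// normc_ge0.
have [r1 h1] := hf (e / 2 / (normc a + 1)) (divr_gt0 (divr_gt0 e0 (ltr0Sn _ _)) na1).
have [r2 h2] := hg (e / 2) (divr_gt0 e0 (ltr0Sn _ _)).
exists (Num.max r1 r2) => x; rewrite gt_max => /andP[/h1 fx /h2 gx].
have e1 : 0 <= (eta x)^-1 by rewrite invr_ge0 ltW// cweight_gt0.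
rewrite fctE; apply: le_lt_trans (ler_wpM2r e1 (le_normcD _ _)) _.
rewrite mulrDl [ltRHS]splitr ler_ltD//.
rewrite ComplexField.Normc.normcM -mulrA.
apply: le_trans (ler_wpM2l (normc_ge0 a) (ltW fx)) _.
by rewrite mulrCA ler_piMr ?divr_ge0 ?(ltW e0)// ler_pdivrMr// mul1r lerDl.
Qed.

Lemma C_eta0 : C_eta 0.
Proof.
split; first exact: cst_continuous.
move=> e e0; exists 0 => x _.
by rewrite (_ : normc _ = 0) ?mul0r// ComplexField.Normc.normc0.
Qed.

Lemma wnorm_lin a f g : C_eta f -> C_eta g ->
  wnorm (a *: f + g) <= normc a * wnorm f + wnorm g.
Proof.
move=> cf cg; apply: ge_sup; first by exists (normc ((a *: f + g) 0) / eta 0), 0.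
move=> _ [x _ <-].
have e1 : 0 <= (eta x)^-1 by rewrite invr_ge0 ltW// cweight_gt0.
rewrite fctE; apply: le_trans (ler_wpM2r e1 (le_normcD _ _)) _.
rewrite mulrDl ComplexField.Normc.normcM -mulrA lerD//.
  rewrite ler_wpM2l ?normc_ge0//; apply: ub_le_sup; last by exists x.
  exact: C_eta_ubound.
by apply: ub_le_sup; [exact: C_eta_ubound|exists x].
Qed.

Lemma wnorm_ge0 f : C_eta f -> 0 <= wnorm f.
Proof.
move=> cf; apply: (@le_trans _ _ (normc (f 0) / eta 0)).
  by rewrite divr_ge0 ?normc_ge0// ltW// cweight_gt0.
by apply: ub_le_sup; [exact: C_eta_ubound|exists 0].
Qed.

Lemma mderivE_lin a f g alpha : smooth f -> smooth g ->
  mderiv alpha (a *: f + g) = a *: mderiv alpha f + mderiv alpha g.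
Proof. by move=> sf sg; apply/funext => x; rewrite mderiv_lin. Qed.

Lemma step_lin (m : R) a f g : 0 < m -> step m f -> step m g ->
  step m (a *: f + g).
Proof.
move=> m0 [sf cf [B hB]] [sg cg [B' hB']]; split.
- exact: smooth_lin.
- by move=> alpha; rewrite mderivE_lin//; exact: C_eta_lin.
- exists (normc a * B + B') => _ [alpha _ <-]; rewrite mderivE_lin//.
  have w0 : 0 <= m ^+ mdeg alpha / (M (mdeg alpha))%:num.
    by rewrite divr_ge0// exprn_ge0// ltW.
  rewrite mulrAC; apply: le_trans (ler_wpM2l w0 (wnorm_lin _ _ _)) _ => //.
  rewrite mulrDr mulrCA lerD//.
    by rewrite ler_wpM2l ?normc_ge0// mulrAC; apply: hB; exists alpha.
  by rewrite mulrAC; apply: hB'; exists alpha.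
Qed.

Lemma step0 m : step m 0.
Proof.
have mE0 alpha : mderiv alpha (0 : 'rV[R]_d -> R[i]^o) = 0.
  by apply/funext => x; rewrite mderiv0.
split; first exact: smooth0.
  by move=> alpha; rewrite mE0; exact: C_eta0.
exists 0 => _ [alpha _ <-]; rewrite mE0.
suff -> : wnorm 0 = 0 by rewrite mulr0 mul0r.
apply/eqP; rewrite eq_le wnorm_ge0 ?andbT//; last exact: C_eta0.
apply: ge_sup; first by exists (normc ((0 : 'rV[R]_d -> R[i]^o) 0) / eta 0), 0.
move=> _ [x _ <-].
by rewrite (_ : normc _ = 0) ?mul0r// ComplexField.Normc.normc0.
Qed.

Lemma step_le (m m' : R) f : 0 < m -> m <= m' -> step m' f -> step m f.
Proof.
move=> m0 mm' [sf cf [B hB]]; split => //; exists B => _ [alpha _ <-].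
apply: le_trans (hB _ (ex_intro2 _ _ alpha I erefl)).
rewrite -!mulrA ler_wpM2r ?divr_ge0 ?wnorm_ge0//.
by rewrite lerXn2r// nnegrE ltW// (lt_le_trans m0).
Qed.

Variable c : um_class.

Definition is_bdot : set ('rV[R]_d -> R[i]^o) :=
  match c with
  | Beurling => [set f | forall m : R, 0 < m -> step m f]
  | Roumieu => [set f | exists m : R, 0 < m /\ step m f]
  end.

Lemma is_bdot_subspace : is_subspace is_bdot.
Proof.
rewrite /is_bdot; case: c.
  split=> [m _|a f g hf hg m m0]; first exact: step0.
  by apply: step_lin => //; [exact: hf|exact: hg].
split=> [|a f g [m [m0 hf]] [m' [m'0 hg]]].
  by exists 1; split => //; exact: step0.
have mm0 : 0 < Num.min m m' by rewrite lt_min m0.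
exists (Num.min m m'); split; first exact: mm0.
apply: (step_lin a mm0); [apply: step_le hf|apply: step_le hg] => //.
  by rewrite ge_min lexx.
by rewrite ge_min lexx orbT.
Qed.

Definition bdot_carrier := subspace is_bdot_subspace.

HB.instance Definition _ := GRing.Lmodule.on bdot_carrier.

(* Projective limit: the norms of the steps.  Locally convex inductive limit: all
   the seminorms whose restrictions to the steps are continuous. *)
Definition bdot_seminorms : set (bdot_carrier -> R) :=
  match c with
  | Beurling => [set p | exists m : R, 0 < m /\
      p = fun f : bdot_carrier => step_norm m (subval f)]
  | Roumieu => [set p | seminorm p /\ forall m : R, 0 < m ->
      exists C : R, forall f : bdot_carrier,
        step m (subval f) -> p f <= C * step_norm m (subval f)]
  end.

Lemma bdot_seminormsP : bdot_seminorms `<=` @seminorm R bdot_carrier.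
Proof.
move=> p hp; have [cE|cE] : c = Beurling \/ c = Roumieu by case: c; [left|right].
  have {hp}[m [m0 ->]] : exists m : R, 0 < m /\
      p = fun f : bdot_carrier => step_norm m (subval f).
    by move: hp; rewrite /bdot_seminorms cE.
  have stepB (f : 'rV[R]_d -> R[i]^o) : is_bdot f -> step m f.
    by rewrite /is_bdot cE; apply.
  have hstep (f : bdot_carrier) : step m (subval f) := stepB _ (subvalP f).
  have sm (f : bdot_carrier) : smooth (subval f) by case: (hstep f).
  have Cf (f : bdot_carrier) alpha : C_eta (mderiv alpha (subval f)).
    by case: (hstep f).
  apply: (@seminorm_sup _ _ _ setT (fun alpha (f : bdot_carrier) =>
    m ^+ mdeg alpha * wnorm (mderiv alpha (subval f)) / (M (mdeg alpha))%:num)).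
    move=> alpha _.
    have sw : seminorm (fun f : bdot_carrier => wnorm (mderiv alpha (subval f))).
      apply: (@seminorm_sup _ _ _ setT (fun x (f : bdot_carrier) =>
        normc (mderiv alpha (subval f) x) / eta x)).
        move=> x _; split=> [f g|a f].
          have -> : mderiv alpha (subval (f + g)) x =
              mderiv alpha (subval f) x + mderiv alpha (subval g) x.
            have := mderiv_lin 1 alpha x (sm f) (sm g).
            by rewrite !scale1r -subvalD.
          rewrite -mulrDl ler_wpM2r ?le_normcD//.
          by rewrite invr_ge0 ltW// cweight_gt0.
        have -> : mderiv alpha (subval (a *: f)) x = a * mderiv alpha (subval f) x.
          have := mderiv_lin a alpha x (sm f) (@smooth0 _ _ _).
          by rewrite mderiv0 !addr0 -subvalZ.
        by rewrite ComplexField.Normc.normcM mulrA.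
      by move=> f; apply: C_eta_ubound.
    by apply: seminorm_scale => //; rewrite exprn_ge0// ltW.
  by move=> f; case: (hstep f).
by move: hp; rewrite /bdot_seminorms cE => -[].
Qed.

Definition bdot : Type := seminormed bdot_seminormsP.

HB.instance Definition _ := Tvs.copy bdot (seminormed bdot_seminormsP).

End scalar_spaces.

(** * The vector-valued space *)

Section vector_space.
Variables (R : realType) (d : nat) (c : um_class) (M : nat -> {posnum R}).
Variables (eta : cweight R d) (F : lcsType R[i]).
Implicit Types (f g : 'rV[R]_d -> F) (q : F -> R) (w : nat -> R).

Definition cts_seminorm q : Prop := seminorm q /\ continuous q.

Definition scaled_D w f (z : ('I_d -> nat) * 'rV[R]_d) : F :=
  (w (mdeg z.1) / eta z.2)%:C *: mderiv z.1 f z.2.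

Definition vnorm q w f : R :=
  sup [set q (scaled_D w f z) | z in [set: ('I_d -> nat) * 'rV[R]_d]].

Definition is_vbdot : set ('rV[R]_d -> F) := [set f | [/\ smooth f,
  forall w q, factors c M w -> cts_seminorm q ->
    has_ubound [set q (scaled_D w f z) | z in [set: ('I_d -> nat) * 'rV[R]_d]] &
  forall (e : R) w q, 0 < e -> factors c M w -> cts_seminorm q ->
    exists K : set 'rV[R]_d, compact K /\
      forall alpha x, ~ K x -> q (scaled_D w f (alpha, x)) <= e]].

Lemma scaled_D_lin w a f g z : smooth f -> smooth g ->
  scaled_D w (a *: f + g) z = a *: scaled_D w f z + scaled_D w g z.
Proof.
by move=> sf sg; rewrite /scaled_D mderiv_lin// scalerDr !scalerA [a * _]mulrC.
Qed.

Lemma scaled_D0 w z : scaled_D w 0 z = 0.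
Proof. by rewrite /scaled_D mderiv0 scaler0. Qed.

Lemma is_vbdot_subspace : is_subspace is_vbdot.
Proof.
split.
  split; first exact: smooth0.
    move=> w q _ [sq _]; exists 0 => _ [z _ <-].
    by rewrite scaled_D0 seminorm0.
  move=> e w q e0 _ [sq _]; exists set0; split; first exact: compact0.
  by move=> alpha x _; rewrite scaled_D0 seminorm0// ltW.
move=> a f g [sf bf vf] [sg bg vg]; split; first exact: smooth_lin.
- move=> w q hw hq; have [B hB] := bf w q hw hq; have [B' hB'] := bg w q hw hq.
  have [[qD qZ] _] := hq.
  exists (normc a * B + B') => _ [z _ <-]; rewrite scaled_D_lin//.
  apply: le_trans (qD _ _) _; rewrite qZ lerD//; last by apply: hB'; exists z.
  by rewrite ler_wpM2l ?normc_ge0//; apply: hB; exists z.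
move=> e w q e0 hw hq; have na1 : 0 < normc a + 1.
  by rewrite ltr_pwDr// normc_ge0.
have e2 : 0 < e / 2 by rewrite divr_gt0.
have [K [cK hK]] := vf _ w q (divr_gt0 e2 na1) hw hq.
have [K' [cK' hK']] := vg _ w q e2 hw hq.
exists (K `|` K'); split; first exact: compactU.
move=> alpha x /not_orP[Kx K'x]; have [[qD qZ] _] := hq.
rewrite scaled_D_lin//; apply: le_trans (qD _ _) _; rewrite qZ [leRHS]splitr.
rewrite lerD ?hK'//; apply: le_trans (ler_wpM2l (normc_ge0 a) (hK alpha x Kx)) _.
by rewrite mulrCA ler_piMr ?(ltW e2)// ler_pdivrMr// mul1r lerDl.
Qed.

Definition vbdot_carrier := subspace is_vbdot_subspace.

HB.instance Definition _ := GRing.Lmodule.on vbdot_carrier.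

Definition vbdot_seminorms : set (vbdot_carrier -> R) :=
  [set p | exists w q, [/\ factors c M w, cts_seminorm q &
     p = fun f : vbdot_carrier => vnorm q w (subval f)]].

Lemma vbdot_seminormsP : vbdot_seminorms `<=` @seminorm R vbdot_carrier.
Proof.
move=> _ [w [q [hw hq ->]]]; have [[qD qZ] _] := hq.
have sm (f : vbdot_carrier) : smooth (subval f) by case: (subvalP f).
apply: (@seminorm_sup _ _ _ setT (fun z (f : vbdot_carrier) =>
    q (scaled_D w (subval f) z))).
  move=> z _; split=> [f g|a f].
    have -> : scaled_D w (subval (f + g)) z =
        scaled_D w (subval f) z + scaled_D w (subval g) z.
      have := scaled_D_lin w 1 z (sm f) (sm g).
      by rewrite !scale1r -subvalD.
    exact: qD.
  have -> : scaled_D w (subval (a *: f)) z = a *: scaled_D w (subval f) z.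
    have := scaled_D_lin w a z (sm f) (@smooth0 _ _ _).
    by rewrite scaled_D0 !addr0 -subvalZ.
  exact: qZ.
by move=> f; case: (subvalP f) => _ bf _; exact: bf.
Qed.

Definition vbdot : Type := seminormed vbdot_seminormsP.

HB.instance Definition _ := Tvs.copy vbdot (seminormed vbdot_seminormsP).

End vector_space.

(* A [tvsType] carries a uniform structure inducing its topology, but nothing
   relates it to the translations: Cauchy sequences are defined from the
   neighborhoods of 0. *)
Definition seq_complete (R : realType) (F : tvsType R[i]) : Prop :=
  forall u : nat -> F,
    (forall U : set F, nbhs 0 U ->
       exists N, forall m n, (N <= m)%N -> (N <= n)%N -> U (u m - u n)) ->
    exists l : F, u @ \oo --> l.

Definition lc_isomorphic (R : realType) (X Y : tvsType R[i]) : Prop :=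
  exists (f : {linear X -> Y}) (g : Y -> X),
    [/\ cancel f g, cancel g f, continuous f & continuous g].

(* Main.v *)
Require Import Defs.
From HB Require Import structures.
From mathcomp Require Import all_boot all_order all_algebra.
From mathcomp Require Import complex.
From mathcomp Require Import all_classical all_reals all_analysis.
From mathcomp Require Import ring lra zify.

(** The isomorphism sends [phi] to the bilinear form
    [(f, y) |-> f (y o phi)] on [X'_c x F'_c], where [X] is the scalar space.

    For the form to make sense, [y o phi] has to belong to [X].  In the Roumieu case
    only its norms for the sequences [M_p R_p] are controlled, and [komatsu_growth]
    recovers a single step of the inductive limit from them ([dual_comp_bdot]).

    For hypocontinuity, the neighborhoods of 0 in [X] are described by the norms
    [sup w_p |D^alpha f| / eta] of the sequences of factors [w].  In the
    Beurling case this is the definition of [X]; in the Roumieu case it says that the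
    inductive limit is also a projective limit ([projective_description]).  Its proof
    writes [f] as a telescoping series of smoothings [S_l f].  The operators [S_l] are
    averages against a kernel at the scale [1 / l], whose derivatives of order [p] are
    bounded by [M_p] and which decays exponentially, whereas [eta] grows more slowly
    than every exponential.  The kernel is a limit of products of the functions
    [cos (x / 2^m) ^ (2^m)]; condition (M.5) makes [M_p] larger, up to a geometric
    factor, than a positive power of [p!], and that is what [kernel_derivative_le] needs.
    All of this happens on the functional [g |-> int kernel * g], along one coordinate
    axis at a time ([smoothing_functional], [smoothing_operators]).

    Fix [phi] and [w].  The vectors [w_p D^alpha phi(x) / eta(x)] form a precompact
    set, but in a space which is only sequentially complete this does not give a
    compact disc containing them.  Instead, the differences of the values of
    [D^alpha phi] at neighboring points of the lattices [4^-j Z^d], with weights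
    [2^j], form a family [u_i] tending to 0 which controls all the values by
    telescoping ([net_vector_null], [net_vector_dominates]).  The sums
    [sum a_i u_i] with [sum |a_i| <= 1] form a compact disc of [F] ([null_disc]), which
    gives the continuity in [y].  For the continuity in [f], the functions [y o phi],
    for [y] in the polar of a seminorm, form a compact disc of [X]
    ([polar_image_compact]).

    Conversely, let [b] be a hypocontinuous form.  For a point [x] the functional
    [y |-> b (delta_x, y)] is continuous on [F'_c], so it is the evaluation at a vector
    [phi(x)], by the theorem of Mackey and Arens ([dual_c_evaluation]).  The same holds
    for the derivatives of [delta_x].  The difference quotients of these functionals
    converge uniformly on the compact subsets of [X], and
    [w_p D^alpha delta_x / eta(x)] tends to 0 in the same sense as [x] goes to
    infinity ([evaluation_derivative], [norming_decay]), so that [phi] is smooth and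
    has the required decay.

    Both topologies are the uniform convergence on products of an equicontinuous set
    of functionals on [X] and the polar of a seminorm of [F]. *)

Set Implicit Arguments.
Unset Strict Implicit.
Unset Printing Implicit Defensive.

Import Order.TTheory GRing.Theory Num.Theory.
Import numFieldTopology.Exports numFieldNormedType.Exports.

Local Open Scope classical_set_scope.
Local Open Scope ring_scope.
Local Open Scope complex_scope.

(** * Complex numbers *)

Section complex_facts.
Variable R : realType.
Implicit Types z : R[i].

Lemma Re_le_normc z : complex.Re z <= normc z.
Proof.
case: z => a b /=; apply: le_trans (ler_norm a) _.
by rewrite -sqrtr_sqr ler_wsqrtr// lerDl sqr_ge0.
Qed.

Lemma normc_eq0 z : (normc z == 0) = (z == 0).
Proof.
apply/eqP/eqP => [/ComplexField.Normc.eq0_normc //|->].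
exact: ComplexField.Normc.normc0.
Qed.

Lemma unit_rotation z : exists2 c : R[i], normc c = 1 & c * z = (normc z)%:C.
Proof.
have [->|z0] := eqVneq z 0.
  by exists 1; rewrite ?mulr0 ?ComplexField.Normc.normc1 ?ComplexField.Normc.normc0.
have nz0 : normc z != 0 by rewrite normc_eq0.
exists ((normc z)%:C / z).
  by rewrite ComplexField.Normc.normcM ComplexField.Normc.normcV normc_real
    ger0_norm ?normc_ge0// divff.
by rewrite divfK.
Qed.

Lemma complex_scaleE (V : lmodType R[i]) (a : R[i]) (x : V) :
  a *: x = (complex.Re a)%:C *: x + (complex.Im a)%:C *: ('i%C *: x).
Proof. by rewrite scalerA -scalerDl mulrC -complexE. Qed.

End complex_facts.

(** * The Hahn-Banach theorem for a seminorm *)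

Section hahn_banach.
Variables (R : realType) (V : lmodType R[i]).
Implicit Types p q : V -> R.

Definition sublinear p : Prop :=
  (forall x y, p (x + y) <= p x + p y) /\
  (forall (t : R) x, 0 <= t -> p (t%:C *: x) = t * p x).

Lemma sublinear0 p : sublinear p -> p 0 = 0.
Proof. by move=> [_ /(_ 0 0 (lexx 0))]; rewrite scaler0 mul0r. Qed.

Lemma sublinear_geN p x : sublinear p -> - p (- x) <= p x.
Proof.
move=> sp; rewrite lerNl -subr_ge0 opprK addrC -(sublinear0 sp) -{1}(subrr x).
by rewrite sp.1.
Qed.

(** Sublinear functionals are bounded below by minus their value at the opposite
    vector, so that infima over directed families exist.  This serves both the chains
    of Zorn's lemma and the slices below. *)
Lemma inf_sublinear (I : Type) (S : set I) (s : I -> V -> R) :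
  S !=set0 -> (forall x, exists m, forall i, S i -> m <= s i x) ->
  (forall i, S i -> s i 0 = 0) ->
  (forall i j x y, S i -> S j -> exists2 k, S k & s k (x + y) <= s i x + s j y) ->
  (forall i (a : R) x, 0 < a -> S i ->
     exists2 k, S k & s k (a%:C *: x) <= a * s i x) ->
  sublinear (fun x => inf [set s i x | i in S]).
Proof.
move=> S0 lbS s0 sD sZ.
have hlb x : has_lbound [set s i x | i in S].
  by have [m hm] := lbS x; exists m => _ [i Si <-]; exact: hm.
have le i x : S i -> inf [set s i x | i in S] <= s i x.
  by move=> Si; apply: ge_inf => //; exists i.
have ne x : [set s i x | i in S] !=set0 by apply/image_nonempty.
have scale (a : R) x : 0 < a ->
    inf [set s i (a%:C *: x) | i in S] <= a * inf [set s i x | i in S].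
  move=> a0; rewrite -ler_pdivrMl//; apply: lb_le_inf => // _ [i Si <-].
  have [k Sk hk] := sZ i a x a0 Si.
  by rewrite ler_pdivrMl//; apply: le_trans hk; exact: le.
split=> [x y|t x].
  rewrite -lerBlDr; apply: lb_le_inf => // _ [i Si <-].
  rewrite lerBlDr -lerBlDl; apply: lb_le_inf => // _ [j Sj <-]; rewrite lerBlDl.
  by have [k Sk hk] := sD i j x y Si Sj; apply: le_trans hk; exact: le.
rewrite le_eqVlt => /predU1P[<-|t0].
  rewrite scale0r mul0r; have -> : [set s i 0 | i in S] = [set 0].
    apply/seteqP; split=> [_ [i Si <-]|_ ->]; first exact: s0.
    by case: S0 => i Si; exists i => //; exact: s0.
  exact: inf1.
apply/eqP; rewrite eq_le scale//= -ler_pdivlMl//.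
have := scale t^-1 (t%:C *: x); rewrite invr_gt0 => /(_ t0).
by rewrite scalerA -rmorphM mulVf ?gt_eqF// scale1r.
Qed.

(** The slice is [x |-> inf_t (p (x + t v) - t p v)], over [t >= 0]. *)
Lemma sublinear_slice p v : sublinear p -> exists p',
  [/\ sublinear p', forall x, p' x <= p x & forall x, p' x <= p (x + v) - p v].
Proof.
move=> sp; have [pD pZ] := sp.
pose s (t : R) x := p (x + t%:C *: v) - t * p v.
pose S := [set t : R | 0 <= t].
have hlb x : has_lbound [set s t x | t in S].
  exists (- p (- x)) => _ [t t0 <-].
  rewrite /s -pZ// lerBrDl lerBlDr; apply: le_trans (pD _ _).
  by rewrite addrAC subrr add0r.
exists (fun x => inf [set s t x | t in S]); split.
- apply: inf_sublinear.
  + by exists 0; rewrite /S /= lexx.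
  + by move=> x; have [m hm] := hlb x; exists m => t t0; apply: hm; exists t.
  + by move=> t t0; rewrite /s add0r pZ// subrr.
  + move=> t u x y /= t0 u0; exists (t + u); first by rewrite /S/= addr_ge0.
    rewrite /s mulrDl opprD [leRHS]addrACA lerD2r rmorphD scalerDl addrACA.
    exact: pD.
  + move=> t a x a0 t0; exists (a * t); first by rewrite /S/= mulr_ge0// ltW.
    by rewrite /s mulrBr mulrA lerD2r -pZ ?(ltW a0)// scalerDr scalerA rmorphM.
- move=> x; apply: ge_inf => //; exists 0; rewrite ?/S /= ?lexx//.
  by rewrite /s scale0r addr0 mul0r subr0.
- by move=> x; apply: ge_inf => //; exists 1; rewrite ?/S /= ?ler01// /s ?scale1r ?mul1r.
Qed.

(** Zorn's lemma for the reverse order: the infimum of a chain is sublinear. *)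
Lemma minimal_sublinear q : sublinear q -> exists p,
  [/\ sublinear p, forall x, p x <= q x &
      forall p', sublinear p' -> (forall x, p' x <= p x) -> p' = p].
Proof.
move=> sq; pose T := {p : V -> R | sublinear p /\ forall x, p x <= q x}.
pose ge (p1 p2 : T) := `[< forall x, sval p2 x <= sval p1 x >].
have [||||[p [sp pq]] pmin] := @Zorn T ge.
- by move=> p; apply/asboolP.
- move=> p1 p2 p3 /asboolP h /asboolP h'; apply/asboolP => x.
  exact: le_trans (h' x) (h x).
- move=> [p1 h1] [p2 h2] /asboolP /= h /asboolP /= h'.
  have E : p1 = p2 by apply/funext => x; apply: le_anti; rewrite h h'.
  by move: h1 h2; rewrite E => h1 h2; congr exist; exact: Prop_irrelevance.
- move=> C totC; have [->|/set0P C0] := eqVneq C set0.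
    by exists (exist _ q (conj sq (fun x => lexx (q x)))).
  have lbC x : has_lbound [set sval s x | s in C].
    exists (- q (- x)) => _ [[s [ss sqq]] Cs <-] /=.
    by apply: le_trans (sublinear_geN x ss); rewrite lerN2.
  have le x s : C s -> inf [set sval s x | s in C] <= sval s x.
    by move=> Cs; apply: ge_inf => //; exists s.
  have si : sublinear (fun x => inf [set sval s x | s in C]).
    apply: inf_sublinear => //.
    + by move=> x; have [m hm] := lbC x; exists m => s Cs; apply: hm; exists s.
    + by move=> [s [ss ?]] _ /=; exact: sublinear0.
    + move=> s1 s2 x y Cs1 Cs2; case: (totC s1 s2 Cs1 Cs2) => /asboolP h.
        by exists s2 => //; apply: le_trans ((svalP s2).1.1 _ _) _; rewrite lerD2r.
      by exists s1 => //; apply: le_trans ((svalP s1).1.1 _ _) _; rewrite lerD2l.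
    + by move=> s a x a0 Cs; exists s => //; rewrite (svalP s).1.2// ltW.
  have iq x : inf [set sval s x | s in C] <= q x.
    by case: C0 => s Cs; apply: le_trans (le x s Cs) _; exact: (svalP s).2.
  pose i x := inf [set sval s x | s in C].
  have si' : sublinear i /\ forall x, i x <= q x by [].
  exists (exist _ i si') => s Cs; apply/asboolP => x /=.
  exact: le.
exists p; split => // p' sp' p'p.
have p'q x : p' x <= q x by apply: le_trans (p'p x) (pq x).
pose t : T := exist _ p' (conj sp' p'q).
exact: (congr1 sval (pmin t (asboolT p'p))).
Qed.

(** A minimal sublinear functional [p] is linear, because its slice
    [x |-> inf_t p (x + t v) - t p v] can only be [p] itself.  Starting from the
    slice of [q] in direction [v] forces the value at [v]. *)
Lemma hahn_banach_real q v : sublinear q -> exists p : V -> R,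
  [/\ forall x y, p (x + y) = p x + p y,
      forall (t : R) x, p (t%:C *: x) = t * p x,
      forall x, p x <= q x & p v = q v].
Proof.
move=> sq; have [q' [sq' q'q q'v]] := sublinear_slice v sq.
have [p [sp pq pmin]] := minimal_sublinear sq'.
have pD x y : p (x + y) = p x + p y.
  apply/eqP; rewrite eq_le sp.1/=.
  have [p' [sp' p'p p'y]] := sublinear_slice y sp.
  by have := p'y x; rewrite (pmin _ sp' p'p) lerBrDr.
have pN x : p (- x) = - p x.
  apply/eqP; rewrite -subr_eq0 opprK addrC -pD subrr.
  by rewrite sublinear0.
exists p; split => //.
- move=> t x; have [t0|t0] := leP 0 t; first exact: sp.2.
  have t0' : 0 <= - t by rewrite oppr_ge0 ltW.
  rewrite -[in LHS](opprK t) rmorphN/= scaleNr pN sp.2//.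
  by rewrite mulNr opprK.
- by move=> x; apply: le_trans (pq x) (q'q x).
- apply/eqP; rewrite eq_le (le_trans (pq v) (q'q v))/=.
  rewrite -lerN2 -pN; apply: le_trans (pq _) (le_trans (q'v _) _).
  by rewrite addNr sublinear0// add0r.
Qed.

(** The complex functional is [f x - i f (i x)], with [f] its real part; a rotation of
    the argument turns the bound for the real part into one for the absolute value. *)
Theorem hahn_banach_seminorm q v : seminorm q -> exists y : V -> R[i]^o,
  [/\ linear y, forall x, normc (y x) <= q x & y v = (q v)%:C].
Proof.
move=> hq; have [qD qZ] := hq.
have sq : sublinear q.
  by split=> // t x t0; rewrite qZ normc_real ger0_norm.
have [p [pD pZ pq pv]] := hahn_banach_real v sq.
pose y (x : V) : R[i]^o := Complex (p x) (- p ('i%C *: x)).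
have ly : linear y.
  move=> a x z; rewrite /y !scalerDr !pD scalerA (mulrC 'i%C) -scalerA.
  rewrite (complex_scaleE a x) (complex_scaleE a ('i%C *: x)) !pD !pZ.
  have -> : p ('i%C *: ('i%C *: x)) = - p x.
    rewrite scalerA -expr2 sqr_i -(mulN1r (p x)) -pZ rmorphN /=.
    by rewrite rmorph1.
  move: (p x) (p ('i%C *: x)) (p z) (p ('i%C *: z)) => u1 u2 u3 u4.
  rewrite -[a *: (_ : R[i]^o)]/(a * (u1 -i* u2)).
  case: a => a b /=; apply/eqP; rewrite eq_complex /=; apply/andP; split; apply/eqP.
    by ring.
  by ring.
have yZ a x : y (a *: x) = a * y x.
  have y0 : y 0 = 0.
    have := ly 1 0 0; rewrite !scale1r addr0 => /eqP.
    by rewrite -subr_eq subrr eq_sym => /eqP.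
  by rewrite -[a *: x]addr0 ly y0 addr0.
have yq x : normc (y x) <= q x.
  have [c c1 cy] := unit_rotation (y x).
  have : complex.Re (y (c *: x)) <= q x.
    by rewrite /=; apply: le_trans (pq _) _; rewrite qZ c1 mul1r.
  by rewrite yZ cy.
exists y; split => //; apply/eqP; rewrite eq_complex /= pv eqxx /=.
have := yq v; rewrite /= pv -(ler_pXn2r (n := 2)) ?nnegrE ?sqrtr_ge0//; last first.
  exact: seminorm_ge0.
rewrite sqr_sqrtr; last by rewrite addr_ge0 ?sqr_ge0.
by rewrite gerDl -[X in X <= _]/(_ ^+ 2) => h; rewrite -sqrf_eq0 eq_le h sqr_ge0.
Qed.

End hahn_banach.

(** * Seminorms on locally convex spaces *)

Section convexity.
Variables (R : realType) (V : lmodType R[i]).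

Lemma convex_combination (A : set V) (t : R) x y : convex_set A ->
  0 <= t <= 1 -> A x -> A y -> A (t%:C *: x + (1 - t)%:C *: y).
Proof.
move=> cA /andP[t0 t1] Ax Ay.
have t0' : 0 <= t%:C by rewrite (lecR 0).
have t1' : t%:C <= 1 by rewrite (lecR _ 1).
have := cA x y (Itv01 t0' t1'); rewrite !inE => /(_ Ax Ay).
by rewrite rmorphB rmorph1.
Qed.

Lemma convex_of_combinations (A : set V) :
  (forall (t : R) x y, 0 <= t <= 1 -> A x -> A y -> A (t%:C *: x + (1 - t)%:C *: y)) ->
  convex_set A.
Proof.
move=> hA x y l; rewrite !inE => Ax Ay.
have [l0 l1] : 0 <= l%:num /\ 0 <= 1 - l%:num by rewrite subr_ge0.
have lE : (complex.Re l%:num)%:C = l%:num by rewrite RRe_real// ger0_real.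
have lE' : (1 - complex.Re l%:num)%:C = 1 - l%:num by rewrite rmorphB /= lE.
have := hA (complex.Re l%:num) x y; rewrite lE' lE; apply => //; move: l0 l1; rewrite -lE subr_ge0.
by rewrite (lecR 0) (lecR _ 1) => -> ->.
Qed.

End convexity.

Section continuous_seminorms.
Variables (R : realType) (E : tvsType R[i]).
Implicit Types (q : E -> R) (U : set E).

Lemma nbhs_translate U x : nbhs 0 U -> nbhs x [set y | U (y - x)].
Proof.
have := @tvs_cvg_lin R E E (nbhs x) _ id (fun=> - x) 1 x (- x) cvg_id (cvg_cst _).
rewrite scale1r subrr => h /h; apply: (@filterS _ (nbhs x)) => y /=.
by rewrite scale1r.
Qed.

Lemma nbhs_untranslate U x : nbhs x U -> nbhs (0 : E) [set v | U (v + x)].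
Proof.
have := @tvs_cvg_lin R E E (nbhs 0) _ id (fun=> x) 1 0 x cvg_id (cvg_cst _).
rewrite scaler0 add0r => h /h; apply: (@filterS _ (nbhs 0)) => v /=.
by rewrite scale1r.
Qed.

Lemma nbhs_scale U (a : R[i]) : nbhs 0 U -> nbhs (0 : E) [set y | U (a *: y)].
Proof.
have := @tvs_cvg_lin R E E (nbhs 0) _ id (fun=> 0) a 0 0 cvg_id (cvg_cst _).
rewrite scaler0 addr0 => h /h; apply: (@filterS _ (nbhs 0)) => y /=.
by rewrite addr0.
Qed.

Lemma seminorm_dist q x y : seminorm q -> `|q x - q y| <= q (x - y).
Proof.
move=> sq; have [qD _] := sq.
have h u v : q u - q v <= q (u - v).
  by rewrite lerBlDr; apply: le_trans (qD _ _); rewrite subrK.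
by rewrite ler_norml h andbT lerNl opprB -(seminormN (x - y) sq) opprB.
Qed.

Lemma seminorm_continuous q : seminorm q -> nbhs 0 [set x | q x <= 1] ->
  continuous q.
Proof.
move=> sq q1 x; apply/cvgrPdist_lt => e e0.
have h := nbhs_translate x (nbhs_scale (2 / e)%:C q1).
apply: (@filterS _ (nbhs x) _ _ _ _ h) => y /=; rewrite sq.2 normc_real.
rewrite ger0_norm; last by rewrite divr_ge0 ?ltW.
rewrite mulrC -ler_pdivlMr ?divr_gt0// mul1r invf_div => qy.
rewrite distrC; apply: le_lt_trans (seminorm_dist _ _ sq) _.
by apply: le_lt_trans qy _; rewrite ltr_pdivrMr// ltr_pMr// ltr1n.
Qed.

Lemma seminorm_near0 q (e : R) : seminorm q -> continuous q -> 0 < e ->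
  nbhs 0 [set x | q x < e].
Proof.
move=> sq cq e0; have /cvgrPdist_lt/(_ e e0) : q @ (0 : E) --> q 0 := cq 0.
apply: (@filterS _ (nbhs 0)) => x; rewrite seminorm0// sub0r normrN.
by rewrite ger0_norm//; exact: seminorm_ge0.
Qed.

Lemma cvg_seminorm (T : Type) (G : set_system T) {FG : Filter G} (u : T -> E) l q :
  seminorm q -> continuous q -> u @ G --> l ->
  forall e : R, 0 < e -> \forall t \near G, q (u t - l) < e.
Proof.
move=> sq cq ul e e0.
exact: (ul _ (nbhs_translate l (seminorm_near0 sq cq e0))).
Qed.

(** The gauge of the balanced core of a convex neighbourhood. *)
Lemma nbhs_seminorm U : nbhs 0 U -> exists q,
  [/\ seminorm q, continuous q & forall x, q x < 1 -> U x].
Proof.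
move=> U0; have [B cB [oB bB]] := @locally_convex _ E.
have [V [BV V0] VU] := bB 0 U U0.
have V0' : nbhs 0 V.
  by apply: open_nbhs_nbhs; split => //; exact: oB.
have convV : convex_set V by apply: cB; rewrite inE.
have := @scale_continuous _ E (0, 0) V; rewrite /= scaler0 => /(_ V0').
move=> [[/= A W] [/= A0 W0] AWV].
have [d d0 dA] : exists2 d : R, 0 < d & forall a : R[i], normc a <= d -> A a.
  have [e /= e0 eA] := (nbhs_ballP _ _).1 A0.
  move: e0; rewrite ltcE /= => /andP[/eqP ie e0].
  exists (complex.Re e / 2); first by rewrite divr_gt0.
  move=> a ad; apply: eA; rewrite -ball_normE /= sub0r normrN normcC.
  rewrite ltcE /= -ie eqxx /=; apply: le_lt_trans ad _.
  by rewrite ltr_pdivrMr// ltr_pMr// ltr1n.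
pose D := [set x : E | forall a, normc a <= 1 -> V (a *: x)].
have D0 : nbhs 0 D.
  apply: (@filterS _ (nbhs 0) _ _ _ _ (nbhs_scale (d^-1)%:C W0)) => x Wx a a1.
  have -> : a *: x = (a * d%:C) *: ((d^-1)%:C *: x).
    by rewrite scalerA -mulrA -rmorphM divff ?gt_eqF// rmorph1 mulr1.
  apply: (AWV (_, _)); split => //=.
  apply: dA; rewrite ComplexField.Normc.normcM normc_real gtr0_norm//.
  by rewrite ler_piMl// ltW.
have Dbal a x : normc a <= 1 -> D x -> D (a *: x).
  move=> a1 Dx b b1; rewrite scalerA; apply: Dx.
  by rewrite ComplexField.Normc.normcM mulr_ile1 ?normc_ge0.
have Dcomb (t : R) x y : 0 <= t <= 1 -> D x -> D y ->
    D (t%:C *: x + (1 - t)%:C *: y).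
  move=> t01 Dx Dy a a1; rewrite scalerDr !scalerA ![a * _]mulrC -!scalerA.
  by apply: convex_combination => //; [exact: Dx|exact: Dy].
pose G x := [set t : R | 0 < t /\ D ((t^-1)%:C *: x)].
have neG x : G x !=set0.
  have := @scale_continuous _ E (0, x) D; rewrite /= scale0r => /(_ D0).
  move=> [[/= A' W'] [/= A'0 W'x] A'W'D].
  have [e /= e0 eA] := (nbhs_ballP _ _).1 A'0.
  move: e0; rewrite ltcE /= => /andP[/eqP ie e0].
  have e20 : 0 < complex.Re e / 2 by rewrite divr_gt0.
  exists (complex.Re e / 2)^-1; split; first by rewrite invr_gt0.
  rewrite invrK; apply: (A'W'D (_, _)); split => /=; last exact: nbhs_singleton.
  apply: eA; rewrite -ball_normE /= sub0r normrN normcC normc_real.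
  rewrite gtr0_norm// ltcE /= -ie eqxx /=.
  by rewrite ltr_pdivrMr// ltr_pMr// ltr1n.
have lbG x : has_lbound (G x) by exists 0 => t [t0 _]; exact: ltW.
pose q x := inf (G x).
have qle x t : 0 < t -> D ((t^-1)%:C *: x) -> q x <= t.
  by move=> t0 Dt; apply: ge_inf.
have qD x y : q (x + y) <= q x + q y.
  rewrite -lerBlDr; apply: lb_le_inf => // t [t0 Dt].
  rewrite lerBlDr -lerBlDl; apply: lb_le_inf => // s [s0 Ds]; rewrite lerBlDl.
  have ts0 : 0 < t + s by rewrite addr_gt0.
  apply: qle => //; rewrite scalerDr.
  have := Dcomb (t / (t + s)) _ _ _ Dt Ds.
  have -> : 1 - t / (t + s) = s / (t + s).
    by rewrite -(divff (lt0r_neq0 ts0)) -mulrBl addrAC subrr add0r.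
  rewrite !scalerA -!rmorphM mulrAC divff ?gt_eqF// mul1r.
  rewrite (mulrAC s) divff ?gt_eqF// mul1r; apply.
  by rewrite divr_ge0 ?(ltW t0) ?(ltW ts0)//= ler_pdivrMr// mul1r lerDl ltW.
have q0 : q 0 = 0.
  apply/eqP; rewrite eq_le; apply/andP; split; last first.
    by apply: lb_le_inf => // t [t0 _]; exact: ltW.
  rewrite leNgt; apply/negP => q0; have := @qle 0 (q 0 / 2).
  rewrite divr_gt0// scaler0 => /(_ erefl (nbhs_singleton D0)).
  by move=> h; lra.
have qZle a x : a != 0 -> q (a *: x) <= normc a * q x.
  move=> a0; have na0 : 0 < normc a by rewrite lt_def normc_ge0 normc_eq0 a0.
  rewrite -ler_pdivrMl//; apply: lb_le_inf => // t [t0 Dt].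
  rewrite ler_pdivrMl//; apply: qle; first by rewrite mulr_gt0.
  rewrite invfM rmorphM scalerA mulrAC -scalerA; apply: Dbal => //.
  rewrite ComplexField.Normc.normcM normc_real ger0_norm ?invr_ge0 ?normc_ge0//.
  by rewrite mulVf// gt_eqF.
have sq : seminorm q.
  split=> // a x; have [->|a0] := eqVneq a 0.
    by rewrite scale0r ComplexField.Normc.normc0 mul0r.
  have na0 : 0 < normc a by rewrite lt_def normc_ge0 normc_eq0 a0.
  apply/eqP; rewrite eq_le qZle//= -ler_pdivlMl//.
  rewrite -ComplexField.Normc.normcV -[in leLHS](scale1r x) -(mulVf a0) -scalerA.
  by apply: qZle; rewrite invr_eq0.
exists q; split => //.
  apply: seminorm_continuous => //.
  apply: (@filterS _ (nbhs 0) _ _ _ _ D0) => x Dx /=.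
  by apply: qle => //; rewrite invr1 scale1r.
move=> x /(inf_lt (neG x))[t [t0 Dt] t1]; apply: VU.
have := Dt t%:C; rewrite scalerA -rmorphM divff ?gt_eqF// scale1r; apply.
by rewrite normc_real gtr0_norm// ltW.
Qed.

End continuous_seminorms.

(** * Duals, and functionals continuous on the dual *)

Section linear_maps.
Variables (R : realType) (U W : lmodType R[i]) (f : U -> W).
Hypothesis lf : linear f.

Lemma lin_0 : f 0 = 0.
Proof.
have := lf 1 0 0; rewrite !scale1r addr0 => /eqP.
by rewrite -subr_eq subrr eq_sym => /eqP.
Qed.

Lemma lin_Z a x : f (a *: x) = a *: f x.
Proof. by rewrite -[a *: x]addr0 lf lin_0 addr0. Qed.

Lemma lin_D x y : f (x + y) = f x + f y.
Proof. by rewrite -{1}[x]scale1r lf scale1r. Qed.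

Lemma lin_N x : f (- x) = - f x.
Proof. by rewrite -scaleN1r lin_Z scaleN1r. Qed.

Lemma lin_B x y : f (x - y) = f x - f y.
Proof. by rewrite lin_D lin_N. Qed.

Lemma lin_sum (I : Type) (r : seq I) (u : I -> U) :
  f (\sum_(i <- r) u i) = \sum_(i <- r) f (u i).
Proof. by apply: (big_morph f lin_D lin_0). Qed.

End linear_maps.

Section scalar_topology.
Variable R : realType.

Lemma nbhs0_normcP (W : set R[i]^o) :
  nbhs (0 : R[i]^o) W <-> exists2 e : R, 0 < e & forall z : R[i], normc z < e -> W z.
Proof.
split=> [/nbhs_ballP[e /= e0 eW]|[e e0 eW]].
  move: e0; rewrite ltcE /= => /andP[/eqP ie e0].
  exists (complex.Re e) => // z ze; apply: eW.
  by rewrite -ball_normE /= sub0r normrN normcC ltcE /= -ie eqxx.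
apply: (@filterS _ (nbhs (0 : R[i]^o)) _ (ball (0 : R[i]^o) e%:C)); last first.
  by apply: nbhsx_ballx; rewrite (ltcR 0).
by move=> z; rewrite -ball_normE /= sub0r normrN normcC ltcR => /eW.
Qed.

Lemma entourage_normcP (E : set (R[i]^o * R[i]^o)) : entourage E ->
  exists2 e : R, 0 < e & forall x y : R[i], normc (x - y) < e -> E (x, y).
Proof.
rewrite -entourage_ballE => -[e /= e0 eE].
move: e0; rewrite ltcE /= => /andP[/eqP ie e0].
exists (complex.Re e) => // x y xy; apply: eE => /=.
by rewrite -ball_normE /= normcC ltcE /= -ie eqxx.
Qed.

Lemma cvg_normcP (T : Type) (G : set_system T) {FG : Filter G} (u : T -> R[i]^o)
    (l : R[i]) :
  u @ G --> (l : R[i]^o) <->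
  forall e : R, 0 < e -> \forall t \near G, normc (u t - l) < e.
Proof.
split=> [ul e e0|h W /nbhs_ballP[e /= e0 eW]].
  have := ul (ball (l : R[i]^o) e%:C) (nbhsx_ballx _ _ _); rewrite (ltcR 0).
  move=> /(_ e0); apply: (@filterS _ G) => t /=.
  by rewrite -ball_normE /= distrC normcC ltcR.
move: e0; rewrite ltcE /= => /andP[/eqP ie e0].
apply: (@filterS _ G _ _ _ _ (h _ e0)) => t /= te; apply: eW.
by rewrite -ball_normE /= distrC normcC ltcE /= -ie eqxx.
Qed.

End scalar_topology.

Section dual_facts.
Variables (R : realType) (Z : tvsType R[i]).
Implicit Types (y : dual Z) (q : Z -> R).

Lemma dual_fun_normc_continuous y : continuous (fun x => normc (dual_fun y x)).
Proof.
move=> x; exact: (@continuous_comp _ _ _ (dual_fun y) (@ComplexField.Normc.normc R)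
  x (@dual_continuous _ _ y x) (@normc_continuous R (dual_fun y x))).
Qed.

Lemma dual_of_seminorm q (f : Z -> R[i]^o) : linear f -> continuous q ->
  seminorm q -> (forall x, normc (f x) <= q x) -> exists y, dual_fun y = f.
Proof.
move=> lf cq sq fq; suff cf : continuous f by exists (Subspace _ (conj lf cf)).
move=> x; apply/cvg_normcP => e e0.
have := nbhs_translate x (seminorm_near0 sq cq e0); apply: (@filterS _ (nbhs x)).
by move=> z /= qz; rewrite -(lin_B lf); apply: le_lt_trans (fq _) qz.
Qed.

(** By the Hahn-Banach theorem, a continuous seminorm is the supremum of the
    functionals that it dominates. *)
Lemma dual_norming q v : seminorm q -> continuous q -> exists y,
  (forall x, normc (dual_fun y x) <= q x) /\ dual_fun y v = (q v)%:C.
Proof.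
move=> sq cq; have [f [lf fq fv]] := hahn_banach_seminorm v sq.
by have [y yf] := dual_of_seminorm lf cq sq fq; exists y; rewrite yf.
Qed.

(** The seminorm is the supremum of the functionals. *)
Lemma equicontinuous_seminorm (S : set (dual Z)) : equicontinuous_dual S ->
  exists q, [/\ seminorm q, continuous q &
    forall y, S y -> forall x, normc (dual_fun y x) <= q x].
Proof.
move=> eqS; pose q x := sup [set normc (dual_fun y x) | y in S].
have ubS x : has_ubound [set normc (dual_fun y x) | y in S].
  by have [m hm] := equicontinuous_ptb x eqS; exists m => _ [y Sy <-]; exact: hm.
have sq : seminorm q.
  apply: (@seminorm_sup _ _ _ S (fun y x => normc (dual_fun y x))) => // y Sy.
  split=> [u v|a u]; first by rewrite (lin_D (dual_linear y)) le_normcD.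
  by rewrite (lin_Z (dual_linear y)) ComplexField.Normc.normcM.
exists q; split => //; last first.
  by move=> y Sy x; apply: ub_le_sup => //; exists y.
apply: seminorm_continuous => //.
have := eqS 0 _ (entourage_normc (@ltr01 R)); apply: (@filterS _ (nbhs 0)).
move=> x /= hx; have [S0|/set0P S0] := eqVneq S set0.
  by rewrite /q S0 image_set0 sup0 ler01.
apply: ge_sup; first exact/image_nonempty.
move=> _ [y Sy <-]; have := hx y Sy.
by rewrite (lin_0 (dual_linear y)) sub0r normcN => /ltW.
Qed.

Lemma seminorm_equicontinuous q : seminorm q -> continuous q ->
  equicontinuous_dual [set y | forall x, normc (dual_fun y x) <= q x].
Proof.
move=> sq cq x E /entourage_normcP[e e0 eE].
have := nbhs_translate x (seminorm_near0 sq cq e0); apply: (@filterS _ (nbhs x)).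
move=> z /= qz y yq; apply: eE; rewrite -(lin_B (dual_linear y)).
by apply: le_lt_trans (yq _) _; rewrite -(seminormN _ sq) opprB.
Qed.

(** Finitely many compact convex circled sets lie, after rescaling, in one. *)
Lemma compact_disc_absorbs (Q : set (dual_c Z -> R)) (e : R) : finite_set Q ->
  Q `<=` @dual_c_seminorms R Z -> 0 < e -> exists K : set Z,
  [/\ compact K, convex_set K, circled K, K 0 &
    forall y, (forall k, K k -> normc (dual_fun y k) <= 1) ->
      forall p, Q p -> p y < e].
Proof.
move=> /finite_setP[n]; elim: n Q => [|n IH] Q.
  rewrite II0 card_eq0 => /eqP -> _ _; exists [set 0]; split => //.
  - exact: compact_set1.
  - apply: convex_of_combinations => t x y _ -> ->.
    by rewrite !scaler0 addr0.
  - by move=> a x _ ->; rewrite /= scaler0.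
move=> /eq_cardSP[p Qp /IH{}IH] QP e0.
have [K [cK vK bK K0 hK]] := IH (fun p' h => QP _ h.1) e0.
have [Kp [cKp vKp bKp pE]] := QP p Qp.
have [Kp0|/set0P[k0 Kk0]] := eqVneq Kp set0.
  exists K; split => // y yK p' Qp'; have [->|pp'] := pselect (p' = p).
    by rewrite pE Kp0 image_set0 sup0.
  by apply: hK.
have Kp0 : Kp 0 by rewrite -(scale0r k0); apply: bKp; rewrite ?ComplexField.Normc.normc0.
pose K' := [set (2 / e)%:C *: k.2 + k.1 | k in K `*` Kp].
exists K'; split.
- apply: continuous_compact; last exact: compact_setX.
  apply: continuous_subspaceT => z.
  exact: (@tvs_cvg_lin R Z (Z * Z)%type (nbhs z) _ snd fst (2 / e)%:C z.2 z.1
    cvg_snd cvg_fst).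
- apply: convex_of_combinations => t u v t01 [[x x'] [/= Kx Kx'] <-].
  move=> [[z z'] [/= Kz Kz'] <-].
  exists (t%:C *: x + (1 - t)%:C *: z, t%:C *: x' + (1 - t)%:C *: z') => /=.
    by split => /=; apply: convex_combination.
  rewrite !scalerDr !scalerA [RHS]addrACA.
  by congr (_ *: _ + _ *: _ + _); exact: mulrC.
- move=> a u a1 [[x x'] [/= Kx Kx'] <-]; exists (a *: x, a *: x') => /=.
    by split => /=; [exact: bK|exact: bKp].
  by rewrite scalerDr !scalerA mulrC.
- by exists (0, 0); rewrite //= scaler0 addr0.
- move=> y yK p' Qp'; have [->|pp'] := pselect (p' = p); last first.
    apply: hK => // k Kk; apply: yK; exists (k, 0) => //=.
    by rewrite scaler0 add0r.
  rewrite pE; apply: (@le_lt_trans _ _ (e / 2)); last first.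
    by rewrite ltr_pdivrMr// ltr_pMr// ltr1n.
  apply: ge_sup; first by apply/image_nonempty; exists 0.
  move=> _ [k Kk <-]; have : K' ((2 / e)%:C *: k).
    by exists (0, k); rewrite //= addr0.
  move=> /yK; rewrite (lin_Z (dual_linear y)) ComplexField.Normc.normcM normc_real.
  rewrite ger0_norm; last by rewrite divr_ge0// ltW.
  by rewrite mulrC -ler_pdivlMr ?divr_gt0// mul1r invf_div.
Qed.

(** If no point of [K] represented [L] on the list [ys], the point of [K] closest
    to [L] on [ys] would give a functional that separates [L] from [K]. *)
Lemma compact_disc_finite (K : set Z) (L : dual Z -> R[i]^o) (ys : seq (dual Z)) :
  compact K -> convex_set K -> circled K -> K 0 -> linear L ->
  (forall y, (forall k, K k -> normc (dual_fun y k) <= 1) -> normc (L y) <= 1) ->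
  exists2 k, K k & forall y, y \in ys -> dual_fun y k = L y.
Proof.
move=> cK vK bK K0 lL LK.
pose D (k : Z) : R := \sum_(y <- ys) normc (dual_fun y k - L y) ^+ 2.
have cD : continuous D.
  rewrite /D => k; elim: (ys) => [|y s IH].
    rewrite (_ : (fun k => _) = fun=> 0); first exact: cst_continuous.
    by apply/funext => z; rewrite big_nil.
  rewrite (_ : (fun k => _) = fun k => normc (dual_fun y k - L y) ^+ 2 +
     \sum_(j <- s) normc (dual_fun j k - L j) ^+ 2); last first.
    by apply/funext => z; rewrite big_cons.
  apply: cvgD; last exact: IH.
  apply: (@continuous_comp _ _ _ (fun k => normc (dual_fun y k - L y)) (fun t : R => t ^+ 2)).
    apply: (@continuous_comp _ _ _ (fun k => dual_fun y k - L y)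
      (@ComplexField.Normc.normc R)); last exact: normc_continuous.
    by apply: (@cvgB _ R[i]^o); [exact: dual_continuous|exact: cvg_cst].
  exact: exprn_continuous.
have [k0] := compact_EVT_min (ex_intro _ 0 K0) cK (continuous_subspaceT cD).
rewrite inE => Kk0 kmin.
have D0 : 0 <= D k0 by apply: sumr_ge0 => y _; rewrite sqr_ge0.
move: D0; rewrite le_eqVlt => /predU1P[/esym/eqP|r0].
  rewrite /D psumr_eq0 => [/allP h|y _]; last exact: sqr_ge0.
  exists k0 => // y /h; rewrite sqrf_eq0 normc_eq0 subr_eq0.
  by move=> /eqP.
set r := D k0 in r0.
pose c y : R[i] := dual_fun y k0 - L y.
pose ystar : dual Z := \sum_(y <- ys) (c y)^*%C *: y.
have fs k : dual_fun ystar k = \sum_(y <- ys) (c y)^*%C * dual_fun y k.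
  rewrite /ystar; elim: (ys) => [|y s IH]; first by rewrite !big_nil.
  by rewrite !big_cons dual_funD dual_funZ IH.
have Re_sum (I : Type) (s : seq I) (g : I -> R[i]) :
    complex.Re (\sum_(i <- s) g i) = \sum_(i <- s) complex.Re (g i).
  by apply: (big_morph (@complex.Re R)) => // -[? ?] [? ?].
have expand k (t : R) : 0 <= t <= 1 -> K k -> r <= r +
    2 * t * complex.Re (dual_fun ystar (k - k0)) +
    t ^+ 2 * \sum_(y <- ys) normc (dual_fun y (k - k0)) ^+ 2.
  move=> t01 Kk; have := convex_combination vK t01 Kk Kk0.
  move=> Kt; have := kmin (t%:C *: k + (1 - t)%:C *: k0); rewrite inE => /(_ Kt).
  move=> /le_trans; apply; rewrite le_eqVlt; apply/orP; left; apply/eqP.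
  rewrite fs Re_sum /r /D !mulr_sumr -!big_split /=; apply: eq_bigr => y _.
  have -> : t%:C *: k + (1 - t)%:C *: k0 = k0 + t%:C *: (k - k0).
    rewrite rmorphB rmorph1 scalerBl scale1r scalerBr.
    by rewrite addrCA addrA.
  rewrite (lin_D (dual_linear y)) (lin_Z (dual_linear y)) /c.
  move: (dual_fun y (k - k0)) (dual_fun y k0) (L y) => [u1 u2] [v1 v2] [w1 w2] /=.
  rewrite !sqr_sqrtr ?addr_ge0 ?sqr_ge0//.
  by ring.
have Re_ge k : K k -> complex.Re (dual_fun ystar k0) <= complex.Re (dual_fun ystar k).
  move=> Kk; rewrite -subr_ge0.
  have -> : complex.Re (dual_fun ystar k) - complex.Re (dual_fun ystar k0) =
      complex.Re (dual_fun ystar (k - k0)).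
    rewrite (lin_B (dual_linear ystar)).
    by case: (dual_fun ystar k) (dual_fun ystar k0) => [? ?] [? ?].
  have := fun t t01 => expand k t t01 Kk.
  set a := complex.Re _; set b := \sum_(y <- ys) _.
  have b0 : 0 <= b by apply: sumr_ge0 => y _; rewrite sqr_ge0.
  move=> h; rewrite leNgt; apply/negP => a0.
  pose t := Num.min 1 (- a / (b + 1)).
  have b1 : 0 < b + 1 by rewrite ltr_wpDl.
  have t0 : 0 < t by rewrite lt_min ltr01 divr_gt0// oppr_gt0.
  have := h t; rewrite (ltW t0) ge_min lexx => /(_ erefl).
  have tb : t * (b + 1) <= - a by rewrite -ler_pdivlMr// ge_min lexx orbT.
  move=> hh; have : 0 <= t * (2 * a + t * b) by nra.
  by rewrite pmulr_rge0//; nra.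
pose a := - complex.Re (dual_fun ystar k0).
have ya k : K k -> normc (dual_fun ystar k) <= a.
  move=> Kk; have [u u1 uk] := unit_rotation (dual_fun ystar k).
  have : K (- u *: k) by apply: bK => //; rewrite normcN u1.
  move=> /Re_ge; rewrite (lin_Z (dual_linear ystar)) -[_ *: _]/(_ * _) mulNr uk /=.
  by rewrite lerNr.
have a0 : 0 <= a by apply: le_trans (ya 0 K0); exact: normc_ge0.
have LE : complex.Re (L ystar) = - a - r.
  rewrite /ystar (lin_sum lL) Re_sum /a fs Re_sum opprK /r /D -sumrB.
  apply: eq_bigr => y _; rewrite (lin_Z lL) -[_ *: _]/(_ * _) /c.
  move: (dual_fun y k0) (L y) => [u1 u2] [v1 v2] /=.
  by rewrite sqr_sqrtr ?addr_ge0 ?sqr_ge0//; ring.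
have ar0 : 0 < a + r / 2 by rewrite ltr_wpDl// divr_gt0.
have := LK ((a + r / 2)^-1%:C *: ystar).
rewrite (lin_Z lL) ComplexField.Normc.normcM normc_real gtr0_norm ?invr_gt0//.
move=> LK'.
have : (a + r / 2)^-1 * normc (L ystar) <= 1.
  apply: LK' => k Kk; rewrite dual_funZ ComplexField.Normc.normcM normc_real.
  rewrite gtr0_norm ?invr_gt0// ler_pdivrMl// mulr1.
  by apply: le_trans (ya k Kk) _; rewrite lerDl divr_ge0// ltW.
rewrite ler_pdivrMl// mulr1 => h.
have := Re_le_normc (- L ystar); rewrite normcN.
have -> : complex.Re (- L ystar) = a + r.
  by move: LE; case: (L ystar) => /= u v ->; rewrite opprD !opprK.
by move=> h'; have := le_trans h' h; rewrite lerD2l; move: r0; lra.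
Qed.

(** A form of the Mackey-Arens theorem: the continuous linear functionals on the
    dual, with uniform convergence on compact discs, are the evaluations. *)
Theorem dual_c_evaluation (L : dual_c Z -> R[i]^o) : linear L ->
  (forall W, nbhs (0 : R[i]^o) W -> \forall y \near (0 : dual_c Z), W (L y)) ->
  exists k : Z, forall y, L y = dual_fun y k.
Proof.
move=> lL cL.
have W1 : nbhs (0 : R[i]^o) [set z : R[i]^o | normc z < 1].
  by apply/nbhs0_normcP; exists 1.
have [Q [e [finQ QP e0 sub]]] := cL _ W1.
have [K [cK vK bK K0 hK]] := compact_disc_absorbs finQ QP e0.
have LK (y : dual Z) : (forall k, K k -> normc (dual_fun y k) <= 1) -> normc (L y) <= 1.
  move=> yK; apply/ltW/sub => p Qp; rewrite subr0; exact: hK.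
pose F := filter_from [set: seq (dual Z)]
  (fun ys => [set k | K k /\ forall y, y \in ys -> dual_fun y k = L y]).
have PF : ProperFilter F.
  apply: filter_from_proper; last first.
    move=> ys _; have [k Kk hk] := @compact_disc_finite K L ys cK vK bK K0 lL LK.
    by exists k.
  apply: filter_from_filter; first by exists [::].
  move=> s t _ _; exists (s ++ t) => // k [Kk hk]; split; split => // y ys;
    by apply: hk; rewrite mem_cat ys ?orbT.
have FK : F K by exists [::] => // k [].
have [k [Kk clk]] := cK F PF FK.
exists k => y; apply/eqP; rewrite eq_sym -subr_eq0 -normc_eq0.
apply/negPn/negP => ne; have e'0 : 0 < normc (dual_fun y k - L y).
  by rewrite lt_def ne normc_ge0.
have Fy : F [set k' | dual_fun y k' = L y].
  by exists [:: y] => // k' [_]; apply; rewrite mem_seq1.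
have cy : dual_fun y @ k --> dual_fun y k := @dual_continuous _ _ y k.
have yB := (cvg_normcP (dual_fun y) _).1 cy _ e'0.
have [k' [/= ->]] := clk _ _ Fy (yB _).
by rewrite -normcN opprB ltxx.
Qed.

End dual_facts.

(** * Differential calculus on lines *)

Section real_lines.
Variable R : realType.

Lemma is_derive_of_cvg (u : R -> R) t0 l :
  (fun h => h^-1 * (u (t0 + h) - u t0)) @ 0^' --> l -> is_derive t0 1 u l.
Proof.
move=> ul; have E : (fun h => h^-1 *: ((u \o shift t0) (h *: (1 : R)) - u t0)) =
    (fun h => h^-1 * (u (t0 + h) - u t0)).
  by apply/funext => h; rewrite /= /shift /= -[h *: _]/(h * 1) mulr1 [h + t0]addrC.
have ul' : (fun h => h^-1 *: ((u \o shift t0) (h *: (1 : R)) - u t0)) @ 0^' --> l.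
  by rewrite E.
apply: DeriveDef; first by apply/cvg_ex; exists l.
by rewrite /derive; apply: cvg_lim ul'.
Qed.

Lemma mean_value (u u' : R -> R) (a b : R) : (forall t : R, is_derive t 1 u (u' t)) ->
  exists c, `|c - a| <= `|b - a| /\ u b - u a = u' c * (b - a).
Proof.
move=> du.
have du' c d : {within `[c, d], continuous u}.
  by apply: derivable_within_continuous => t _; exact: (@ex_derive _ _ _ _ _ _ _ (du t)).
have [ab|ba] := leP a b.
  have [c] := @MVT_segment R u u' a b ab (fun t _ => du t) (du' _ _).
  rewrite in_itv /= => /andP[ac cb] E; exists c; split => //.
  by rewrite !ger0_norm ?subr_ge0// lerD2r.
have [c] := @MVT_segment R u u' b a (ltW ba) (fun t _ => du t) (du' _ _).
rewrite in_itv /= => /andP[bc ca] E; exists c; split.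
  by rewrite !ler0_norm ?subr_le0 ?(ltW ba)// lerN2 lerD2r.
by rewrite -[LHS]opprB E -mulrN opprB.
Qed.

Lemma cvg_Re (T : Type) (G : set_system T) {FG : Filter G} (u : T -> R[i]^o) (l : R[i]) :
  u @ G --> (l : R[i]^o) -> (fun t => complex.Re (u t)) @ G --> complex.Re l.
Proof.
move=> ul; apply/cvgrPdist_lt => e e0; have h := (@cvg_normcP R T G FG u l).1 ul e e0.
apply: filterS h => t; apply: le_lt_trans.
rewrite distrC; have := Re_le_normc (u t - l); have := Re_le_normc (- (u t - l)).
rewrite normcN; case: (u t) (l) => [a b] [a' b'] /= h h'.
by rewrite ler_norml h' andbT lerNl.
Qed.

End real_lines.

Section smooth_functions.
Variables (R : realType) (d : nat).
Notation e_ j := (delta_mx 0 j : 'rV[R]_d).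

Lemma continuous_box (g : 'rV[R]_d -> R) (x v w : 'rV[R]_d) (e : R) : 0 < e ->
  {for x, continuous g} -> exists2 r : R, 0 < r &
    forall a b, `|a| < r -> `|b| < r -> `|g x - g (x + a *: v + b *: w)| < e.
Proof.
move=> e0 cg.
have cl : (fun z : R * R => x + z.1 *: v + z.2 *: w) @ ((0 : R), (0 : R)) -->
    x + (0 : R) *: v + (0 : R) *: w.
  apply: cvgD; last by apply: cvgZ; [exact: cvg_snd|exact: cvg_cst].
  by apply: cvgD; [exact: cvg_cst|apply: cvgZ; [exact: cvg_fst|exact: cvg_cst]].
rewrite !scale0r !addr0 in cl.
have cgl := cvg_comp _ _ cl cg.
have /cvgrPdist_lt/(_ e e0) := cgl.
move=> [[/= A B] [/= /nbhs_ballP[r1 /= r10 h1] /nbhs_ballP[r2 /= r20 h2]] AB].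
exists (Num.min r1 r2); first by rewrite lt_min r10.
move=> a b; rewrite !lt_min => /andP[ar _] /andP[_ br].
apply: (AB (a, b)); split => /=; [apply: h1|apply: h2];
  by rewrite -ball_normE /= sub0r normrN.
Qed.

(** Both mixed second derivatives are limits of the same double difference. *)
Lemma double_difference (U Ui Uj Uij Uji : R -> R -> R) (t : R) :
  (forall a b : R, is_derive a 1 (U^~ b) (Ui a b)) ->
  (forall a b : R, is_derive b 1 (U a) (Uj a b)) ->
  (forall a b : R, is_derive b 1 (Ui a) (Uji a b)) ->
  (forall a b : R, is_derive a 1 (Uj^~ b) (Uij a b)) -> 0 < t ->
  exists a b c c', [/\ `|a| <= t, `|b| <= t, `|c| <= t, `|c'| <= t &
    Uij a b = Uji c c'].
Proof.
move=> di dj dji dij t0.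
have [c [ct Ec]] := @mean_value R (fun s => U s t - U s 0)
  (fun s => Ui s t - Ui s 0) 0 t (fun s => is_deriveB (di s t) (di s 0)).
have [c' [ct' Ec']] := mean_value 0 t (dji c).
have [b [bt Eb]] := @mean_value R (fun s => U t s - U 0 s)
  (fun s => Uj t s - Uj 0 s) 0 t (fun s => is_deriveB (dj t s) (dj 0 s)).
have [a [at' Ea]] := mean_value 0 t (dij^~ b).
exists a, b, c, c'; move: at' bt ct ct'; rewrite !subr0 (gtr0_norm t0).
move=> -> -> -> ->; split => //.
move: Ec Eb; rewrite Ec' Ea !subr0 => Ec Eb.
have tt : t * t != 0 by rewrite mulf_neq0 ?gt_eqF.
apply: (mulIf tt); rewrite !mulrA -Ec -Eb; ring.
Qed.

(** Schwarz' theorem. *)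
Lemma mixed_derivatives (u ui uj uij uji : 'rV[R]_d -> R) (i j : 'I_d) :
  (forall x (t : R), is_derive t 1 (fun t => u (x + t *: e_ i)) (ui (x + t *: e_ i))) ->
  (forall x (t : R), is_derive t 1 (fun t => u (x + t *: e_ j)) (uj (x + t *: e_ j))) ->
  (forall x (t : R), is_derive t 1 (fun t => ui (x + t *: e_ j)) (uji (x + t *: e_ j))) ->
  (forall x (t : R), is_derive t 1 (fun t => uj (x + t *: e_ i)) (uij (x + t *: e_ i))) ->
  continuous uij -> continuous uji -> uij =1 uji.
Proof.
move=> di dj dji dij cij cji x; apply/eqP; rewrite -subr_eq0 -normr_le0.
apply/ler_addgt0Pl => e e0; rewrite addr0.
have e20 : 0 < e / 2 by rewrite divr_gt0.
have [r r0 hr] := continuous_box (e_ i) (e_ j) e20 (cij x).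
have [r' r'0 hr'] := continuous_box (e_ i) (e_ j) e20 (cji x).
pose t := Num.min r r' / 2.
have rr0 : 0 < Num.min r r' by rewrite lt_min r0.
have t0 : 0 < t by rewrite divr_gt0.
have : t < Num.min r r' by rewrite ltr_pdivrMr// ltr_pMr// ltr1n.
rewrite lt_min => /andP[tr1 tr2].
pose P (g : 'rV[R]_d -> R) (a b : R) := g (x + a *: e_ i + b *: e_ j).
have PC g b : (P g)^~ b = (fun a => g (x + b *: e_ j + a *: e_ i)).
  by apply/funext => a; rewrite /P addrAC.
have d1 (a b : R) : is_derive a 1 ((P u)^~ b) (P ui a b).
  by rewrite PC /P addrAC; exact: di.
have d2 (a b : R) : is_derive a 1 ((P uj)^~ b) (P uij a b).
  by rewrite PC /P addrAC; exact: dij.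
have [a [b [c [c' [ha hb hc hc' E]]]]] := @double_difference (P u) (P ui) (P uj)
  (P uij) (P uji) t d1 (fun a b => dj _ b) (fun a b => dji _ b) d2 t0.
have h1 := hr a b (le_lt_trans ha tr1) (le_lt_trans hb tr1).
have h2 := hr' c c' (le_lt_trans hc tr2) (le_lt_trans hc' tr2).
rewrite -/(P uji _ _) -E /P in h2.
rewrite (splitr e) -(subrKA (uij (x + a *: e_ i + b *: e_ j))).
apply: le_trans (ler_normD _ _) _; rewrite lerD ?(ltW h1)// distrC ltW//.
Qed.

Section scalar_functions.
Variable f : 'rV[R]_d -> R[i]^o.
Hypothesis sf : smooth f.

Lemma pderivsE s j x : diff_quot (pderivs s f) j x @ 0^' --> pderivs (j :: s) f x.
Proof. by have [l fl] := sf.2 s j x; rewrite /= (pderivE fl). Qed.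

Lemma is_derive_Re s j x (t : R) : is_derive t 1
  (fun t => complex.Re (pderivs s f (x + t *: e_ j)))
  (complex.Re (pderivs (j :: s) f (x + t *: e_ j))).
Proof.
apply: is_derive_of_cvg.
rewrite [X in X @ _](_ : _ =
    (fun h => complex.Re (diff_quot (pderivs s f) j (x + t *: e_ j) h))).
  exact: cvg_Re (@pderivsE s j (x + t *: e_ j)).
apply/funext => h; rewrite /diff_quot scalerDl addrA.
move: (pderivs s f (x + t *: e_ j + h *: e_ j)) (pderivs s f (x + t *: e_ j)).
by move=> [a b] [a' b']; rewrite /= mul0r subr0.
Qed.

Lemma Re_pderivs_continuous s : continuous (fun x => complex.Re (pderivs s f x)).
Proof. by move=> x; exact: (@cvg_Re _ _ (nbhs x) _ (pderivs s f) _ (sf.1 s x)). Qed.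

End scalar_functions.

Section vector_functions.
Variables (F : lcsType R[i]) (phi : 'rV[R]_d -> F).
Hypothesis sphi : smooth phi.

Lemma diff_quot_dual (y : dual F) (g : 'rV[R]_d -> F) j x l :
  diff_quot g j x @ 0^' --> l ->
  diff_quot (fun x => dual_fun y (g x)) j x @ 0^' --> dual_fun y l.
Proof.
move=> gl; have -> : diff_quot (fun x => dual_fun y (g x)) j x =
    dual_fun y \o diff_quot g j x.
  by apply/funext => t; rewrite /diff_quot /= (lin_Z (dual_linear y)) (lin_B (dual_linear y)).
by apply: (continuous_cvg _ (@dual_continuous _ _ y l)).
Qed.

Lemma pderivs_dual (y : dual F) s :
  pderivs s (fun x => dual_fun y (phi x)) = (fun x => dual_fun y (pderivs s phi x)).
Proof.
elim: s => // j s IH; rewrite /= -!/(pderivs _ _) IH; apply/funext => x.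
have [l hl] := sphi.2 s j x; rewrite (pderivE hl).
exact/pderivE/diff_quot_dual.
Qed.

Lemma smooth_dual (y : dual F) : smooth (fun x => dual_fun y (phi x)).
Proof.
split=> s.
  rewrite pderivs_dual => x.
  exact: (@continuous_comp _ _ _ (pderivs s phi) (dual_fun y) x (sphi.1 s x)
    (@dual_continuous _ _ y _)).
move=> j x; rewrite pderivs_dual; have [l hl] := sphi.2 s j x.
by exists (dual_fun y l); exact: diff_quot_dual.
Qed.

End vector_functions.

Section separation.
Variable F : lcsType R[i].

Lemma lcs_cvgP (T : Type) (G : set_system T) {FG : Filter G} (u : T -> F) l :
  (forall q, cts_seminorm q -> forall e : R, 0 < e -> \forall t \near G, q (u t - l) < e) ->
  u @ G --> l.
Proof.
move=> h W Wl; have Wl' := nbhs_untranslate Wl.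
have [q [sq cq qW]] := nbhs_seminorm Wl'.
apply: (@filterS _ G _ _ _ _ (h q (conj sq cq) 1 ltr01)) => t /= /qW /=.
by rewrite subrK.
Qed.

(** Both vectors are limits of the same filter. *)
Lemma lcs_separated (v w : F) :
  (forall q, cts_seminorm q -> q (v - w) = 0) -> v = w.
Proof.
move=> h; apply: (cvg_unique hausdorffP (F := nbhs v)); first exact: cvg_id.
apply: lcs_cvgP => q hq e e0.
have [sq cq] := hq; apply: (@filterS _ (nbhs v) _ _ _ _
  (@cvg_seminorm R F F (nbhs v) _ id v q sq cq cvg_id e e0)) => t /= tv; rewrite -(subrKA v).
by apply: le_lt_trans (sq.1 _ _) _; rewrite h// addr0.
Qed.

Lemma dual_separated (v w : F) : (forall y, dual_fun y v = dual_fun y w) -> v = w.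
Proof.
move=> h; apply: lcs_separated => q [sq cq].
have [y [_ yv]] := dual_norming (v - w) sq cq.
move: yv; rewrite (lin_B (dual_linear y)) h subrr => /esym/eqP.
by rewrite (_ : 0 = 0%:C)// => /eqP/complexI.
Qed.

End separation.

Section vector_calculus.
Variables (F : lcsType R[i]) (phi : 'rV[R]_d -> F).
Hypothesis sphi : smooth phi.

Lemma dual_ReP (v w : F) :
  (forall y, complex.Re (dual_fun y v) = complex.Re (dual_fun y w)) -> v = w.
Proof.
move=> h; apply: dual_separated => y.
have := h (- 'i%C *: y); have := h y; rewrite !dual_funZ.
move: (dual_fun y v) (dual_fun y w) => [a b] [a' b'].
by rewrite /= !oppr0 !mul0r !sub0r !mulN1r !opprK => -> ->.
Qed.

(** Schwarz' theorem for scalar functions, applied to the composites with functionals,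
    which separate the points. *)
Lemma pderivs_swap i j s : pderivs [:: i, j & s] phi = pderivs [:: j, i & s] phi.
Proof.
apply/funext => x; apply: dual_ReP => y.
have sf := smooth_dual sphi y; set f := (fun x => dual_fun y (phi x)) in sf.
have E t : dual_fun y (pderivs t phi x) = pderivs t f x by rewrite pderivs_dual.
apply: (etrans (congr1 (@complex.Re R) (E [:: i, j & s]))).
apply: (etrans _ (esym (congr1 (@complex.Re R) (E [:: j, i & s])))).
move: x {E}; apply: (@mixed_derivatives
  (fun x => complex.Re (pderivs s f x)) (fun x => complex.Re (pderivs (i :: s) f x))
  (fun x => complex.Re (pderivs (j :: s) f x))
  (fun x => complex.Re (pderivs [:: i, j & s] f x))
  (fun x => complex.Re (pderivs [:: j, i & s] f x)) i j).
- by move=> x t; exact: is_derive_Re.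
- by move=> x t; exact: is_derive_Re.
- by move=> x t; exact: is_derive_Re.
- by move=> x t; exact: is_derive_Re.
- exact: Re_pderivs_continuous.
- exact: Re_pderivs_continuous.
Qed.

Lemma pderivs_move i s t : pderivs (s ++ i :: t) phi = pderivs (i :: s ++ t) phi.
Proof.
elim: s => //= j s IH; rewrite -/(pderivs _ _) IH.
exact: pderivs_swap.
Qed.

Lemma pderivs_perm s t : perm_eq s t -> pderivs s phi = pderivs t phi.
Proof.
elim: s t => [|i s IH] t; first by rewrite perm_sym => /perm_nilP ->.
move=> st; have it : i \in t by rewrite -(perm_mem st) mem_head.
move: st; case/splitPr: it => t1 t2; rewrite perm_sym perm_catC /= perm_cons.
rewrite perm_catC perm_sym => st.
by rewrite pderivs_move /= -!/(pderivs _ _) (IH _ st).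
Qed.

(** The mean value theorem holds only for real functions; with [dual_norming] it
    gives the increment and Taylor estimates for seminorms. *)
Lemma dual_mean_value (y : dual F) s j x (t : R) : exists r : R, `|r| <= `|t| /\
  complex.Re (dual_fun y (pderivs s phi (x + t *: e_ j) - pderivs s phi x)) =
  t * complex.Re (dual_fun y (pderivs (j :: s) phi (x + r *: e_ j))).
Proof.
have sf := smooth_dual sphi y; set f := (fun x => dual_fun y (phi x)) in sf.
have E u z : dual_fun y (pderivs u phi z) = pderivs u f z by rewrite pderivs_dual.
have [r [rt h]] := mean_value 0 t (fun t => is_derive_Re sf s j x t).
exists r; move: rt h; rewrite !subr0 scale0r addr0 => rt h; split => //.
rewrite (lin_B (dual_linear y)) !E mulrC -h.
by case: (pderivs s f _) (pderivs s f _) => [? ?] [? ?].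
Qed.

Lemma increment_le q s j x (t B : R) : cts_seminorm q ->
  (forall r : R, `|r| <= `|t| -> q (pderivs (j :: s) phi (x + r *: e_ j)) <= B) ->
  q (pderivs s phi (x + t *: e_ j) - pderivs s phi x) <= `|t| * B.
Proof.
move=> [sq cq] hB; set v := _ - _.
have [y [yq yv]] := dual_norming v sq cq.
have [r [rt h]] := dual_mean_value y s j x t.
have -> : q v = complex.Re (dual_fun y v) by rewrite yv.
rewrite h; apply: le_trans (ler_norm _) _; rewrite normrM ler_wpM2l//.
apply: le_trans (hB r rt); apply: le_trans (yq _); rewrite ler_norml.
rewrite Re_le_normc andbT lerNl -normcN.
by apply: le_trans (Re_le_normc _); case: (dual_fun y _).
Qed.

Lemma taylor_le q s j x (t B : R) : cts_seminorm q ->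
  (forall r : R, `|r| <= `|t| -> q (pderivs [:: j, j & s] phi (x + r *: e_ j)) <= B) ->
  q (pderivs s phi (x + t *: e_ j) - pderivs s phi x -
     t%:C *: pderivs (j :: s) phi x) <= `|t| ^+ 2 * B.
Proof.
move=> hq hB; have [sq cq] := hq; set v := _ - _.
have [y [yq yv]] := dual_norming v sq cq.
have [r [rt h]] := dual_mean_value y s j x t.
have -> : q v = complex.Re (dual_fun y v) by rewrite yv.
have -> : complex.Re (dual_fun y v) = t * complex.Re (dual_fun y
    (pderivs (j :: s) phi (x + r *: e_ j) - pderivs (j :: s) phi x)).
  rewrite /v (lin_B (dual_linear y)) (lin_B (dual_linear y) (pderivs (j :: s) phi _)).
  move: h; rewrite (lin_Z (dual_linear y)).
  set a1 := dual_fun y (pderivs s phi _ - _); set a2 := dual_fun y _.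
  set a3 := dual_fun y _; move: a1 a2 a3 => [a b] [a' b'] [a2 b2].
  by rewrite /= => ->; ring.
apply: le_trans (ler_norm _) _; rewrite normrM expr2 -mulrA ler_wpM2l//.
have rB : q (pderivs (j :: s) phi (x + r *: e_ j) - pderivs (j :: s) phi x) <= `|r| * B.
  by apply: increment_le => // r' r'r; apply: hB; apply: le_trans rt.
apply: (@le_trans _ _ (`|r| * B)); last first.
  apply: ler_wpM2r => //; apply: le_trans (hB 0 _); last by rewrite normr0.
  exact: seminorm_ge0.
apply: le_trans rB; apply: le_trans (yq _); rewrite ler_norml.
rewrite Re_le_normc andbT lerNl -normcN.
by apply: le_trans (Re_le_normc _); case: (dual_fun y _).
Qed.

End vector_calculus.

Section multi_indices.
Variables (F : lcsType R[i]) (phi : 'rV[R]_d -> F).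

Lemma size_mseq (alpha : 'I_d -> nat) : size (mseq alpha) = mdeg alpha.
Proof.
rewrite /mseq /mdeg size_flatten /shape -map_comp sumnE big_map big_enum.
by apply: eq_bigr => j _; rewrite /= size_nseq.
Qed.

Lemma seminorm_mderiv q alpha x : seminorm q ->
  q (mderiv alpha phi x) = q (pderivs (mseq alpha) phi x).
Proof.
move=> [_ qZ]; rewrite /mderiv qZ.
suff -> : normc ((- 'i%C) ^+ mdeg alpha : R[i]) = 1 by rewrite mul1r.
elim: (mdeg alpha) => [|n IH]; first by rewrite expr0 ComplexField.Normc.normc1.
rewrite exprS ComplexField.Normc.normcM IH mulr1 normcN /=.
by rewrite expr0n add0r expr1n sqrtr1.
Qed.

Lemma perm_mseq (s : seq 'I_d) : perm_eq (mseq (fun j => count_mem j s)) s.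
Proof.
apply/allP => j _ /=; apply/eqP; rewrite /mseq count_flatten -map_comp sumnE.
rewrite big_map big_enum /= (bigD1 j)//= count_nseq /= eqxx mul1n big1 ?addn0// => i ij.
by rewrite count_nseq /= (negbTE ij).
Qed.

(** From here on, words of directions replace multi-indices: seminorms do not see the
    order of the derivations nor the factors [-i]. *)
Lemma mderiv_pderivs q s x : smooth phi -> seminorm q -> exists2 alpha,
  mdeg alpha = size s & q (pderivs s phi x) = q (mderiv alpha phi x).
Proof.
move=> sphi sq; exists (fun j => count_mem j s).
  by rewrite -size_mseq (perm_size (perm_mseq s)).
by rewrite seminorm_mderiv// (pderivs_perm sphi (perm_mseq s)).
Qed.

End multi_indices.
End smooth_functions.

(** * Products of cosines *)

Section cosine_products.
Variable R : realType.
Implicit Types (x y r : R) (s : seq R).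

(** The derivatives of the cosine, by their order. *)
Definition cosd (i : nat) y : R :=
  if odd i then (-1) ^+ (i./2).+1 * sin y else (-1) ^+ i./2 * cos y.

Lemma is_derive_cosd i y : is_derive y 1 (cosd i) (cosd i.+1 y).
Proof.
have [io|ie] := boolP (odd i).
  have E : cosd i = (-1) ^+ (i./2).+1 \*: sin.
    by apply/funext => z; rewrite /cosd io.
  have -> : cosd i.+1 y = (-1) ^+ (i./2).+1 *: cos y.
    by rewrite /cosd /= io /= uphalf_half io add1n.
  by rewrite E; exact: is_deriveZ.
have E : cosd i = (-1) ^+ i./2 \*: cos.
  by apply/funext => z; rewrite /cosd (negbTE ie).
have -> : cosd i.+1 y = (-1) ^+ i./2 *: - sin y.
  rewrite /cosd /= (negbTE ie) /= uphalf_half (negbTE ie) add0n.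
  by rewrite exprS mulN1r mulNr -mulrN.
by rewrite E; exact: is_deriveZ.
Qed.

Lemma cosd_le1 i y : `|cosd i y| <= 1.
Proof.
rewrite /cosd; case: ifP => _; rewrite normrM normrX normrN1 expr1n mul1r.
  exact: sin_max.
exact: cos_max.
Qed.

(** The Taylor coefficients at [x] of the product of the functions
    [x |-> cos (w x)], for [w] in [s]. *)
Fixpoint jet s (p : nat) x : R :=
  if s is w :: s' then
    \sum_(i < p.+1) w ^+ i * cosd i (w * x) / i`!%:R * jet s' (p - i) x
  else (p == 0%N)%:R.

Lemma is_derive_jet s p x : is_derive x 1 (jet s p) (p.+1%:R * jet s p.+1 x).
Proof.
elim: s p => [|w s IH] p; first by rewrite /= mulr0; exact: is_derive_cst.
pose a (i : nat) (z : R) := w ^+ i * cosd i (w * z) / i`!%:R.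
have da i : is_derive x 1 (a i) (i.+1%:R * a i.+1 x).
  have h : is_derive x 1 (fun z => cosd i (w * z)) (cosd i.+1 (w * x) * w).
    apply: is_derive1_comp; first exact: is_derive_cosd.
    have := @is_deriveZ R R R id w x 1 1 (is_derive_id _ _).
    by rewrite [w *: 1]mulr1.
  have E : a i = (w ^+ i / i`!%:R) \*: (fun z => cosd i (w * z)).
    by apply/funext => z; rewrite /a /= mulrAC.
  rewrite E; have := is_deriveZ (w ^+ i / i`!%:R) h.
  congr (is_derive _ _ _ _); rewrite /a factS natrM invfM exprS -[LHS]/(_ * _).
  have key (k u v c : R) : k != 0 -> u * v * (c * w) = k * (w * u * c * (k^-1 * v)).
    by move=> k0; field.
  by apply: key; rewrite pnatr_eq0.
have E : jet (w :: s) p = \sum_(i < p.+1) (a i * jet s (p - i)).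
  by apply/funext => z; rewrite fct_sumE.
have := is_derive_sum (fun i : 'I_p.+1 => is_deriveM (da i) (IH (p - i)%N)).
rewrite E; congr (is_derive _ _ _ _).
have -> : jet (w :: s) p.+1 x = \sum_(i < p.+2) a i x * jet s (p.+1 - i) x by [].
rewrite big_split /= addrC.
have h1 : \sum_(i < p.+2) i%:R * (a i x * jet s (p.+1 - i) x) =
    \sum_(i < p.+1) jet s (p - i) x *: (i.+1%:R * a i.+1 x).
  rewrite big_ord_recl mul0r add0r; apply: eq_bigr => i _.
  by rewrite lift0 subSS [RHS]mulrC mulrA.
have h2 : \sum_(i < p.+2) (p.+1 - i)%:R * (a i x * jet s (p.+1 - i) x) =
    \sum_(i < p.+1) a i x *: ((p - i).+1%:R * jet s (p - i).+1 x).
  rewrite big_ord_recr /= subnn mul0r addr0; apply: eq_bigr => i _.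
  by rewrite subSn 1?mulrCA// -ltnS.
rewrite -h1 -h2 -big_split /= mulr_sumr; apply: eq_bigr => i _.
by rewrite -mulrDl -natrD subnKC// -ltnS.
Qed.

(** A zero of multiplicity [n]. *)
Lemma jet_vanish n w s p x : cos (w * x) = 0 -> (p < n)%N -> jet (nseq n w ++ s) p x = 0.
Proof.
move=> c0; elim: n p => // n IH p pn /=; rewrite big1// => -[[|i] /= ip] _.
  by rewrite /cosd /= c0 !(mulr0, mul0r).
by rewrite IH ?mulr0// ltn_subLR ?(leq_trans pn)//; rewrite addSn ltnS leq_addl.
Qed.

(** Leibniz' rule for the sums [sum_(i < P) r^i |f^(i)(y)| / i!]. *)
Lemma convolution_sum (u v : nat -> R) P :
  \sum_(p < P) \sum_(i < p.+1) u i * v (p - i)%N =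
  \sum_(i < P) u i * \sum_(j < (P - i)%N) v j.
Proof.
elim: P => [|P IH]; first by rewrite !big_ord0.
rewrite big_ord_recr /= IH [RHS]big_ord_recr /= subSnn big_ord1.
rewrite [X in _ + X]big_ord_recr /= subnn addrA; congr (_ + _).
rewrite -big_split /=; apply: eq_bigr => i _.
by rewrite subSn ?(ltnW (ltn_ord i))// big_ord_recr /= mulrDr.
Qed.

Definition cos_majorant P r y : R := \sum_(i < P) r ^+ i * `|cosd i y| / i`!%:R.

Lemma cos_majorant_ge0 P r y : 0 <= r -> 0 <= cos_majorant P r y.
Proof. by move=> r0; apply: sumr_ge0 => i _; rewrite divr_ge0// mulr_ge0// exprn_ge0. Qed.

(** By Leibniz' rule, the sums are submultiplicative. *)
Lemma jet_majorant s r x P : 0 <= r -> all (fun w => 0 <= w) s ->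
  \sum_(p < P) r ^+ p * `|jet s p x| <= \prod_(w <- s) cos_majorant P (r * w) (w * x).
Proof.
move=> r0; elim: s => [_|w s IH /= /andP[w0 s0]].
  rewrite big_nil; case: P => [|P]; first by rewrite big_ord0.
  rewrite big_ord_recl /= normr1 mulr1 expr0 big1 ?addr0// => i _.
  by rewrite normr0 mulr0.
rewrite big_cons; apply: le_trans (ler_wpM2l _ (IH s0)); last first.
  by apply: cos_majorant_ge0; rewrite mulr_ge0.
pose u i := (r * w) ^+ i * `|cosd i (w * x)| / i`!%:R.
pose v j := r ^+ j * `|jet s j x|.
have u0 i : 0 <= u i by rewrite divr_ge0// mulr_ge0// exprn_ge0// mulr_ge0.
have v0 i : 0 <= v i by rewrite mulr_ge0// exprn_ge0.
apply: (@le_trans _ _ (\sum_(p < P) \sum_(i < p.+1) u i * v (p - i)%N)).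
  apply: ler_sum => p _; rewrite -(ger0_norm (exprn_ge0 p r0)) -normrM /= mulr_sumr.
  apply: le_trans (ler_norm_sum _ _ _) _; apply: ler_sum => i _.
  rewrite /u /v exprMn !normrM normfV (ger0_norm (exprn_ge0 _ r0)).
  rewrite (ger0_norm (exprn_ge0 _ w0)) normr_nat.
  have -> : r ^+ p = r ^+ i * r ^+ (p - i) by rewrite -exprD subnKC// -ltnS.
  rewrite le_eqVlt; apply/orP; left; apply/eqP; ring.
rewrite convolution_sum mulr_suml; apply: ler_sum => i _; rewrite ler_wpM2l//.
rewrite (big_ord_widen P (fun j => v j) (leq_subr i P)).
rewrite [leRHS](bigID (fun j : 'I_P => (j < P - i)%N)) /= -[leLHS]addr0.
by apply: lerD; [exact: lexx|apply: sumr_ge0 => j _; exact: v0].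
Qed.

Lemma sum_exp_coeff_le r P : 0 <= r -> \sum_(i < P) r ^+ i / i`!%:R <= expR r.
Proof.
move=> r0; rewrite /expR; have -> : \sum_(i < P) r ^+ i / i`!%:R = series (exp_coeff r) P.
  by rewrite /series /= big_mkord; apply: eq_bigr => i _.
apply: nondecreasing_cvgn_le; last exact: is_cvg_series_exp_coeff.
apply/nondecreasing_seqP => n; rewrite /series /= big_nat_recr//= lerDl.
exact: exp_coeff_ge0.
Qed.

Lemma cos_majorant_exp P r y : 0 <= r -> cos_majorant P r y <= expR r.
Proof.
move=> r0; apply: le_trans (sum_exp_coeff_le P r0); apply: ler_sum => i _.
rewrite ler_wpM2r ?invr_ge0// ler_piMr ?exprn_ge0//; exact: cosd_le1.
Qed.

Lemma expn2_le_fact i : (2 ^ i.+1 <= (i.+2)`!)%N.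
Proof.
by elim: i => // i IH; rewrite expnS (factS i.+2) leq_mul.
Qed.

Lemma sum_geometric_half P : \sum_(i < P) (2 ^- i.+1 : R) <= 1.
Proof.
suff -> : \sum_(i < P) (2 ^- i.+1 : R) = 1 - 2 ^- P.
  by rewrite gerBl invr_ge0 exprn_ge0.
elim: P => [|P IH]; first by rewrite big_ord0 expr0 invr1 subrr.
by rewrite big_ord_recr /= IH exprS; field; rewrite expf_neq0.
Qed.

(** The terms of order at least 2 sum up to at most [r^2]. *)
Lemma cos_majorant_small P r y : 0 <= r <= 1 ->
  cos_majorant P r y <= `|cos y| + r * `|sin y| + r ^+ 2.
Proof.
move=> /andP[r0 r1].
have r20 : 0 <= r ^+ 2 by rewrite sqr_ge0.
case: P => [|[|P]]; rewrite /cos_majorant.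
- by rewrite big_ord0 !addr_ge0// mulr_ge0.
- rewrite big_ord1 expr0 mul1r fact0 divr1 /cosd /= expr0 mul1r -addrA lerDl.
  by rewrite addr_ge0// mulr_ge0.
have c0 : cosd 0 y = cos y by rewrite /cosd /= expr0 mul1r.
have c1 : cosd 1 y = - sin y by rewrite /cosd /= expr1 mulN1r.
rewrite 2!big_ord_recl /= /bump /= expr0 expr1 mul1r !divr1.
rewrite c0 c1 normrN addrA lerD2l.
apply: (@le_trans _ _ (\sum_(i < P) r ^+ 2 * 2 ^- i.+1)).
  apply: ler_sum => i _; rewrite !add1n.
  apply: ler_pM.
  - by rewrite mulr_ge0// exprn_ge0.
  - by rewrite invr_ge0.
  - rewrite -[leRHS]mulr1; apply: ler_pM => //; first exact: exprn_ge0.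
      by apply: ler_wiXn2l.
    exact: cosd_le1.
  - rewrite lef_pV2 ?posrE ?exprn_gt0 ?ltr0n ?fact_gt0//.
    by rewrite -natrX ler_nat expn2_le_fact.
by rewrite -mulr_sumr ler_piMr// sum_geometric_half.
Qed.

Lemma sin_le_id y : `|sin y| <= `|y|.
Proof.
have [c [_]] := mean_value 0 y (@is_derive_sin R).
rewrite sin0 !subr0 => ->; rewrite normrM ler_piMl//; exact: cos_max.
Qed.

Lemma cos_le_quadratic y : `|y| <= pi / 2 -> `|cos y| <= 1 - y ^+ 2 / 4.
Proof.
move=> hy; rewrite ger0_norm; last by apply: cos_ge0_pihalf; rewrite -ler_norml.
have p4 : 0 <= pi / 4 :> R by rewrite divr_ge0// pi_ge0.
have -> : cos y = 1 - 2 * sin (y / 2) ^+ 2.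
  have := cosD (y / 2) (y / 2); rewrite -splitr => ->.
  have := cos2Dsin2 (y / 2); rewrite !expr2; nra.
have [c [cy]] := mean_value 0 (y / 2) (@is_derive_sin R).
rewrite sin0 !subr0 => ->; move: cy; rewrite !subr0 => cy.
have c4 : `|c| <= pi / 4.
  apply: le_trans cy _; rewrite normrM (@ger0_norm _ 2^-1)//.
  by move: hy; have := normr_ge0 y; lra.
have : 2^-1 <= cos c ^+ 2.
  have -> : cos c = cos `|c| by case: (ger0P c); rewrite ?cosN.
  have -> : 2^-1 = cos (pi / 4 : R) ^+ 2.
    have := cosD (pi / 4 : R) (pi / 4); have := cos2Dsin2 (pi / 4 : R).
    have -> : pi / 4 + pi / 4 = pi / 2 :> R by field.
    rewrite cos_pihalf !expr2; lra.
  have pi0 := @pi_ge0 R.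
  have hle : cos (pi / 4 : R) <= cos `|c|.
    rewrite leNgt (@ltr_cos R) -?leNgt// in_itv /= ?normr_ge0 /=; lra.
  rewrite lerXn2r// ?nnegrE//; last apply: le_trans hle;
    by apply: cos_ge0_pihalf; lra.
have := sqr_ge0 y; rewrite exprMn !expr2; nra.
Qed.

(** Of the two bounds, the linear one in [r] holds for every [r], and the quadratic one
    is summable over the levels at which [r] is small. *)
Lemma cos_majorant_decay P r y : 0 <= r -> `|y| <= pi / 2 ->
  cos_majorant P r y <= expR (3 * r - y ^+ 2 / 8) /\
  (r <= 1 -> cos_majorant P r y <= expR (3 * r ^+ 2 - y ^+ 2 / 8)).
Proof.
move=> r0 hy.
have h2 : r <= 1 -> cos_majorant P r y <= expR (3 * r ^+ 2 - y ^+ 2 / 8).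
  move=> r1; apply: le_trans (expR_ge1Dx _).
  have := @cos_majorant_small P r y; rewrite r0 => /(_ r1) /le_trans; apply.
  have hs := sin_le_id y; have hc := cos_le_quadratic hy.
  have -> : y ^+ 2 = `|y| ^+ 2 by rewrite real_normK ?num_real.
  have hq : r * `|sin y| <= r * `|y| by rewrite ler_wpM2l.
  move: hc; have -> : y ^+ 2 = `|y| ^+ 2 by rewrite real_normK ?num_real.
  have := sqr_ge0 (`|y| - 4 * r); rewrite !expr2; nra.
split=> //; have [r1|r1] := leP r 1.
  apply: le_trans (h2 r1) _; rewrite ler_expR lerD2r ler_wpM2l//.
  by rewrite expr2 ler_piMl.
apply: le_trans (cos_majorant_exp P y r0) _; rewrite ler_expR.
have : y ^+ 2 <= 4.
  have -> : y ^+ 2 = `|y| ^+ 2 by rewrite real_normK ?num_real.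
  have := @pihalf_lt2 R; have := normr_ge0 y; rewrite expr2; nra.
lra.
Qed.

End cosine_products.

(** * The kernel and its derivatives *)

Section kernel_bounds.
Variable R : realType.
Implicit Types (x y r : R).

(** The product of the functions [cos (w x)] over these frequencies is the kernel
    [prod_m cos (x / 2^m) ^ (2^m)].  The multiplicities make each level contribute
    a decay as [exp (- x^2 / 2^m)] for [|x|] up to about [2^m]: together, an
    exponential decay. *)
Fixpoint freqs (K : nat) : seq R :=
  if K is K'.+1 then nseq (2 ^ K'.+1) (2 ^- K'.+1) ++ freqs K' else [::].

(** The kernel vanishes to order [2^K] at both ends of [-edge K, edge K], where it is
    cut off. *)
Definition edge (K : nat) : R := 2 ^+ K * (pi / 2).

Lemma freqs_ge0 K : all (fun w : R => 0 <= w) (freqs K).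
Proof.
elim: K => //= K IH; rewrite all_cat IH andbT.
by apply/allP => w; rewrite mem_nseq => /andP[_ /eqP ->]; rewrite invr_ge0 exprn_ge0.
Qed.

Lemma prod_freqs (f : R -> R) K :
  \prod_(w <- freqs K) f w = \prod_(m < K) f (2 ^- m.+1) ^+ (2 ^ m.+1).
Proof.
elim: K => [|K IH]; first by rewrite big_nil big_ord0.
by rewrite big_cat /= big_nseq iter_mulr_1 IH big_ord_recr /= mulrC.
Qed.

Lemma sum_geometric_tail J K :
  \sum_(m < K) (if (J <= m)%N then 2 ^- m.+1 else 0 : R) <= 2 ^- J.
Proof.
suff h : \sum_(m < K) (if (J <= m)%N then 2 ^- m.+1 else 0 : R) <=
    if (K <= J)%N then 0 else 2 ^- J - 2 ^- K.
  apply: le_trans h _; case: ifP => _; first by rewrite invr_ge0 exprn_ge0.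
  by rewrite gerBl invr_ge0 exprn_ge0.
elim: K => [|K IH]; first by rewrite big_ord0.
rewrite big_ord_recr /=; move: IH; case: (leqP K J) => KJ IH.
  have [KJ'|JK] := ltnP K J; first by rewrite addr0.
  move: IH; have -> : J = K by apply/eqP; rewrite eqn_leq JK KJ.
  move=> IH; apply: le_trans (lerD IH (lexx _)) _; rewrite add0r exprS.
  by rewrite le_eqVlt; apply/orP; left; apply/eqP; field; rewrite expf_neq0.
rewrite ltnNge (ltnW KJ) /=; apply: le_trans (lerD IH (lexx _)) _.
by rewrite exprS le_eqVlt; apply/orP; left; apply/eqP; field; rewrite !expf_neq0.
Qed.

Lemma sqr_le_expn2 n : (n ^ 2 <= 2 ^ n.+1)%N.
Proof.
elim: n => // n IH; case: n IH => [|[|[|n]]] // IH.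
rewrite (expnS 2 n.+4) mul2n -addnn; apply: leq_trans (leq_add IH IH).
rewrite -!mulnn !(mulSn, mulnS); lia.
Qed.

(** At level [m] the argument is [2^-m x].  While it exceeds [pi / 2], only the
    exponential bound is used; from the first level [n] where it does not, each
    factor decays, and the decay at level [n] alone gives [exp (- |x| / 32)].  In [r],
    the linear bound is used up to the level [J], and the quadratic one beyond. *)
Lemma kernel_majorant r x J K P : 0 <= r -> 2 * (32 * r) ^+ 2 <= 2 ^+ J ->
  (0 < K)%N -> `|x| <= edge K ->
  \sum_(p < P) r ^+ p * `|jet (freqs K) p x| <= expR (4 * r * J%:R + 2 - `|x| / 32).
Proof.
move=> r0 rJ K0 xK; apply: le_trans (jet_majorant x P r0 (freqs_ge0 K)) _.
rewrite prod_freqs.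
have exn : exists n, `|x| <= 2 ^+ n.+1 * (pi / 2).
  by exists K.-1; rewrite prednK.
pose n := ex_minn exn.
have [xn nK nmin] : [/\ `|x| <= 2 ^+ n.+1 * (pi / 2), (n < K)%N &
    forall m, (m < n)%N -> 2 ^+ m.+1 * (pi / 2) < `|x|].
  rewrite /n; case: ex_minnP => n' h hmin; split => //.
    by rewrite -(prednK K0) ltnS; apply: hmin; rewrite prednK.
  by move=> m mn; rewrite ltNge; apply/negP => /hmin; rewrite leqNgt mn.
pose D : R := x ^+ 2 / (8 * 2 ^+ n.+1).
pose T (m : nat) : R := 3 * r * (m < J)%:R +
   3 * r ^+ 2 * (if (J <= m)%N then 2 ^- m.+1 else 0) +
   r * (m < n)%:R - D * (m == n)%:R.
have p20 : 0 <= pi / 2 :> R by rewrite divr_ge0// pi_ge0.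
have D0 : 0 <= D by rewrite divr_ge0 ?sqr_ge0// mulr_ge0// exprn_ge0.
have factor m : cos_majorant P (r * 2 ^- m.+1) (2 ^- m.+1 * x) ^+ (2 ^ m.+1) <= expR (T m).
  have r2 : 0 <= r * 2 ^- m.+1 by rewrite mulr_ge0// invr_ge0 exprn_ge0.
  have pw E : cos_majorant P (r * 2 ^- m.+1) (2 ^- m.+1 * x) <= expR E ->
      cos_majorant P (r * 2 ^- m.+1) (2 ^- m.+1 * x) ^+ (2 ^ m.+1) <=
      expR (2 ^+ m.+1 * E).
    move=> h; have -> : 2 ^+ m.+1 * E = (2 ^ m.+1)%:R * E by rewrite natrX.
    rewrite expRM_natl.
    by apply: lerXn2r h; rewrite nnegrE ?expR_ge0// cos_majorant_ge0.
  have u0 : 2 ^+ m.+1 != 0 :> R by rewrite expf_neq0.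
  have [mn|nm] := ltnP m n.
    apply: le_trans (pw _ (cos_majorant_exp P _ r2)) _; rewrite ler_expR.
    rewrite mulrC divfK// /T mn mulr1 (ltn_eqF mn) mulr0 subr0 lerDr.
    rewrite addr_ge0// ?mulr_ge0 ?sqr_ge0//.
    by case: ifP => // _; rewrite invr_ge0 exprn_ge0.
  have hy : `|2 ^- m.+1 * x| <= pi / 2.
    rewrite normrM ger0_norm ?invr_ge0 ?exprn_ge0// ler_pdivrMl ?exprn_gt0//.
    apply: le_trans xn _; rewrite ler_wpM2r// ler_eXn2l ?ltr1n//.
  have [h1 h2] := cos_majorant_decay P r2 hy.
  have dec : 2 ^+ m.+1 * ((2 ^- m.+1 * x) ^+ 2 / 8) >= D * (m == n)%:R.
    have [->|_] := eqVneq m n; last by rewrite mulr0 mulr_ge0 ?divr_ge0 ?sqr_ge0 ?exprn_ge0.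
    rewrite mulr1 /D le_eqVlt; apply/orP; left; apply/eqP.
    by field; rewrite expf_neq0.
  have [mJ|Jm] := ltnP m J.
    apply: le_trans (pw _ h1) _; rewrite ler_expR /T mJ leqNgt mJ /=.
    rewrite ltnNge nm /= !mulr0 mulr1 !addr0 mulrBr lerB//.
    by rewrite mulrCA (mulrCA (2 ^+ m.+1)) divff// mulr1.
  have r1 : r * 2 ^- m.+1 <= 1.
    rewrite ler_pdivrMr ?exprn_gt0// mul1r; apply: (@le_trans _ _ (2 ^+ J)).
      have : 1 <= 2 ^+ J :> R by rewrite exprn_ege1// ler1n.
      by move: rJ r0; rewrite expr2; nra.
    by rewrite ler_eXn2l ?ltr1n// leqW.
  apply: le_trans (pw _ (h2 r1)) _; rewrite ler_expR /T ltnNge Jm /=.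
  rewrite ltnNge nm /= !mulr0 add0r addr0 mulrBr lerB//.
  by rewrite le_eqVlt; apply/orP; left; apply/eqP; field.
apply: (@le_trans _ _ (\prod_(m < K) expR (T m))).
  apply: ler_prod => m _; rewrite factor andbT exprn_ge0// cos_majorant_ge0//.
  by rewrite mulr_ge0// invr_ge0 exprn_ge0.
rewrite -expR_sum ler_expR /T sumrB !big_split /= -!mulr_sumr.
have sD : \sum_(m < K) ((m == n :> nat)%:R : R) = 1.
  rewrite (bigD1 (Ordinal nK)) //= eqxx big1 ?addr0// => m /negPf mn.
  by case: eqP => // mn'; move: mn; rewrite -(inj_eq val_inj) /= mn' eqxx.
have sI (L : nat) : \sum_(m < K) ((m < L)%:R : R) <= L%:R.
  rewrite -natr_sum ler_nat; suff -> : (\sum_(m < K) (m < L) = minn K L)%N.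
    exact: geq_minr.
  elim: (K) => [|k IH]; first by rewrite big_ord0 min0n.
  by rewrite big_ord_recr /= IH; case: (ltnP k L) => h /=; lia.
rewrite sD mulr1.
have sJ : 3 * r * \sum_(m < K) ((m < J)%:R : R) <= 3 * r * J%:R.
  by rewrite ler_wpM2l// mulr_ge0.
have sT : 3 * r ^+ 2 * \sum_(m < K) (if (J <= m)%N then 2 ^- m.+1 else 0 : R) <= 1.
  apply: (@le_trans _ _ (3 * r ^+ 2 * 2 ^- J)).
    by rewrite ler_wpM2l ?mulr_ge0 ?sqr_ge0// sum_geometric_tail.
  rewrite ler_pdivrMr ?exprn_gt0// mul1r; apply: le_trans rJ.
  by have := sqr_ge0 r; rewrite !expr2; lra.
have sn : r * \sum_(m < K) ((m < n)%:R : R) <= r * n%:R by rewrite ler_wpM2l.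
suff : r * n%:R - D <= r * J%:R + 1 - `|x| / 32.
  by move: sJ sT sn; lra.
have x2 : x ^+ 2 = `|x| ^+ 2 by rewrite real_normK ?num_real.
have [n0|n0] := posnP n.
  rewrite n0 mulr0 /D x2 n0 expr1; have := mulr_ge0 r0 (ler0n R J).
  have := sqr_ge0 (`|x| - 1); rewrite !expr2.
  by have := normr_ge0 x; nra.
have xn' : 2 ^+ n <= `|x|.
  have := nmin n.-1; rewrite prednK// leqnn => /(_ erefl)/ltW; apply: le_trans.
  by rewrite ler_peMr ?exprn_ge0// pihalf_ge1.
have u0 : 0 < 2 ^+ n :> R by rewrite exprn_gt0.
have D16 : `|x| / 16 <= D.
  rewrite /D x2 (exprS 2 n) ler_pdivlMr; last by rewrite mulr_gt0 ?mulr_gt0.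
  rewrite (_ : _ / 16 * _ = `|x| * 2 ^+ n); last by field.
  by rewrite expr2 ler_wpM2l.
suff : r * n%:R <= r * J%:R + `|x| / 32 by lra.
have rJ0 : 0 <= r * J%:R by rewrite mulr_ge0.
have [nJ|Jn] := leqP n J.
  have : r * n%:R <= r * J%:R by rewrite ler_wpM2l// ler_nat.
  by have := normr_ge0 x; lra.
suff : 32 * r * n%:R <= 2 ^+ n by lra.
have n2 : n%:R ^+ 2 <= 2 * 2 ^+ n :> R.
  by rewrite -exprS -!natrX ler_nat sqr_le_expn2.
have r2 : (32 * r) ^+ 2 <= 2 ^+ n / 2.
  rewrite ler_pdivlMr// mulrC; apply: le_trans rJ _.
  by rewrite ler_eXn2l ?ltr1n// ltnW.
have r32 : 0 <= 32 * r by rewrite mulr_ge0.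
rewrite -(ler_pXn2r (n := 2)) ?nnegrE ?(ltW u0)//; last by rewrite mulr_ge0.
rewrite exprMn.
apply: (@le_trans _ _ ((2 ^+ n / 2) * (2 * 2 ^+ n))).
  by apply: ler_pM => //; exact: sqr_ge0.
by rewrite mulrA divfK// expr2.
Qed.

End kernel_bounds.

(** * Growth of the weight sequence *)

Section weight_growth.
Variables (R : realType) (M : nat -> {posnum R}).
Hypotheses (M0 : (M 0)%:num = 1) (M1 : (M 1)%:num = 1).
Hypothesis logconvex : cond_M1 M.

Definition ratio (p : nat) : R := (M p.+1)%:num / (M p)%:num.

Lemma ratio_le p q : (p <= q)%N -> ratio p <= ratio q.
Proof.
elim: q => [|q IH]; first by rewrite leqn0 => /eqP ->.
rewrite leq_eqVlt => /predU1P[->//|]; rewrite ltnS => /IH/le_trans; apply.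
have := logconvex (ltn0Sn q); rewrite /ratio /= => h.
by rewrite ler_pdivrMr// mulrAC ler_pdivlMr// -expr2 mulrC.
Qed.

Lemma ratio_ge1 p : 1 <= ratio p.
Proof.
by have := ratio_le (leq0n p); rewrite {1}/ratio M0 M1 divr1.
Qed.

Lemma weightS p : (M p.+1)%:num = ratio p * (M p)%:num.
Proof. by rewrite /ratio divfK. Qed.

Lemma weight_mul p q : (M p)%:num * (M q)%:num <= (M (p + q))%:num.
Proof.
elim: q => [|q IH]; first by rewrite M0 mulr1 addn0.
rewrite addnS !weightS mulrCA; apply: ler_pM => //.
  by apply: le_trans (ratio_ge1 _).
by apply: ratio_le; rewrite leq_addl.
Qed.

(** The terms of the series in (M.5) decrease, and for [p = 1] its sum is bounded, so
    that the term of index [n] is [O(1 / n)]: the quotients [M_{n+1} / M_n] grow at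
    least as a power of [n]. *)
Lemma weight_factorial : cond_M5 M ->
  exists k (c : R), [/\ (0 < k)%N, 0 < c & forall p,
    c ^+ p * (p`!%:R) ^+ 2 <= (M p)%:num ^+ k.*2].
Proof.
move=> [q [c0 [q0 c01 hM5]]].
have c00 : 0 < c0 by apply: lt_le_trans c01.
have ratio0 p : 0 < ratio p by apply: lt_le_trans (ratio_ge1 p).
pose nu p := (M p)%:num `^ q / (M p.+1)%:num `^ q.
have nuE p : nu p = (ratio p `^ q)^-1.
  have m0 : (M p)%:num `^ q != 0 by rewrite lt0r_neq0// powR_gt0.
  by rewrite /nu weightS powRM ?(ltW (ratio0 p))// invfM mulrCA mulfV// mulr1.
have sum_nu n : \sum_(1 <= i < n.+1) nu i <= c0.
  have := @nneseries_lim_ge R (fun j => ((M j.-1)%:num `^ q / (M j)%:num `^ q)%:E)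
    xpredT 2 n.+2.
  move=> /(_ _)/le_trans h; have := h _ _ (hM5 1%N isT).
  rewrite mulr1; have -> : (\sum_(2 <= i < n.+2)
      ((M i.-1)%:num `^ q / (M i)%:num `^ q)%:E)%E = (\sum_(1 <= i < n.+1) nu i)%:E.
    by rewrite sumEFin big_add1.
  rewrite lee_fin => h'; apply: le_trans (h' _) _ => [j _ _|].
    by rewrite lee_fin divr_ge0// powR_ge0.
  rewrite -[leRHS]mulr1 ler_wpM2l ?(ltW c00)// -/(nu 1%N) nuE invf_le1 ?powR_gt0//.
  have := ge0_ler_powR (ltW q0) _ _ (ratio_ge1 1); rewrite powR1 !nnegrE.
  by apply; rewrite // ltW.
have t_ge n : (0 < n)%N -> n%:R / c0 <= ratio n `^ q.
  move=> n0; rewrite ler_pdivrMr// mulrC -ler_pdivrMr ?powR_gt0//.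
  apply: le_trans (sum_nu n).
  have -> : n%:R / ratio n `^ q = \sum_(1 <= i < n.+1) (ratio n `^ q)^-1.
    by rewrite sumr_const_nat subn1 mulrC mulr_natr.
  rewrite !big_nat; apply: ler_sum => i /andP[_ iN]; rewrite nuE.
  rewrite lef_pV2 ?posrE ?powR_gt0//.
  apply: ge0_ler_powR; [exact: ltW|by rewrite nnegrE ltW|by rewrite nnegrE ltW|].
  exact: ratio_le.
pose k := (Num.bound q).+1; have qk : q <= k%:R.
  by apply/ltW; apply: lt_le_trans (archi_boundP (ltW q0)) _; rewrite ler_nat leqnSn.
have ratio_k n : n.+1%:R / (2 * c0) <= ratio n ^+ k.
  have [->|n0] := posnP n.
    rewrite (@le_trans _ _ 1) ?exprn_ege1 ?ratio_ge1//.
    by rewrite ler_pdivrMr ?mulr_gt0// mul1r; lra.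
  rewrite -powR_mulrn ?(ltW (ratio0 n))//.
  apply: le_trans (ler_powR (ratio_ge1 n) qk); apply: le_trans (t_ge n n0).
  rewrite invfM mulrA ler_wpM2r ?invr_ge0 ?(ltW c00)// ler_pdivrMr//.
  by rewrite -natrM ler_nat; lia.
exists k, ((2 * c0)^-1 ^+ 2); split => //.
  by rewrite exprn_gt0// invr_gt0 mulr_gt0.
have Mk p : (2 * c0)^-1 ^+ p * p`!%:R <= (M p)%:num ^+ k.
  elim: p => [|p IH]; first by rewrite expr0 mul1r M0 expr1n.
  rewrite weightS exprMn factS natrM exprS mulrACA; apply: ler_pM => //.
  - by rewrite mulr_ge0// invr_ge0 mulr_ge0// ltW.
  - by rewrite mulr_ge0// exprn_ge0// invr_ge0 mulr_ge0// ltW.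
  - by rewrite mulrC.
move=> p; rewrite -muln2 (exprM _ k) (exprAC _ 2 p) -exprMn.
by rewrite lerXn2r ?nnegrE ?exprn_ge0// mulr_ge0// exprn_ge0// invr_ge0 mulr_ge0// ltW.
Qed.

End weight_growth.

(** * A functional that gains derivatives *)

Section kernel_estimate.
Variable R : realType.

Lemma root_bracket k (p : nat) : (0 < k)%N -> (0 < p)%N ->
  exists m, [/\ (0 < m)%N, (m ^ k <= p)%N & (p < m.+1 ^ k)%N].
Proof.
move=> k0 p0; have ex0 : exists m, (m ^ k <= p)%N by exists 0%N; rewrite exp0n.
have bd m : (m ^ k <= p)%N -> (m <= p)%N.
  by apply: leq_trans; case: m => // m; rewrite -{1}(expn1 m.+1) leq_pexp2l.
case: (ex_maxnP ex0 bd) => m mp mmax; exists m; split => //.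
  by apply: mmax; rewrite exp1n.
by rewrite ltnNge; apply/negP => /mmax; rewrite ltnn.
Qed.

Lemma fact_le_pow p : (p`! <= p ^ p)%N.
Proof.
suff h q : (q <= p -> q`! <= p ^ q)%N by exact: h.
elim: q => // q IH qp; rewrite factS expnS leq_mul//.
exact/IH/ltnW.
Qed.

Lemma pow_le_exp_fact (r : R) p : 0 <= r -> r ^+ p <= expR r * p`!%:R.
Proof.
move=> r0; rewrite -ler_pdivrMr ?ltr0n ?fact_gt0//.
apply: le_trans (sum_exp_coeff_le p.+1 r0); rewrite big_ord_recr /= lerDr.
by apply: sumr_ge0 => i _; rewrite divr_ge0// exprn_ge0.
Qed.

(** With [m ~ p^(1/k)], the radius [r = p / m] costs only a factor [exp (O(p))]
    and leaves the [p]-th derivative of the kernel of order [m^p ~ p!^(1/k)]. *)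
Lemma kernel_derivative_le (M : nat -> {posnum R}) k (c l : R) :
  (M 0)%:num = 1 -> (0 < k)%N -> 0 < c -> 0 < l ->
  (forall p, c ^+ p * (p`!%:R) ^+ 2 <= (M p)%:num ^+ k) ->
  exists C, 0 < C /\ forall p K (x : R), (0 < K)%N -> `|x| <= edge R K ->
    l ^+ p * p`!%:R * `|jet (freqs R K) p x| <= C * (M p)%:num * expR (- (`|x| / 32)).
Proof.
move=> M0 k0 c0 l0 hM.
pose E : R := expR (8 * k%:R + 44); pose G := (l * E) ^+ k * expR 1.
have E0 : 0 < E by exact: expR_gt0.
have G0 : 0 < G by rewrite mulr_gt0 ?expR_gt0// exprn_gt0// mulr_gt0.
pose C := expR 2 * expR (G / c).
have C1 : 1 <= expR (G / c) :> R.
  by apply: le_trans (expR_ge1Dx _); rewrite lerDl divr_ge0// ltW.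
exists C; split; first by rewrite mulr_gt0// expR_gt0.
move=> p K x K0 xK; have [->|p0] := posnP p.
  rewrite expr0 fact0 !mul1r M0 mulr1.
  have := @kernel_majorant R 0 x 0 K 1 (lexx 0).
  rewrite mulr0 expr0n mulr0 expr0 ler01 => /(_ erefl K0 xK).
  rewrite big_ord1 expr0 !mulr0 ?mul0r add0r mul1r => /le_trans; apply.
  by rewrite expRD ler_wpM2r ?expR_ge0// /C ler_peMr ?expR_ge0.
have [m [m0 mp pm]] := root_bracket k0 p0.
have mR : 0 < m%:R :> R by rewrite ltr0n.
have pR : 0 < p%:R :> R by rewrite ltr0n.
pose r : R := p%:R / m%:R.
have r0 : 0 < r by rewrite divr_gt0.
pose J := ((k * m).*2 + 11)%N.
have rp : 32 * r <= 32 * 2 ^+ (k * m).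
  rewrite ler_wpM2l// /r ler_pdivrMr//; apply: (@le_trans _ _ (2 ^+ (k * m))).
    rewrite -natrX ler_nat; apply: leq_trans (ltnW pm) _.
    by rewrite mulnC expnM leq_exp2r// ltn_expl.
  by rewrite ler_peMr ?exprn_ge0// ler1n.
have rJ : 2 * (32 * r) ^+ 2 <= 2 ^+ J.
  have -> : 2 ^+ J = 2 * (32 * 2 ^+ (k * m)) ^+ 2 :> R.
    have e11 : 2 ^+ 11 = 2 * 32 ^+ 2 :> R by ring.
    rewrite /J exprD -muln2 exprM e11; ring.
  by rewrite ler_wpM2l// lerXn2r// nnegrE mulr_ge0// ?(ltW r0)// exprn_ge0.
have key := kernel_majorant p.+1 (ltW r0) rJ K0 xK.
have jb : r ^+ p * `|jet (freqs R K) p x| <= expR 2 * E ^+ p * expR (- (`|x| / 32)).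
  apply: (@le_trans _ _ (\sum_(i < p.+1) r ^+ i * `|jet (freqs R K) i x|)).
    rewrite big_ord_recr /= lerDr; apply: sumr_ge0 => i _.
    by rewrite mulr_ge0// exprn_ge0// ltW.
  apply: le_trans key _; rewrite -expRM_natl -!expRD ler_expR lerD2r addrC lerD2l.
  have -> : 4 * r * J%:R = p%:R * (8 * k%:R + 44 / m%:R).
    rewrite /J /r natrD -mul2n !natrM; field.
    by rewrite gt_eqF.
  by rewrite ler_wpM2l// lerD2l ler_pdivrMr// ler_peMr// ler1n.
have jb' : p`!%:R * `|jet (freqs R K) p x| <=
    m%:R ^+ p * (expR 2 * E ^+ p * expR (- (`|x| / 32))).
  apply: le_trans (ler_wpM2l (exprn_ge0 p (ltW mR)) jb).
  rewrite mulrA -exprMn /r mulrC (mulrC m%:R) divfK ?gt_eqF// mulrC ler_wpM2r//.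
  by rewrite -natrX ler_nat fact_le_pow.
rewrite -mulrA; apply: le_trans (ler_wpM2l (exprn_ge0 p (ltW l0)) jb') _.
have -> : l ^+ p * (m%:R ^+ p * (expR 2 * E ^+ p * expR (- (`|x| / 32)))) =
    (expR 2 * (l * E * m%:R) ^+ p) * expR (- (`|x| / 32)).
  by rewrite !exprMn; ring.
rewrite ler_wpM2r ?expR_ge0//.
have lEm : 0 <= l * E * m%:R by rewrite !mulr_ge0// ltW.
rewrite -(ler_pXn2r k0) ?nnegrE; last 2 first.
- by rewrite mulr_ge0 ?expR_ge0// exprn_ge0.
- by rewrite mulr_ge0// mulr_ge0// expR_ge0.
have mk : (m%:R ^+ k) ^+ p <= expR 1 ^+ p * p`!%:R :> R.
  rewrite -expRM_natl mulr1; apply: le_trans (pow_le_exp_fact p (ltW pR)).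
  by rewrite lerXn2r ?nnegrE ?exprn_ge0// -natrX ler_nat.
have Gc : G ^+ p <= c ^+ p * (expR (G / c) * p`!%:R).
  rewrite -ler_pdivrMl ?exprn_gt0// mulrC -expr_div_n.
  by apply: pow_le_exp_fact; rewrite divr_ge0// ltW.
have -> : (expR 2 * (l * E * m%:R) ^+ p) ^+ k =
    expR 2 ^+ k * (((l * E) ^+ k) ^+ p * (m%:R ^+ k) ^+ p).
  by rewrite exprMn (exprAC _ p k) (exprMn k (l * E)) (exprMn p).
rewrite (exprMn k C) /C (exprMn k (expR 2)) -mulrA.
rewrite ler_wpM2l ?exprn_ge0 ?expR_ge0//.
have lEk : 0 <= ((l * E) ^+ k) ^+ p by rewrite !exprn_ge0// mulr_ge0// ltW.
apply: (@le_trans _ _ (G ^+ p * p`!%:R)).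
  by rewrite /G (exprMn p ((l * E) ^+ k)) -mulrA ler_wpM2l.
apply: le_trans (ler_wpM2r (ler0n _ _) Gc) _.
apply: (@le_trans _ _ (expR (G / c) * (c ^+ p * p`!%:R ^+ 2))).
  by rewrite le_eqVlt; apply/orP; left; apply/eqP; ring.
apply: ler_pM; rewrite ?expR_ge0//.
  by rewrite mulr_ge0// ?exprn_ge0// ltW.
by rewrite -[leLHS]expr1; exact: ler_weXn2l.
Qed.

End kernel_estimate.

Section integrals.
Variable R : realType.
Implicit Types (b : R) (h g H G : R -> R).

Lemma antiderivative b h : continuous h ->
  exists H, forall x : R, `|x| <= b -> is_derive x 1 H (h x).
Proof.
move=> ch; pose u := b + 1.
exists (fun x => \int[lebesgue_measure]_(t in [set` `[- u, x]]) h t)%R.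
move=> x; rewrite ler_norml => /andP[bx xb].
have xu : x < u by rewrite ltr_pwDr.
have ux : - u < x by rewrite /u; lra.
have ih : lebesgue_measure.-integrable `[- u, u] (EFin \o h).
  apply: continuous_compact_integrable; first exact: segment_compact.
  exact: continuous_subspaceT.
have [dH dE] := continuous_FTC1_closed xu ih ux (ch x).
by apply: DeriveDef; [exact: dH|rewrite -derive1E; exact: dE].
Qed.

Lemma mean_value_on b H h (x y : R) : (forall x : R, `|x| <= b -> is_derive x 1 H (h x)) ->
  `|x| <= b -> `|y| <= b -> x <= y -> exists c, x <= c <= y /\ H y - H x = h c * (y - x).
Proof.
move=> dH xb yb xy.
have inb t : x <= t <= y -> `|t| <= b.
  move=> /andP[xt ty]; move: xb yb; rewrite !ler_norml => /andP[? ?] /andP[? ?].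
  by apply/andP; split; lra.
have d' t : t \in `]x, y[ -> is_derive t 1 H (h t).
  by rewrite in_itv /= => /andP[xt ty]; apply/dH/inb; rewrite !ltW.
have cH : {within `[x, y], continuous H}.
  apply: derivable_within_continuous => t; rewrite in_itv /= => /inb /dH dt.
  exact: (@ex_derive _ _ _ _ _ _ _ dt).
by have [c cin E] := MVT_segment xy d' cH; exists c; rewrite in_itv /= in cin.
Qed.

(** The integral over [-b, b], through an antiderivative. *)
Definition integ b h : R :=
  xget 0 [set v | exists2 H, (forall x : R, `|x| <= b -> is_derive x 1 H (h x)) &
                   v = H b - H (- b)].

Lemma integE b h H : 0 <= b -> (forall x : R, `|x| <= b -> is_derive x 1 H (h x)) ->
  integ b h = H b - H (- b).
Proof.
move=> b0 dH; rewrite /integ.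
have [H' dH' ->] := @xgetI _ 0 [set v | exists2 H, (forall x : R, `|x| <= b ->
  is_derive x 1 H (h x)) & v = H b - H (- b)] _ (ex_intro2 _ _ H dH erefl).
have dHH (x : R) : `|x| <= b -> is_derive x 1 (H' - H) (0 : R).
  by move=> xb; have := is_deriveB (dH' x xb) (dH x xb); rewrite subrr.
have bb : - b <= b by rewrite -subr_ge0 opprK addr_ge0.
have nb : `|b| <= b by rewrite ger0_norm.
have nNb : `|- b| <= b by rewrite normrN.
have [c [_]] := mean_value_on dHH nNb nb bb.
by rewrite mul0r !fctE => /eqP; rewrite subr_eq0 => /eqP E; lra.
Qed.

Lemma integ_lin b (a : R) g h : 0 <= b -> continuous g -> continuous h ->
  integ b (fun x => a * g x + h x) = a * integ b g + integ b h.
Proof.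
move=> b0 /(antiderivative b)[G dG] /(antiderivative b)[H dH].
have E : integ b (fun x => a * g x + h x) = (a * G b + H b) - (a * G (- b) + H (- b)).
  apply: (integE (H := fun x => a * G x + H x) b0) => x xb.
  exact: (is_deriveD (is_deriveZ a (dG x xb)) (dH x xb)).
by rewrite (integE b0 dG) (integE b0 dH) E; ring.
Qed.

Lemma integ_bound b h g G : 0 <= b -> continuous h ->
  (forall x : R, `|x| <= b -> is_derive x 1 G (g x)) ->
  (forall x : R, `|x| <= b -> `|h x| <= g x) -> `|integ b h| <= G b - G (- b).
Proof.
move=> b0 /(antiderivative b)[H dH] dG hg; rewrite (integE b0 dH).
have bb : - b <= b by rewrite -subr_ge0 opprK addr_ge0.
have nb : `|b| <= b by rewrite ger0_norm.
have nNb : `|- b| <= b by rewrite normrN.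
have inb c : - b <= c <= b -> `|c| <= b by rewrite ler_norml.
rewrite ler_norml; apply/andP; split.
  have [c [/inb cb E]] := mean_value_on (fun x xb => is_deriveD (dG x xb) (dH x xb)) nNb nb bb.
  rewrite -subr_ge0 opprK addrC; move: E; rewrite !fctE => E.
  have -> : G b - G (- b) + (H b - H (- b)) = G b + H b - (G (- b) + H (- b)) by ring.
  rewrite E mulr_ge0 ?subr_ge0//.
  by have := hg c cb; rewrite ler_norml => /andP[? _]; lra.
have [c [/inb cb E]] := mean_value_on (fun x xb => is_deriveB (dG x xb) (dH x xb)) nNb nb bb.
rewrite -subr_ge0; move: E; rewrite !fctE => E.
have -> : G b - G (- b) - (H b - H (- b)) = G b - H b - (G (- b) - H (- b)) by ring.
rewrite E mulr_ge0 ?subr_ge0//.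
by have := hg c cb; rewrite ler_norml => /andP[_ ?]; lra.
Qed.

Lemma integ_by_parts b (f f' g g' : R -> R) : 0 <= b ->
  (forall x : R, is_derive x 1 f (f' x)) -> (forall x : R, is_derive x 1 g (g' x)) ->
  continuous f' -> continuous g' -> f b = 0 -> f (- b) = 0 ->
  integ b (fun x => f x * g' x) = - integ b (fun x => f' x * g x).
Proof.
move=> b0 df dg cf' cg' fb fNb.
have cont (u u' : R -> R) : (forall x : R, is_derive x 1 u (u' x)) -> continuous u.
  move=> du x; apply: differentiable_continuous; apply/derivable1_diffP.
  exact: (@ex_derive _ _ _ _ _ _ _ (du x)).
have c1 : continuous (fun x => f x * g' x).
  by move=> x; apply: cvgM; [exact: (cont f f')|exact: cg'].
have c2 : continuous (fun x => f' x * g x).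
  by move=> x; apply: cvgM; [exact: cf'|exact: (cont g g')].
apply/eqP; rewrite -subr_eq0 opprK -[X in X + _]mul1r -integ_lin//.
have E : integ b (fun x => 1 * (f x * g' x) + f' x * g x) = f b * g b - f (- b) * g (- b).
  apply: (integE (H := fun x => f x * g x) b0) => x _.
  have := is_deriveM (df x) (dg x); congr (is_derive _ _ _ _).
  by rewrite mul1r -![_ *: _]/(_ * _) [g x * _]mulrC.
by rewrite E fb fNb !mul0r subrr.
Qed.

Lemma integ_ge1 b h : 1 <= b -> continuous h ->
  (forall x, `|x| <= b -> 0 <= h x) -> (forall x, `|x| <= 1 -> 2^-1 <= h x) ->
  1 <= integ b h.
Proof.
move=> b1 /(antiderivative b)[H dH] h0 h2.
have b0 : 0 <= b by apply: le_trans b1.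
rewrite (integE b0 dH).
have n1 : `|1| <= b by rewrite normr1.
have n1' : `|- 1| <= b by rewrite normrN normr1.
have nb : `|b| <= b by rewrite ger0_norm.
have nb' : `|- b| <= b by rewrite normrN ger0_norm.
have b1' : - b <= - 1 by rewrite lerN2.
have N11 : - 1 <= 1 :> R by rewrite -subr_ge0 opprK addr_ge0.
have [c1 [c1b E1]] := mean_value_on dH nb' n1' b1'.
have [c2 [c2b E2]] := mean_value_on dH n1' n1 N11.
have [c3 [c3b E3]] := mean_value_on dH n1 nb b1.
have k1 : 0 <= h c1 * (- 1 - - b).
  rewrite mulr_ge0//; last by rewrite opprK addrC subr_ge0.
  by apply: h0; rewrite ler_norml; move: c1b => /andP[? ?]; apply/andP; split; lra.
have k3 : 0 <= h c3 * (b - 1).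
  rewrite mulr_ge0 ?subr_ge0//; apply: h0.
  by rewrite ler_norml; move: c3b => /andP[? ?]; apply/andP; split; lra.
have k2 : 2^-1 <= h c2 by apply: h2; rewrite ler_norml.
lra.
Qed.

End integrals.

Section derivative_gain.
Variable R : realType.
Implicit Types (g h : R -> R) (K : nat).

(** The growth [exp (|x| / 64)] is half the decay of the kernel. *)
Definition tame (B : R) g : Prop :=
  continuous g /\ forall x, `|g x| <= B * expR (`|x| / 64).

Notation jetK K := (jet (freqs R K)).
Definition functional K g : R := integ (edge R K) (fun x => jetK K 0 x * g x).

Lemma edge_ge1 K : 1 <= edge R K.
Proof.
rewrite /edge -[leLHS]mulr1; apply: ler_pM => //; last exact: pihalf_ge1.
by rewrite exprn_ege1// ler1n.
Qed.

Lemma jet_continuous (s : seq R) p : continuous (jet s p).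
Proof.
move=> x; apply: differentiable_continuous; apply/derivable1_diffP.
exact: (@ex_derive _ _ _ _ _ _ _ (is_derive_jet s p x)).
Qed.

Lemma jet_edge K p : (p < 2 ^ K.+1)%N ->
  jetK K.+1 p (edge R K.+1) = 0 /\ jetK K.+1 p (- edge R K.+1) = 0.
Proof.
move=> pK; have E : 2 ^- K.+1 * edge R K.+1 = pi / 2.
  by rewrite /edge mulKf ?expf_neq0.
by split; apply: jet_vanish => //; rewrite ?mulrN ?cosN E cos_pihalf.
Qed.

(** Integration by parts: the zeros of the kernel at both ends kill the boundary terms. *)
Lemma derive_gain K p (G : nat -> R -> R) : (p < 2 ^ K.+1)%N ->
  (forall i (x : R), is_derive x 1 (G i) (G i.+1 x)) ->
  functional K.+1 (G p) =
    (-1) ^+ p * p`!%:R * integ (edge R K.+1) (fun x => jetK K.+1 p x * G 0%N x).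
Proof.
move=> pK dG.
have cG i : continuous (G i).
  move=> x; apply: differentiable_continuous; apply/derivable1_diffP.
  exact: (@ex_derive _ _ _ _ _ _ _ (dG i x)).
have e0 : 0 <= edge R K.+1 by apply: le_trans (edge_ge1 _).
suff h i : (i <= p)%N -> functional K.+1 (G p) = (-1) ^+ i * i`!%:R *
    integ (edge R K.+1) (fun x => jetK K.+1 i x * G (p - i)%N x).
  by rewrite (h p)// subnn.
elim: i => [_|i IH ip]; first by rewrite expr0 fact0 !mul1r subn0.
rewrite (IH (ltnW ip)).
have -> : (p - i)%N = (p - i.+1).+1 by rewrite subnSK.
have [v1 v2] := jet_edge (ltn_trans ip pK).
have -> : integ (edge R K.+1) (fun x => jetK K.+1 i x * G (p - i.+1).+1 x) =
    - integ (edge R K.+1) (fun x => i.+1%:R * jetK K.+1 i.+1 x * G (p - i.+1)%N x).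
  apply: (integ_by_parts (f := jetK K.+1 i) (g := G (p - i.+1)%N)
    (f' := fun x => i.+1%:R * jetK K.+1 i.+1 x)) => //.
  - by move=> x; exact: is_derive_jet.
  - by move=> x; apply: cvgM; [exact: cvg_cst|exact: jet_continuous].
have -> : integ (edge R K.+1) (fun x => i.+1%:R * jetK K.+1 i.+1 x * G (p - i.+1)%N x) =
    i.+1%:R * integ (edge R K.+1) (fun x => jetK K.+1 i.+1 x * G (p - i.+1)%N x).
  have := @integ_lin R (edge R K.+1) i.+1%:R
    (fun x => jetK K.+1 i.+1 x * G (p - i.+1)%N x) (fun=> 0) e0.
  have -> : integ (edge R K.+1) (fun=> 0 : R) = 0.
    by rewrite (integE (H := fun=> 0) e0) ?subrr// => x _; exact: is_derive_cst.
  rewrite addr0 => <-.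
  - by congr integ; apply/funext => x; rewrite addr0 mulrA.
  - by move=> x; apply: cvgM; [exact: jet_continuous|exact: cG].
  - by move=> x; exact: cvg_cst.
by rewrite exprS factS natrM; ring.
Qed.

Lemma exp_quadratic_bound (x : R) :
  expR (- (`|x| / 64)) <= (2 * 64 ^+ 2) * (1 + x ^+ 2)^-1.
Proof.
have x2 : 0 < 1 + x ^+ 2 by rewrite ltr_pwDl// sqr_ge0.
rewrite expRN ler_pdivlMr// ler_pdivrMl ?expR_gt0//.
have [t [t0 xt]] : exists t, 0 <= t /\ `|x| = 64 * t.
  by exists (`|x| / 64); split; [rewrite divr_ge0|field].
have -> : x ^+ 2 = (64 * t) ^+ 2 by rewrite -xt real_normK ?num_real.
rewrite xt (_ : 64 * t / 64 = t); last by field.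
have := expR_ge1Dxn 1 t0; rewrite (_ : (2`!)%:R = 2 :> R)// => h.
rewrite [leRHS]mulrC; apply: le_trans (ler_wpM2l _ h); last by rewrite mulr_ge0// exprn_ge0.
have -> : 2 * 64 ^+ 2 * (1 + t ^+ 2 / 2) = 64 ^+ 2 + 64 ^+ 2 + (64 * t) ^+ 2 by field.
rewrite lerD2r -[leLHS]addr0 lerD ?exprn_ge0//.
by rewrite exprn_ege1// ler1n.
Qed.

(** The product decays as [exp (- |x| / 64)], which is compared with the derivative of the
    arctangent. *)
Lemma integ_kernel_bound K p (C B : R) g : 0 <= C -> 0 <= B ->
  (forall x, `|x| <= edge R K.+1 -> `|jetK K.+1 p x| <= C * expR (- (`|x| / 32))) ->
  tame B g ->
  `|integ (edge R K.+1) (fun x => jetK K.+1 p x * g x)| <= C * (8 * 64 ^+ 2) * B.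
Proof.
move=> C0 B0 hC [cg gB]; pose D : R := C * B * (2 * 64 ^+ 2).
have D0 : 0 <= D by rewrite !mulr_ge0// exprn_ge0.
have e0 : 0 <= edge R K.+1 by apply: le_trans (edge_ge1 _).
have cj : continuous (fun x => jetK K.+1 p x * g x).
  by move=> x; apply: cvgM; [exact: jet_continuous|exact: cg].
have dG (x : R) : `|x| <= edge R K.+1 ->
    is_derive x 1 (fun x => D * atan x) (D * (1 + x ^+ 2)^-1).
  by move=> _; exact: (is_deriveZ D (is_derive1_atan x)).
apply: le_trans (integ_bound e0 cj dG _) _ => [x xe|].
  rewrite normrM; apply: (@le_trans _ _ (C * B * expR (- (`|x| / 64)))).
    apply: le_trans (ler_pM _ _ (hC x xe) (gB x)) _ => //.
    rewrite mulrACA ler_wpM2l ?mulr_ge0// -expRD ler_expR le_eqVlt.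
    by apply/orP; left; apply/eqP; field.
  by rewrite /D -(mulrA (C * B)) ler_wpM2l ?mulr_ge0// exp_quadratic_bound.
rewrite -mulrBr; apply: (@le_trans _ _ (D * 4)).
  rewrite ler_wpM2l//; have := atan_ltpi2 (edge R K.+1).
  by have := atan_gtNpi2 (- edge R K.+1); have := pihalf_lt2 R; lra.
by rewrite le_eqVlt; apply/orP; left; apply/eqP; rewrite /D; ring.
Qed.

Lemma jet0E (s : seq R) x : jet s 0 x = \prod_(w <- s) cos (w * x).
Proof.
elim: s => [|w s IH]; first by rewrite big_nil.
rewrite big_cons -IH /= big_ord1 expr0 mul1r fact0 divr1 subn0.
by rewrite /cosd /= expr0 mul1r.
Qed.

Lemma kernel_ge0 K x : 0 <= jetK K 0 x.
Proof.
rewrite jet0E prod_freqs; apply: prodr_ge0 => m _.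
by rewrite expnS exprM exprn_ge0// sqr_ge0.
Qed.

Lemma cos_ge_quadratic (y : R) : 1 - y ^+ 2 / 2 <= cos y.
Proof.
have -> : cos y = 1 - 2 * sin (y / 2) ^+ 2.
  have := cosD (y / 2) (y / 2); rewrite -splitr => ->.
  by have := cos2Dsin2 (y / 2); rewrite !expr2; lra.
have h : sin (y / 2) ^+ 2 <= (y / 2) ^+ 2.
  rewrite -(real_normK (num_real (sin _))) -(real_normK (num_real (y / 2))).
  by rewrite lerXn2r ?nnegrE// sin_le_id.
move: h; rewrite exprMn !expr2; lra.
Qed.

Lemma prod_ge_sum (I : Type) (s : seq I) (a : I -> R) :
  (forall i, 0 <= a i <= 1) -> 1 - \sum_(i <- s) a i <= \prod_(i <- s) (1 - a i).
Proof.
move=> ha; suff : 0 <= \prod_(i <- s) (1 - a i) <= 1 /\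
    1 - \sum_(i <- s) a i <= \prod_(i <- s) (1 - a i) by case.
elim: s => [|i s [/andP[p0 p1] IH]]; first by rewrite !big_nil subr0 ler01 lexx.
rewrite !big_cons; have /andP[a0 a1] := ha i; split.
  by rewrite mulr_ge0 ?subr_ge0//= mulr_ile1 ?subr_ge0// gerBl.
set p := \prod_(j <- s) _ in p0 p1 IH *; set t := \sum_(j <- s) _ in IH *.
have : a i * p <= a i by rewrite ler_piMr.
lra.
Qed.

(** The multiplicity [2^m] of the frequency [2^-m] is small enough for the product to
    keep away from 0 near the origin. *)
Lemma sum_freqs_sq K : \sum_(w <- freqs R K) w ^+ 2 <= 1.
Proof.
have -> : \sum_(w <- freqs R K) w ^+ 2 = \sum_(m < K) (2 ^- m.+1 : R).
  elim: K => [|K IH]; first by rewrite big_nil big_ord0.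
  rewrite big_cat /= IH big_ord_recr /= addrC; congr (_ + _).
  rewrite big_nseq iter_addr_0 -[LHS]mulr_natl natrX.
  by rewrite expr2 mulrA mulfV ?mul1r// expf_neq0.
exact: sum_geometric_half.
Qed.

(** Keeps the mass of the kernel away from 0, so that it can be normalized. *)
Lemma kernel_ge_half K x : `|x| <= 1 -> 2^-1 <= jetK K 0 x.
Proof.
move=> x1; have x21 : x ^+ 2 <= 1.
  by rewrite -(real_normK (num_real x)) expr_le1.
have w1 w : w \in freqs R K -> w ^+ 2 <= 1.
  move=> wK; apply: le_trans (sum_freqs_sq K); rewrite (big_rem w)//= lerDl.
  by apply: sumr_ge0 => v _; rewrite sqr_ge0.
pose a w : R := Num.min 1 ((w * x) ^+ 2 / 2).
have ha w : 0 <= a w <= 1 by rewrite /a le_min ler01 ge_min lexx divr_ge0 ?sqr_ge0.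
rewrite jet0E; apply: (@le_trans _ _ (\prod_(w <- freqs R K) (1 - a w))).
  apply: le_trans (prod_ge_sum _ ha).
  apply: (@le_trans _ _ (1 - \sum_(w <- freqs R K) w ^+ 2 / 2)).
    by rewrite -mulr_suml; have := sum_freqs_sq K; lra.
  rewrite lerD2l lerN2; apply: ler_sum => w _; rewrite /a ge_min; apply/orP; right.
  by rewrite ler_wpM2r// exprMn ler_piMr// sqr_ge0.
rewrite big_seq [leRHS]big_seq; apply: ler_prod => w wK.
have /andP[a0 a1] := ha w; rewrite subr_ge0 a1 /=.
apply: le_trans (cos_ge_quadratic _); rewrite lerD2l lerN2 /a le_min lexx andbT.
rewrite exprMn ler_pdivrMr// mul1r; apply: (@le_trans _ _ 1); last by rewrite ler1n.
by rewrite mulr_ile1 ?sqr_ge0// w1.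
Qed.

End derivative_gain.

Section limit_functional.
Variable R : realType.
Implicit Types (g h : R -> R).

Lemma ultra_cvg_real (T : Type) (U : set_system T) (UU : UltraFilter U) (u : T -> R) b :
  (\forall t \near U, `|u t| <= b) -> exists l : R, u @ U --> l.
Proof.
move=> ub; have PU : ProperFilter U by apply: ultra_proper.
have Uu : (u @ U) `[- b, b]%classic.
  by apply: (@filterS _ U _ _ _ _ ub) => K; rewrite /= in_itv /= -ler_norml.
have [l [_ cl]] := @segment_compact R (- b) b (u @ U) _ Uu.
exists l => W Wl; have [//|nW] := in_ultra_setVsetC (u @^-1` W) UU.
by have [x [/= nWx Wx]] := cl (~` W) W nW Wl.
Qed.

Lemma norm_lim_le (U : set_system nat) (UU : ProperFilter U) (u : nat -> R) l b :
  u @ U --> l -> (\forall K \near U, `|u K| <= b) -> `|l| <= b.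
Proof.
move=> ul ub; apply/ler_addgt0Pl => e e0.
have ue : U [set K | `|l - u K| < e] by have /cvgrPdist_lt/(_ e e0) := ul.
have [K [/= h1 h2]] := @filter_ex _ U _ _ (filterI ue ub).
rewrite -(subrK (u K) l); apply: le_trans (ler_normD _ _) _.
by rewrite lerD// ltW.
Qed.

(** A functional that is the integral against a kernel of total mass 1, decaying
    exponentially, whose derivatives are smaller than the weights at every
    scale [l].  The limit is taken on the integrals against the finite products, along
    an ultrafilter. *)
Theorem smoothing_functional (M : nat -> {posnum R}) k (c : R) :
  (M 0)%:num = 1 -> (0 < k)%N -> 0 < c ->
  (forall p, c ^+ p * (p`!%:R) ^+ 2 <= (M p)%:num ^+ k) ->
  exists L : (R -> R) -> R, [/\
    forall (a B B' : R) g h, tame B g -> tame B' h ->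
      L (fun x => a * g x + h x) = a * L g + L h,
    exists C0, forall B g, 0 <= B -> tame B g -> `|L g| <= C0 * B,
    L (fun=> 1) = 1 &
    forall l : R, 0 < l -> exists C, 0 <= C /\ forall p B (G : nat -> R -> R),
      0 <= B -> tame B (G 0%N) ->
      (forall i (x : R), is_derive x 1 (G i) (G i.+1 x)) ->
      (exists B', tame B' (G p)) -> l ^+ p * `|L (G p)| <= C * (M p)%:num * B].
Proof.
move=> M0 k0 c0 hM.
have [U [UU Uoo]] := @ultraFilterLemma nat \oo _.
have PU : ProperFilter U by apply: ultra_proper.
have [C1 [C10 hC1]] := kernel_derivative_le M0 k0 c0 ltr01 hM.
have ker0 K x : `|x| <= edge R K.+1 ->
    `|jet (freqs R K.+1) 0 x| <= C1 * expR (- (`|x| / 32)).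
  by move=> xK; have := hC1 0%N K.+1 x isT xK; rewrite fact0 expr0 M0 !mul1r mulr1.
pose u g K := functional K.+1 g.
pose C0 := C1 * (8 * 64 ^+ 2).
have C00 : 0 <= C0 by rewrite !mulr_ge0 ?ltW// exprn_gt0.
have ub B g K : 0 <= B -> tame B g -> `|u g K| <= C0 * B.
  move=> B0 tg; exact: (integ_kernel_bound (ltW C10) B0 (@ker0 K) tg).
pose L0 g := xget 0 [set l : R | u g @ U --> l].
have L0P B g : 0 <= B -> tame B g -> u g @ U --> L0 g.
  move=> B0 tg; have [l ul] := ultra_cvg_real UU (@nearW _ U _ PU (fun K => ub B g K B0 tg)).
  exact: (@xgetI _ 0 [set l : R | u g @ U --> l] l ul).
have tame1 : tame 1 (fun=> 1 : R).
  split; first by move=> x; exact: cvg_cst.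
  move=> x; rewrite normr1 mul1r; apply: le_trans (expR_ge1Dx _).
  by rewrite lerDl divr_ge0.
have u1 K : 1 <= u (fun=> 1) K.
  apply: integ_ge1.
  - exact: edge_ge1.
  - by move=> x; apply: cvgM; [exact: jet_continuous|exact: cvg_cst].
  - by move=> x _; rewrite mulr1 kernel_ge0.
  - by move=> x x1; rewrite mulr1 kernel_ge_half.
have l1 : 1 <= L0 (fun=> 1).
  have h := L0P 1 _ ler01 tame1; rewrite leNgt; apply/negP => lt1.
  have e0 : 0 < 1 - L0 (fun=> 1) by rewrite subr_gt0.
  have ue : U [set K | `|L0 (fun=> 1) - u (fun=> 1) K| < 1 - L0 (fun=> 1)].
    by have /cvgrPdist_lt/(_ _ e0) := h.
  have [K /= hK] := @filter_ex _ U _ _ ue.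
  by move: hK (u1 K); rewrite ltr_norml => /andP[? ?] ?; lra.
have l10 : 0 < L0 (fun=> 1) by apply: lt_le_trans l1.
have tame_ge0 B g : tame B g -> 0 <= B.
  move=> [_ /(_ 0)]; rewrite normr0 mul0r expR0 mulr1; exact: le_trans.
have L0_le B g : tame B g -> `|L0 g| <= C0 * B.
  move=> tg; have B0 := tame_ge0 _ _ tg.
  by apply: (norm_lim_le PU (L0P B g B0 tg)); apply: nearW => K; exact: ub.
have inv1 : (L0 (fun=> 1))^-1 <= 1 by rewrite invf_le1.
exists (fun g => L0 g / L0 (fun=> 1)); split.
- move=> a B B' g h tg th; rewrite mulrA -mulrDl; congr (_ / _).
  have B0 := tame_ge0 _ _ tg; have B0' := tame_ge0 _ _ th.
  have tgh : tame (`|a| * B + B') (fun x => a * g x + h x).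
    split=> [x|x].
      by apply: cvgD; [apply: cvgM; [exact: cvg_cst|exact: tg.1]|exact: th.1].
    apply: le_trans (ler_normD _ _) _; rewrite normrM mulrDl lerD ?th.2//.
    by rewrite -mulrA ler_wpM2l// tg.2.
  apply: (cvg_unique _ (L0P _ _ (tame_ge0 _ _ tgh) tgh)) => //.
  have -> : u (fun x => a * g x + h x) = (fun K => a * u g K + u h K).
    apply/funext => K; rewrite /u /functional -integ_lin.
    + by congr integ; apply/funext => x; rewrite mulrDr mulrCA.
    + by apply: le_trans (edge_ge1 _ _).
    + by move=> x; apply: cvgM; [exact: jet_continuous|exact: tg.1].
    + by move=> x; apply: cvgM; [exact: jet_continuous|exact: th.1].
  apply: cvgD; last exact: L0P B0' th.
  by apply: cvgM; [exact: cvg_cst|exact: L0P B0 tg].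
- exists C0 => B g B0 tg; rewrite normrM normfV (gtr0_norm l10).
  apply: le_trans (ler_wpM2r _ (L0_le _ _ tg)) _; first by rewrite invr_ge0 ltW.
  by rewrite ler_piMr// mulr_ge0.
- by rewrite divff// gt_eqF.
- move=> l l0; have [C [C0' hC]] := kernel_derivative_le M0 k0 c0 l0 hM.
  exists (C * (8 * 64 ^+ 2)); split; first by rewrite mulr_ge0 ?ltW// mulr_gt0 ?exprn_gt0.
  move=> p B G B0 tG dG [B' tGp].
  have lp0 : 0 < l ^+ p by rewrite exprn_gt0.
  rewrite normrM normfV (gtr0_norm l10) -ler_pdivlMl//.
  apply: (@le_trans _ _ `|L0 (G p)|); first by rewrite ler_piMr.
  apply: (norm_lim_le PU (L0P B' _ (tame_ge0 _ _ tGp) tGp)).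
  have Up : U [set K | (p <= K)%N] by apply: Uoo; exists p.
  apply: (@filterS _ U _ _ _ _ Up) => K /= pK.
  rewrite /u derive_gain//; last first.
    by apply: leq_ltn_trans pK _; apply: ltn_trans (ltn_expl K.+1 (ltnSn 1)).
  rewrite ler_pdivlMl// !normrM normrX normrN1 expr1n mul1r normr_nat.
  have pf : 0 < p`!%:R :> R by rewrite ltr0n fact_gt0.
  pose D := C * (M p)%:num / (l ^+ p * p`!%:R).
  have D0 : 0 <= D by rewrite divr_ge0 ?mulr_ge0 ?ltW.
  have hD x : `|x| <= edge R K.+1 ->
      `|jet (freqs R K.+1) p x| <= D * expR (- (`|x| / 32)).
    move=> xK; rewrite mulrAC ler_pdivlMr ?mulr_gt0// mulrC.
    exact: hC.
  have IB := integ_kernel_bound D0 B0 hD tG.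
  rewrite [leLHS]mulrA; apply: le_trans (ler_wpM2l _ IB) _; first by rewrite mulr_ge0 ?ltW.
  by rewrite le_eqVlt; apply/orP; left; apply/eqP; rewrite /D; field; rewrite !gt_eqF.
Qed.

End limit_functional.

(** * Weight functions and increments *)

Section weight_functions.
Variables (R : realType) (d : nat).
Notation e_ j := (delta_mx 0 j : 'rV[R]_d).
Implicit Types (x h v : 'rV[R]_d).

Lemma coord_le_enorm x k : `|x 0 k| <= enorm x.
Proof.
rewrite /enorm -sqrtr_sqr ler_wsqrtr// (bigD1 k)//= lerDl.
by apply: sumr_ge0 => i _; rewrite sqr_ge0.
Qed.

Lemma enorm_le x (r : R) : 0 <= r -> (forall k, `|x 0 k| <= r) -> enorm x <= d%:R * r.
Proof.
move=> r0 hx; have dr : 0 <= d%:R * r by rewrite mulr_ge0.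
rewrite -[leRHS](ger0_norm dr) -sqrtr_sqr ler_wsqrtr//.
apply: (@le_trans _ _ (\sum_(i < d) r ^+ 2)).
  apply: ler_sum => i _; rewrite -(real_normK (num_real (x 0 i))).
  by rewrite lerXn2r ?nnegrE.
rewrite sumr_const card_ord -[leLHS]mulr_natl exprMn ler_wpM2r ?sqr_ge0//.
by rewrite -natrX ler_nat; case: (d) => // n; rewrite expnS expn1 leq_pmull.
Qed.

Lemma enorm_delta j (t : R) : enorm (t *: e_ j) = `|t|.
Proof.
rewrite /enorm (bigD1 j)//= big1 ?addr0 => [|i ij].
  by rewrite !mxE !eqxx mulr1 sqrtr_sqr.
by rewrite !mxE (negbTE ij) andbF mulr0 expr0n.
Qed.

(** By (M.6) the series of [exp (L0 rho)] dominates the terms [rho^p / A_p]. *)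
Lemma assoc_fun_exp (A : nat -> {posnum R}) : cond_M6 A ->
  exists c0 L0 : R, [/\ 1 <= c0, 1 <= L0 &
    forall rho, 0 <= rho -> expR (assoc_fun A rho) <= c0 * expR (L0 * rho)].
Proof.
move=> [c0 [L0 [c01 L01 hA]]]; exists c0, L0; split => // rho rho0.
have c00 : 0 < c0 by apply: lt_le_trans c01.
have L00 : 0 < L0 by apply: lt_le_trans L01.
have -> : c0 * expR (L0 * rho) = expR (ln c0 + L0 * rho).
  by rewrite expRD lnK// posrE.
have b0 : 0 <= ln c0 + L0 * rho by rewrite addr_ge0 ?ln_ge0// mulr_ge0// ltW.
rewrite ler_expR; apply: ge_sup; first by exists (Num.max 0 (ln (rho ^+ 0 / (A 0%N)%:num))), 0%N.
move=> _ [p _ <-]; rewrite ge_max b0 /=.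
have [rp0|rp0] := leP (rho ^+ p / (A p)%:num) 0; first by rewrite ln0.
rewrite -ler_expR expRD lnK ?posrE// lnK ?posrE//.
have pf : 0 < p`!%:R :> R by rewrite ltr0n fact_gt0.
apply: (@le_trans _ _ (c0 * ((L0 * rho) ^+ p / p`!%:R))).
  rewrite ler_pdivrMr// exprMn.
  have -> : c0 * (L0 ^+ p * rho ^+ p / p`!%:R) * (A p)%:num =
    rho ^+ p * (c0 * L0 ^+ p * (A p)%:num / p`!%:R) by ring.
  by rewrite ler_peMr ?exprn_ge0// ler_pdivlMr// mul1r.
rewrite ler_wpM2l ?(ltW c00)// ler_pdivrMr//.
by apply: pow_le_exp_fact; rewrite mulr_ge0// ltW.
Qed.

Variables (A : nat -> {posnum R}) (eta : cweight R d).
Hypothesis hA : cond_M6 A.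

Lemma dagger_beurling : class_dagger Beurling A eta -> exists C k : R,
  [/\ 0 < C, 0 < k & forall x h, eta (x + h) <= C * eta x * expR (k * enorm h)].
Proof.
move=> [C [tau [C0 tau0 hC]]]; have [c0 [L0 [c01 L01 hc]]] := assoc_fun_exp hA.
have c00 : 0 < c0 by apply: lt_le_trans c01.
have L00 : 0 < L0 by apply: lt_le_trans L01.
exists (C * c0), (L0 * tau); split; [by rewrite mulr_gt0|by rewrite mulr_gt0|].
move=> x h; apply: le_trans (hC x h) _; rewrite -!mulrA ler_wpM2l ?(ltW C0)//.
rewrite mulrCA ler_wpM2l ?(ltW (cweight_gt0 eta x))//.
by apply: hc; rewrite mulr_ge0 ?(ltW tau0)// sqrtr_ge0.
Qed.

Lemma dagger_roumieu : class_dagger Roumieu A eta -> forall k : R, 0 < k ->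
  exists C : R, 0 < C /\ forall x h, eta (x + h) <= C * eta x * expR (k * enorm h).
Proof.
move=> hd k k0; have [c0 [L0 [c01 L01 hc]]] := assoc_fun_exp hA.
have c00 : 0 < c0 by apply: lt_le_trans c01.
have L00 : 0 < L0 by apply: lt_le_trans L01.
have [C [C0 hC]] := hd (k / L0) (divr_gt0 k0 L00).
exists (C * c0); split; first by rewrite mulr_gt0.
move=> x h; apply: le_trans (hC x h) _.
have -> : C * c0 * eta x * expR (k * enorm h) =
    C * eta x * (c0 * expR (L0 * (k / L0 * enorm h))).
  rewrite (_ : L0 * (k / L0 * enorm h) = k * enorm h); first by ring.
  by field; rewrite gt_eqF.
rewrite ler_wpM2l//; first by rewrite mulr_ge0// ltW// cweight_gt0.
by apply: hc; rewrite mulr_ge0 ?divr_ge0 ?(ltW k0) ?(ltW L00)// sqrtr_ge0.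
Qed.

(** The growth of [eta] matters for the smoothing operators only; everything else uses
    this local bound. *)
Lemma weight_box c : class_dagger c A eta -> exists C : R, 0 < C /\
  forall x y : 'rV[R]_d, (forall k, `|y 0 k - x 0 k| <= 1) -> eta y <= C * eta x.
Proof.
move=> hd; have [C [k [C0 k0 hC]]] : exists C k : R,
    [/\ 0 < C, 0 < k & forall x h, eta (x + h) <= C * eta x * expR (k * enorm h)].
  case: c hd => hd; first exact: dagger_beurling.
  by have [C [C0 hC]] := dagger_roumieu hd ltr01; exists C, 1.
exists (C * expR (k * d%:R)); split; first by rewrite mulr_gt0 ?expR_gt0.
move=> x y xy; rewrite -(subrKC x y); apply: le_trans (hC _ _) _.
rewrite mulrAC ler_wpM2r ?(ltW (cweight_gt0 eta x))// ler_wpM2l ?(ltW C0)//.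
rewrite ler_expR ler_wpM2l ?(ltW k0)// -[leRHS]mulr1; apply: enorm_le => // i.
by rewrite !mxE.
Qed.

End weight_functions.

Section box_increments.
Variables (R : realType) (d : nat) (F : lcsType R[i]) (phi : 'rV[R]_d -> F).
Hypothesis sphi : smooth phi.
Notation e_ j := (delta_mx 0 j : 'rV[R]_d).

(** The box is crossed along the coordinate axes, one at a time. *)
Lemma box_increment q s (x v : 'rV[R]_d) (B : R) : cts_seminorm q ->
  (forall j (y : 'rV[R]_d), (forall k, `|y 0 k - x 0 k| <= `|v 0 k|) ->
     q (pderivs (j :: s) phi y) <= B) ->
  q (pderivs s phi (x + v) - pderivs s phi x) <= (\sum_k `|v 0 k|) * B.
Proof.
move=> hq hB; have [sq cq] := hq.
suff H (r : seq 'I_d) : uniq r ->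
    q (pderivs s phi (x + \sum_(k <- r) v 0 k *: e_ k) - pderivs s phi x) <=
    (\sum_(k <- r) `|v 0 k|) * B.
  by have := H (index_enum 'I_d) (index_enum_uniq _); rewrite -row_sum_delta.
elim: r => [_|j r IH /= /andP[jr ur]].
  by rewrite !big_nil addr0 subrr mul0r seminorm0.
rewrite !big_cons mulrDl addrCA addrC.
set z := x + \sum_(k <- r) v 0 k *: e_ k.
rewrite -(subrKA (pderivs s phi z)); apply: le_trans (sq.1 _ _) _.
apply: lerD; last exact: IH.
apply: increment_le => // t ht; apply: hB => k.
have E : z 0 k = x 0 k + (if k \in r then v 0 k else 0).
  rewrite /z mxE summxE; congr (_ + _); elim: (r) ur => [_|i r' IH' /= /andP[ir ur']].
    by rewrite big_nil.
  rewrite big_cons IH'// !mxE eqxx in_cons /=.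
  have [->|ki] := eqVneq k i; first by rewrite (negbTE ir) mulr1 addr0.
  by rewrite mulr0 add0r.
rewrite [(z + _) 0 k]mxE E !mxE eqxx /=; have [->|kj] := eqVneq k j.
  by rewrite (negbTE jr) mulr1 addr0 addrAC subrr add0r.
rewrite mulr0 addr0 addrAC subrr add0r; case: ifP => // _.
by rewrite normr0.
Qed.

End box_increments.

(** * Smoothing operators *)

Section complex_parts.
Variable R : realType.

Lemma cvg_Im (T : Type) (G : set_system T) {FG : Filter G} (u : T -> R[i]^o) (l : R[i]) :
  u @ G --> (l : R[i]^o) -> (fun t => complex.Im (u t)) @ G --> complex.Im l.
Proof.
move=> ul; apply/cvgrPdist_lt => e e0; have h := (@cvg_normcP R T G FG u l).1 ul e e0.
apply: filterS h => t; apply: le_lt_trans; rewrite distrC.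
case: (u t) (l) => [a b] [a' b'] /=.
by rewrite -sqrtr_sqr ler_wsqrtr// lerDr sqr_ge0.
Qed.

Lemma normc_ge_Re (z : R[i]) : `|complex.Re z| <= normc z.
Proof. by case: z => a b /=; rewrite -sqrtr_sqr ler_wsqrtr// lerDl sqr_ge0. Qed.

Lemma normc_ge_Im (z : R[i]) : `|complex.Im z| <= normc z.
Proof. by case: z => a b /=; rewrite -sqrtr_sqr ler_wsqrtr// lerDr sqr_ge0. Qed.

Lemma normc_le_parts (z : R[i]) : normc z <= `|complex.Re z| + `|complex.Im z|.
Proof.
case: z => a b /=; rewrite -[leRHS]ger0_norm ?addr_ge0// -sqrtr_sqr ler_wsqrtr//.
by rewrite sqrrD !real_normK ?num_real// lerD2r lerDl mulrn_wge0.
Qed.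

End complex_parts.

Section averages.
Variables (R : realType) (d : nat) (eta : cweight R d) (M : nat -> {posnum R}).
Variables (L : (R -> R) -> R) (C0 Ce Cb : R).
Notation e_ j := (delta_mx 0 j : 'rV[R]_d).
Notation fn := ('rV[R]_d -> R[i]^o).
Hypothesis L_lin : forall (a B B' : R) g h, tame B g -> tame B' h ->
  L (fun x => a * g x + h x) = a * L g + L h.
Hypothesis C00 : 0 <= C0.
Hypothesis L_bound : forall B g, 0 <= B -> tame B g -> `|L g| <= C0 * B.
Hypothesis L_one : L (fun=> 1) = 1.
Hypothesis L_gain : forall l : R, 0 < l -> exists C, 0 <= C /\
  forall p B (G : nat -> R -> R), 0 <= B -> tame B (G 0%N) ->
    (forall i (x : R), is_derive x 1 (G i) (G i.+1 x)) ->
    (exists B', tame B' (G p)) -> l ^+ p * `|L (G p)| <= C * (M p)%:num * B.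
Hypothesis Ce0 : 0 < Ce.
Hypothesis eta_exp : forall x h, eta (x + h) <= Ce * eta x * expR (enorm h / 128).
Hypothesis Cb0 : 0 < Cb.
Hypothesis eta_box : forall x y : 'rV[R]_d,
  (forall k, `|y 0 k - x 0 k| <= 1) -> eta y <= Cb * eta x.

Let eta0 x : 0 < eta x := cweight_gt0 eta x.

Definition Lc (g : R -> R[i]) : R[i] :=
  Complex (L (fun h => complex.Re (g h))) (L (fun h => complex.Im (g h))).

Definition tamec (B : R) (g : R -> R[i]^o) : Prop :=
  continuous g /\ forall x, normc (g x) <= B * expR (`|x| / 64).

Lemma tamec_parts B g : tamec B g ->
  tame B (fun h => complex.Re (g h)) /\ tame B (fun h => complex.Im (g h)).
Proof.
move=> [cg gB]; split; split=> x.
- exact: (@cvg_Re _ _ (nbhs x) _ g _ (cg x)).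
- exact: le_trans (normc_ge_Re _) (gB x).
- exact: (@cvg_Im _ _ (nbhs x) _ g _ (cg x)).
- exact: le_trans (normc_ge_Im _) (gB x).
Qed.

Lemma Lc_lin (a B B' : R) g h : tamec B g -> tamec B' h ->
  Lc (fun x => a%:C * g x + h x) = a%:C * Lc g + Lc h.
Proof.
move=> /tamec_parts[gr gi] /tamec_parts[hr hi]; rewrite /Lc.
have -> : (fun x => complex.Re (a%:C * g x + h x)) =
    (fun x => a * complex.Re (g x) + complex.Re (h x)).
  by apply/funext => x; case: (g x) (h x) => [? ?] [? ?] /=; rewrite mul0r subr0.
have -> : (fun x => complex.Im (a%:C * g x + h x)) =
    (fun x => a * complex.Im (g x) + complex.Im (h x)).
  by apply/funext => x; case: (g x) (h x) => [? ?] [? ?] /=; rewrite mul0r addr0.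
rewrite (L_lin a gr hr) (L_lin a gi hi).
by apply/eqP; rewrite eq_complex /= !mul0r subr0 addr0 !eqxx.
Qed.

Lemma Lc_bound B g : 0 <= B -> tamec B g -> normc (Lc g) <= 2 * C0 * B.
Proof.
move=> B0 /tamec_parts[gr gi]; apply: le_trans (normc_le_parts _) _ => /=.
by have := L_bound B0 gr; have := L_bound B0 gi; lra.
Qed.

Lemma tame_cst (a : R) : tame `|a| (fun=> a).
Proof.
split=> [x|x]; first exact: cvg_cst.
by rewrite ler_peMr// (le_trans _ (expR_ge1Dx _))// lerDl divr_ge0.
Qed.

Lemma Lc_cst z : Lc (fun=> z) = z.
Proof.
have L0 : L (fun=> 0) = 0.
  have := L_lin (-1) (tame_cst 0) (tame_cst 0); rewrite mulr0 addr0.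
  by move=> h; lra.
have Lk a : L (fun=> a) = a.
  by have := L_lin a (tame_cst 1) (tame_cst 0); rewrite L_one L0 mulr1 addr0.
by rewrite /Lc !Lk; case: z.
Qed.

Definition wbound (B : R) (g : fn) : Prop := forall x, normc (g x) <= B * eta x.

Definition wsmooth (f : fn) : Prop :=
  smooth f /\ forall s, exists2 B : R, 0 <= B & wbound B (pderivs s f).

(** The mean of [g] along the [j]-th axis, at the scale [1 / l]. *)
Definition avg (l : R) (j : 'I_d) (g : fn) : fn :=
  fun x => Lc (fun h => g (x + (h / l) *: e_ j)).

Variable l : R.
Hypothesis l1 : 1 <= l.
Let l0 : 0 < l := lt_le_trans ltr01 l1.

Lemma line_continuous (g : fn) (x v : 'rV[R]_d) (a : R) : continuous g ->
  continuous (fun h : R => g (x + (h * a) *: v)).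
Proof.
move=> cg h; apply: (@continuous_comp _ _ _ (fun h : R => x + (h * a) *: v) g);
  last exact: cg.
apply: cvgD; first exact: cvg_cst.
apply: cvgZ; last exact: cvg_cst.
by apply: cvgM; [exact: cvg_id|exact: cvg_cst].
Qed.

Lemma norm_scaled (h : R) : `|h / l| <= `|h|.
Proof. by rewrite normrM ler_piMr// normfV gtr0_norm// invf_le1. Qed.

Lemma line_tamec j (g : fn) (B : R) x : continuous g -> 0 <= B -> wbound B g ->
  tamec (Ce * B * eta x) (fun h => g (x + (h / l) *: e_ j)).
Proof.
move=> cg B0 gB; split; first exact: line_continuous.
move=> h; apply: le_trans (gB _) _.
apply: le_trans (ler_wpM2l B0 (eta_exp _ _)) _; rewrite enorm_delta.
rewrite -!mulrA [leRHS]mulrCA ler_wpM2l// ler_wpM2l ?(ltW Ce0)//.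
rewrite ler_wpM2l ?(ltW (eta0 x))// ler_expR.
by apply: ler_pM => //; [exact: norm_scaled|rewrite lef_pV2 ?posrE// ler_nat].
Qed.

Let C2 := 2 * C0 * Ce.
Let C20 : 0 <= C2. Proof. by rewrite !mulr_ge0// ltW. Qed.

Lemma avg_bound j (g : fn) B : continuous g -> 0 <= B -> wbound B g ->
  wbound (C2 * B) (avg l j g).
Proof.
move=> cg B0 gB x; have tg := line_tamec j x cg B0 gB.
apply: le_trans (Lc_bound _ tg) _; first by rewrite !mulr_ge0 ?(ltW Ce0) ?(ltW (eta0 x)).
by rewrite /C2 !mulrA.
Qed.

Lemma avg_lin j (g h : fn) (a B B' : R) x : continuous g -> continuous h ->
  0 <= B -> 0 <= B' -> wbound B g -> wbound B' h ->
  avg l j (fun z => a%:C * g z + h z) x = a%:C * avg l j g x + avg l j h x.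
Proof.
move=> cg ch B0 B'0 gB hB.
exact: (Lc_lin a (line_tamec j x cg B0 gB) (line_tamec j x ch B'0 hB)).
Qed.

Lemma avgZ j (g : fn) (a B : R) x : continuous g -> 0 <= B -> wbound B g ->
  avg l j (fun z => a%:C * g z) x = a%:C * avg l j g x.
Proof.
move=> cg B0 gB.
have c0 : continuous ((fun=> 0) : fn) by exact: cst_continuous.
have b0 : wbound 0 ((fun=> 0) : fn).
  by move=> z; rewrite ComplexField.Normc.normc0 mul0r.
have := avg_lin j a x cg c0 B0 (lexx 0) gB b0.
rewrite [X in _ = _ + X]/avg Lc_cst addr0 => <-.
by rewrite /avg; congr Lc; apply/funext => h; rewrite addr0.
Qed.

Lemma normc_cts_seminorm : @cts_seminorm R R[i]^o (@ComplexField.Normc.normc R).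
Proof.
split; last exact: normc_continuous.
by split; [exact: le_normcD|move=> a x; exact: ComplexField.Normc.normcM].
Qed.

Section average_of_smooth.
Variables (f : fn) (j : 'I_d).
Hypothesis wf : wsmooth f.
Let sf : smooth f := wf.1.

Lemma translate_continuous (g : fn) (v : 'rV[R]_d) : continuous g ->
  continuous (fun z : 'rV[R]_d => g (z + v)).
Proof.
move=> cg z; apply: (@continuous_comp _ _ _ (fun z : 'rV[R]_d => z + v) g); last exact: cg.
by apply: cvgD; [exact: (nbhs_filter z)|exact: (@cvg_id _ (nbhs z))|exact: (@cvg_cst _ v _ (nbhs z) (nbhs_filter z))].
Qed.

Lemma scale_cts (g : fn) (a : R) : continuous g -> continuous ((fun z => a%:C * g z) : fn).
Proof.
by move=> cg z; apply: (@cvgZr _ R[i]^o _ (nbhs z)); exact: cg.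
Qed.

Lemma add_cts (g h : fn) : continuous g -> continuous h ->
  continuous ((fun z => g z + h z) : fn).
Proof.
move=> cg ch z.
by apply: (@cvgD _ R[i]^o _ (nbhs z) (nbhs_filter z)); [exact: cg|exact: ch].
Qed.

Lemma wbound_translate (g : fn) B (v : 'rV[R]_d) : 0 <= B -> wbound B g ->
  wbound (B * (Ce * expR (enorm v / 128))) (fun z : 'rV[R]_d => g (z + v)).
Proof.
move=> B0 gB z; apply: le_trans (gB _) _; rewrite -mulrA ler_wpM2l//.
by apply: le_trans (eta_exp _ _) _; rewrite mulrAC.
Qed.

Lemma wbound_scale (g : fn) B (a : R) : wbound B g ->
  wbound (`|a| * B) (fun z => a%:C * g z).
Proof.
by move=> gB z; rewrite ComplexField.Normc.normcM normc_real -mulrA ler_wpM2l.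
Qed.

Lemma wbound_add (g h : fn) B B' : wbound B g -> wbound B' h ->
  wbound (B + B') (fun z => g z + h z).
Proof.
by move=> gB hB z; apply: le_trans (le_normcD _ _) _; rewrite mulrDl lerD.
Qed.

(** Uniform bounds for one more derivative make the mean uniformly continuous. *)
Lemma avg_increment s (v : 'rV[R]_d) (B : R) x : (forall k, `|v 0 k| <= 1) -> 0 <= B ->
  (forall i, wbound B (pderivs (i :: s) f)) ->
  normc (avg l j (pderivs s f) (x + v) - avg l j (pderivs s f) x) <=
  C2 * ((\sum_k `|v 0 k|) * (B * Cb)) * eta x.
Proof.
move=> v1 B0 hB; pose g : fn := pderivs s f; have cg : continuous g := sf.1 s.
have [B1 B10 gB] := wf.2 s.
pose D : fn := fun z => (-1)%:C * g z + g (z + v).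
have cD : continuous D.
  exact: (add_cts (scale_cts (a := -1) cg) (translate_continuous (v := v) cg)).
have S0 : 0 <= (\sum_k `|v 0 k|) * (B * Cb).
  by rewrite mulr_ge0 ?sumr_ge0// mulr_ge0// ltW.
have DB : wbound ((\sum_k `|v 0 k|) * (B * Cb)) D.
  move=> z; rewrite /D rmorphN rmorph1 mulN1r addrC -mulrA.
  apply: (box_increment sf normc_cts_seminorm) => i y yz.
  apply: le_trans (hB i y) _; rewrite -mulrA ler_wpM2l//.
  by apply: eta_box => k; apply: le_trans (yz k) (v1 k).
have := avg_bound j cD S0 DB x; congr (normc _ <= _).
have gv := wbound_translate v B10 gB.
rewrite (@avg_lin j g (fun z : 'rV[R]_d => g (z + v)) (-1) B1 _ x cg _ B10 _ gB gv).
- rewrite rmorphN rmorph1 mulN1r addrC; congr (_ - _).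
  by congr Lc; apply/funext => h; rewrite addrAC.
- exact: (translate_continuous (v := v) cg).
- by rewrite !mulr_ge0 ?expR_ge0// ltW.
Qed.

Lemma common_bound s : exists2 B : R, 0 <= B & forall i, wbound B (pderivs (i :: s) f).
Proof.
pose b i := projT1 (cid2 (wf.2 (i :: s))).
have b0 i : 0 <= b i by rewrite /b; case: cid2.
exists (\sum_i b i); first by apply: sumr_ge0.
move=> i x; apply: (@le_trans _ _ (b i * eta x)).
  by rewrite /b; case: cid2 => B ? h; exact: h.
rewrite ler_wpM2r ?(ltW (eta0 x))// (bigD1 i)//= lerDl.
by apply: sumr_ge0.
Qed.

Lemma avg_continuous s : continuous (avg l j (pderivs s f)).
Proof.
move=> x; have [B B0 hB] := common_bound s.
apply/(@cvg_normcP R _ (nbhs x) (nbhs_filter x)) => e e0.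
pose D := C2 * (B * Cb) * eta x + 1.
have D0 : 0 < D by rewrite ltr_wpDl// !mulr_ge0// ltW.
have FN := nbhs_filter x.
have cs (r : seq 'I_d) : (fun y : 'rV[R]_d => \sum_(k <- r) `|y 0 k - x 0 k|) @ x --> (0 : R).
  elim: r => [|k r IH].
    rewrite (_ : (fun=> _) = fun=> 0); first exact: (@cvg_cst _ (0 : R) _ _ FN).
    by apply/funext => y; rewrite big_nil.
  rewrite (_ : (fun=> _) = fun y : 'rV[R]_d => `|y 0 k - x 0 k| + \sum_(k <- r) `|y 0 k - x 0 k|);
    last by apply/funext => y; rewrite big_cons.
  have h1 : (fun y : 'rV[R]_d => `|y 0 k - x 0 k|) @ x --> `|x 0 k - x 0 k|.
    apply: (@cvg_norm _ _ _ _ FN).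
    apply: (@cvgB _ _ _ _ FN); last exact: (@cvg_cst _ (x 0 k) _ _ FN).
    exact: coord_continuous.
  rewrite subrr normr0 in h1.
  by have := @cvgD _ _ _ _ FN _ _ _ _ h1 IH; rewrite addr0.
have m0 : 0 < Num.min 1 (e / D) by rewrite lt_min ltr01 divr_gt0.
have := (@cvgrPdist_lt _ _ _ _ FN _ _).1 (cs (index_enum 'I_d)) _ m0.
apply: (@filterS _ (nbhs x)) => y; rewrite sub0r normrN ger0_norm ?sumr_ge0//.
rewrite lt_min => /andP[y1 yD]; rewrite -(subrKC x y).
have vE k : (y - x) 0 k = y 0 k - x 0 k by rewrite !mxE.
apply: le_lt_trans (avg_increment (v := y - x) x _ B0 hB) _.
  move=> k; rewrite vE; apply: le_trans (ltW y1); rewrite (bigD1 k)//= lerDl.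
  by apply: sumr_ge0.
under eq_bigr do rewrite vE.
rewrite ltr_pdivlMr// in yD; apply: le_lt_trans yD.
set t := \sum_k _; have t0 : 0 <= t by apply: sumr_ge0.
have -> : C2 * (t * (B * Cb)) * eta x = t * (C2 * (B * Cb) * eta x) by ring.
by rewrite ler_wpM2l// lerDl.
Qed.

(** The remainder of the difference quotient is [O(t)], uniformly, hence so is its mean. *)
Lemma avg_diff_quot s i x : diff_quot (avg l j (pderivs s f)) i x @ 0^' -->
  avg l j (pderivs (i :: s) f) x.
Proof.
pose g : fn := pderivs s f; pose g' : fn := pderivs (i :: s) f.
have cg : continuous g := sf.1 s; have cg' : continuous g' := sf.1 (i :: s).
have [B1 B10 gB] := wf.2 s; have [B2 B20 gB'] := wf.2 (i :: s).
have [B3 B30 gB3] := wf.2 [:: i, i & s].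
apply/(@cvg_normcP R) => e e0.
pose D := C2 * (B3 * Cb) * eta x + 1.
have D0 : 0 < D by rewrite ltr_wpDl// !mulr_ge0// ltW.
have m0 : 0 < Num.min 1 (e / D) by rewrite lt_min ltr01 divr_gt0.
near=> t.
have t0 : t != 0 by near: t; exact: nbhs_dnbhs_neq.
have : `|t| < Num.min 1 (e / D) by near: t; exact: dnbhs0_lt.
rewrite lt_min => /andP[t1 tD].
pose gt : fn := fun z => g (z + t *: e_ i).
have cgt : continuous gt := translate_continuous (v := (t *: e_ i)) cg.
have gtB := wbound_translate (t *: e_ i) B10 gB.
have E0 : 0 <= B1 * (Ce * expR (enorm (t *: e_ i) / 128)).
  by rewrite !mulr_ge0 ?expR_ge0// ltW.
pose a := t^-1; pose r1 : fn := fun z => (- a)%:C * g z + (-1)%:C * g' z.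
pose rem : fn := fun z => a%:C * gt z + r1 z.
have cr1 : continuous r1 := add_cts (scale_cts (a := - a) cg) (scale_cts (a := -1) cg').
have r1B := wbound_add (wbound_scale (- a) gB) (wbound_scale (-1) gB').
have r10 : 0 <= `|- a| * B1 + `|-1| * B2 by rewrite addr_ge0// mulr_ge0.
have crem : continuous rem := add_cts (scale_cts (a := a) cgt) cr1.
have remB : wbound (`|t| * (B3 * Cb)) rem.
  move=> z; have -> : rem z = a%:C * (gt z - g z - t%:C * g' z).
    rewrite /rem /r1 !mulrBr mulrA -rmorphM mulVf// rmorph1 mul1r rmorphN mulNr.
    by rewrite rmorphN rmorph1 mulN1r addrA.
  rewrite ComplexField.Normc.normcM normc_real /a normfV ler_pdivrMl ?normr_gt0//.
  rewrite mulrA mulrA -expr2 -mulrA.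
  apply: (taylor_le sf normc_cts_seminorm) => r rt.
  apply: le_trans (gB3 _) _; rewrite -mulrA ler_wpM2l//.
  apply: eta_box => k; rewrite !mxE eqxx /= addrAC subrr add0r.
  case: (k == i); rewrite ?mulr1 ?mulr0 ?normr0//.
  by apply: le_trans rt (ltW t1).
have tB0 : 0 <= `|t| * (B3 * Cb) by rewrite !mulr_ge0// ltW.
have := avg_bound j crem tB0 remB x.
have -> : avg l j rem x = diff_quot (avg l j g) i x t - avg l j g' x.
  rewrite (avg_lin j a x cgt cr1 E0 r10 gtB r1B).
  have cg1 : continuous ((fun z => (-1)%:C * g' z) : fn) := scale_cts (a := -1) cg'.
  have g1B := wbound_scale (-1) gB'.
  have g10 : 0 <= `|-1| * B2 by rewrite mulr_ge0.
  rewrite (avg_lin j (- a) x cg cg1 B10 g10 gB g1B) (avgZ j (-1) x cg' B20 gB').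
  rewrite /diff_quot -[_ *: _]/(_ * _) rmorphN rmorphN rmorph1 mulN1r mulNr mulrBr addrA.
  congr (_ * _ - _ - _); congr Lc; apply/funext => h.
  by rewrite /gt addrAC.
move=> /le_lt_trans; apply; rewrite ltr_pdivlMr// in tD; apply: le_lt_trans tD.
have -> : C2 * (`|t| * (B3 * Cb)) * eta x = `|t| * (C2 * (B3 * Cb) * eta x) by ring.
by rewrite ler_wpM2l// lerDl.
Unshelve. all: by end_near. Qed.

Lemma avg_pderivs s : pderivs s (avg l j f) = avg l j (pderivs s f).
Proof.
elim: s => // i s IH; rewrite /= -!/(pderivs _ _) IH.
by apply/funext => x; apply: pderivE; exact: avg_diff_quot.
Qed.

Lemma avg_wsmooth : wsmooth (avg l j f).
Proof.
split; last first.
  move=> s; have [B B0 hB] := wf.2 s; exists (C2 * B); first exact: mulr_ge0.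
  by rewrite avg_pderivs; apply: avg_bound => //; exact: sf.1.
split=> s; first by rewrite avg_pderivs; exact: avg_continuous.
move=> i x; rewrite avg_pderivs; exists (avg l j (pderivs (i :: s) f) x).
exact: avg_diff_quot.
Qed.

End average_of_smooth.

Let C3 := 2 * C0 * (128 * Ce).

(** The increment over a step [h / l] is at most [|h| / l] times a bound for the
    derivative, and [|h| <= 128 exp (|h| / 128)] keeps it tame. *)
Lemma avg_near f j s B : wsmooth f -> 0 <= B -> wbound B (pderivs (j :: s) f) ->
  wbound (C3 / l * B) (fun x => avg l j (pderivs s f) x - pderivs s f x).
Proof.
move=> wf B0 hB x; pose g : fn := pderivs s f.
have cg : continuous g := wf.1.1 s; have [B1 B10 gB] := wf.2 s.
pose E := 128 * Ce / l * B * eta x.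
have E0 : 0 <= E by rewrite !mulr_ge0 ?invr_ge0 ?(ltW Ce0) ?(ltW (eta0 x)) ?(ltW l0).
pose u : R -> R[i]^o := fun h => g (x + (h / l) *: e_ j).
pose v : R -> R[i]^o := fun h => (-1)%:C * g x + u h.
have tu : tamec (Ce * B1 * eta x) u by exact: line_tamec.
have tx : tamec (normc (g x)) ((fun=> g x) : R -> R[i]^o).
  split=> [h|h]; first exact: cvg_cst.
  rewrite ler_peMr ?normc_ge0// (le_trans _ (expR_ge1Dx _))// lerDl.
  by rewrite divr_ge0.
have LE : Lc v = avg l j g x - g x.
  by rewrite (Lc_lin (-1) tx tu) Lc_cst rmorphN rmorph1 mulN1r addrC.
have tv : tamec E v.
  split=> [h|h].
    apply: (@cvgD _ R[i]^o _ (nbhs h) (nbhs_filter h)); first exact: cvg_cst.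
    exact: tu.1.
  have -> : v h = g (x + (h / l) *: e_ j) - g x.
    by rewrite /v rmorphN rmorph1 mulN1r addrC.
  have hl : `|h / l| = `|h| / l by rewrite normrM normfV (gtr0_norm l0).
  apply: (@le_trans _ _ (`|h / l| * (B * (Ce * eta x * expR (`|h| / 128))))).
    apply: (increment_le wf.1 normc_cts_seminorm) => r rh.
    apply: le_trans (hB _) _; rewrite ler_wpM2l//.
    apply: le_trans (eta_exp _ _) _; rewrite enorm_delta.
    rewrite ler_wpM2l ?mulr_ge0 ?(ltW Ce0) ?(ltW (eta0 x))// ler_expR.
    rewrite ler_wpM2r ?invr_ge0//.
    exact: le_trans rh (norm_scaled h).
  rewrite hl; have -> : `|h| / l * (B * (Ce * eta x * expR (`|h| / 128))) =
      `|h| * expR (`|h| / 128) * (Ce / l * B * eta x) by ring.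
  have -> : E * expR (`|h| / 64) = 128 * expR (`|h| / 64) * (Ce / l * B * eta x).
    by rewrite /E; ring.
  rewrite ler_wpM2r ?mulr_ge0 ?invr_ge0 ?(ltW Ce0) ?(ltW (eta0 x)) ?(ltW l0)//.
  have -> : `|h| / 64 = `|h| / 128 + `|h| / 128 by field.
  rewrite expRD mulrA ler_wpM2r ?expR_ge0//.
  have := expR_ge1Dx (`|h| / 128); have := normr_ge0 h; lra.
have := Lc_bound E0 tv; rewrite LE => /le_trans; apply.
by rewrite le_eqVlt /E /C3; apply/orP; left; apply/eqP; ring.
Qed.

Lemma is_derive_Im (f : fn) s j x (t : R) : smooth f -> is_derive t 1
  (fun t => complex.Im (pderivs s f (x + t *: e_ j)))
  (complex.Im (pderivs (j :: s) f (x + t *: e_ j))).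
Proof.
move=> sf; have sg := smooth_lin (- 'i%C) sf (@smooth0 R d R[i]^o).
have E u y : complex.Im (pderivs u f y) = complex.Re (pderivs u (- 'i%C *: f + 0) y).
  have p0 : pderivs u (0 : fn) = 0.
    have := pderivs_lin (-1) u (@smooth0 R d R[i]^o) (@smooth0 R d R[i]^o).
    by rewrite scaler0 addr0 scaleN1r addNr.
  have -> := pderivs_lin (- 'i%C) u sf (@smooth0 R d R[i]^o).
  rewrite p0 addr0 fctE -[_ *: _]/(_ * _); case: (pderivs u f y) => a b /=.
  by rewrite !(mul0r, mulN1r, oppr0, sub0r, opprK, mul1r, mulNr).
rewrite E; rewrite (_ : (fun _ => _) =
  fun t => complex.Re (pderivs s (- 'i%C *: f + 0) (x + t *: e_ j))).
  exact: is_derive_Re.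
by apply/funext => r; rewrite E.
Qed.

Lemma is_derive_rescaled (u u' : R -> R) (a : R) :
  (forall t : R, is_derive t 1 u (u' t)) ->
  forall t b : R, is_derive t 1 (fun h => b * u (h * a)) (b * a * u' (t * a)).
Proof.
move=> du t b.
have dm : is_derive t 1 (fun h : R => h * a) (a : R).
  have := @is_deriveZ R R R id a t 1 1 (is_derive_id _ _).
  rewrite -[_ *: 1]/(_ * _) mulr1 (_ : _ \*: _ = fun h => h * a)//.
  by apply/funext => h; exact: mulrC.
have dc := @is_derive1_comp R u (fun h : R => h * a) t _ _ (du (t * a)) dm.
have := is_deriveZ b dc; rewrite -[_ *: _]/(_ * _).
by rewrite [u' _ * a]mulrC mulrA.
Qed.

(** [p] derivatives of the mean fall on the function; moved back to the
    functional, they cost [M p]. *)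
Lemma avg_gain : exists2 C : R, 0 <= C & forall f j p B, wsmooth f -> 0 <= B ->
  wbound B f -> wbound (C * (M p)%:num * B) (pderivs (nseq p j) (avg l j f)).
Proof.
have [C [C_ge0 hC]] := L_gain l0.
exists (2 * C * Ce); first by rewrite !mulr_ge0// ltW.
move=> f j p B wf B0 fB x; rewrite avg_pderivs//.
have lV0 : l^-1 != 0 by rewrite invr_eq0 gt_eqF.
have part (P : R[i]^o -> R) : (forall z, `|P z| <= normc z) ->
    (forall (g : R -> R[i]^o), continuous g -> continuous (fun h => P (g h))) ->
    (forall s (t : R), is_derive t 1 (fun t => P (pderivs s f (x + t *: e_ j)))
       (P (pderivs (j :: s) f (x + t *: e_ j)))) ->
    `|L (fun h => P (pderivs (nseq p j) f (x + (h / l) *: e_ j)))| <=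
    C * (M p)%:num * (Ce * B * eta x).
  move=> PN Pc dP.
  pose G i h := l^-1 ^+ i * P (pderivs (nseq i j) f (x + (h / l) *: e_ j)).
  have tP i : exists2 B', 0 <= B' &
      tame B' (fun h => P (pderivs (nseq i j) f (x + (h / l) *: e_ j))).
    have [B' B'0 hB'] := wf.2 (nseq i j); exists (Ce * B' * eta x).
      by rewrite !mulr_ge0// ltW.
    have [c1 c2] := line_tamec j x (wf.1.1 (nseq i j)) B'0 hB'.
    split; first exact: Pc.
    by move=> h; apply: le_trans (PN _) (c2 h).
  have t0' : tame (Ce * B * eta x) (G 0%N).
    have [c1 c2] := line_tamec j x (wf.1.1 [::]) B0 fB.
    split.
      rewrite (_ : G 0%N = fun h => P (pderivs [::] f (x + (h / l) *: e_ j))).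
        exact: Pc.
      by apply/funext => h; rewrite /G expr0 mul1r.
    by move=> h; rewrite /G expr0 mul1r; apply: le_trans (PN _) (c2 h).
  have dG i (h : R) : is_derive h 1 (G i) (G i.+1 h).
    have := is_derive_rescaled l^-1 (dP (nseq i j)) h (l^-1 ^+ i).
    by rewrite -exprSr.
  have E0 : 0 <= Ce * B * eta x by rewrite !mulr_ge0// ltW.
  have [B' B'0 [cP hP]] := tP p.
  have z0 : tame 0 (fun=> 0 : R).
    by split=> [h|h]; [exact: cvg_cst|rewrite normr0 mul0r].
  have LG : L (G p) = l^-1 ^+ p * L (fun h => P (pderivs (nseq p j) f (x + (h / l) *: e_ j))).
    have := L_lin (l^-1 ^+ p) (conj cP hP) z0.
    have -> : L (fun=> 0) = 0 by have := L_lin (-1) z0 z0; rewrite mulr0 addr0; lra.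
    rewrite addr0 => <-; congr L; apply/funext => h; rewrite addr0.
    by [].
  have tGp : exists B', tame B' (G p).
    exists B'; split.
      move=> h; apply: cvgM; [exact: cvg_cst|exact: cP].
    move=> h; rewrite /G normrM; apply: le_trans (hP h).
    rewrite ler_piMl// normrX normfV (gtr0_norm l0) exprVn invf_le1 ?exprn_gt0//.
    by rewrite exprn_ege1.
  have := hC p _ G E0 t0' dG tGp; rewrite LG normrM normrX normfV (gtr0_norm l0).
  by rewrite mulrA exprVn divff ?mul1r// expf_neq0// gt_eqF.
have r1 : `|L (fun h => complex.Re (pderivs (nseq p j) f (x + (h / l) *: e_ j)))| <=
    C * (M p)%:num * (Ce * B * eta x).
  apply: (part (@complex.Re R)).
  - exact: normc_ge_Re.
  - by move=> g cg h; exact: (@cvg_Re _ _ (nbhs h) _ g _ (cg h)).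
  - by move=> s t; exact: (is_derive_Re wf.1).
have r2 : `|L (fun h => complex.Im (pderivs (nseq p j) f (x + (h / l) *: e_ j)))| <=
    C * (M p)%:num * (Ce * B * eta x).
  apply: (part (@complex.Im R)).
  - exact: normc_ge_Im.
  - by move=> g cg h; exact: (@cvg_Im _ _ (nbhs h) _ g _ (cg h)).
  - by move=> s t; exact: (is_derive_Im _ _ _ _ wf.1).
apply: le_trans (normc_le_parts _) _ => /=.
apply: le_trans (lerD r1 r2) _.
by rewrite le_eqVlt; apply/orP; left; apply/eqP; ring.
Qed.

(** Decay at infinity, in terms of the largest coordinate. *)
Definition vanishing (g : fn) : Prop := forall e : R, 0 < e ->
  exists rho : R, forall (x : 'rV[R]_d) k, rho < `|x 0 k| -> normc (g x) <= e * eta x.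

(** A translation by at most [T] does not affect decay; the larger ones are
    discounted by [exp (- T / 128)]. *)
Lemma avg_vanishing j (g : fn) B : continuous g -> 0 <= B -> wbound B g ->
  vanishing g -> vanishing (avg l j g).
Proof.
move=> cg B0 gB vg e e0.
pose e' := e / (C2 + 1).
have D0 : 0 < C2 + 1 by rewrite ltr_wpDl.
have e'0 : 0 < e' by rewrite divr_gt0.
have [rho hrho] := vg e' e'0.
pose T := 128 * (B / e').
have T0 : 0 <= T by rewrite !mulr_ge0 ?invr_ge0// ltW.
have TE : B <= e' * expR (T / 128).
  have : 1 + B / e' <= expR (T / 128).
    by rewrite (_ : T / 128 = B / e') ?expR_ge1Dx// /T; field; rewrite gt_eqF.
  move=> h; rewrite -ler_pdivrMl// mulrC; apply: le_trans h; rewrite lerDr.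
  exact: ler01.
exists (rho + T) => x k xk.
have tg : tamec (Ce * e' * eta x) (fun h => g (x + (h / l) *: e_ j)).
  split; first exact: line_continuous.
  move=> h; set y := x + _.
  have yE : eta y <= Ce * eta x * expR (`|h| / 128).
    apply: le_trans (eta_exp _ _) _; rewrite enorm_delta.
    rewrite ler_wpM2l ?mulr_ge0 ?(ltW Ce0) ?(ltW (eta0 x))// ler_expR.
    by rewrite ler_wpM2r ?invr_ge0// norm_scaled.
  have h2 : `|h| / 64 = `|h| / 128 + `|h| / 128 by field.
  have [hT|hT] := leP `|h / l| T.
    have yk : rho < `|y 0 k|.
      have : `|x 0 k| <= `|y 0 k| + `|h / l|.
        rewrite -[X in `|X| <= _](addrK ((h / l) * (k == j)%:R)).
        apply: le_trans (ler_normB _ _) _; rewrite !mxE eqxx /= lerD2l normrM.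
        by case: (k == j); rewrite ?normr1 ?normr0 ?mulr1 ?mulr0.
      by lra.
    apply: le_trans (hrho y k yk) _.
    apply: (@le_trans _ _ (e' * (Ce * eta x * expR (`|h| / 128)))).
      by rewrite ler_wpM2l// ltW.
    have -> : Ce * e' * eta x * expR (`|h| / 64) = e' * (Ce * eta x * expR (`|h| / 64)).
      by ring.
    rewrite ler_wpM2l ?(ltW e'0)// ler_wpM2l ?mulr_ge0 ?(ltW Ce0) ?(ltW (eta0 x))//.
    by rewrite ler_expR h2 lerDl divr_ge0.
  apply: le_trans (gB y) _.
  apply: (@le_trans _ _ (B * (Ce * eta x * expR (`|h| / 128)))).
    by rewrite ler_wpM2l.
  have -> : B * (Ce * eta x * expR (`|h| / 128)) = B * expR (`|h| / 128) * (Ce * eta x).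
    by ring.
  have -> : Ce * e' * eta x * expR (`|h| / 64) = e' * expR (`|h| / 64) * (Ce * eta x).
    by ring.
  rewrite ler_wpM2r ?mulr_ge0 ?(ltW Ce0) ?(ltW (eta0 x))// h2 expRD mulrA.
  rewrite ler_wpM2r ?expR_ge0//; apply: le_trans TE _.
  rewrite ler_wpM2l ?(ltW e'0)// ler_expR ler_wpM2r ?invr_ge0//.
  exact: le_trans (ltW hT) (norm_scaled h).
have E0 : 0 <= Ce * e' * eta x := mulr_ge0 (mulr_ge0 (ltW Ce0) (ltW e'0)) (ltW (eta0 x)).
have := Lc_bound E0 tg; move/le_trans; apply.
have -> : 2 * C0 * (Ce * e' * eta x) = C2 * e' * eta x by rewrite /C2; ring.
rewrite ler_wpM2r ?(ltW (eta0 x))// /e' mulrCA ler_piMr ?(ltW e0)//.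
by rewrite ler_pdivrMr// mul1r lerDl.
Qed.

Hypothesis M0 : (M 0)%:num = 1.
Hypothesis MM : forall p q, (M p)%:num * (M q)%:num <= (M (p + q))%:num.

Definition smoothing (r : seq 'I_d) (f : fn) : fn := foldr (avg l) f r.

Lemma pderivs_cat s t (f : fn) : pderivs (s ++ t) f = pderivs s (pderivs t f).
Proof. by rewrite /pderivs foldr_cat. Qed.

Lemma wsmooth_pderivs s f : wsmooth f -> wsmooth (pderivs s f).
Proof.
move=> [[c1 c2] c3]; split; first split.
- by move=> t; rewrite -pderivs_cat; exact: c1.
- by move=> t j x; rewrite -pderivs_cat; exact: c2.
- by move=> t; rewrite -pderivs_cat; exact: c3.
Qed.

Lemma smoothing_wsmooth r f : wsmooth f -> wsmooth (smoothing r f).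
Proof. by move=> wf; elim: r => //= j r IH; exact: avg_wsmooth. Qed.

Lemma smoothing_pderivs r f s : wsmooth f ->
  pderivs s (smoothing r f) = smoothing r (pderivs s f).
Proof.
move=> wf; elim: r => //= j r IH; rewrite avg_pderivs ?IH//.
exact: smoothing_wsmooth.
Qed.

Let C4 : R := Num.max 1 C2.
Let C41 : 1 <= C4. Proof. by rewrite le_max lexx. Qed.
Let C40 : 0 <= C4. Proof. exact: le_trans ler01 C41. Qed.

Lemma wbound_le (B B' : R) (g : fn) : B <= B' -> wbound B g -> wbound B' g.
Proof. by move=> BB gB x; apply: le_trans (gB x) _; rewrite ler_wpM2r// ltW. Qed.

Lemma smoothing_bound r f B : wsmooth f -> 0 <= B -> wbound B f ->
  wbound (C4 ^+ size r * B) (smoothing r f).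
Proof.
move=> wf B0 fB; elim: r => [|j r IH] /=; first by rewrite expr0 mul1r.
have := avg_bound j ((smoothing_wsmooth r wf).1.1 [::]) _ IH.
rewrite mulr_ge0 ?exprn_ge0// => /(_ isT); apply: wbound_le.
rewrite exprS -[leRHS]mulrA ler_wpM2r ?mulr_ge0 ?exprn_ge0//.
by rewrite le_max lexx orbT.
Qed.

(** The error telescopes over the axes. *)
Lemma smoothing_near r f B : wsmooth f -> 0 <= B ->
  (forall j, wbound B (pderivs [:: j] f)) ->
  wbound ((size r)%:R * C3 * C4 ^+ size r / l * B) (fun x => smoothing r f x - f x).
Proof.
move=> wf B0 fB; elim: r => [|j r IH] x /=.
  by rewrite subrr ComplexField.Normc.normc0 !mul0r.
have wS := smoothing_wsmooth r wf.
have C30 : 0 <= C3 by rewrite !mulr_ge0// ltW.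
have fB' : wbound (C4 ^+ size r * B) (pderivs [:: j] (smoothing r f)).
  by rewrite smoothing_pderivs//; apply: smoothing_bound => //; exact: wsmooth_pderivs.
have E0 : 0 <= C4 ^+ size r * B by rewrite mulr_ge0 ?exprn_ge0.
have h := @avg_near _ j [::] _ wS E0 fB' x.
rewrite -(subrK (smoothing r f x) (avg l j _ x)) -addrA.
apply: le_trans (le_normcD _ _) _; apply: le_trans (lerD h (IH x)) _.
rewrite -mulrDl ler_wpM2r ?(ltW (eta0 x))//.
have -> : C3 / l * (C4 ^+ size r * B) + (size r)%:R * C3 * C4 ^+ size r / l * B =
    (size r).+1%:R * C3 * C4 ^+ size r / l * B.
  by rewrite -[in RHS]natr1; ring.
rewrite ler_wpM2r// ler_wpM2r ?invr_ge0 ?(ltW l0)// ler_wpM2l ?mulr_ge0 ?(ltW Ce0)//.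
by rewrite exprS ler_peMl ?exprn_ge0.
Qed.

(** Sort the derivations by direction: those along an axis are absorbed by the mean
    along it, and [M_p M_q <= M_{p+q}]. *)
Lemma smoothing_gain r : exists2 C : R, 0 <= C & forall f s B, wsmooth f -> 0 <= B ->
  wbound B f -> {subset s <= r} ->
  wbound (C * (M (size s))%:num * B) (pderivs s (smoothing r f)).
Proof.
have [C1 C10 hC1] := avg_gain.
elim: r => [|j r [C C_ge0 IH]].
  exists 1 => // f [|i s] B wf B0 fB sr; first by rewrite M0 !mul1r.
  by have := sr i (mem_head _ _).
exists (C1 * C); first exact: mulr_ge0.
move=> f s B wf B0 fB sr; pose n := count_mem j s; pose s' := [seq i <- s | i != j].
have ss : perm_eq s (nseq n j ++ s').
  have -> : nseq n j = [seq i <- s | i == j].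
    by rewrite /n -size_filter; apply/esym/all_pred1P; exact: filter_all.
  by rewrite perm_sym; exact/permPl/perm_filterC.
have wS := smoothing_wsmooth r wf.
rewrite (pderivs_perm (smoothing_wsmooth (j :: r) wf).1 ss) pderivs_cat /=.
rewrite -/(smoothing r f) avg_pderivs//.
have s'r : {subset s' <= r}.
  by move=> i; rewrite mem_filter => /andP[ij /sr]; rewrite inE (negbTE ij).
have h := IH f s' B wf B0 fB s'r.
have E0 : 0 <= C * (M (size s'))%:num * B by rewrite !mulr_ge0.
apply: (wbound_le _ (hC1 _ j n _ (wsmooth_pderivs s' wS) E0 h)).
have -> : C1 * (M n)%:num * (C * (M (size s'))%:num * B) =
  C1 * C * B * ((M n)%:num * (M (size s'))%:num) by ring.
rewrite [leRHS]mulrAC ler_wpM2l ?mulr_ge0// (perm_size ss) size_cat size_nseq.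
exact: MM.
Qed.

Lemma smoothing_vanishing r f B : wsmooth f -> 0 <= B -> wbound B f -> vanishing f ->
  vanishing (smoothing r f).
Proof.
move=> wf B0 fB vf; elim: r => //= j r IH.
have E0 : 0 <= C4 ^+ size r * B by rewrite mulr_ge0 ?exprn_ge0.
exact: (@avg_vanishing j _ _ ((smoothing_wsmooth r wf).1.1 [::]) E0
  (smoothing_bound r wf B0 fB) IH).
Qed.
End averages.

(** * Sequences of factors *)

Section factor_sequences.
Variables (R : realType) (M : nat -> {posnum R}).
Implicit Types (r : nat -> {posnum R}) (w : nat -> R).

Definition rprod r p : R := \prod_(1 <= j < p.+1) (r j)%:num.

Lemma rprod0 r : rprod r 0 = 1.
Proof. by rewrite /rprod big_nil. Qed.

Lemma rprodS r p : rprod r p.+1 = rprod r p * (r p.+1)%:num.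
Proof. by rewrite /rprod big_nat_recr. Qed.

Lemma rprod_gt0 r p : 0 < rprod r p.
Proof. by elim: p => [|p IH]; rewrite ?rprod0// rprodS mulr_gt0. Qed.

Lemma frakR_intro r : (forall p, (0 < p)%N -> (r p)%:num <= (r p.+1)%:num) ->
  (forall a : R, exists N, forall n, (N <= n)%N -> a <= (r n)%:num) -> frakR r.
Proof.
move=> rS rN; split => //; apply/cvgryPge => a; have [N hN] := rN a.
by exists N => // n /=; exact: hN.
Qed.

Lemma frakR_large r (a : R) : frakR r -> exists N, forall n, (N <= n)%N -> a <= (r n)%:num.
Proof. by move=> [_ /cvgryPge /(_ a)] [N _ hN]; exists N => n Nn; exact: hN. Qed.

Lemma frakR_geometric r (a : R) : frakR r -> 0 < a ->
  exists2 C : R, 0 < C & forall p, a ^+ p <= C * rprod r p.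
Proof.
move=> hr a0; have [N hN] := frakR_large a hr.
pose C : R := \sum_(q < N.+1) a ^+ q / rprod r q.
have t0 q : 0 <= a ^+ q / rprod r q.
  by rewrite divr_ge0 ?exprn_ge0 ?(ltW a0)// ltW// rprod_gt0.
have C_le q : (q <= N)%N -> a ^+ q <= C * rprod r q.
  move=> qN; rewrite -ler_pdivrMr ?rprod_gt0// /C (bigD1 (inord q))//= inordK//.
  by rewrite lerDl sumr_ge0.
exists C.
  apply: (@lt_le_trans _ _ 1) => //; have := C_le 0%N (leq0n _).
  by rewrite expr0 rprod0 mulr1.
elim=> [|p IH]; first exact: C_le.
have [pN|Np] := leqP p.+1 N; first exact: C_le.
rewrite exprSr rprodS mulrA; apply: ler_pM => //.
- by rewrite exprn_ge0// ltW.
- exact: ltW.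
- by apply: hN; exact: ltnW.
Qed.

(** Divergence can be made as slow as desired: [r] takes the value [2^n] up to the
    index [N n]. *)
Lemma frakR_slow (N : nat -> nat) : exists2 r : nat -> {posnum R}, frakR r &
  (forall n j, (j <= N n)%N -> (r j)%:num <= 2 ^+ n).
Proof.
pose N' n := (n + \sum_(i < n.+1) N i)%N.
have N'mono n k : (n <= k)%N -> (N' n <= N' k)%N.
  move=> nk; rewrite leq_add//.
  rewrite -!(big_mkord xpredT N) (@big_cat_nat _ _ _ n.+1 0 k.+1)//=.
  exact: leq_addr.
have ex j : exists n, (j <= N' n)%N by exists j; exact: leq_addr.
pose e j := ex_minn (ex j).
have e_le n j : (j <= N' n)%N -> (e j <= n)%N.
  by move=> h; rewrite /e; case: ex_minnP => k _; apply.
have e_ge j : (j <= N' (e j))%N by rewrite /e; case: ex_minnP.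
have p0 j : 0 < (2 : R) ^+ e j by exact: exprn_gt0.
exists (fun j => PosNum (p0 j)).
  apply: frakR_intro => [p _ /=|a].
    by rewrite ler_eXn2l ?ltr1n// e_le// (leq_trans (leqnSn p)).
  exists (N' (Num.bound `|a|)).+1 => n Nn /=.
  apply: (@le_trans _ _ (Num.bound `|a|)%:R).
    apply: le_trans (ler_norm a) _; apply: ltW; exact: archi_boundP.
  apply: (@le_trans _ _ (e n)%:R); last first.
    by rewrite -natrX ler_nat ltnW// ltn_expl.
  rewrite ler_nat leqNgt; apply/negP => en.
  by have := leq_trans (e_ge n) (N'mono _ _ (ltnW en)); rewrite leqNgt Nn.
move=> n j jN /=; rewrite ler_eXn2l ?ltr1n// e_le//.
rewrite (leq_trans jN)// /N' big_ord_recr /= addnA leq_addl//.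
Qed.

Lemma rprod_slow r n k : (forall j, (j <= k)%N -> (r j)%:num <= 2 ^+ n) ->
  rprod r k <= 2 ^+ n ^+ k.
Proof.
elim: k => [|k IH] h; first by rewrite rprod0.
rewrite rprodS exprSr; apply: ler_pM => //; first exact: ltW (rprod_gt0 _ _).
- by apply: IH => j jk; apply: h; exact: leq_trans jk _.
- exact: h.
Qed.

(** Komatsu's lemma.  If the quotients by [M_p] exceeded every geometric growth, they
    would exceed [R_p] along a subsequence as soon as [R] rises slowly enough. *)
Lemma komatsu_growth (a : nat -> R) :
  (forall r, frakR r -> exists C : R, forall p, a p <= C * ((M p)%:num * rprod r p)) ->
  exists m C : R, [/\ 0 < m, 0 <= C & forall p, m ^+ p * a p <= C * (M p)%:num].
Proof.
move=> ha; apply/not_existsP => nh.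
have bad n : exists p, n%:R * 2 ^+ n ^+ p * (M p)%:num < a p.
  apply/not_existsP => np; apply: (nh (2 ^- n)); exists n%:R; split => //.
  move=> p; rewrite exprVn ler_pdivrMl ?exprn_gt0//.
  by rewrite mulrA leNgt; apply/negP; rewrite (mulrC _ n%:R); exact: np.
have [N hN] := choice bad; have [r hr r_le] := frakR_slow N.
have [C hC] := ha r hr; have [n Cn] : exists n : nat, C <= n%:R.
  by exists (Num.bound `|C|); rewrite (le_trans (ler_norm C))// ltW// archi_boundP.
have := le_lt_trans (hC (N n)) _; have := lt_le_trans (hN n) (hC (N n)).
rewrite ltNge => /negP + _; apply.
have h : rprod r (N n) <= 2 ^+ n ^+ (N n) by apply: rprod_slow; exact: r_le.
apply: (@le_trans _ _ (n%:R * ((M (N n))%:num * rprod r (N n)))).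
  by rewrite ler_wpM2r// mulr_ge0// ltW// rprod_gt0.
by rewrite -mulrA ler_wpM2l// mulrC ler_wpM2r.
Qed.

Lemma roumieuP w : factors Roumieu M w <->
  exists2 r, frakR r & w = fun p => ((M p)%:num * rprod r p)^-1.
Proof. by split=> [[r [hr ->]]|[r hr ->]]; exists r. Qed.

Lemma weight_M2 c0 H p : cond_M2 c0 H M -> (M 1)%:num = 1 -> 0 <= c0 -> 0 <= H ->
  (M p.+1)%:num <= c0 * H ^+ p.+1 * (M p)%:num.
Proof.
move=> h M1 c0_ge0 H_ge0; apply: le_trans (h p.+1) _.
rewrite ler_wpM2l ?mulr_ge0 ?exprn_ge0//.
have i : (1 < p.+2)%N by [].
have := bigmin_le_cond ((M p.+1)%:num * (M 0)%:num) (P := xpredT)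
  (fun q : 'I_p.+2 => (M (p.+1 - q)%N)%:num * (M q)%:num) (j := Ordinal i) isT.
by rewrite /= subSS subn0 M1 mulr1.
Qed.

(** By (M.2) a shift of the order costs a geometric factor, which is absorbed by
    rescaling and, in the Roumieu case, delaying the sequence [r]. *)
Lemma factors_shift c w (a : R) : (M 1)%:num = 1 ->
  (exists c0 H : R, [/\ 1 <= c0, 1 <= H & cond_M2 c0 H M]) ->
  factors c M w -> 1 <= a ->
  exists2 w', factors c M w' & exists2 C : R, 0 <= C &
    forall p, a ^+ p * w p <= w' p /\ a ^+ p * w p <= C * w' p.+1.
Proof.
move=> M1 [c0 [H [c01 H1 hM2]]] + a1; have a0 : 0 < a := lt_le_trans ltr01 a1.
have c00 : 0 < c0 := lt_le_trans ltr01 c01; have H0 : 0 < H := lt_le_trans ltr01 H1.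
have hM p : (M p)%:num^-1 <= c0 * H ^+ p.+1 / (M p.+1)%:num.
  rewrite ler_pdivlMr// mulrC ler_pdivrMr//.
  exact: weight_M2 hM2 M1 (ltW c00) (ltW H0).
have aH : 0 < a * H by exact: mulr_gt0.
case: c => [[r [r0 ->]]|/roumieuP[r hr ->]].
  exists (fun p => (a * H * r) ^+ p / (M p)%:num).
    by exists (a * H * r); split => //; exact: mulr_gt0.
  exists (c0 / (a * r)); first by rewrite divr_ge0 ?mulr_ge0// ltW.
  move=> p; have ar0 : 0 <= a ^+ p * r ^+ p by rewrite mulr_ge0 ?exprn_ge0// ltW.
  rewrite mulrA; split.
    rewrite ler_wpM2r ?invr_ge0// !exprMn [leRHS]mulrAC ler_peMr//.
    by rewrite exprn_ege1.
  apply: le_trans (ler_wpM2l ar0 (hM p)) _.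
  rewrite le_eqVlt; apply/orP; left; apply/eqP.
  rewrite !exprMn !exprS; field; apply/and3P; split; rewrite ?gt_eqF//.
pose r' j := PosNum (divr_gt0 [gt0 of (r (maxn 1 j.-1))%:num] aH).
have r1 j : (0 < j)%N -> (r 1%N)%:num <= (r j)%:num.
  case: j => // j _; elim: j => // j IH; apply: le_trans IH _; exact: hr.1.
have r'S p : rprod r' p.+1 = (a * H) ^- p.+1 * ((r 1%N)%:num * rprod r p).
  elim: p => [|p IH].
    by rewrite rprodS !rprod0 /= expr1 mul1r mulr1 mulrC.
  rewrite rprodS IH [rprod r p.+1]rprodS /= (_ : maxn 1 p.+1 = p.+1); last by lia.
  rewrite [in RHS]exprSr [in RHS](invfM ((a * H) ^+ p.+1)).
  by move: (_ ^+ _)^-1 (_ * _)^-1 => u v; ring.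
exists (fun p => ((M p)%:num * rprod r' p)^-1).
  apply/roumieuP; exists r' => //; apply: frakR_intro => [[//|[|p]] _|b] /=.
  - by [].
  - have E k : maxn 1 k.+1 = k.+1 by lia.
    by rewrite !E ler_wpM2r ?invr_ge0 ?(ltW aH)//; exact: hr.1.
  - have [N hN] := frakR_large (b * (a * H)) hr; exists N.+2 => n Nn.
    by rewrite ler_pdivlMr// hN// leq_max; lia.
exists (c0 * (r 1%N)%:num / a); first by rewrite divr_ge0 ?mulr_ge0// ltW.
move=> p; have Rp := rprod_gt0 r p; have R'p := rprod_gt0 r' p.
have ap : 0 < a ^+ p by exact: exprn_gt0.
split.
  rewrite invfM [leRHS]invfM mulrCA ler_wpM2l ?invr_ge0//.
  rewrite -[a ^+ p]invrK -invfM lef_pV2 ?posrE ?mulr_gt0 ?invr_gt0//.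
  apply: (@le_trans _ _ ((a * H) ^- p * rprod r p)).
    case: p {Rp R'p ap} => [|p]; first by rewrite !rprod0 expr0 invr1 mul1r.
    rewrite r'S ler_wpM2l ?invr_ge0 ?exprn_ge0 ?(ltW aH)// rprodS mulrC.
    by rewrite ler_wpM2l ?(ltW (rprod_gt0 _ _))// r1.
  rewrite ler_wpM2r ?(ltW Rp)// lef_pV2 ?posrE ?exprn_gt0//.
  by rewrite exprMn ler_peMr ?(ltW ap)// exprn_ege1.
rewrite r'S !invfM mulrCA.
apply: le_trans (ler_wpM2r _ (hM p)) _; first by rewrite mulr_ge0 ?invr_ge0 ?ltW.
rewrite le_eqVlt; apply/orP; left; apply/eqP.
rewrite invrK !exprMn !exprS; field.
by rewrite !gt_eqF.
Qed.

End factor_sequences.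

(** * The scalar space *)

Section bdot_elements.
Variables (R : realType) (d : nat) (M : nat -> {posnum R}) (eta : cweight R d).
Notation fn := ('rV[R]_d -> R[i]^o).
Let eta0 x : 0 < eta x := cweight_gt0 eta x.

Lemma C_eta_vanishing (f : fn) : C_eta eta f -> vanishing eta f.
Proof.
move=> [_ hf] e e0; have [rho hrho] := hf e e0; exists rho => x k xk.
rewrite -ler_pdivrMr//; apply/ltW/hrho.
exact: lt_le_trans xk (coord_le_enorm x k).
Qed.

Lemma vanishing_C_eta (f : fn) : continuous f -> vanishing eta f -> C_eta eta f.
Proof.
move=> cf vf; split => // e e0.
have e20 : 0 < e / 2 by rewrite divr_gt0.
have [rho hrho] := vf _ e20; pose r := Num.max 0 rho.
exists (d%:R * r) => x hx.
have [k xk] : exists k, r < `|x 0 k|.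
  apply/not_existsP => nx; move: hx; rewrite ltNge => /negP; apply.
  apply: enorm_le => [|k]; first by rewrite /r le_max lexx.
  by rewrite leNgt; apply/negP; exact: nx.
apply: (@le_lt_trans _ _ (e / 2)).
  rewrite ler_pdivrMr//; apply: (hrho x k); apply: le_lt_trans xk.
  by rewrite /r le_max lexx orbT.
by rewrite ltr_pdivrMr// ltr_pMr// ltr1n.
Qed.

Lemma normc_mderiv (f : fn) alpha x :
  normc (mderiv alpha f x) = normc (pderivs (mseq alpha) f x).
Proof. exact: (seminorm_mderiv f alpha x (normc_cts_seminorm R).1). Qed.

Lemma C_eta_mderiv (f : fn) alpha :
  C_eta eta (mderiv alpha f) -> vanishing eta (pderivs (mseq alpha) f).
Proof.
move=> /C_eta_vanishing vf e e0; have [rho hrho] := vf e e0; exists rho => x k xk.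
by rewrite -normc_mderiv; exact: hrho xk.
Qed.

Lemma step_bound (m : R) (f : fn) s x : 0 < m -> step M eta m f ->
  m ^+ size s * normc (pderivs s f x) <=
  step_norm M eta m f * (M (size s))%:num * eta x.
Proof.
move=> m0 [sf cf ub].
have [alpha <- ->] := mderiv_pderivs s x sf (normc_cts_seminorm R).1.
have h1 : normc (mderiv alpha f x) <= wnorm eta (mderiv alpha f) * eta x.
  rewrite -ler_pdivrMr//; apply: ub_le_sup; last by exists x.
  exact: C_eta_ubound (cf alpha).
have h2 : m ^+ mdeg alpha * wnorm eta (mderiv alpha f) <=
    step_norm M eta m f * (M (mdeg alpha))%:num.
  rewrite -ler_pdivrMr//; apply: ub_le_sup; last by exists alpha.
  exact: ub.
have mk : 0 <= m ^+ mdeg alpha by rewrite exprn_ge0// ltW.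
apply: le_trans (ler_wpM2l mk h1) _.
by rewrite mulrA ler_wpM2r ?(ltW (eta0 x)).
Qed.

Lemma step_norm_ge0 (m : R) (f : fn) : 0 < m -> step M eta m f -> 0 <= step_norm M eta m f.
Proof.
move=> m0 hf; have := step_bound [::] 0 m0 hf; rewrite expr0 mul1r => h.
have := le_trans (normc_ge0 _) h.
by rewrite pmulr_lge0// pmulr_lge0.
Qed.

Lemma step_intro (m B : R) (f : fn) : 0 < m -> smooth f ->
  (forall s, vanishing eta (pderivs s f)) ->
  (forall s x, m ^+ size s * normc (pderivs s f x) <= B * (M (size s))%:num * eta x) ->
  step M eta m f /\ step_norm M eta m f <= B.
Proof.
move=> m0 sf vf hB.
have cf alpha : C_eta eta (mderiv alpha f).
  apply: vanishing_C_eta => [x|e e0].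
    exact: (@cvgZr _ R[i]^o _ (nbhs x) _ _ _ _ (sf.1 (mseq alpha) x)).
  have [rho hrho] := vf (mseq alpha) e e0; exists rho => x k xk.
  by rewrite normc_mderiv; exact: hrho xk.
have le alpha :
    m ^+ mdeg alpha * wnorm eta (mderiv alpha f) / (M (mdeg alpha))%:num <= B.
  have mk : 0 < m ^+ mdeg alpha by rewrite exprn_gt0.
  rewrite ler_pdivrMr// -ler_pdivlMl//; apply: ge_sup.
    by exists (normc (mderiv alpha f 0) / eta 0), 0.
  move=> _ [x _ <-]; rewrite ler_pdivrMr// -mulrA ler_pdivlMl//.
  by rewrite normc_mderiv -size_mseq; exact: hB.
split; first by split => //; exists B => _ [alpha _ <-]; exact: le.
apply: ge_sup; last by move=> _ [alpha _ <-]; exact: le.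
pose z : 'I_d -> nat := fun=> 0%N.
by exists (m ^+ mdeg z * wnorm eta (mderiv z f) / (M (mdeg z))%:num), z.
Qed.

Lemma step_vanishing (m : R) (f : fn) s : step M eta m f -> vanishing eta (pderivs s f).
Proof.
move=> [sf cf _] e e0.
rewrite -(pderivs_perm sf (perm_mseq s)); exact: (C_eta_mderiv (cf _) e0).
Qed.

Lemma step_wsmooth (m : R) (f : fn) : 0 < m -> step M eta m f -> wsmooth eta f.
Proof.
move=> m0 hf; split=> [|s]; first by case: hf.
exists (step_norm M eta m f * (M (size s))%:num / m ^+ size s).
  by rewrite !mulr_ge0 ?invr_ge0 ?exprn_ge0 ?(ltW m0)// step_norm_ge0.
move=> x; rewrite mulrAC ler_pdivlMr ?exprn_gt0// mulrC.
exact: step_bound.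
Qed.

Variable c : um_class.

Lemma bdot_step (f : bdot_carrier M eta c) :
  exists2 m : R, 0 < m & step M eta m (subval f).
Proof.
have := subvalP f; rewrite /is_bdot; case: c f => f => [h|[m [m0 h]]].
  by exists 1 => //; exact: h.
by exists m.
Qed.

Lemma bdot_wsmooth (f : bdot_carrier M eta c) : wsmooth eta (subval f).
Proof. by have [m m0 /(step_wsmooth m0)] := bdot_step f. Qed.

Lemma bdot_smooth (f : bdot_carrier M eta c) : smooth (subval f).
Proof. exact: (bdot_wsmooth f).1. Qed.

Lemma bdot_vanishing (f : bdot_carrier M eta c) s : vanishing eta (pderivs s (subval f)).
Proof. by have [m m0 /(@step_vanishing _ _ s)] := bdot_step f. Qed.

(** The bounds are stated without suprema, and over words of directions instead of
    multi-indices. *)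
Definition dominated (w : nat -> R) (B : R) (f : fn) : Prop :=
  forall s x, w (size s) * normc (pderivs s f x) <= B * eta x.

Lemma pderivs_subD s (f g : bdot_carrier M eta c) x :
  pderivs s (subval (f + g)) x = pderivs s (subval f) x + pderivs s (subval g) x.
Proof.
have := pderivs_lin 1 s (bdot_smooth f) (bdot_smooth g); rewrite !scale1r => h.
by rewrite subvalD h fctE.
Qed.

Lemma pderivs0 s (x : 'rV[R]_d) : pderivs s (0 : fn) x = 0.
Proof.
have := pderivs_lin (-1) s (@smooth0 R d R[i]^o) (@smooth0 R d R[i]^o).
by rewrite scaler0 addr0 scaleN1r addNr => ->.
Qed.

Lemma pderivs_subZ s a (f : bdot_carrier M eta c) x :
  pderivs s (subval (a *: f)) x = a * pderivs s (subval f) x.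
Proof.
have := pderivs_lin a s (bdot_smooth f) (@smooth0 R d R[i]^o); rewrite addr0 => h.
by rewrite subvalZ h -[LHS]/(a * _ + _) pderivs0 addr0.
Qed.

Lemma dominated_le w (B B' : R) f : B <= B' -> dominated w B f -> dominated w B' f.
Proof. by move=> BB h s x; apply: le_trans (h s x) _; rewrite ler_wpM2r// ltW. Qed.

End bdot_elements.

Section factor_seminorms.
Variables (R : realType) (d : nat) (M : nat -> {posnum R}) (eta : cweight R d).
Let eta0 x : 0 < eta x := cweight_gt0 eta x.

(** [R_p] outgrows every geometric sequence. *)
Lemma roumieu_dominated r (m : R) : frakR r -> 0 < m -> exists2 C : R, 0 <= C &
  forall f, step M eta m f ->
  dominated eta (fun p => ((M p)%:num * rprod r p)^-1) (C * step_norm M eta m f) f.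
Proof.
move=> hr m0; have mV : 0 < m^-1 by rewrite invr_gt0.
have [C C0 hC] := frakR_geometric hr mV.
exists C; first exact: ltW.
move=> f hf s x; set k := size s; have := step_bound s x m0 hf; rewrite -/k => h.
have Rk := rprod_gt0 r k; have mk : 0 < m ^+ k by rewrite exprn_gt0.
rewrite ler_pdivrMl ?mulr_gt0//.
have h1 : normc (pderivs s f x) <= m ^- k * (step_norm M eta m f * (M k)%:num * eta x).
  by rewrite ler_pdivlMl.
apply: le_trans h1 _.
have := hC k; rewrite exprVn => h2.
have S0 : 0 <= step_norm M eta m f * (M k)%:num * eta x.
  by rewrite !mulr_ge0 ?step_norm_ge0// ltW.
apply: le_trans (ler_wpM2r S0 h2) _.
by rewrite le_eqVlt; apply/orP; left; apply/eqP; ring.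
Qed.

Lemma bdot_factor_seminorm c w : factors c M w -> exists2 p,
  @bdot_seminorms R d M eta c p &
  forall f : bdot_carrier M eta c, dominated eta w (p f) (subval f).
Proof.
case: c => [[r [r0 ->]]|/roumieuP[r hr {w}->]].
  exists (fun f => step_norm M eta r (subval f)); first by exists r.
  move=> f s x; have := step_bound s x r0 (subvalP f r r0) => h.
  by rewrite mulrAC ler_pdivrMr// mulrAC.
pose w p : R := ((M p)%:num * rprod r p)^-1; rewrite -/w.
have w0 k : 0 <= w k by rewrite invr_ge0 mulr_ge0// ltW// rprod_gt0.
pose N (z : seq 'I_d * 'rV[R]_d) (f : bdot_carrier M eta Roumieu) :=
  w (size z.1) * normc (pderivs z.1 (subval f) z.2) / eta z.2.
have ub (f : bdot_carrier M eta Roumieu) m : 0 < m -> step M eta m (subval f) ->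
    exists2 C, 0 <= C & forall z, N z f <= C * step_norm M eta m (subval f).
  move=> m0 hf; have [C C0 hC] := roumieu_dominated hr m0.
  by exists C => // z; rewrite ler_pdivrMr//; exact: hC.
have hub (f : bdot_carrier M eta Roumieu) : has_ubound [set N z f | z in setT].
  have [m m0 hf] := bdot_step f; have [C C0 hC] := ub f m m0 hf.
  by exists (C * step_norm M eta m (subval f)) => _ [z _ <-].
exists (fun f => sup [set N z f | z in setT]).
  split.
    apply: seminorm_sup => // z _.
    apply: seminorm_scale => //; first exact: ltW.
    split=> [f g|a f]; first by rewrite pderivs_subD le_normcD.
    by rewrite pderivs_subZ ComplexField.Normc.normcM.
  move=> m m0; have [C C0 hC] := roumieu_dominated hr m0; exists C => f hf.
  apply: ge_sup; first by exists (N ([::], 0) f), ([::], 0).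
  by move=> _ [z _ <-]; rewrite ler_pdivrMr//; exact: hC.
move=> f s x; rewrite -ler_pdivrMr//; apply: ub_le_sup; first exact: hub.
by exists (s, x).
Qed.

End factor_seminorms.

(** * The projective description *)

Section smoothing_operators.
Variables (R : realType) (d : nat) (M A : nat -> {posnum R}) (eta : cweight R d).
Notation fn := ('rV[R]_d -> R[i]^o).
Hypothesis M0 : (M 0)%:num = 1.
Hypothesis M1 : (M 1)%:num = 1.
Hypothesis logconvex : cond_M1 M.
Hypothesis hM5 : cond_M5 M.
Hypothesis hA : cond_M6 A.
Hypothesis hdag : class_dagger Roumieu A eta.

(** The means along all the axes: an approximate identity, as [l] goes to infinity,
    which turns bounded functions into ultradifferentiable ones. *)
Lemma smoothing_operators : exists (S : R -> fn -> fn) (D : R), 0 <= D /\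
  forall l : R, 1 <= l -> [/\
    forall f, wsmooth eta f -> wsmooth eta (S l f) /\
      forall s, pderivs s (S l f) = S l (pderivs s f),
    forall f B, wsmooth eta f -> 0 <= B -> wbound eta B f -> vanishing eta f ->
      vanishing eta (S l f),
    forall f B, wsmooth eta f -> 0 <= B ->
      (forall j, wbound eta B (pderivs [:: j] f)) ->
      wbound eta (D / l * B) (fun x => S l f x - f x) &
    exists2 C : R, 0 <= C & forall f s B, wsmooth eta f -> 0 <= B -> wbound eta B f ->
      wbound eta (C * (M (size s))%:num * B) (pderivs s (S l f))].
Proof.
have [k [c [k0 c0 hk]]] := weight_factorial M0 M1 logconvex hM5.
have k20 : (0 < k.*2)%N by rewrite double_gt0.
have [L [L_lin [C0' L_bound'] L_one L_gain]] := smoothing_functional M0 k20 c0 hk.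
pose C0 := Num.max 0 C0'.
have C00 : 0 <= C0 by rewrite le_max lexx.
have L_bound B g : 0 <= B -> tame B g -> `|L g| <= C0 * B.
  by move=> B0 /(L_bound' _ _ B0) /le_trans; apply; rewrite ler_wpM2r// le_max lexx orbT.
have k128 : 0 < (128 : R)^-1 by rewrite invr_gt0.
have [Ce [Ce0 eta_exp']] := dagger_roumieu hA hdag k128.
have eta_exp x h : eta (x + h) <= Ce * eta x * expR (enorm h / 128).
  by rewrite (mulrC (enorm h)).
have [Cb [Cb0 eta_box]] := weight_box hA hdag.
have MM := weight_mul M0 M1 logconvex.
pose r := enum 'I_d.
pose C3 := 2 * C0 * (128 * Ce); pose C4 := Num.max 1 (2 * C0 * Ce).
exists (fun l => smoothing L l r), ((size r)%:R * C3 * C4 ^+ size r); split.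
  by rewrite !mulr_ge0 ?exprn_ge0 ?(ltW Ce0)// le_max ler01.
move=> l l1; split.
- move=> f wf; split.
    exact: (smoothing_wsmooth L_lin C00 L_bound L_one Ce0 eta_exp Cb0 eta_box l1).
  move=> s.
  exact: (smoothing_pderivs L_lin C00 L_bound L_one Ce0 eta_exp Cb0 eta_box l1).
- move=> f B wf B0 fB vf.
  exact: (smoothing_vanishing L_lin C00 L_bound L_one Ce0 eta_exp Cb0 eta_box l1 r wf B0 fB vf).
- move=> f B wf B0 fB.
  exact: (smoothing_near L_lin C00 L_bound L_one Ce0 eta_exp Cb0 eta_box l1 r wf B0 fB).
- have [C C_ge0 hC] := smoothing_gain L_lin C00 L_bound L_one L_gain Ce0 eta_exp Cb0
    eta_box l1 M0 MM r.
  exists C => // f s B wf B0 fB; apply: hC => // i _.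
  exact: mem_enum.
Qed.

End smoothing_operators.

Section projective_description.
Variables (R : realType) (d : nat) (M A : nat -> {posnum R}) (eta : cweight R d).
Notation fn := ('rV[R]_d -> R[i]^o).
Let eta0 x : 0 < eta x := cweight_gt0 eta x.
Hypothesis M0 : (M 0)%:num = 1.
Hypothesis M1 : (M 1)%:num = 1.
Hypothesis logconvex : cond_M1 M.
Hypothesis hM2 : exists c0 H : R, [/\ 1 <= c0, 1 <= H & cond_M2 c0 H M].
Hypothesis hM5 : cond_M5 M.
Hypothesis hA : cond_M6 A.

Section roumieu.
Hypothesis hdag : class_dagger Roumieu A eta.
Notation E := (bdot_carrier M eta Roumieu).

Lemma pderivs_subB s (f g : E) x :
  pderivs s (subval (f - g)) x = pderivs s (subval f) x - pderivs s (subval g) x.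
Proof. by rewrite pderivs_subD -scaleN1r pderivs_subZ mulN1r. Qed.

Lemma dominated_wbound (f : E) r B : dominated eta (fun p => ((M p)%:num * rprod r p)^-1) B
  (subval f) -> forall s, wbound eta (B * ((M (size s))%:num * rprod r (size s)))
     (pderivs s (subval f)).
Proof.
move=> h s x; have := h s x; rewrite ler_pdivrMl ?mulr_gt0 ?rprod_gt0//.
by rewrite mulrCA mulrA.
Qed.

(** A continuous seminorm is evaluated on the telescoping series of the smoothings
    [S_n f].  A term of it is small in a step chosen in advance: for the low orders
    because [S_n] is close to the identity, for the high orders because smoothing
    makes the derivatives grow as [M_p] only.  The threshold between the two may be
    taken so large that the factors [r_j] have hardly begun to grow at the orders
    where the derivatives of [f] itself are used. *)
Lemma projective_description_roumieu (p : E -> R) : seminorm p ->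
  (forall m : R, 0 < m -> exists C : R, forall f : E,
     step M eta m (subval f) -> p f <= C * step_norm M eta m (subval f)) ->
  exists2 w, factors Roumieu M w & exists2 C : R, 0 <= C & forall (f : E) B, 0 <= B ->
    dominated eta w B (subval f) -> p f <= C * B.
Proof.
move=> sp hp.
have [c0 [H [c01 H1 cM2]]] := hM2.
have c00 : 0 < c0 := lt_le_trans ltr01 c01; have H0 : 0 < H := lt_le_trans ltr01 H1.
have MS k : (M k.+1)%:num <= c0 * H ^+ k.+1 * (M k)%:num.
  exact: weight_M2 cM2 M1 (ltW c00) (ltW H0).
have [S [D [D0 hS]]] := smoothing_operators M0 M1 logconvex hM5 hA hdag.
have {hp}hp m : 0 < m -> exists2 C : R, 0 <= C & forall (f : E) B, 0 <= B ->
    (forall s x, m ^+ size s * normc (pderivs s (subval f) x) <=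
       B * (M (size s))%:num * eta x) -> p f <= C * B.
  move=> m0; have [C hC] := hp m m0; exists (Num.max 0 C); first by rewrite le_max lexx.
  move=> f B B0 hB.
  have [st nB] := step_intro m0 (bdot_smooth f) (bdot_vanishing f) hB.
  apply: le_trans (hC f st) _; apply: (@le_trans _ _ (Num.max 0 C * step_norm M eta m (subval f))).
    by rewrite ler_wpM2r ?step_norm_ge0// le_max lexx orbT.
  by rewrite ler_wpM2l// le_max lexx.
(* [H] cancels the shift of the order by the estimate for [S_n], [2 ^ n] the factors
   [r_j], and the remaining [2 ^- k] makes the high orders small. *)
pose m n : R := (H * 2 ^+ n.+1)^-1.
have m0 n : 0 < m n by rewrite invr_gt0 mulr_gt0// exprn_gt0.
have [cm cm0 hcm] : exists2 cm : nat -> R, (forall n, 0 <= cm n) & forall n (f : E) B,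
    0 <= B -> (forall s x, m n ^+ size s * normc (pderivs s (subval f) x) <=
       B * (M (size s))%:num * eta x) -> p f <= cm n * B.
  have [cm hcm] := choice (fun n => let: ex_intro2 C C_ge0 hC := hp (m n) (m0 n) in
    ex_intro (fun C : R => 0 <= C /\ forall (f : E) B,
    0 <= B -> (forall s x, m n ^+ size s * normc (pderivs s (subval f) x) <=
       B * (M (size s))%:num * eta x) -> p f <= C * B) C (conj C_ge0 hC)).
  by exists cm => n; [case: (hcm n)|exact: (hcm n).2].
(* The scales depend on the constants of the steps, and make the low orders summable. *)
pose K n : R := 2 * D * c0 * H * 2 ^+ n.
have K0 n : 0 <= K n by rewrite !mulr_ge0 ?exprn_ge0 ?(ltW c00) ?(ltW H0).
pose lam n : R := \sum_(i < n.+1) (1 + cm i * K i * 2 ^+ i).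
have lt0 i : 0 <= cm i * K i * 2 ^+ i.
  by apply: mulr_ge0; [exact: mulr_ge0|exact: exprn_ge0].
have lam_n n : n.+1%:R <= lam n.
  rewrite /lam -[n.+1 in leLHS]card_ord -sum1_card natr_sum; apply: ler_sum => i _.
  by rewrite lerDl.
have lam1 n : 1 <= lam n by apply: le_trans (lam_n n); rewrite ler1n.
have lam0 n : 0 < lam n by apply: lt_le_trans (lam1 n).
have lamS n : lam n <= lam n.+1.
  by rewrite /lam [leRHS]big_ord_recr /= lerDl addr_ge0.
have lamK n : cm n * K n * 2 ^+ n <= lam n.
  rewrite /lam big_ord_recr /= addrA lerDr addr_ge0// sumr_ge0// => i _.
  by rewrite addr_ge0.
have [CL CL0 hCL] : exists2 CL : nat -> R, (forall n, 0 <= CL n) &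
    forall n f s B, wsmooth eta f -> 0 <= B -> wbound eta B f ->
    wbound eta (CL n * (M (size s))%:num * B) (pderivs s (S (lam n) f)).
  have ex n : exists C : R, 0 <= C /\ forall f s B, wsmooth eta f -> 0 <= B ->
      wbound eta B f -> wbound eta (C * (M (size s))%:num * B) (pderivs s (S (lam n) f)).
    by have [_ _ _ [C C_ge0 hC]] := hS _ (lam1 n); exists C.
  have [CL hL] := choice ex.
  by exists CL => n; [case: (hL n)|exact: (hL n).2].
(* The threshold is chosen last, knowing what the smoothings at both scales cost. *)
have exN n : exists N : nat, cm n * (CL n + CL n.+1) * 2 ^+ n <= 2 ^+ N.
  set b := cm n * _ * _; exists (Num.bound `|b|).
  apply: le_trans (ler_norm _) _; apply: le_trans (ltW (archi_boundP (normr_ge0 b))) _.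
  by rewrite -natrX ler_nat ltnW// ltn_expl.
have [N hN] := choice exN; have [r hr r_le] := frakR_slow R N.
exists (fun k => ((M k)%:num * rprod r k)^-1); first by apply/roumieuP; exists r.
have [C1 C10 hC1] := hp 1 ltr01.
have bd n (f : E) : is_bdot M eta Roumieu (S (lam n) (subval f)).
  have [h1 h2 _ _] := hS _ (lam1 n); have wf := bdot_wsmooth f.
  have [B B0 fB] := wf.2 [::].
  have [h1f h1E] := h1 _ wf.
  exists 1; split => //; apply: (proj1 (@step_intro _ _ _ _ 1 (CL n * B) _ ltr01 h1f.1 _ _)).
    move=> s; rewrite h1E; have ws := wsmooth_pderivs s wf; have [B' B'0 sB] := wf.2 s.
    exact: h2 ws B'0 sB (bdot_vanishing f s).
  move=> s x; rewrite expr1n mul1r; have := hCL n _ s _ wf B0 fB x.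
  by rewrite [CL n * _ * B]mulrAC.
pose Sf n (f : E) : E := Subspace _ (bd n f).
have SfE n (f : E) : subval (Sf n f) = S (lam n) (subval f) by [].
have Spd n (f : E) s : pderivs s (S (lam n) (subval f)) = S (lam n) (pderivs s (subval f)).
  by have [h1 _ _ _] := hS _ (lam1 n); have [_ ->] := h1 _ (bdot_wsmooth f).
have near n (f : E) s B : 0 <= B -> (forall j, wbound eta B (pderivs (j :: s) (subval f))) ->
    forall x, normc (pderivs s (subval f) x - pderivs s (subval (Sf n f)) x) <=
      D / lam n * B * eta x.
  move=> B0 hB x; have [_ _ h3 _] := hS _ (lam1 n).
  rewrite SfE Spd -normcN opprB.
  exact: (h3 _ _ (wsmooth_pderivs s (bdot_wsmooth f)) B0 hB x).
exists (C1 * CL 0%N + 4); first by rewrite addr_ge0// mulr_ge0.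
move=> f B B0 hB; have fB := dominated_wbound hB.
have fB0 : wbound eta B (subval f).
  by have := fB [::]; rewrite rprod0 mulr1 M0 mulr1.
have wf := bdot_wsmooth f.
have first : p (Sf 0%N f) <= C1 * CL 0%N * B.
  rewrite -mulrA; apply: hC1 => [|s x]; first by rewrite mulr_ge0.
  rewrite expr1n mul1r; have := hCL 0%N _ s _ wf B0 fB0 x.
  by rewrite [CL 0%N * _ * B]mulrAC.
have incr n : p (Sf n.+1 f - Sf n f) <= 2 ^- n * (2 * B).
  have CLn : 0 <= CL n + CL n.+1 by rewrite addr_ge0.
  pose tau := K n / lam n + (CL n + CL n.+1) * 2 ^- N n.
  have t1 : 0 <= K n / lam n by rewrite divr_ge0// ltW.
  have t2 : 0 <= (CL n + CL n.+1) * 2 ^- N n.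
    by apply: mulr_ge0 => //; rewrite invr_ge0 exprn_ge0.
  have tau_le : cm n * tau <= 2 ^- n * 2.
    rewrite mulrDr mulr_natr mulr2n lerD//.
      rewrite mulrA ler_pdivrMr// ler_pdivlMl ?exprn_gt0//.
      by rewrite mulrC; exact: lamK.
    by rewrite mulrA ler_pdivrMr ?exprn_gt0// ler_pdivlMl ?exprn_gt0// mulrC.
  have -> : 2 ^- n * (2 * B) = 2 ^- n * 2 * B by rewrite mulrA.
  apply: (@le_trans _ _ (cm n * (tau * B))); last by rewrite mulrA ler_wpM2r.
  have tauB : 0 <= tau * B by apply: mulr_ge0 => //; exact: addr_ge0.
  apply: hcm => // s x; set k := size s.
  have mk : m n ^+ k = H ^- k * (2 ^- n) ^+ k * 2 ^- k.
    rewrite /m exprS !exprVn !exprMn !invfM.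
    by move: (H ^+ k)^-1 ((2 ^+ n) ^+ k)^-1 (2 ^+ k)^-1 => u v w; ring.
  have mk0 : 0 <= m n ^+ k by rewrite exprn_ge0// ltW.
  rewrite pderivs_subB.
  have sep a b : 0 <= a -> 0 <= b -> normc (pderivs s (subval (Sf n.+1 f)) x -
      pderivs s (subval (Sf n f)) x) <= a ->
      m n ^+ k * a <= b * B * (M k)%:num * eta x -> b <= tau ->
      m n ^+ k * normc (pderivs s (subval (Sf n.+1 f)) x -
      pderivs s (subval (Sf n f)) x) <= tau * B * (M k)%:num * eta x.
    move=> a0 b0 h1 h2 bt; apply: le_trans (ler_wpM2l mk0 h1) _.
    apply: le_trans h2 _; rewrite ler_wpM2r ?(ltW (eta0 x))// ler_wpM2r//.
    by rewrite ler_wpM2r.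
  have [kN|Nk] := ltnP k (N n).
    (* Both smoothings are close to [f], and [r_j <= 2 ^ n] up to the order [k.+1]. *)
    have Rk : rprod r k.+1 <= 2 ^+ n ^+ k.+1.
      by apply: rprod_slow => j jk; apply: r_le; exact: leq_trans jk kN.
    pose b' := B * (c0 * H ^+ k.+1 * (M k)%:num * 2 ^+ n ^+ k.+1).
    have b'0 : 0 <= b'.
      by rewrite !mulr_ge0 ?exprn_ge0 ?(ltW c00) ?(ltW H0).
    have jb j : wbound eta b' (pderivs (j :: s) (subval f)).
      apply: (wbound_le _ (fB (j :: s))); rewrite ler_wpM2l//=.
      by apply: ler_pM (ltW (rprod_gt0 _ _)) (MS k) Rk.
    have n1 := near n f s b' b'0 jb x; have n2 := near n.+1 f s b' b'0 jb x.
    apply: (sep (2 * (D / lam n * b' * eta x)) (K n / lam n)) => //.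
    - have Dl : 0 <= D / lam n := divr_ge0 D0 (ltW (lam0 n)).
      exact: mulr_ge0 (ler0n _ 2) (mulr_ge0 (mulr_ge0 Dl b'0) (ltW (eta0 x))).
    - have -> : pderivs s (subval (Sf n.+1 f)) x - pderivs s (subval (Sf n f)) x =
          (pderivs s (subval f) x - pderivs s (subval (Sf n f)) x) -
          (pderivs s (subval f) x - pderivs s (subval (Sf n.+1 f)) x).
        by rewrite opprB [RHS]addrC addrA subrK.
      apply: le_trans (le_normcD _ _) _; rewrite normcN.
      apply: le_trans (lerD n1 n2) _; rewrite mulr_natl mulr2n lerD2l.
      rewrite ler_wpM2r ?(ltW (eta0 x))// ler_wpM2r// ler_wpM2l//.
      by rewrite lef_pV2 ?posrE.
    - have Hk : H ^+ k != 0 by rewrite expf_neq0// gt_eqF.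
      have uk : (2 ^+ n : R) ^+ k != 0 by rewrite !expf_neq0.
      have ln : lam n != 0 by rewrite gt_eqF.
      have -> : m n ^+ k * (2 * (D / lam n * b' * eta x)) =
          2 ^- k * (K n / lam n * B * (M k)%:num * eta x).
        rewrite mk /b' /K [H ^+ k.+1]exprS [(2 ^+ n) ^+ k.+1]exprS exprVn.
        move: Hk uk ln; move: (H ^+ k) ((2 ^+ n : R) ^+ k) (lam n) (2 ^- k : R) (2 ^+ n : R).
        move=> Hk uk ln k2 u Hk0 uk0 ln0; field.
        by apply/and3P; split.
      rewrite ler_piMl//; last by rewrite invf_le1 ?exprn_gt0// exprn_ege1// ler1n.
      apply: mulr_ge0; last exact: ltW.
      by do 2 (apply: mulr_ge0 => //).
    - by rewrite lerDl.
  (* The bounds for the two smoothings are separately small, by [2 ^- k <= 2 ^- N n]. *)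
  have n1 := hCL n _ s _ wf B0 fB0 x; have n2 := hCL n.+1 _ s _ wf B0 fB0 x.
  apply: (sep ((CL n + CL n.+1) * (M k)%:num * B * eta x) ((CL n + CL n.+1) * 2 ^- N n)) => //.
  - by rewrite !mulr_ge0 ?(ltW (eta0 x)).
  - apply: le_trans (le_normcD _ _) _; rewrite normcN addrC.
    by apply: le_trans (lerD n1 n2) _; rewrite -!mulrDl.
  - have -> : (CL n + CL n.+1) * 2 ^- N n * B * (M k)%:num * eta x =
      2 ^- N n * ((CL n + CL n.+1) * (M k)%:num * B * eta x) by ring.
    rewrite ler_wpM2r ?mulr_ge0 ?(ltW (eta0 x))// mk.
    apply: (@le_trans _ _ (2 ^- k)).
      rewrite ler_piMl ?invr_ge0 ?exprn_ge0//.
      apply: mulr_ile1; rewrite ?invr_ge0 ?exprn_ge0 ?invr_ge0 ?exprn_ge0 ?(ltW H0)//.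
        by rewrite invf_le1 ?exprn_gt0// exprn_ege1.
      by rewrite exprn_ile1 ?invr_ge0 ?exprn_ge0// invf_le1 ?exprn_gt0// exprn_ege1// ler1n.
    by rewrite lef_pV2 ?posrE ?exprn_gt0// ler_eXn2l ?ltr1n.
  - by rewrite lerDr.
have rem : exists2 k : R, 0 <= k & forall n, p (f - Sf n f) <= k / lam n.
  (* [f] itself lies in some step, which the shift of the order leaves for a larger one. *)
  have [m1 m10 st] := bdot_step f; pose B' := step_norm M eta m1 (subval f).
  have B'0 : 0 <= B' by exact: step_norm_ge0.
  have m20 : 0 < m1 / H by exact: divr_gt0.
  have [C2 C20 hC2] := hp _ m20.
  pose b := D * B' * c0 * H / m1.
  have b0 : 0 <= b by rewrite !mulr_ge0 ?invr_ge0 ?(ltW c00) ?(ltW H0) ?(ltW m10).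
  exists (C2 * b); first exact: mulr_ge0.
  move=> n; rewrite -mulrA; apply: hC2; first by rewrite divr_ge0// ltW.
  move=> s x; set k := size s; rewrite pderivs_subB.
  pose b' := B' * (c0 * H ^+ k.+1 * (M k)%:num) / m1 ^+ k.+1.
  have b'0 : 0 <= b'.
    by rewrite !mulr_ge0 ?invr_ge0 ?exprn_ge0 ?(ltW c00) ?(ltW H0) ?(ltW m10).
  have jb j : wbound eta b' (pderivs (j :: s) (subval f)).
    move=> y; have := step_bound (j :: s) y m10 st; rewrite /= -/k => h.
    rewrite /b' mulrAC ler_pdivlMr ?exprn_gt0// mulrC.
    by apply: le_trans h _; rewrite ler_wpM2r ?(ltW (eta0 y))// ler_wpM2l.
  have n1 := near n f s b' b'0 jb x.
  have mk0 : 0 <= (m1 / H) ^+ k by rewrite exprn_ge0// ltW.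
  apply: le_trans (ler_wpM2l mk0 n1) _.
  have Hk : H ^+ k != 0 by rewrite expf_neq0// gt_eqF.
  have mk : m1 ^+ k != 0 by rewrite expf_neq0// gt_eqF.
  have ln : lam n != 0 by rewrite gt_eqF.
  have m1n : m1 != 0 by rewrite gt_eqF.
  rewrite le_eqVlt; apply/orP; left; apply/eqP.
  rewrite /b' /b exprMn exprVn [H ^+ k.+1]exprS [m1 ^+ k.+1]exprS.
  move: Hk mk ln; move: (H ^+ k) (m1 ^+ k) (lam n) => Hk mk ln Hk0 mk1 ln0.
  by field; rewrite Hk0 mk1 ln0 m1n.
have [pD _] := sp.
have tel n : p f <= C1 * CL 0%N * B + \sum_(i < n) 2 ^- i * (2 * B) + p (f - Sf n f).
  elim: n => [|n IH].
    rewrite big_ord0 addr0; apply: le_trans (lerD first (lexx _)).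
    by rewrite -[leLHS](_ : p (Sf 0%N f + (f - Sf 0%N f)) = _) ?pD// addrC subrK.
  apply: le_trans IH _; rewrite big_ord_recr /= -!addrA !lerD2l.
  apply: le_trans (lerD (incr n) (lexx _)).
  by rewrite -[leLHS](_ : p ((Sf n.+1 f - Sf n f) + (f - Sf n.+1 f)) = _) ?pD// addrC subrKA.
have geo n : \sum_(i < n) 2 ^- i * (2 * B) <= 4 * B.
  have -> : \sum_(i < n) 2 ^- i * (2 * B) = (\sum_(i < n) 2 ^- i.+1) * (4 * B).
    rewrite mulr_suml; apply: eq_bigr => i _; rewrite exprS invfM; field.
    by rewrite expf_neq0.
  by rewrite ler_piMl ?mulr_ge0// sum_geometric_half.
have [k k0 hk] := rem; apply/ler_addgt0Pl => e e0.
pose n := Num.bound (k / e); have kn : k / e < n%:R by apply: archi_boundP; rewrite divr_ge0// ltW.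
have ke : k / lam n <= e.
  rewrite ler_pdivrMr// mulrC -ler_pdivrMr//.
  by apply: le_trans (ltW kn) (le_trans _ (lam_n n)); rewrite ler_nat.
apply: le_trans (tel n) _; rewrite [leRHS]addrC.
apply: lerD; last exact: le_trans (hk n) ke.
have -> : (C1 * CL 0%N + 4) * B = C1 * CL 0%N * B + 4 * B by rewrite mulrDl.
exact: lerD (lexx _) (geo n).
Qed.

End roumieu.

Lemma projective_description c (p : bdot_carrier M eta c -> R) : class_dagger c A eta ->
  bdot_seminorms p ->
  exists2 w, factors c M w & exists2 C : R, 0 <= C & forall (f : bdot_carrier M eta c) B,
    0 <= B -> dominated eta w B (subval f) -> p f <= C * B.
Proof.
case: c p => p hdag; last by move=> [sp hp]; exact: projective_description_roumieu.
move=> [m [m0 ->]]; exists (fun k => m ^+ k / (M k)%:num); first by exists m.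
exists 1 => // f B B0 hB; rewrite mul1r.
apply: (proj2 (step_intro m0 (bdot_smooth f) (bdot_vanishing f) _)) => s x.
by have := hB s x; rewrite mulrAC ler_pdivrMr// mulrAC.
Qed.
End projective_description.

(** * Neighborhoods and functionals of the scalar space *)

Section complex_ultralimits.
Variables (R : realType) (T : Type) (U : set_system T).
Hypothesis UU : UltraFilter U.

Lemma ultra_cvg_complex (u : T -> R[i]^o) (b : R) : (\forall t \near U, normc (u t) <= b) ->
  exists l : R[i], forall e : R, 0 < e -> \forall t \near U, normc (u t - l) < e.
Proof.
move=> ub; have PU : ProperFilter U by apply: ultra_proper.
have [x ux] : exists l : R, (fun t => complex.Re (u t)) @ U --> l.
  apply: (ultra_cvg_real UU (b := b)); apply: (@filterS _ U _ _ _ _ ub) => t.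
  exact/le_trans/normc_ge_Re.
have [y uy] : exists l : R, (fun t => complex.Im (u t)) @ U --> l.
  apply: (ultra_cvg_real UU (b := b)); apply: (@filterS _ U _ _ _ _ ub) => t.
  exact/le_trans/normc_ge_Im.
exists (Complex x y) => e e0; have e20 : 0 < e / 2 by rewrite divr_gt0.
have /cvgrPdist_lt/(_ _ e20) hx := ux; have /cvgrPdist_lt/(_ _ e20) hy := uy.
apply: (@filterS2 _ U _ _ _ _ _ hx hy) => t xt yt.
apply: le_lt_trans (normc_le_parts _) _; rewrite [ltRHS]splitr.
by move: xt yt; case: (u t) => a b' /= xt yt; rewrite ltrD// distrC.
Qed.

Lemma ultra_lim_le (u : T -> R[i]) l (b : R) :
  (forall e : R, 0 < e -> \forall t \near U, normc (u t - l) < e) ->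
  (\forall t \near U, normc (u t) <= b) -> normc l <= b.
Proof.
move=> ul ub; have PU : ProperFilter U by apply: ultra_proper.
apply/ler_addgt0Pl => e e0.
have [t [ut tb]] := filter_ex (filterI (ul e e0) ub).
rewrite -[l](subrK (u t)); apply: le_trans (le_normcD _ _) _.
by rewrite lerD// -normcN opprB ltW.
Qed.

End complex_ultralimits.

Section bdot_topology.
Variables (R : realType) (d : nat) (M : nat -> {posnum R}) (eta : cweight R d).
Variable c : um_class.
Notation E := (bdot M eta c).
Notation e_ j := (delta_mx 0 j : 'rV[R]_d).
Let eta0 x : 0 < eta x := cweight_gt0 eta x.

Lemma factors_gt0 w p : factors c M w -> 0 < w p.
Proof.
case: c => [[r [r0 ->]]|/roumieuP[r hr ->]]; first by rewrite divr_gt0// exprn_gt0.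
by rewrite invr_gt0 mulr_gt0// rprod_gt0.
Qed.

Lemma factors_ex : exists w, factors c M w.
Proof.
case: c; first by exists (fun p => 1 ^+ p / (M p)%:num), 1.
have [r hr _] := frakR_slow R (fun=> 0%N).
by exists (fun p => ((M p)%:num * rprod r p)^-1); apply/roumieuP; exists r.
Qed.

Lemma rprod_le (r r' : nat -> {posnum R}) p : (forall j, (r j)%:num <= (r' j)%:num) ->
  rprod r p <= rprod r' p.
Proof.
move=> rr; elim: p => [|p IH]; first by rewrite !rprod0.
by rewrite !rprodS; apply: ler_pM => //; exact: ltW (rprod_gt0 _ _).
Qed.

Lemma factors_directed w w' : factors c M w -> factors c M w' ->
  exists2 v, factors c M v & forall p, w p <= v p /\ w' p <= v p.
Proof.
case: c => [[r [r0 ->]] [r' [r'0 ->]]|/roumieuP[r hr ->] /roumieuP[r' hr' ->]].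
  exists (fun p => (Num.max r r') ^+ p / (M p)%:num).
    by exists (Num.max r r'); rewrite lt_max r0.
  have m0 : 0 <= Num.max r r' by rewrite le_max (ltW r0).
  by move=> p; split; rewrite ler_wpM2r ?invr_ge0// lerXn2r// ?nnegrE ?(ltW r0) ?(ltW r'0)//
    le_max lexx ?orbT.
have m0 j : 0 < Num.min (r j)%:num (r' j)%:num by rewrite lt_min !gt0.
pose s j := PosNum (m0 j).
exists (fun p => ((M p)%:num * rprod s p)^-1).
  apply/roumieuP; exists s => //; apply: frakR_intro => [p p0|a] /=.
    by rewrite le_min !ge_min (hr.1 p p0) (hr'.1 p p0) orbT.
  have [N hN] := frakR_large a hr; have [N' hN'] := frakR_large a hr'.
  exists (maxn N N') => n; rewrite geq_max => /andP[/hN h /hN' h'].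
  by rewrite le_min h h'.
move=> p; split; rewrite lef_pV2 ?posrE ?mulr_gt0 ?rprod_gt0//;
  by rewrite ler_wpM2l//; apply: rprod_le => j /=; rewrite ge_min lexx ?orbT.
Qed.

Hypothesis hPD : forall p : E -> R, bdot_seminorms p -> exists2 w, factors c M w &
  exists2 C : R, 0 <= C & forall (f : bdot_carrier M eta c) B, 0 <= B ->
    dominated eta w B (subval f) -> p f <= C * B.

Lemma dominated_mono w w' (B : R) (f : 'rV[R]_d -> R[i]^o) : (forall p, w p <= w' p) ->
  dominated eta w' B f -> dominated eta w B f.
Proof.
move=> ww h s x; apply: le_trans (h s x).
by rewrite ler_wpM2r ?normc_ge0.
Qed.

(** Here the projective description enters: finitely many seminorms are dominated by one
    sequence of factors. *)
Lemma nbhs0_bdot (U : set E) : nbhs (0 : E) U -> exists2 w, factors c M w &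
  exists2 e : R, 0 < e & forall f : bdot_carrier M eta c, dominated eta w e (subval f) -> U f.
Proof.
move=> [Q [e [finQ QP e0 sub]]].
suff [w hw [C C0 hC]] : exists2 w, factors c M w & exists2 C : R, 0 <= C &
    forall p, Q p -> forall (f : bdot_carrier M eta c) B, 0 <= B ->
    dominated eta w B (subval f) -> p f <= C * B.
  have C1 : 0 < C + 1 by rewrite ltr_wpDl.
  exists w => //; exists (e / (C + 1)); first exact: divr_gt0.
  move=> f hf; apply: sub => p Qp; rewrite subr0.
  apply: le_lt_trans (hC p Qp f _ (ltW (divr_gt0 e0 C1)) hf) _.
  by rewrite mulrA ltr_pdivrMr// mulrC ltr_pM2l// ltrDl.
move: finQ QP {sub} => /finite_setP[n]; elim: n Q => [|n IH] Q.
  rewrite II0 card_eq0 => /eqP -> _; have [w hw] := factors_ex.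
  by exists w => //; exists 0.
move=> /eq_cardSP[q Qq /IH hQ] QP.
have [w hw [C C0 hC]] : exists2 w, factors c M w & exists2 C : R, 0 <= C &
    forall p, (Q `\ q) p -> forall (f : bdot_carrier M eta c) B, 0 <= B ->
    dominated eta w B (subval f) -> p f <= C * B.
  by apply: hQ => p [/QP].
have [w' hw' [C' C'0 hC']] := hPD (QP q Qq).
have [v hv vw] := factors_directed hw hw'; exists v => //.
exists (C + C'); first exact: addr_ge0.
move=> p Qp f B B0 hB; rewrite mulrDl.
have h1 := dominated_mono (fun k => (vw k).1) hB.
have h2 := dominated_mono (fun k => (vw k).2) hB.
have [->|pq] := pselect (p = q).
  by apply: le_trans (hC' f B B0 h2) _; rewrite lerDr mulr_ge0.
by apply: le_trans (hC p (conj Qp pq) f B B0 h1) _; rewrite lerDl mulr_ge0.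
Qed.

Lemma bdot_nbhs0 w (e : R) : factors c M w -> 0 < e ->
  nbhs (0 : E) [set f : E | dominated eta w e (subval (f : bdot_carrier M eta c))].
Proof.
move=> hw e0; have [p hp pw] := bdot_factor_seminorm eta hw.
exists [set p], e; split => //; first by move=> _ ->.
move=> f fp; apply: dominated_le (pw f); apply: ltW.
by have := fp p erefl; rewrite subr0.
Qed.

Definition evaluation s (x : 'rV[R]_d) (f : E) : R[i]^o :=
  pderivs s (subval (f : bdot_carrier M eta c)) x.

Lemma evaluation_dual s x : is_dual (evaluation s x).
Proof.
split.
  move=> a f g; rewrite /evaluation.
  have -> : (a *: f + g : E) = (a *: (f : bdot_carrier M eta c) + g) by [].
  by rewrite pderivs_subD pderivs_subZ.
have lin : linear (evaluation s x).
  move=> a f g; rewrite /evaluation.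
  have -> : (a *: f + g : E) = (a *: (f : bdot_carrier M eta c) + g) by [].
  by rewrite pderivs_subD pderivs_subZ.
move=> f; apply/(@cvg_normcP _ _ (nbhs f) (nbhs_filter f)) => e e0.
have [w hw] := factors_ex.
have wp := factors_gt0 (size s) hw.
have e'0 : 0 < e / 2 * w (size s) / eta x by rewrite !divr_gt0// mulr_gt0// divr_gt0.
have := nbhs_translate f (bdot_nbhs0 hw e'0); apply: (@filterS _ (nbhs f)) => g /= hg.
rewrite -(lin_B lin); apply: (@le_lt_trans _ _ (e / 2)).
  have := hg s x; rewrite divfK ?gt_eqF// mulrC ler_pM2r//.
by rewrite ltr_pdivrMr// ltr_pMr// ltr1n.
Qed.

Definition evald s x : dual E := Subspace _ (evaluation_dual s x).

Lemma evaldE s x f : dual_fun (evald s x) f = pderivs s (subval (f : bdot_carrier M eta c)) x.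
Proof. by []. Qed.

(** The functionals whose absolute values have the norm of the factors [w] as their
    supremum. *)
Definition norming w : set (dual E) :=
  [set y | exists s x, y = (w (size s) / eta x)%:C *: evald s x].

Lemma norming_fun w s x f : factors c M w ->
  normc (dual_fun ((w (size s) / eta x)%:C *: evald s x) f) =
  w (size s) * normc (pderivs s (subval (f : bdot_carrier M eta c)) x) / eta x.
Proof.
move=> hw; rewrite dual_funZ ComplexField.Normc.normcM normc_real evaldE.
by rewrite ger0_norm 1?mulrAC// divr_ge0// ltW// factors_gt0.
Qed.

Lemma norming_equicontinuous w : factors c M w -> equicontinuous_dual (norming w).
Proof.
move=> hw f U /entourage_normcP[e e0 eU].
have e20 : 0 < e / 2 by rewrite divr_gt0.
have := nbhs_translate f (bdot_nbhs0 hw e20); apply: (@filterS _ (nbhs f)) => g /= hg.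
move=> y [s [x ->]]; apply: eU; set z := _ *: _.
rewrite -(lin_B (dual_linear z) f g) /z norming_fun// ltr_pdivrMr//.
apply: (@le_lt_trans _ _ (e / 2 * eta x)); last first.
  by rewrite ltr_pM2r// ltr_pdivrMr// ltr_pMr// ltr1n.
have := hg s x; rewrite -!evaldE.
have -> : dual_fun (evald s x) (f - g) = - dual_fun (evald s x) (g - f).
  by rewrite -(lin_N (dual_linear (evald s x)) (g - f)) opprB.
by rewrite normcN.
Qed.

(** The norming functionals are equicontinuous, hence bounded on compact sets. *)
Lemma compact_dominated (K : set E) w : compact K -> factors c M w ->
  exists2 B : R, 0 <= B & forall f, K f -> dominated eta w B (subval (f : bdot_carrier M eta c)).
Proof.
move=> cK hw; have [m hm] := equicontinuous_compact_ub (norming_equicontinuous hw) cK.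
exists (Num.max 0 m); first by rewrite le_max lexx.
move=> f Kf s x; rewrite -ler_pdivrMr// -norming_fun// le_max.
by rewrite hm ?orbT//; exists s, x.
Qed.

End bdot_topology.

Section dual_c_neighborhoods.
Variables (R : realType) (Z : tvsType R[i]).

(** Finitely many compact discs lie in one. *)
Lemma dual_c_near (T : Type) (G : set_system T) {FG : Filter G} (y : T -> dual_c Z) :
  (forall K : set Z, compact K -> \forall t \near G, forall k, K k ->
     normc (dual_fun (y t) k) <= 1) ->
  forall U, nbhs (0 : dual_c Z) U -> \forall t \near G, U (y t).
Proof.
move=> hy U [Q [e [finQ QP e0 sub]]].
have [K [cK _ _ _ hK]] := compact_disc_absorbs finQ QP e0.
apply: (@filterS _ G _ _ _ _ (hy K cK)) => t /hK ht; apply: sub => p Qp.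
by rewrite subr0; exact: ht.
Qed.

Lemma dual_c_nbhs0 (K : set Z) (e : R) : compact K -> convex_set K -> circled K -> 0 < e ->
  nbhs (0 : dual_c Z) [set y : dual_c Z | forall k, K k -> normc (dual_fun (y : dual Z) k) <= e].
Proof.
move=> cK vK bK e0; exists [set fun f : dual Z => sup [set normc (dual_fun f x) | x in K]], e.
split => //; first by move=> _ ->; exists K.
move=> y /(_ _ erefl); rewrite subr0 => ye k Kk; apply: le_trans (ltW ye).
apply: ub_le_sup; last by exists k.
have [m hm] := equicontinuous_compact_ub (equicontinuous_set1 (y : dual Z)) cK.
by exists m => _ [x Kx <-]; exact: hm.
Qed.

End dual_c_neighborhoods.

Section evaluations.
Variables (R : realType) (d : nat) (M : nat -> {posnum R}) (eta : cweight R d).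
Variable c : um_class.
Notation E := (bdot M eta c).
Notation e_ j := (delta_mx 0 j : 'rV[R]_d).
Let eta0 x : 0 < eta x := cweight_gt0 eta x.
Hypothesis hSH : forall w (a : R), factors c M w -> 1 <= a ->
  exists2 w', factors c M w' & exists2 C : R, 0 <= C &
    forall p, a ^+ p * w p <= w' p /\ a ^+ p * w p <= C * w' p.+1.
Variable Cb : R.
Hypothesis Cb0 : 0 < Cb.
Hypothesis eta_box : forall x y : 'rV[R]_d,
  (forall k, `|y 0 k - x 0 k| <= 1) -> eta y <= Cb * eta x.

Lemma finite_words n : finite_set [set s : seq 'I_d | (size s <= n)%N].
Proof.
elim: n => [|n IH].
  apply: (@sub_finite_set _ _ [set [::]]) => [s /=|]; last exact: finite_set1.
  by rewrite leqn0 => /nilP.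
apply: (@sub_finite_set _ _ ([set [::]] `|`
    [set p.1 :: p.2 | p in [set: 'I_d] `*` [set s : seq 'I_d | (size s <= n)%N]])).
  by move=> [|j s] /= h; [left|right; exists (j, s)].
rewrite finite_setU; split; first exact: finite_set1.
by apply: finite_image; apply: finite_setX => //; exact: finite_finset.
Qed.

Lemma locally_bounded w (B : R) (g : E) s (x : 'rV[R]_d) : factors c M w ->
  dominated eta w B (subval (g : bdot_carrier M eta c)) -> 0 <= B ->
  forall y : 'rV[R]_d, (forall k, `|y 0 k - x 0 k| <= 1) ->
  normc (pderivs s (subval (g : bdot_carrier M eta c)) y) <= B * Cb * eta x / w (size s).
Proof.
move=> hw hB B0 y yx; rewrite ler_pdivlMr ?(factors_gt0 _ hw)// mulrC.
apply: le_trans (hB s y) _; rewrite -mulrA ler_wpM2l//; exact: eta_box.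
Qed.

(** On a compact set of functions the derivatives of the next order are uniformly
    bounded near [x]. *)
Lemma evaluation_cvg s (x : 'rV[R]_d) (U : set (dual_c E)) : nbhs 0 U ->
  \forall y \near x, U (evald M eta c s y - evald M eta c s x).
Proof.
move: U; apply: (dual_c_near (FG := nbhs_filter x)) => K cK.
have [w hw] := factors_ex M c; have [B B0 hB] := compact_dominated cK hw.
pose D := B * Cb * eta x / w (size s).+1 + 1.
have wp := factors_gt0 (size s).+1 hw.
have D0 : 0 < D by rewrite ltr_wpDl// !mulr_ge0 ?invr_ge0 ?(ltW Cb0) ?(ltW wp) ?(ltW (eta0 x)).
have dD0 : 0 < d%:R * D + 1 by rewrite ltr_wpDl// mulr_ge0// ltW.
pose r := Num.min 1 (d%:R * D + 1)^-1.
have r0 : 0 < r by rewrite lt_min ltr01 invr_gt0.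
have rD : d%:R * r * D <= 1.
  apply: (@le_trans _ _ (d%:R * (d%:R * D + 1)^-1 * D)).
    by rewrite ler_wpM2r ?(ltW D0)// ler_wpM2l// /r ge_min lexx orbT.
  by rewrite mulrAC ler_pdivrMr// mul1r lerDl.
have near_x : \forall y \near nbhs x, forall k : 'I_d, `|(y : 'rV[R]_d) 0 k - x 0 k| <= r.
  have h k : \forall y \near nbhs x, `|(y : 'rV[R]_d) 0 k - x 0 k| <= r.
    have := @coord_continuous R 1 d 0 k x => /cvgrPdist_le/(_ _ r0).
    by apply: (@filterS _ (nbhs x)) => y; rewrite distrC.
  by apply: (@filter_forall _ _ _ (nbhs x) (nbhs_filter x)) => k; exact: h.
apply: (@filterS _ (nbhs x) _ _ _ _ near_x) => y yx f Kf.
have -> : dual_fun (evald M eta c s y - evald M eta c s x) f =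
    pderivs s (subval (f : bdot_carrier M eta c)) (x + (y - x)) -
    pderivs s (subval (f : bdot_carrier M eta c)) x by rewrite subrKC.
apply: (@le_trans _ _ ((\sum_k `|(y - x) 0 k|) * D)).
  apply: (box_increment (bdot_smooth (f : bdot_carrier M eta c)) (normc_cts_seminorm R)) => j z hz.
  apply: le_trans (locally_bounded (x := x) (j :: s) hw (hB f Kf) B0 _) _.
    move=> k; apply: le_trans (hz k) _; rewrite !mxE; apply: le_trans (yx k) _.
    by rewrite /r ge_min lexx.
  by rewrite lerDl.
apply: le_trans rD; rewrite ler_wpM2r ?(ltW D0)//.
apply: (@le_trans _ _ (\sum_(k < d) r)).
  by apply: ler_sum => k _; rewrite !mxE.
by rewrite sumr_const card_ord mulr_natl.
Qed.

(** Taylor's formula, with uniform bounds for two more derivatives. *)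
Lemma evaluation_derivative s j (x : 'rV[R]_d) (U : set (dual_c E)) : nbhs 0 U ->
  \forall t \near (0 : R)^', U ((t^-1)%:C *: (evald M eta c s (x + t *: e_ j) -
    evald M eta c s x) - evald M eta c (j :: s) x).
Proof.
move: U; apply: dual_c_near => K cK.
have [w hw] := factors_ex M c; have [B B0 hB] := compact_dominated cK hw.
pose D := B * Cb * eta x / w (size s).+2 + 1.
have wp := factors_gt0 (size s).+2 hw.
have D0 : 0 < D by rewrite ltr_wpDl// !mulr_ge0 ?invr_ge0 ?(ltW Cb0) ?(ltW wp) ?(ltW (eta0 x)).
have r0 : 0 < Num.min 1 D^-1 by rewrite lt_min ltr01 invr_gt0.
near=> t.
have t0 : t != 0 by near: t; exact: nbhs_dnbhs_neq.
have : `|t| < Num.min 1 D^-1 by near: t; exact: dnbhs0_lt.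
rewrite lt_min => /andP[t1 tD] f Kf.
set F := subval (f : bdot_carrier M eta c).
have -> : dual_fun ((t^-1)%:C *: (evald M eta c s (x + t *: e_ j) -
    evald M eta c s x) - evald M eta c (j :: s) x) f =
    (t^-1)%:C * (pderivs s F (x + t *: e_ j) - pderivs s F x - t%:C * pderivs (j :: s) F x).
  by rewrite mulrBr mulrA -rmorphM mulVf// rmorph1 mul1r.
rewrite ComplexField.Normc.normcM normc_real normfV ler_pdivrMl ?normr_gt0// mulr1.
apply: (@le_trans _ _ (`|t| ^+ 2 * D)).
  apply: (taylor_le (bdot_smooth (f : bdot_carrier M eta c)) (normc_cts_seminorm R)) => r rt.
  apply: le_trans (locally_bounded (x := x) [:: j, j & s] hw (hB f Kf) B0 _) _.
    move=> k; rewrite !mxE eqxx /= addrAC subrr add0r.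
    case: (k == j); rewrite ?mulr1 ?mulr0 ?normr0//.
    by apply: le_trans rt (ltW t1).
  by rewrite lerDl.
rewrite expr2 -mulrA ler_piMr// -ler_pdivlMr// mul1r; exact: ltW.
Unshelve. all: by end_near. Qed.

(** The low orders decay at infinity, the high ones are small everywhere. *)
Lemma uniform_decay w (e : R) (g : E) : factors c M w -> 0 < e ->
  exists rho : R, forall s (x : 'rV[R]_d) k, rho < `|x 0 k| ->
    w (size s) * normc (pderivs s (subval (g : bdot_carrier M eta c)) x) <= e * eta x.
Proof.
move=> hw e0; have l2 : 1 <= (2 : R) by rewrite ler1n.
have [w' hw' [C C0 hC]] := hSH hw l2.
have cg := @compact_set1 E g.
have [B B0 /(_ g erefl) hB] := compact_dominated cg hw'.
pose S := Num.bound (B / e).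
have BS : B <= e * 2 ^+ S.
  have h : B / e < S%:R by apply: archi_boundP; rewrite divr_ge0// ltW.
  rewrite -ler_pdivrMl// mulrC; apply: le_trans (ltW h) _.
  by rewrite -natrX ler_nat ltnW// ltn_expl.
have ex s : exists rho : R, forall (x : 'rV[R]_d) k, rho < `|x 0 k| ->
    w (size s) * normc (pderivs s (subval (g : bdot_carrier M eta c)) x) <= e * eta x.
  have ws := factors_gt0 (size s) hw.
  have [rho hrho] := bdot_vanishing (g : bdot_carrier M eta c) s (divr_gt0 e0 ws).
  exists rho => x k xk; apply: le_trans (ler_wpM2l (ltW ws) (hrho x k xk)) _.
  by rewrite mulrA mulrCA divff ?mulr1// gt_eqF.
have [rho hrho] := choice ex.
have [m m0 hm] := finite_ub rho (finite_words S).
exists m => s x k xk; have [sS|Ss] := leqP (size s) S.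
  by apply: (hrho s x k); apply: lt_trans xk; exact: hm.
have h2 : 0 < (2 : R) ^+ size s by rewrite exprn_gt0.
rewrite -(ler_pM2l h2) mulrA.
apply: le_trans (ler_wpM2r (normc_ge0 _) (hC (size s)).1) _.
apply: le_trans (hB s x) _; rewrite mulrA ler_wpM2r ?(ltW (eta0 x))//.
apply: le_trans BS _; rewrite mulrC ler_wpM2r ?(ltW e0)//.
by rewrite ler_eXn2l ?ltr1n// ltnW.
Qed.

(** The decay of each function is uniform in the order of the derivative, and by
    compactness it is uniform on a compact set of functions. *)
Lemma norming_decay w (U : set (dual_c E)) : factors c M w -> nbhs 0 U ->
  exists rho : R, forall s (x : 'rV[R]_d) k, rho < `|x 0 k| ->
    U ((w (size s) / eta x)%:C *: evald M eta c s x).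
Proof.
move=> hw [Q [e [finQ QP e0 sub]]].
have [K [cK _ _ _ hK]] := compact_disc_absorbs finQ QP e0.
suff [rho hrho] : exists rho : R, forall s (x : 'rV[R]_d) k, rho < `|x 0 k| -> forall g, K g ->
    w (size s) * normc (pderivs s (subval (g : bdot_carrier M eta c)) x) <= eta x.
  exists rho => s x k xk; apply: sub => p Qp; rewrite subr0; apply: hK Qp => g Kg.
  by rewrite norming_fun// ler_pdivrMr// mul1r; exact: hrho xk g Kg.
have /compact_near_coveringP cK' := cK.
have : \forall rho \near +oo, K `<=` (fun g : E => forall s (x : 'rV[R]_d) k, rho < `|x 0 k| ->
    w (size s) * normc (pderivs s (subval (g : bdot_carrier M eta c)) x) <= eta x).
  have h2 : 0 < (2 : R)^-1 by rewrite invr_gt0.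
  apply: cK' => g Kg; have [r0 hr0] := uniform_decay g hw h2.
  have ng := nbhs_translate g (bdot_nbhs0 eta hw h2).
  exists ([set f | dominated eta w 2^-1 (subval (f - g : bdot_carrier M eta c))],
    [set t | r0 < t]).
    split => //=; exists r0; split => //; exact: num_real.
  move=> [f t] [/= fg rt] s x k xk.
  have -> : pderivs s (subval (f : bdot_carrier M eta c)) x =
      pderivs s (subval (f - g : bdot_carrier M eta c)) x +
      pderivs s (subval (g : bdot_carrier M eta c)) x.
    by rewrite -pderivs_subD subrK.
  have ws := factors_gt0 (size s) hw.
  apply: le_trans (ler_wpM2l (ltW ws) (le_normcD _ _)) _; rewrite mulrDr.
  apply: le_trans (lerD (fg s x) (hr0 s x k (lt_trans rt xk))) _.
  have h1 : (2 : R)^-1 + 2^-1 = 1 by field.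
  by rewrite -mulrDl h1 mul1r.
move=> [m [_ hm]]; exists (m + 1) => s x k xk g Kg.
by apply: (hm (m + 1) _ g Kg s x k xk); rewrite ltrDl.
Qed.

End evaluations.

(** * Compact discs *)

Section null_families.
Variables (R : realType) (F : lcsType R[i]).
Implicit Types (q : F -> R).

Lemma near_finite (T I : Type) (G : set_system T) {FG : Filter G} (S : set I)
    (P : I -> T -> Prop) : finite_set S -> (forall i, S i -> \forall t \near G, P i t) ->
  \forall t \near G, forall i, S i -> P i t.
Proof.
move=> /finite_setP[n]; elim: n S => [|n IH] S.
  by rewrite II0 card_eq0 => /eqP -> _; apply: (@filterS _ G _ setT _ _ filterT).
move=> /eq_cardSP[i Si /IH h] hS.
have h1 : \forall t \near G, forall k, (S `\ i) k -> P k t by apply: h => k [/hS].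
apply: (@filterS2 _ G _ _ _ _ _ (hS i Si) h1) => t Pi Pk k Sk.
by have [->//|ki] := pselect (k = i); apply: Pk.
Qed.

Definition null_family (I : Type) (u : I -> F) : Prop :=
  forall q (e : R), cts_seminorm q -> 0 < e -> finite_set [set i | e < q (u i)].

Lemma seminorm_sum q (I : Type) (r : seq I) (v : I -> F) : seminorm q ->
  q (\sum_(i <- r) v i) <= \sum_(i <- r) q (v i).
Proof.
move=> sq; elim: r => [|i r IH]; first by rewrite !big_nil seminorm0.
by rewrite !big_cons; apply: le_trans (sq.1 _ _) _; rewrite lerD2l.
Qed.

Hypothesis Fc : seq_complete F.
Variable v : nat -> F.
Hypothesis v0 : forall q (e : R), cts_seminorm q -> 0 < e ->
  exists N, forall n, (N <= n)%N -> q (v n) <= e.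

Definition in_l1_ball (a : nat -> R[i]) : Prop :=
  forall N, \sum_(n < N) normc (a n) <= 1.

Definition partial (a : nat -> R[i]) N : F := \sum_(n < N) a n *: v n.

(** The terms beyond [N] contribute at most the supremum of [q (v n)] for [n >= N]. *)
Lemma partial_tail q (e : R) : cts_seminorm q -> 0 < e -> exists N, forall a m n,
  in_l1_ball a -> (N <= m)%N -> (N <= n)%N -> q (partial a m - partial a n) <= e.
Proof.
move=> hq e0; have [sq cq] := hq; have [N hN] := v0 hq e0.
have main a m n : in_l1_ball a -> (N <= m)%N -> (m <= n)%N -> q (partial a n - partial a m) <= e.
  move=> ha Nm mn; have -> : partial a n - partial a m = \sum_(m <= k < n) a k *: v k.
    rewrite /partial -!(big_mkord xpredT (fun k => a k *: v k)).
    by rewrite (@big_cat_nat _ _ _ m 0 n)//= addrAC subrr add0r.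
  apply: le_trans (seminorm_sum _ _ sq) _.
  apply: (@le_trans _ _ (\sum_(m <= k < n) normc (a k) * e)).
    rewrite big_nat_cond [leRHS]big_nat_cond; apply: ler_sum => k /andP[/andP[mk _] _].
    by rewrite sq.2 ler_wpM2l ?normc_ge0// hN// (leq_trans Nm).
  rewrite -mulr_suml ler_piMl ?(ltW e0)//; apply: le_trans (ha n).
  rewrite -(big_mkord xpredT (fun k => normc (a k))) (@big_cat_nat _ _ _ m 0 n)//=.
  by rewrite lerDr sumr_ge0// => k _; exact: normc_ge0.
exists N => a m n ha Nm Nn; have [mn|/ltnW nm] := leqP m n; last exact: main.
by rewrite -(seminormN _ sq) opprB; exact: main.
Qed.

Lemma partial_cvg a : in_l1_ball a -> exists k : F, partial a @ \oo --> k.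
Proof.
move=> ha; apply: Fc => U U0; have [q [sq cq qU]] := nbhs_seminorm U0.
have e0 : 0 < (2 : R)^-1 by rewrite invr_gt0.
have [N hN] := partial_tail (conj sq cq) e0.
exists N => m n Nm Nn; apply: qU; apply: le_lt_trans (hN a m n ha Nm Nn) _.
by rewrite invf_lt1// ltr1n.
Qed.

Definition l1_hull : set F :=
  [set k | exists2 a, in_l1_ball a & partial a @ \oo --> k].

Lemma partial_limit q (e : R) : cts_seminorm q -> 0 < e -> exists N, forall a k,
  in_l1_ball a -> partial a @ \oo --> k -> q (partial a N - k) <= e.
Proof.
move=> hq e0; have [sq cq] := hq; have [N hN] := partial_tail hq e0.
exists N => a k ha ak; apply/ler_addgt0Pl => e' e'0.
have near1 : \forall n \near \oo, q (partial a n - k) < e' by exact: (cvg_seminorm sq cq ak e'0).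
have near2 : \forall n \near \oo, (N <= n)%N by exists N.
have [n [h1 h2]] := filter_ex (filterI near1 near2).
rewrite -(subrKA (partial a n)) addrC; apply: le_trans (sq.1 _ _) _.
rewrite lerD//; first exact: ltW.
exact: hN.
Qed.

Lemma l1_hull_lin (s t : R[i]) a b x y : partial a @ \oo --> x -> partial b @ \oo --> y ->
  partial (fun n => s * a n + t * b n) @ \oo --> s *: x + t *: y.
Proof.
move=> ax bz.
have -> : partial (fun n => s * a n + t * b n) = fun N => s *: partial a N + t *: partial b N.
  apply/funext => N; rewrite /partial !scaler_sumr -big_split; apply: eq_bigr => n _.
  by rewrite scalerDl !scalerA.
have bz' : (fun n => t *: partial b n) @ \oo --> t *: y.
  have h := @tvs_cvg_lin R F nat \oo _ (partial b) (fun=> 0) t y 0 bz (@cvg_cst _ _ _ _ _).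
  have E : (fun n => t *: partial b n) = (fun n => t *: partial b n + 0).
    by apply: funext => n; rewrite addr0.
  by rewrite E -(addr0 (t *: y)); exact: h.
exact: (@tvs_cvg_lin R F nat \oo _ (partial a) _ s x _ ax bz').
Qed.

Lemma l1_ball_comb (s t : R[i]) a b : normc s + normc t <= 1 -> in_l1_ball a ->
  in_l1_ball b -> in_l1_ball (fun n => s * a n + t * b n).
Proof.
move=> st ha hb N.
apply: (@le_trans _ _ (normc s * (\sum_(n < N) normc (a n)) +
    normc t * (\sum_(n < N) normc (b n)))).
  rewrite !mulr_sumr -big_split; apply: ler_sum => n _; apply: le_trans (le_normcD _ _) _.
  by rewrite !ComplexField.Normc.normcM.
apply: le_trans st; rewrite lerD// ler_piMr ?normc_ge0//.
Qed.

Lemma l1_ball0 : in_l1_ball (fun=> 0).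
Proof. by move=> N; rewrite big1// => n _; exact: ComplexField.Normc.normc0. Qed.

Lemma l1_hull_mem n : l1_hull (v n).
Proof.
exists (fun k => (k == n)%:R) => [N|].
  apply: (@le_trans _ _ (\sum_(k < N) (if (k : nat) == n then 1 else 0))).
    apply: ler_sum => k _; case: eqP => _.
      by rewrite ComplexField.Normc.normc1.
    by rewrite ComplexField.Normc.normc0.
  have [nN|Nn] := ltnP n N.
    rewrite (bigD1 (Ordinal nN))//= eqxx big1 ?addr0// => k.
    by rewrite -val_eqE /= => /negbTE ->.
  rewrite big1 ?ler01// => k _; case: eqP => // kn.
  by have := ltn_ord k; rewrite kn ltnNge Nn.
apply: (@cvg_near_cst _ _ (v n)); exists n.+1 => // N /= nN.
rewrite /partial (bigD1 (Ordinal nN))//= eqxx scale1r big1 ?addr0// => k.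
by rewrite -val_eqE /= => /negbTE ->; rewrite scale0r.
Qed.

Lemma l1_hull_circled : circled l1_hull.
Proof.
move=> s x s1 [a ha ax].
have p0 : partial (fun=> 0) @ \oo --> (0 : F).
  apply: cvg_near_cst; apply: nearW => N.
  by rewrite /partial big1// => n _; rewrite scale0r.
have := l1_hull_lin (s := s) (t := 0) ax p0; rewrite scaler0 addr0 => h.
exists (fun n => s * a n + 0 * 0) => //; apply: (l1_ball_comb (t := 0) _ ha l1_ball0).
by rewrite ComplexField.Normc.normc0 addr0.
Qed.

Lemma l1_hull_convex : convex_set l1_hull.
Proof.
apply: convex_of_combinations => t x y /andP[t0 t1] [a ha ax] [b hb bz].
exists (fun n => t%:C * a n + (1 - t)%:C * b n); last exact: l1_hull_lin.
apply: l1_ball_comb => //; rewrite !normc_real !ger0_norm ?subr_ge0//.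
by rewrite addrC subrK.
Qed.

(** The coefficients converge along an ultrafilter, each in its disc, and the tails
    of the series are uniformly small. *)
Lemma l1_hull_compact : compact l1_hull.
Proof.
rewrite compact_ultra => U UU UK; have PU : ProperFilter U by apply: ultra_proper.
have ex k : exists a, l1_hull k -> in_l1_ball a /\ partial a @ \oo --> k.
  by have [[a ha ak]|nk] := pselect (l1_hull k); [exists a|exists (fun=> 0)].
have [a ha] := choice ex.
have a_lim n : exists l : R[i], forall e : R, 0 < e -> \forall k \near U, normc (a k n - l) < e.
  apply: (@ultra_cvg_complex R F U UU (fun k => a k n) 1).
  apply: (@filterS _ U _ _ _ _ UK) => k /ha[h _]; apply: le_trans (h n.+1).
  by rewrite big_ord_recr /= lerDr sumr_ge0// => i _; exact: normc_ge0.
have [l hl] := choice a_lim.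
have near_sum N (e : R) : 0 < e -> \forall k \near U, \sum_(n < N) normc (a k n - l n) <= e.
  move=> e0; have e'0 : 0 < e / N.+1%:R by rewrite divr_gt0.
  have h : \forall k \near U, forall n : 'I_N, normc (a k n - l n) < e / N.+1%:R.
    by apply: (@filter_forall _ _ _ U PU) => n; exact: hl.
  apply: (@filterS _ U _ _ _ _ h) => k hk.
  apply: (@le_trans _ _ (\sum_(n < N) e / N.+1%:R)).
    by apply: ler_sum => n _; exact: ltW.
  rewrite sumr_const card_ord -[_ *+ N]mulr_natr -mulrA ler_piMr ?(ltW e0)//.
  by rewrite mulrC ler_pdivrMr// mul1r ler_nat.
have lb : in_l1_ball l.
  move=> N; apply/ler_addgt0Pl => e e0.
  have [k [hk1 /ha[hk2 _]]] := filter_ex (filterI (near_sum N e e0) UK).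
  apply: le_trans (lerD hk1 (hk2 N)); rewrite -big_split; apply: ler_sum => n _ /=.
  rewrite -(normcN (a k n - l n)) opprB; apply: le_trans (le_normcD _ _).
  by rewrite subrK.
have [k0 lk0] := partial_cvg lb; exists k0; split; first by exists l.
apply: lcs_cvgP => q hq e e0; have [sq cq] := hq.
have e40 : 0 < e / 4 by rewrite divr_gt0.
have [N hN] := partial_limit hq e40.
pose m := \sum_(n < N) q (v n) + 1.
have m0 : 0 < m by rewrite ltr_wpDl// sumr_ge0// => n _; exact: seminorm_ge0.
have em0 : 0 < e / 4 / m by rewrite divr_gt0.
have h : \forall k \near U, forall n : 'I_N, normc (a k n - l n) < e / 4 / m.
  by apply: (@filter_forall _ _ _ U PU) => n; exact: hl.
apply: (@filterS2 _ U _ _ _ _ _ h UK) => k hk /ha[ak pk].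
have h1 := hN _ _ ak pk; have h2 := hN _ _ lb lk0.
have h3 : q (partial (a k) N - partial l N) <= e / 4.
  rewrite /partial -sumrB; apply: le_trans (seminorm_sum _ _ sq) _.
  apply: (@le_trans _ _ (\sum_(n < N) e / 4 / m * q (v n))).
    apply: ler_sum => n _; rewrite -scalerBl sq.2 ler_wpM2r ?seminorm_ge0//.
    exact: ltW.
  rewrite -mulr_sumr mulrAC -mulrA ler_piMr ?(ltW e40)// ler_pdivrMr// mul1r.
  by rewrite lerDl.
have -> : k - k0 = - (partial (a k) N - k) + ((partial (a k) N - partial l N) +
    (partial l N - k0)).
  by rewrite opprB !subrKA.
apply: le_lt_trans (sq.1 _ _) _; rewrite (seminormN _ sq).
apply: le_lt_trans (lerD h1 (le_trans (sq.1 _ _) (lerD h3 h2))) _.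
by lra.
Qed.

End null_families.

(** Enumerate the family. *)
Lemma null_disc (R : realType) (F : lcsType R[i]) (I : countType) (u : I -> F) :
  seq_complete F -> null_family u ->
  exists K : set F, [/\ compact K, convex_set K, circled K & forall i, K (u i)].
Proof.
move=> Fc hu; pose v n := oapp u 0 (pickle_inv n : option I).
have v0 q (e : R) : cts_seminorm q -> 0 < e -> exists N, forall n, (N <= n)%N -> q (v n) <= e.
  move=> hq e0; have [m _ hm] := finite_ub (fun i => (pickle i)%:R : R) (hu q e hq e0).
  exists (Num.bound `|m|) => n mn; rewrite leNgt; apply/negP => evn.
  case E : (pickle_inv n : option I) => [i|].
    have ni : pickle i = n by have := @pickle_invK I n; rewrite /ocancel E.
    have : e < q (u i) by move: evn; rewrite /v E.
    move=> /hm; rewrite ni ltNge => /negP; apply.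
    apply: le_trans (ler_norm m) (le_trans (ltW (archi_boundP (normr_ge0 m))) _).
    by rewrite ler_nat.
  by move: evn; rewrite /v E /= seminorm0; [rewrite ltNge (ltW e0)|exact: hq.1].
exists (l1_hull v); split.
- exact: l1_hull_compact.
- exact: l1_hull_convex.
- exact: l1_hull_circled.
- move=> i; have -> : u i = v (pickle i) by rewrite /v pickleK_inv.
  exact: l1_hull_mem.
Qed.

(** * Vector-valued functions and functionals *)

Section vector_functions.
Variables (R : realType) (d : nat) (c : um_class) (M : nat -> {posnum R}).
Variables (eta : cweight R d) (F : lcsType R[i]).
Notation e_ j := (delta_mx 0 j : 'rV[R]_d).
Let eta0 x : 0 < eta x := cweight_gt0 eta x.
Implicit Types (q : F -> R) (w : nat -> R).

Definition vdominated w q (B : R) (phi : 'rV[R]_d -> F) : Prop :=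
  forall s x, w (size s) * q (pderivs s phi x) <= B * eta x.

Lemma seminorm_scaled_D w q phi alpha x : factors c M w -> seminorm q ->
  q (scaled_D eta w phi (alpha, x)) = w (mdeg alpha) / eta x * q (mderiv alpha phi x).
Proof.
move=> hw sq; rewrite -[scaled_D _ _ _ _]/((w (mdeg alpha) / eta x)%:C *: mderiv alpha phi x).
rewrite sq.2 normc_real ger0_norm// divr_ge0 ?(factors_ge0 _ hw)//.
exact: ltW.
Qed.

Lemma vnorm_dominated w q phi : factors c M w -> cts_seminorm q ->
  is_vbdot c M eta phi -> vdominated w q (vnorm eta q w phi) phi.
Proof.
move=> hw hq [sphi bphi _] s x; have [sq cq] := hq.
have [alpha <- ->] := mderiv_pderivs s x sphi sq.
have -> : w (mdeg alpha) * q (mderiv alpha phi x) = q (scaled_D eta w phi (alpha, x)) * eta x.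
  by rewrite seminorm_scaled_D// [RHS]mulrAC divfK ?gt_eqF.
rewrite ler_wpM2r ?(ltW (eta0 x))//; apply: ub_le_sup; first exact: bphi.
by exists (alpha, x).
Qed.

Lemma scaled_D_le w q (B : R) phi alpha x : factors c M w -> seminorm q ->
  w (mdeg alpha) * q (pderivs (mseq alpha) phi x) <= B * eta x ->
  q (scaled_D eta w phi (alpha, x)) <= B.
Proof.
move=> hw sq h; rewrite seminorm_scaled_D//.
by rewrite seminorm_mderiv// mulrAC ler_pdivrMr.
Qed.

Lemma vnorm_le w q (B : R) phi : factors c M w -> seminorm q -> vdominated w q B phi ->
  vnorm eta q w phi <= B.
Proof.
move=> hw sq h; apply: ge_sup.
  by exists (q (scaled_D eta w phi ((fun=> 0%N), 0))), ((fun=> 0%N), 0).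
move=> _ [[alpha x] _ <-]; apply: scaled_D_le => //.
by rewrite -size_mseq; exact: h.
Qed.

Lemma compact_coord (K : set 'rV[R]_d) : compact K ->
  exists rho : R, forall x, K x -> forall k, `|x 0 k| <= rho.
Proof.
move=> /compact_near_coveringP cK.
have : \forall m \near +oo, K `<=` (fun x : 'rV[R]_d => forall k, `|x 0 k| <= m).
  apply: cK => x Kx; pose b : R := \sum_k `|x 0 k| + 1.
  have h k : \forall y \near nbhs x, `|(y : 'rV[R]_d) 0 k - x 0 k| <= 1.
    have := @coord_continuous R 1 d 0 k x => /cvgrPdist_le/(_ _ ltr01).
    by apply: (@filterS _ (nbhs x)) => y; rewrite distrC.
  exists ([set y : 'rV[R]_d | forall k, `|y 0 k - x 0 k| <= 1], [set t | b < t]).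
    split => /=; last by exists b; split => //; exact: num_real.
    by apply: (@filter_forall _ _ _ (nbhs x) (nbhs_filter x)) => k; exact: h.
  move=> [y t] [/= yx bt] k; apply: le_trans (ltW bt).
  rewrite -(subrK (x 0 k) (y 0 k)) addrC; apply: le_trans (ler_normD _ _) _.
  rewrite lerD// (bigD1 k)//= lerDl sumr_ge0//.
move=> [m [_ hm]]; exists (m + 1) => x Kx.
by apply: (hm (m + 1)) Kx; rewrite ltrDl.
Qed.

Lemma vbdot_decay w q (e : R) phi : factors c M w -> cts_seminorm q ->
  is_vbdot c M eta phi -> 0 < e -> exists rho : R, forall s (x : 'rV[R]_d) k,
    rho < `|x 0 k| -> w (size s) * q (pderivs s phi x) <= e * eta x.
Proof.
move=> hw hq [sphi _ vphi] e0; have [sq cq] := hq.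
have [K [cK hK]] := vphi e w q e0 hw hq; have [rho hrho] := compact_coord cK.
exists rho => s x k xk; have [alpha <- ->] := mderiv_pderivs s x sphi sq.
have nKx : ~ K x by move=> /hrho /(_ k); rewrite leNgt xk.
have := hK alpha x nKx.
by rewrite seminorm_scaled_D// mulrAC ler_pdivrMr.
Qed.

Lemma dual_dominated w q (B : R) phi (y : dual F) : smooth phi -> 
  (forall p, 0 <= w p) -> (forall v, normc (dual_fun y v) <= q v) -> vdominated w q B phi ->
  dominated eta w B (fun x => dual_fun y (phi x)).
Proof.
move=> sphi w0 yq h s x; rewrite pderivs_dual//; apply: le_trans (h s x).
by rewrite ler_wpM2l.
Qed.

Lemma dual_seminorm (y : dual F) : cts_seminorm (fun v => normc (dual_fun y v)).
Proof.
split; last exact: dual_fun_normc_continuous.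
split=> [v v'|a v]; first by rewrite (lin_D (dual_linear y)) le_normcD.
by rewrite dualZ ComplexField.Normc.normcM.
Qed.

(** The hypotheses bound the derivatives by [M_p R_p] for every [R]; only the growth
    lemma turns this into a step of the inductive limit. *)
Lemma dual_comp_bdot phi (y : dual F) : is_vbdot c M eta phi ->
  is_bdot M eta c (fun x => dual_fun y (phi x)).
Proof.
move=> hphi; have [sphi _ _] := hphi.
have hy := dual_seminorm y; set g := fun x => _.
have sg : smooth g by exact: smooth_dual.
have dom w : factors c M w -> exists2 B : R, 0 <= B & dominated eta w B g.
  move=> hw; exists (vnorm eta (fun v => normc (dual_fun y v)) w phi).
    have := vnorm_dominated hw hy hphi [::] 0.
    move=> h; rewrite -(pmulr_lge0 _ (eta0 0)); apply: le_trans h.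
    by rewrite mulr_ge0 ?normc_ge0// (factors_ge0 _ hw).
  apply: dual_dominated (vnorm_dominated hw hy hphi) => //.
  by move=> p; exact: factors_ge0 hw.
have van s : vanishing eta (pderivs s g).
  move=> e e0; have [w hw] := factors_ex M c; have wp := factors_gt0 (size s) hw.
  have [rho hrho] := vbdot_decay hw hy hphi (mulr_gt0 wp e0).
  exists rho => x k xk; rewrite pderivs_dual//.
  by have := hrho s x k xk; rewrite -mulrA ler_pM2l.
move: dom; rewrite /is_bdot; case: (c) => dom.
  move=> m m0; have [|B B0 hB] := dom (fun p => m ^+ p / (M p)%:num); first by exists m.
  apply: (proj1 (@step_intro _ _ _ _ m B _ m0 sg van _)) => s x.
  by have := hB s x; rewrite mulrAC ler_pdivrMr// mulrAC.
pose S p := [set v : R | v = 0 \/ exists s x, size s = p /\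
  v = normc (pderivs s g x) / eta x].
have S_le r : frakR r -> exists2 C : R, 0 <= C &
    forall p v, S p v -> v <= C * ((M p)%:num * rprod r p).
  move=> hr; have [|B B0 hB] := dom (fun p => ((M p)%:num * rprod r p)^-1).
    by apply/roumieuP; exists r.
  exists B => // p v; have Mr : 0 < (M p)%:num * rprod r p by rewrite mulr_gt0// rprod_gt0.
  case=> [->|[s [x [sp ->]]]]; first by rewrite mulr_ge0// ltW.
  by have := hB s x; rewrite sp ler_pdivrMl// ler_pdivrMr// mulrA [_ * B]mulrC.
have S0 p : S p 0 by left.
have [r0 hr0 _] := frakR_slow R (fun=> 0%N); have [C0 C00 hC0] := S_le r0 hr0.
have bS p : has_ubound (S p) by exists (C0 * ((M p)%:num * rprod r0 p)) => v; exact: hC0.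
have [|m [C [m0 C_ge0 hC]]] := @komatsu_growth R M (fun p => sup (S p)).
  move=> r /S_le[C C_ge0 hC]; exists C => p; apply: ge_sup; first by exists 0.
  by move=> v; exact: hC.
exists m; split => //; apply: (proj1 (@step_intro _ _ _ _ m C _ m0 sg van _)) => s x.
rewrite -ler_pdivrMr// -mulrA; apply: le_trans (hC (size s)).
rewrite ler_wpM2l ?exprn_ge0 ?(ltW m0)//; apply: ub_le_sup => //.
by right; exists s, x.
Qed.

End vector_functions.

(** * Null families controlling a function *)

Section dyadic_nets.
Variables (R : realType) (d : nat) (c : um_class) (M : nat -> {posnum R}).
Variables (eta : cweight R d) (F : lcsType R[i]).
Let eta0 x : 0 < eta x := cweight_gt0 eta x.
Hypothesis hSH : forall w (a : R), factors c M w -> 1 <= a ->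
  exists2 w', factors c M w' & exists2 C : R, 0 <= C &
    forall p, a ^+ p * w p <= w' p /\ a ^+ p * w p <= C * w' p.+1.
Variable Cb : R.
Hypothesis Cb0 : 0 < Cb.
Hypothesis eta_box : forall x y : 'rV[R]_d,
  (forall k, `|y 0 k - x 0 k| <= 1) -> eta y <= Cb * eta x.
Variables (phi : 'rV[R]_d -> F) (w : nat -> R).
Hypothesis hphi : is_vbdot c M eta phi.
Hypothesis hw : factors c M w.
Let sphi : smooth phi. Proof. by case: hphi. Qed.

Definition node (j : nat) (z : 'rV[int]_d) : 'rV[R]_d := \row_k ((z 0 k)%:~R / 4 ^+ j).

Definition node_below (j : nat) (x : 'rV[R]_d) : 'rV[int]_d :=
  \row_k Num.floor (4 ^+ j * x 0 k).

Let p4 j : 0 < (4 : R) ^+ j. Proof. exact: exprn_gt0. Qed.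

Lemma node_below_bounds j (x : 'rV[R]_d) k :
  x 0 k - 4 ^- j <= node j (node_below j x) 0 k <= x 0 k.
Proof.
rewrite !mxE; set t := 4 ^+ j * x 0 k.
have t1 : t < (Num.floor t)%:~R + 1 by have := floorD1_gt t; rewrite rmorphD.
have t2 : (Num.floor t)%:~R <= t := ge_floor t.
have xE : x 0 k = t / 4 ^+ j by rewrite /t mulrAC divff ?mul1r// gt_eqF.
rewrite xE ler_pM2r ?invr_gt0// t2 andbT -[X in _ - X]mul1r -mulrBl ler_pM2r ?invr_gt0//.
by rewrite lerBlDr ltW.
Qed.

(** Both nodes lie within [4^-j] below [x]. *)
Lemma node_below_step j (x : 'rV[R]_d) k :
  `|node j.+1 (node_below j.+1 x) 0 k - node j (node_below j x) 0 k| <= 4 ^- j.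
Proof.
have /andP[a1 a2] := node_below_bounds j x k.
have /andP[b1 b2] := node_below_bounds j.+1 x k.
have le : (4 : R) ^- j.+1 <= 4 ^- j.
  by rewrite lef_pV2 ?posrE// ler_eXn2l// ltr1n.
by rewrite ler_norml; apply/andP; split; lra.
Qed.

Definition node_coef (s : seq 'I_d) j z : R :=
  2 ^+ size s * 2 ^+ j * (w (size s) / eta (node j z)).

Lemma node_coef_ge0 s j z : 0 <= node_coef s j z.
Proof.
by rewrite !mulr_ge0 ?exprn_ge0 ?invr_ge0 ?(ltW (eta0 _))// (factors_ge0 _ hw).
Qed.

(** The values at the integer points start the telescoping, and the increments between
    adjacent nodes of consecutive levels continue it. *)
Definition base_vector (i : seq 'I_d * 'rV[int]_d) : F :=
  (node_coef i.1 0 i.2)%:C *: pderivs i.1 phi (node 0 i.2).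

Definition adjacent j (z z' : 'rV[int]_d) : bool :=
  [forall k, `|node j.+1 z' 0 k - node j z 0 k| <= 4 ^- j].

Definition step_vector (i : seq 'I_d * nat * 'rV[int]_d * 'rV[int]_d) : F :=
  let: (s, j, z, z') := i in
  if adjacent j z z' then
    (node_coef s j z)%:C *: (pderivs s phi (node j.+1 z') - pderivs s phi (node j z))
  else 0.

Definition net_vector (i : (seq 'I_d * 'rV[int]_d) +
    (seq 'I_d * nat * 'rV[int]_d * 'rV[int]_d)) : F :=
  match i with inl i1 => base_vector i1 | inr i2 => step_vector i2 end.

Lemma finite_box_int (N : nat) : finite_set [set z : 'rV[int]_d | forall k, (`|z ord0 k|%N <= N)%N].
Proof.
pose h (f : {ffun 'I_d -> 'I_(N + N).+1}) : 'rV[int]_d := \row_k ((f k : nat)%:Z - N%:Z).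
apply: (@sub_finite_set _ _ (h @` [set: {ffun 'I_d -> 'I_(N + N).+1}])) => [z /= hz|]; last first.
  by apply: finite_image; exact: finite_finset.
exists [ffun k => inord (absz (z 0%R k + N%:Z)%R)] => //.
have zk k : (absz (z 0%R k) <= N)%N := hz k.
by apply/rowP => k; rewrite !mxE ffunE; have zk' := zk k; rewrite inordK; lia.
Qed.

Lemma finite_nodes (rho : R) n : finite_set
  [set z : 'rV[int]_d | exists2 j, (j <= n)%N & forall k, `|node j z 0 k| <= rho].
Proof.
pose N := Num.bound (4 ^+ n * `|rho|).
apply: sub_finite_set (finite_box_int N) => z [j jn hz] k /=.
have h0 : 0 <= 4 ^+ n * `|rho| by rewrite mulr_ge0 ?exprn_ge0.
have := hz k; rewrite mxE normrM normfV (gtr0_norm (p4 j)) ler_pdivrMr// => h.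
have : `|(z 0 k)%:~R| < (N%:R : R).
  apply: le_lt_trans (archi_boundP h0); apply: le_trans h _.
  have r0 : 0 <= rho := le_trans (normr_ge0 _) (hz k).
  have j4 : (4 : R) ^+ j <= 4 ^+ n by rewrite ler_eXn2l// ltr1n.
  by rewrite [leLHS]mulrC; apply: ler_pM (ltW (p4 j)) r0 j4 (ler_norm rho).
rewrite -intr_norm -[N%:R]/((N%:Z)%:~R) ltr_int.
by rewrite -[z ord0 k]/(z 0 k); move: (z 0 k) => t; lia.
Qed.

Lemma high_index (D e : R) : 0 < e -> exists S : nat, forall k,
  e < 2 ^- k * D -> (k <= S)%N.
Proof.
move=> e0; exists (Num.bound `|D / e|) => k h; rewrite leqNgt; apply/negP => Sk.
move: h; rewrite ltNge => /negP; apply.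
rewrite ler_pdivrMl ?exprn_gt0// -ler_pdivrMr//.
apply: le_trans (ler_norm _) (le_trans (ltW (archi_boundP (normr_ge0 _))) _).
rewrite -natrX ler_nat; apply: leq_trans (ltnW Sk) _; exact: ltnW (ltn_expl _ _).
Qed.

Lemma base_vector_le q (B : R) w' s z : seminorm q -> (forall p, 4 ^+ p * w p <= w' p) ->
  w' (size s) * q (pderivs s phi (node 0 z)) <= B * eta (node 0 z) ->
  q (base_vector (s, z)) <= 2 ^- size s * B.
Proof.
move=> sq ww h; set x := node 0 z in h *; set k := size s in h *.
rewrite /base_vector sq.2 normc_real ger0_norm ?node_coef_ge0//= /node_coef expr0 mulr1 -/k -/x.
rewrite ler_pdivlMl ?exprn_gt0//.
have -> : 2 ^+ k * (2 ^+ k * (w k / eta x) * q (pderivs s phi x)) =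
    (4 ^+ k * w k * q (pderivs s phi x)) / eta x.
  have -> : (4 : R) ^+ k = 2 ^+ k * 2 ^+ k by rewrite -exprMn -natrM.
  by ring.
rewrite ler_pdivrMr//; apply: le_trans h.
by rewrite ler_wpM2r ?seminorm_ge0.
Qed.

(** An increment over a distance [4^-j], with the weight [2^j], is of size [2^-j]; the
    weight [2^p] on the order [p] is paid by a sequence of factors [4^p] times larger. *)
Lemma step_vector_le q (B C : R) w' s j z z' : cts_seminorm q -> factors c M w' ->
  0 <= B -> 0 <= C -> (forall p, 4 ^+ p * w p <= C * w' p.+1) ->
  (forall i (y : 'rV[R]_d), (forall k, `|y 0 k - node j z 0 k| <= 1) ->
     w' (size s).+1 * q (pderivs (i :: s) phi y) <= B * eta y) ->
  q (step_vector (s, j, z, z')) <= 2 ^- (size s + j) * (d%:R * C * Cb * B).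
Proof.
move=> hq hw' B0 C0 ww h; have [sq _] := hq.
have P0 : 0 <= 2 ^- (size s + j) * (d%:R * C * Cb * B).
  by rewrite !mulr_ge0 ?invr_ge0 ?exprn_ge0// ltW.
rewrite /step_vector; case: ifP => [/forallP adj|_]; last by rewrite seminorm0.
set x := node j z in h adj *; set x' := node j.+1 z' in adj *; set k := size s in h ww P0 *.
have w'p : 0 < w' k.+1 := factors_gt0 k.+1 hw'.
have j1 : (4 : R) ^- j <= 1 by rewrite invf_le1// exprn_ege1// ler1n.
have vE l : (x' - x) 0 l = x' 0 l - x 0 l by rewrite [LHS]mxE [X in _ + X]mxE.
have inc : q (pderivs s phi x' - pderivs s phi x) <= d%:R * 4 ^- j * (B * Cb * eta x / w' k.+1).
  rewrite -(subrKC x x').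
  apply: (@le_trans _ _ ((\sum_k `|(x' - x) 0 k|) * (B * Cb * eta x / w' k.+1))).
    apply: (box_increment sphi hq) => i y hy.
    have y1 l : `|y 0 l - x 0 l| <= 1.
      by apply: le_trans (hy l) _; rewrite vE; apply: le_trans (adj l) j1.
    rewrite ler_pdivlMr// mulrC; apply: le_trans (h i y y1) _.
    by rewrite -mulrA ler_wpM2l//; exact: eta_box.
  rewrite ler_wpM2r ?mulr_ge0 ?invr_ge0 ?(ltW w'p) ?(ltW (eta0 x)) ?(ltW Cb0)//.
  apply: (@le_trans _ _ (\sum_(l < d) 4 ^- j)).
    by apply: ler_sum => l _; rewrite vE; exact: adj.
  by rewrite sumr_const card_ord mulr_natl.
rewrite sq.2 normc_real ger0_norm ?node_coef_ge0//.
apply: le_trans (ler_wpM2l (node_coef_ge0 _ _ _) inc) _; rewrite /node_coef -/k -/x.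
have h4 (n : nat) : (4 : R) ^+ n = 2 ^+ n * 2 ^+ n by rewrite -exprMn -natrM.
rewrite ler_pdivlMl ?exprn_gt0// exprD h4.
have e1 : eta x != 0 by rewrite gt_eqF.
have e2 : w' k.+1 != 0 by rewrite gt_eqF.
have e3 : (2 : R) ^+ j != 0 by rewrite expf_neq0.
have -> : 2 ^+ k * 2 ^+ j * (2 ^+ k * 2 ^+ j * (w k / eta x) *
    (d%:R * (2 ^+ j * 2 ^+ j)^-1 * (B * Cb * eta x / w' k.+1))) =
    (4 ^+ k * w k) * (d%:R * Cb * B / w' k.+1).
  rewrite h4; move: e1 e2 e3; move: (2 ^+ j) (w' k.+1) (eta x) (2 ^+ k) (d%:R : R).
  by move=> tj wk ex tk dd ex0 wk0 tj0; field; rewrite ex0 wk0 tj0.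
have D0 : 0 <= d%:R * Cb * B / w' k.+1 by rewrite !mulr_ge0 ?invr_ge0 ?(ltW w'p)// ltW.
apply: le_trans (ler_wpM2r D0 (ww k)) _.
rewrite le_eqVlt; apply/orP; left; apply/eqP.
by move: e2; move: (w' k.+1) => wk wk0; field.
Qed.

(** A large value bounds the order [p] and the level [j] by the previous estimates, and
    then the node, by the decay at infinity. *)
Lemma net_vector_null : null_family net_vector.
Proof.
move=> q e hq e0; have [sq _] := hq.
have l4 : 1 <= (4 : R) by rewrite ler1n.
have [w' hw' [C C0 hC]] := hSH hw l4.
have q0 v : 0 <= q v := seminorm_ge0 v sq.
have dom := vnorm_dominated hw' hq hphi; set B := vnorm _ _ _ _ in dom.
have B0 : 0 <= B.
  rewrite -(pmulr_lge0 _ (eta0 0)); apply: le_trans (dom [::] 0).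
  by rewrite mulr_ge0// (factors_ge0 _ hw').
pose D := d%:R * C * Cb.
have D0 : 0 <= D by rewrite !mulr_ge0// ltW.
have D1 : 0 < D + 1 by rewrite ltr_wpDl.
have e'0 : 0 < e / (D + 1) by rewrite divr_gt0.
have [rho hrho] := vbdot_decay hw' hq hphi e0.
have [rho' hrho'] := vbdot_decay hw' hq hphi e'0.
have [S hS] := high_index B e0; have [S' hS'] := high_index (D * B) e0.
pose A1 := [set s : seq 'I_d | (size s <= S)%N] `*`
  [set z : 'rV[int]_d | exists2 j, (j <= 0)%N & forall k, `|node j z 0 k| <= rho].
pose A2 := [set s : seq 'I_d | (size s <= S')%N] `*` [set j | (j <= S')%N] `*`
  [set z : 'rV[int]_d | exists2 j, (j <= S')%N & forall k, `|node j z 0 k| <= rho' + 1] `*`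
  [set z : 'rV[int]_d | exists2 j, (j <= S'.+1)%N & forall k, `|node j z 0 k| <= rho' + 2].
have fin1 : finite_set A1 by apply: finite_setX (finite_words _ _) (finite_nodes _ _).
have finj n : finite_set [set j : nat | (j <= n)%N].
  by apply: sub_finite_set (finite_II n.+1) => j /=; rewrite ltnS.
have fin2 : finite_set A2.
  by apply: finite_setX (finite_nodes _ _); apply: finite_setX (finite_nodes _ _);
    apply: finite_setX (finite_words _ _) (finj _).
apply: (@sub_finite_set _ _ ((inl @` A1) `|` (inr @` A2))); last first.
  by rewrite finite_setU; split; exact: finite_image.
move=> [[s z]|[[[s j] z] z']] /= ei; [left; exists (s, z) => //|right; exists (s, j, z, z') => //].
  have h2 : (2 : R) ^- size s <= 1 by rewrite invf_le1 ?exprn_gt0// exprn_ege1// ler1n.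
  split => /=.
    apply: hS; apply: lt_le_trans ei _.
    by apply: (base_vector_le (w' := w')) => // p; exact: (hC p).1.
  exists 0%N => // k; rewrite leNgt; apply/negP => xk.
  have := @base_vector_le q e w' s z sq (fun p => (hC p).1) (hrho s _ k xk).
  move=> /(lt_le_trans ei); rewrite ltNge => /negP; apply.
  by rewrite ler_piMl// ltW.
have adj : adjacent j z z'.
  by move: ei; case: ifP => // _; rewrite seminorm0// ltNge (ltW e0).
have h2 n : (2 : R) ^- n <= 1 by rewrite invf_le1 ?exprn_gt0// exprn_ege1// ler1n.
have big : (size s + j <= S')%N.
  apply: hS'; apply: lt_le_trans ei _.
  apply: (@step_vector_le q B C w') => // [p|i y _]; [exact: (hC p).2|exact: (dom (i :: s) y)].
have zb k : `|node j z 0 k| <= rho' + 1.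
  rewrite leNgt; apply/negP => xk.
  have := @step_vector_le q (e / (D + 1)) C w' s j z z' hq hw' (ltW e'0) C0
    (fun p => (hC p).2) _.
  have hh i (y : 'rV[R]_d) : (forall k0, `|y 0 k0 - node j z 0 k0| <= 1) ->
      w' (size s).+1 * q (pderivs (i :: s) phi y) <= e / (D + 1) * eta y.
    move=> y1; apply: (hrho' (i :: s) y k).
    have := y1 k; have := ler_normB (y 0 k) (y 0 k - node j z 0 k).
    by rewrite opprB addrC subrK; lra.
  move=> /(_ hh) /(lt_le_trans ei); rewrite ltNge => /negP; apply.
  rewrite -/D; apply: (@le_trans _ _ (1 * (D * (e / (D + 1))))).
    by apply: (ler_wpM2r (mulr_ge0 D0 (ltW e'0)) (h2 _)).
  by rewrite mul1r mulrCA ler_piMr ?(ltW e0)// ler_pdivrMr// mul1r lerDl.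
split => /=; last first.
  exists j.+1; first by rewrite ltnS (leq_trans _ big)// leq_addl.
  move=> k; have /forallP/(_ k) zk := adj.
  have j1 : (4 : R) ^- j <= 1 by rewrite invf_le1// exprn_ege1// ler1n.
  have := zb k; have := ler_normD (node j z 0 k) (node j.+1 z' 0 k - node j z 0 k).
  by rewrite addrC subrK; lra.
split => /=; last by exists j; rewrite ?(leq_trans _ big)// leq_addl.
by split => /=; rewrite (leq_trans _ big)// ?leq_addr ?leq_addl.
Qed.

(** A functional is bounded on all the derivatives by its bounds on the net: the
    values along [node_below j x] telescope, with ratio [1 / 2]. *)
Lemma net_vector_dominates (y : dual F) (B : R) : 0 <= B ->
  (forall i, normc (dual_fun y (net_vector i)) <= B) ->
  dominated eta w (3 * Cb * B) (fun x => dual_fun y (phi x)).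
Proof.
move=> B0 hB s x; rewrite pderivs_dual//; set g := pderivs s phi; set k := size s.
have wk := factors_gt0 k hw.
pose a j := node j (node_below j x).
have a1 j l : `|a j 0 l - x 0 l| <= 4 ^- j.
  have /andP[h1 h2] := node_below_bounds j x l.
  have := p4 j; rewrite -invr_gt0 => h3.
  by rewrite ler_norml; apply/andP; split; rewrite /a; lra.
have eta_a j : eta (a j) <= Cb * eta x.
  apply: eta_box => l; apply: le_trans (a1 j l) _.
  by rewrite invf_le1// exprn_ege1// ler1n.
have p2 n : 0 < (2 : R) ^+ n by rewrite exprn_gt0.
have p21 n : (1 : R) <= 2 ^+ n by rewrite exprn_ege1// ler1n.
have coef j (v : F) : normc (dual_fun y ((node_coef s j (node_below j x))%:C *: v)) <= B ->
    w k * normc (dual_fun y v) <= 2 ^- j * (B * (Cb * eta x)).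
  rewrite dualZ ComplexField.Normc.normcM normc_real ger0_norm ?node_coef_ge0// => h.
  rewrite ler_pdivlMl//; apply: (@le_trans _ _ (B * eta (a j))); last by rewrite ler_wpM2l.
  rewrite -ler_pdivrMr//; apply: le_trans h; rewrite /node_coef -/k -/(a j).
  have -> : 2 ^+ j * (w k * normc (dual_fun y v)) / eta (a j) =
    1 * (2 ^+ j * (w k / eta (a j)) * normc (dual_fun y v)) by ring.
  rewrite -!mulrA ler_wpM2r// !mulr_ge0 ?invr_ge0 ?normc_ge0 ?(ltW wk) ?(ltW (p2 j))//.
  exact: ltW.
have base : w k * normc (dual_fun y (g (a 0%N))) <= B * (Cb * eta x).
  by have := coef 0%N _ (hB (inl (s, node_below 0 x))); rewrite expr0 invr1 mul1r.
have step j : w k * normc (dual_fun y (g (a j.+1) - g (a j))) <= 2 ^- j * (B * (Cb * eta x)).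
  apply: coef; have := hB (inr (s, j, node_below j x, node_below j.+1 x)).
  rewrite /= (_ : adjacent _ _ _ = true)//; apply/forallP => l; exact: node_below_step.
have E0 : 0 <= B * (Cb * eta x) by rewrite !mulr_ge0// ltW.
have tel j : w k * normc (dual_fun y (g (a j))) <=
    (1 + \sum_(i < j) 2 ^- i) * (B * (Cb * eta x)).
  elim: j => [|j IH]; first by rewrite big_ord0 addr0 mul1r.
  rewrite big_ord_recr /= addrA mulrDl.
  apply: le_trans (lerD IH (step j)); rewrite -mulrDr ler_wpM2l ?(ltW wk)//.
  have := lin_D (dual_linear y) (g (a j)) (g (a j.+1) - g (a j)); rewrite subrKC => ->.
  exact: le_normcD.
have bnd j : w k * normc (dual_fun y (g (a j))) <= 3 * Cb * B * eta x.
  apply: le_trans (tel j) _; have -> : 3 * Cb * B * eta x = (1 + 2) * (B * (Cb * eta x)) by ring.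
  rewrite ler_wpM2r// lerD2l.
  have -> : \sum_(i < j) (2 : R) ^- i = 2 * \sum_(i < j) 2 ^- i.+1.
    rewrite mulr_sumr; apply: eq_bigr => i _; rewrite exprS invfM mulrA divff ?mul1r//.
  by rewrite ler_piMr// sum_geometric_half.
apply/ler_addgt0Pl => e e0; have ek : 0 < e / w k by rewrite divr_gt0.
have cg : continuous (fun z : 'rV[R]_d => normc (dual_fun y (g z))).
  move=> z; apply: (@continuous_comp _ _ _ g (fun v => normc (dual_fun y v))).
    exact: sphi.1.
  exact: dual_fun_normc_continuous.
have /cvgrPdist_lt/(_ _ ek) := cg x; rewrite near_simpl => /nbhs_ballP[r /= r0 hr].
have [j jr] : exists j, (4 : R) ^- j < r.
  exists (Num.bound r^-1); rewrite invf_plt ?posrE//.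
  apply: lt_le_trans (archi_boundP _) _; first by rewrite invr_ge0 ltW.
  by rewrite -natrX ler_nat ltnW// ltn_expl.
have /hr /= : ball x r (a j).
  split=> // i l; rewrite (ord1 i) /ball /= distrC; exact: le_lt_trans (a1 j l) jr.
move=> /ltW h; have h' : normc (dual_fun y (g x)) <= normc (dual_fun y (g (a j))) + e / w k.
  rewrite -lerBlDl; exact: le_trans (ler_norm _) h.
apply: le_trans (ler_wpM2l (ltW wk) h') _; rewrite mulrDr mulrCA divff ?mulr1 ?gt_eqF//.
by rewrite addrC lerD2l.
Qed.

End dyadic_nets.

(** * The isomorphism *)

Section seminormed_maps.
Variables (R : realType) (V V' : lmodType R[i]).
Variables (P : set (V -> R)) (P' : set (V' -> R)).
Variables (hP : P `<=` @seminorm R V) (hP' : P' `<=` @seminorm R V').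

Lemma seminormed_continuous (T : seminormed hP -> seminormed hP') :
  (forall p', P' p' -> exists2 p, P p & exists2 C : R, 0 <= C &
     forall x y, p' (T x - T y) <= C * p (x - y)) -> continuous T.
Proof.
move=> hT x U [Q [e [finQ QP e0 sub]]].
suff h : \forall y \near x, forall p', Q p' -> p' (T y - T x) < e.
  by apply: (@filterS _ (nbhs x) _ _ _ _ h) => y hy; apply: sub.
apply: (near_finite (FG := nbhs_filter x) (P := fun p' y => p' (T y - T x) < e) finQ) => p' /QP Pp'.
have [p Pp [C C0 hC]] := hT p' Pp'.
have C1 : 0 < C + 1 by rewrite ltr_wpDl.
exists [set p], (e / (C + 1)); split => //; first by move=> _ ->.
  exact: divr_gt0.
move=> y /(_ p erefl) yx; apply: le_lt_trans (hC y x) _.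
have p0 : 0 <= p (y - x) := seminorm_ge0 _ (hP Pp).
apply: (@le_lt_trans _ _ ((C + 1) * p (y - x))); first by rewrite ler_wpM2r// lerDl.
by rewrite mulrC -ltr_pdivlMr.
Qed.

End seminormed_maps.

Section isomorphism.
Variables (R : realType) (d : nat) (c : um_class) (M : nat -> {posnum R}).
Variables (eta : cweight R d) (F : lcsType R[i]).
Notation E := (bdot M eta c).
Notation Ec := (bdot_carrier M eta c).
Notation V := (vbdot_carrier c M eta F).
Notation e_ j := (delta_mx 0 j : 'rV[R]_d).
Let eta0 x : 0 < eta x := cweight_gt0 eta x.
Hypothesis hPD : forall p : E -> R, bdot_seminorms p -> exists2 w, factors c M w &
  exists2 C : R, 0 <= C & forall (f : Ec) B, 0 <= B ->
    dominated eta w B (subval f) -> p f <= C * B.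
Hypothesis hSH : forall w (a : R), factors c M w -> 1 <= a ->
  exists2 w', factors c M w' & exists2 C : R, 0 <= C &
    forall p, a ^+ p * w p <= w' p /\ a ^+ p * w p <= C * w' p.+1.
Variable Cb : R.
Hypothesis Cb0 : 0 < Cb.
Hypothesis eta_box : forall x y : 'rV[R]_d,
  (forall k, `|y 0 k - x 0 k| <= 1) -> eta y <= Cb * eta x.
Hypothesis Fc : seq_complete F.

Definition comp (phi : V) (y : dual F) : Ec :=
  Subspace _ (dual_comp_bdot y (subvalP phi)).

Lemma vbdot_smooth (phi : V) : smooth (subval phi).
Proof. by case: (subvalP phi). Qed.

Lemma comp_linr (phi : V) (a : R[i]) (y z : dual F) :
  comp phi (a *: y + z) = a *: comp phi y + comp phi z.
Proof.
apply: subval_inj; apply/funext => x.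
by rewrite -[LHS]/(dual_fun (a *: y + z) (subval phi x)) dual_funD dual_funZ.
Qed.

Lemma comp_linl (phi psi : V) (a : R[i]) (y : dual F) :
  comp (a *: phi + psi) y = a *: comp phi y + comp psi y.
Proof. by apply: subval_inj; apply/funext => x; exact: (dual_linear y). Qed.

Lemma dominating_net (phi : V) w (e : R) : factors c M w -> 0 < e ->
  exists (I : countType) (u : I -> F), null_family u /\
  exists2 e' : R, 0 < e' & forall y, (forall i, normc (dual_fun y (u i)) <= e') ->
    dominated eta w e (subval (comp phi y)).
Proof.
move=> hw e0; exists _, (net_vector eta (subval phi) w).
split; first exact: (net_vector_null hSH Cb0 eta_box (subvalP phi) hw).
have e'0 : 0 < e / (3 * Cb) by rewrite divr_gt0// mulr_gt0.
exists (e / (3 * Cb)) => // y hy.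
have := net_vector_dominates Cb0 eta_box (subvalP phi) hw (ltW e'0) hy.
by rewrite mulrC divfK// gt_eqF// mulr_gt0.
Qed.

Definition polar q : set (dual F) := [set y | forall v, normc (dual_fun y v) <= q v].

(** The functionals of the polar of [q] converge pointwise along an ultrafilter, and
    the pointwise convergence on a null family is uniform. *)
Lemma polar_image_compact (phi : V) q : cts_seminorm q ->
  compact [set g : E | exists2 y, polar q y & g = comp phi y].
Proof.
move=> hq; have [sq cq] := hq.
rewrite compact_ultra => U UU UK; have PU : ProperFilter U by apply: ultra_proper.
have ex (g : E) : exists y : dual F, (exists2 y, polar q y & g = comp phi y) ->
    polar q y /\ g = comp phi y.
  have [[y yq ->]|nk] := pselect (exists2 y, polar q y & g = comp phi y); first by exists y.
  by exists 0.
have [Y hY] := choice ex.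
have lim v : exists l : R[i], forall e : R, 0 < e ->
    \forall g \near U, normc (dual_fun (Y g) v - l) < e.
  apply: (@ultra_cvg_complex R E U UU (fun g => dual_fun (Y g) v) (q v)).
  by apply: (@filterS _ U _ _ _ _ UK) => g /hY[h _]; exact: h.
have [l hl] := choice lim.
have lin : linear (l : F -> R[i]^o).
  move=> a v v'; apply/eqP; rewrite -subr_eq0 -normc_eq0.
  rewrite eq_le normc_ge0 andbT.
  apply: (@ultra_lim_le R E U UU (fun=> 0)); last first.
    by apply: (@filterS _ U _ setT _ _ filterT) => g _; rewrite ComplexField.Normc.normc0.
  move=> e e0; have b0 : 0 < normc a + 2 by rewrite ltr_wpDl// normc_ge0.
  have e'0 : 0 < e / (normc a + 2) by rewrite divr_gt0.
  apply: (@filterS3 _ U _ _ _ _ _ _ (hl (a *: v + v') _ e'0) (hl v _ e'0) (hl v' _ e'0)).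
  move=> g h1 h2 h3; set A := l _ in h1 *; set B := l v in h2 *; set D := l v' in h3 *.
  rewrite (dual_linear (Y g)) in h1; set z := dual_fun (Y g) v in h1 h2.
  set z' := dual_fun (Y g) v' in h1 h3.
  have -> : 0 - (A - (a *: (B : R[i]^o) + D)) = (a *: (z : R[i]^o) + z' - A) - a * (z - B) - (z' - D).
    rewrite -![_ *: _]/(_ * _); ring.
  apply: le_lt_trans (le_normcD _ _) _; rewrite normcN.
  apply: (@le_lt_trans _ _ (normc (a *: (z : R[i]^o) + z' - A) + normc a * normc (z - B) +
      normc (z' - D))).
    rewrite lerD2r; apply: le_trans (le_normcD _ _) _.
    by rewrite normcN ComplexField.Normc.normcM.
  have -> : e = e / (normc a + 2) + normc a * (e / (normc a + 2)) + e / (normc a + 2).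
    by field; rewrite gt_eqF.
  rewrite ltrD// ltr_leD// ler_wpM2l ?normc_ge0//; exact: ltW.
have lq v : normc (l v) <= q v.
  apply: (ultra_lim_le UU (hl v)).
  by apply: (@filterS _ U _ _ _ _ UK) => g /hY[h _]; exact: h.
have [y yl] := dual_of_seminorm lin cq sq lq.
exists (comp phi y); split; first by exists y => // v; rewrite yl.
move=> W /nbhs_untranslate /(nbhs0_bdot hPD)[w hw [e e0 hW]].
have [I [u [nu [e' e'0 hu]]]] := dominating_net phi hw e0.
have e20 : 0 < e' / 2 by rewrite divr_gt0.
have h : \forall g \near U, forall i, [set i | e' / 2 < q (u i)] i ->
    normc (dual_fun (Y g) (u i) - l (u i)) < e'.
  by apply: (near_finite (FG := PU) (nu q _ hq e20)) => i _; exact: hl.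
apply: (@filterS2 _ U _ _ _ _ _ h UK) => g hg /hY[Yq gE].
have yq v : normc (dual_fun y v) <= q v by rewrite yl.
have gE' : g - comp phi y = comp phi (Y g - y).
  have h1 := comp_linr phi (-1) y (Y g); rewrite !scaleN1r in h1.
  by rewrite {1}gE [LHS]addrC -h1 [- y + _]addrC.
suff hd : dominated eta w e (subval (g - comp phi y : Ec)).
  have h2 : W ((g - comp phi y : E) + comp phi y) := hW _ hd.
  by rewrite subrK in h2.
rewrite gE'; apply: hu => i.
have yE : dual_fun (Y g - y) (u i) = dual_fun (Y g) (u i) - dual_fun y (u i) by [].
have [hi|hi] := ltP (e' / 2) (q (u i)); first by rewrite yE yl; exact/ltW/hg.
rewrite yE; apply: le_trans (le_normcD _ _) _; rewrite normcN [leRHS]splitr.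
by rewrite lerD// (le_trans _ hi).
Qed.

Definition pairing (phi : V) : dual_c E -> dual_c F -> R[i]^o :=
  fun f y => dual_fun (f : dual E) (comp phi (y : dual F) : E).

(** Uniformity over equicontinuous sets in one variable is continuity in the other, for
    the topology of a compact disc. *)
Lemma pairing_eps phi : is_eps (pairing phi).
Proof.
split.
- move=> f a y z; rewrite /pairing.
  have -> : comp phi (a *: y + z : dual F) = a *: comp phi y + comp phi z := comp_linr _ _ _ _.
  exact: (dual_linear (f : dual E)).
- move=> y a f g; rewrite /pairing.
  by rewrite -[LHS]/(dual_fun (a *: (f : dual E) + g) (comp phi y)) dual_funD dual_funZ.
- split=> [A eqA W /nbhs0_normcP[e e0 eW]|B eqB W /nbhs0_normcP[e e0 eW]].
    have [q [sq cq hA]] := equicontinuous_seminorm eqA.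
    have [w hw [e1 e10 hq]] := nbhs0_bdot hPD (seminorm_near0 sq cq e0).
    have [I [u [nu [e' e'0 hu]]]] := dominating_net phi hw e10.
    have [K [cK vK bK Ku]] := null_disc Fc nu.
    apply: (@filterS _ (nbhs (0 : dual_c F)) _ _ _ _ (dual_c_nbhs0 cK vK bK e'0)) => y hy f Af.
    apply: eW; apply: le_lt_trans (hA f Af _) _; apply: hq; apply: hu => i.
    exact: hy.
  have [q [sq cq hB]] := equicontinuous_seminorm eqB.
  set K := [set g : E | exists2 y, polar q y & g = comp phi y].
  have cK : compact K by apply: polar_image_compact.
  have pq (a b : R[i]) (y z : dual F) : normc a + normc b <= 1 -> polar q y -> polar q z ->
      polar q (a *: y + b *: z).
    move=> ab yq zq v; rewrite dual_funD !dual_funZ; apply: le_trans (le_normcD _ _) _.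
    rewrite !ComplexField.Normc.normcM.
    apply: (@le_trans _ _ ((normc a + normc b) * q v)).
      by rewrite mulrDl lerD// ler_wpM2l ?normc_ge0.
    by rewrite ler_piMl// seminorm_ge0.
  have vK : convex_set K.
    apply: convex_of_combinations => t _ _ /andP[t0 t1] [y yq ->] [z zq ->].
    exists (t%:C *: y + (1 - t)%:C *: z).
      by apply: pq => //; rewrite !normc_real !ger0_norm ?subr_ge0// addrC subrK.
    apply: subval_inj; apply/funext => x.
    rewrite -[RHS]/(dual_fun (t%:C *: y + (1 - t)%:C *: z) (subval phi x)).
    by rewrite dual_funD !dual_funZ.
  have bK : circled K.
    move=> a _ a1 [y yq ->]; exists (a *: y + 0 *: y).
      by apply: pq => //; rewrite ComplexField.Normc.normc0 addr0.
    apply: subval_inj; apply/funext => x.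
    rewrite -[RHS]/(dual_fun (a *: y + 0 *: y) (subval phi x)).
    by rewrite dual_funD !dual_funZ scale0r addr0.
  have e20 : 0 < e / 2 by rewrite divr_gt0.
  apply: (@filterS _ (nbhs (0 : dual_c E)) _ _ _ _ (dual_c_nbhs0 cK vK bK e20)) => f hf y By.
  apply: eW; apply: (@le_lt_trans _ _ (e / 2)).
    by apply: hf; exists y => // v; exact: hB.
  by rewrite ltr_pdivrMr// ltr_pMr// ltr1n.
Qed.

Definition pairing_map (phi : vbdot c M eta F) : eps_product E F :=
  Subspace _ (pairing_eps phi).

Lemma pairing_map_linear : linear pairing_map.
Proof.
move=> a phi psi; apply: subval_inj; apply/funext => f; apply/funext => y.
rewrite /= /pairing -[LHS]/(dual_fun (f : dual E) (comp (a *: (phi : V) + psi) y)).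
by rewrite comp_linl; exact: (dual_linear (f : dual E)).
Qed.

Section inverse.
Variable b : eps_carrier E F.
Let form_linr f : linear (eps_fun b f). Proof. by have [h _ _] := subvalP b; exact: h. Qed.
Let form_linl y : linear ((eps_fun b)^~ y). Proof. by have [_ h _] := subvalP b; exact: h. Qed.
Let form_hypocontinuous : hypocontinuous (eps_fun b). Proof. by have [_ _ h] := subvalP b. Qed.

(** The form restricted to a functional on the scalar space is continuous on the dual
    of [F]. *)
Lemma representation_ex s x : exists k : F, forall y : dual F,
  eps_fun b (evald M eta c s x) y = dual_fun y k.
Proof.
apply: dual_c_evaluation (form_linr _) _ => W W0.
have := form_hypocontinuous.1 _ (equicontinuous_set1 (evald M eta c s x)) W W0.
by apply: (@filterS _ (nbhs (0 : dual_c F))) => y; apply.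
Qed.

Definition representation s x : F := projT1 (cid (representation_ex s x)).

Lemma representationE s x (y : dual F) :
  eps_fun b (evald M eta c s x) y = dual_fun y (representation s x).
Proof. by rewrite /representation; case: cid => k hk; exact: hk. Qed.

Lemma polar_near0 q (e : R) : cts_seminorm q -> 0 < e ->
  nbhs (0 : dual_c E) [set f : dual_c E | forall y, polar q y -> normc (eps_fun b f y) < e].
Proof.
move=> [sq cq] e0.
have W0 : nbhs (0 : R[i]^o) [set z : R[i]^o | normc z < e] by apply/nbhs0_normcP; exists e.
exact: form_hypocontinuous.2 _ (seminorm_equicontinuous sq cq) _ W0.
Qed.

(** A seminorm is the supremum of the functionals of its polar, on which the form is
    small as soon as its first argument is near 0. *)
Lemma seminorm_via_polar q (v : F) (f : dual_c E) (e : R) : cts_seminorm q ->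
  (forall y : dual F, dual_fun y v = eps_fun b f y) ->
  (forall y, polar q y -> normc (eps_fun b f y) <= e) -> q v <= e.
Proof.
move=> [sq cq] vE fe; have [y [yq yv]] := dual_norming v sq cq.
have := fe y yq; rewrite -vE yv normc_real ger0_norm//.
exact: seminorm_ge0.
Qed.

Lemma representation_continuous s : continuous (representation s).
Proof.
move=> x; apply: (lcs_cvgP (FG := nbhs_filter x)) => q hq e e0.
have e20 : 0 < e / 2 by rewrite divr_gt0.
have := evaluation_cvg Cb0 eta_box s x (polar_near0 hq e20).
apply: (@filterS _ (nbhs x)) => z hz; apply: (@le_lt_trans _ _ (e / 2)); last first.
  by rewrite ltr_pdivrMr// ltr_pMr// ltr1n.
apply: (seminorm_via_polar (f := evald M eta c s z - evald M eta c s x)) => // [y|y yq].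
  rewrite (lin_B (dual_linear y)) -!representationE.
  by rewrite -(lin_B (form_linl y)).
exact/ltW/hz.
Qed.

(** The difference quotients of the evaluation functionals converge in the dual, and a
    seminorm sees the form only on its polar. *)
Lemma representation_derivative s j x :
  diff_quot (representation s) j x @ 0^' --> representation (j :: s) x.
Proof.
apply: lcs_cvgP => q hq e e0; have e20 : 0 < e / 2 by rewrite divr_gt0.
have := evaluation_derivative Cb0 eta_box s j x (polar_near0 hq e20).
apply: filterS => t ht; apply: (@le_lt_trans _ _ (e / 2)); last first.
  by rewrite ltr_pdivrMr// ltr_pMr// ltr1n.
apply: (seminorm_via_polar (f := (t^-1)%:C *: (evald M eta c s (x + t *: e_ j) -
    evald M eta c s x) - evald M eta c (j :: s) x)) => // [y|y yq].
  rewrite /diff_quot (lin_B (dual_linear y)) dualZ (lin_B (dual_linear y)) -!representationE.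
  by rewrite -(lin_B (form_linl y)) -(lin_Z (form_linl y)) -(lin_B (form_linl y)).
exact/ltW/ht.
Qed.

Lemma representation_pderivs s : pderivs s (representation [::]) = representation s.
Proof.
elim: s => // j s IH; rewrite /= -/(pderivs _ _) IH; apply/funext => x.
exact/pderivE/representation_derivative.
Qed.

Lemma representation_smooth : smooth (representation [::]).
Proof.
split=> s; rewrite representation_pderivs; first exact: representation_continuous.
by move=> j x; exists (representation (j :: s) x); exact: representation_derivative.
Qed.

(** Hypocontinuity bounds the form on products of equicontinuous sets. *)
Lemma eps_bounded (A : set (dual E)) q : equicontinuous_dual A -> cts_seminorm q ->
  exists m : R, forall f y, A f -> polar q y -> normc (eps_fun b f y) <= m.
Proof.
move=> eqA [sq cq].
have W0 : nbhs (0 : R[i]^o) [set z : R[i]^o | normc z < 1] by apply/nbhs0_normcP; exists 1.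
have [Q [e [finQ QP e0 sub]]] := form_hypocontinuous.1 A eqA _ W0.
have [K [cK _ _ _ hK]] := compact_disc_absorbs finQ QP e0.
have [m hm] := equicontinuous_compact_ub (seminorm_equicontinuous sq cq) cK.
pose m' := Num.max 1 m.
have m'0 : 0 < m' by rewrite lt_max ltr01.
exists m' => f y Af yq.
have h : normc (eps_fun b f ((m'^-1)%:C *: (y : dual_c F))) < 1.
  apply: (sub _ _ f Af) => p Qp; rewrite subr0; apply: hK Qp => k Kk.
  rewrite dual_funZ ComplexField.Normc.normcM normc_real gtr0_norm ?invr_gt0//.
  by rewrite ler_pdivrMl// mulr1 le_max (hm y k yq Kk) orbT.
move: h; rewrite (lin_Z (form_linr f)) ComplexField.Normc.normcM normc_real.
by rewrite gtr0_norm ?invr_gt0// ltr_pdivrMl// mulr1 => /ltW.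
Qed.

Lemma norming_form w s x (y : dual F) : factors c M w ->
  dual_fun y ((w (size s) / eta x)%:C *: representation s x) =
  eps_fun b ((w (size s) / eta x)%:C *: evald M eta c s x) y.
Proof. by move=> hw; rewrite dualZ -representationE (lin_Z (form_linl y)). Qed.

Lemma representation_bound w q (m : R) s x : factors c M w -> cts_seminorm q ->
  (forall y, polar q y ->
     normc (eps_fun b ((w (size s) / eta x)%:C *: evald M eta c s x) y) <= m) ->
  w (size s) * q (representation s x) <= m * eta x.
Proof.
move=> hw hq hm; rewrite -ler_pdivrMr// mulrAC.
have := seminorm_via_polar hq (fun y => norming_form s x y hw) hm.
rewrite hq.1.2 normc_real ger0_norm//.
by rewrite divr_ge0 ?(factors_ge0 _ hw)// ltW.
Qed.

Lemma representation_vbdot : is_vbdot c M eta (representation [::]).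
Proof.
split; first exact: representation_smooth.
  move=> w q hw hq; have [m hm] := eps_bounded (norming_equicontinuous (eta := eta) hw) hq.
  exists m => _ [[alpha x] _ <-]; apply: (scaled_D_le hw hq.1).
  rewrite -size_mseq representation_pderivs; apply: representation_bound => // y yq.
  by apply: hm => //; exists (mseq alpha), x.
move=> e w q e0 hw hq.
have [rho hrho] := norming_decay hSH hw (polar_near0 hq e0).
pose K := [set v : 'rV[R]_d | forall i, `[- rho, rho]%classic (v ord0 i)].
exists K; split.
  apply: (@rV_compact _ _ (fun=> `[- rho, rho]%classic)) => _; exact: segment_compact.
move=> alpha x nKx; have [k xk] : exists k, rho < `|x 0 k|.
  apply/not_existsP => nk; apply: nKx => k /=.
  by rewrite in_itv /= -ler_norml leNgt; apply/negP; exact: nk.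
apply: (scaled_D_le hw hq.1).
rewrite -size_mseq representation_pderivs; apply: representation_bound => // y yq.
exact/ltW/(hrho (mseq alpha) x k xk).
Qed.

End inverse.

Definition unpairing (b : eps_product E F) : vbdot c M eta F :=
  Subspace _ (representation_vbdot b).

Lemma pairing_mapK : cancel pairing_map unpairing.
Proof.
move=> phi; apply: subval_inj; apply/funext => x; apply: dual_separated => y.
exact/esym/(representationE (pairing_map phi) [::] x y).
Qed.

(** For a fixed [y], the form is an evaluation in its first argument as well; the
    evaluations at points then identify the function. *)
Lemma unpairingK : cancel unpairing pairing_map.
Proof.
move=> b; apply: subval_inj; apply/funext => f; apply/funext => y.
have [_ linl [_ hyp]] := subvalP b.
have [|k hk] := @dual_c_evaluation R E ((eps_fun b)^~ y) (linl y).
  move=> W W0; have := hyp _ (equicontinuous_set1 (y : dual F)) W W0.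
  by apply: (@filterS _ (nbhs (0 : dual_c E))) => g; apply.
have kE : (k : Ec) = comp (unpairing b) y.
  apply: subval_inj; apply/funext => x.
  have := hk (evald M eta c [::] x); rewrite representationE => h.
  exact: esym h.
have := hk f; rewrite kE => h; exact: esym h.
Qed.

Lemma pairing_map_continuous : continuous pairing_map.
Proof.
apply: seminormed_continuous => _ [A [B [eqA eqB ->]]].
have [q [sq cq hq]] := equicontinuous_seminorm eqA.
have [w hw [e e0 hwe]] := nbhs0_bdot hPD (seminorm_near0 sq cq ltr01).
have [q' [sq' cq' hB]] := equicontinuous_seminorm eqB.
exists (fun f : V => vnorm eta q' w (subval f)); first by exists w, q'.
exists e^-1; first by rewrite invr_ge0 ltW.
move=> phi psi; rewrite -(lin_B pairing_map_linear).
set chi : V := (phi : V) - psi.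
have dom y : B y -> dominated eta w (vnorm eta q' w (subval chi)) (subval (comp chi y)).
  move=> By; apply: dual_dominated (vbdot_smooth chi) _ (hB y By) _.
    by move=> p; exact: factors_ge0 hw.
  exact: vnorm_dominated hw (conj sq' cq') (subvalP chi).
set m := vnorm _ _ _ _ in dom *.
have m0 : 0 <= m.
  have := vnorm_dominated hw (conj sq' cq') (subvalP chi) [::] 0 => h.
  rewrite -(pmulr_lge0 _ (eta0 0)); apply: le_trans h.
  by rewrite mulr_ge0 ?(factors_ge0 _ hw)// seminorm_ge0.
have [->|ne] := eqVneq (A `*` B) set0.
  by rewrite image_set0 sup0 mulr_ge0// invr_ge0 ltW.
apply: ge_sup; first by apply/image_nonempty/set0P.
move=> _ [[f y] [/= Af By] <-].
change (normc (dual_fun (f : dual E) (comp chi y : E)) <= e^-1 * m).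
apply: le_trans (hq f Af _) _; apply/ler_addgt0Pl => r r0.
have mr : 0 < m + e * r by rewrite ltr_wpDl// mulr_gt0.
have t0 : 0 < e / (m + e * r) by rewrite divr_gt0.
have h : dominated eta w e (subval ((e / (m + e * r))%:C *: comp chi y : Ec)).
  move=> s x; rewrite pderivs_subZ ComplexField.Normc.normcM normc_real gtr0_norm// mulrCA.
  apply: le_trans (ler_wpM2l (ltW t0) (dom y By s x)) _.
  rewrite mulrA ler_wpM2r ?(ltW (eta0 x))// mulrAC ler_pdivrMr// ler_wpM2l ?(ltW e0)//.
  by rewrite lerDl ltW// mulr_gt0.
have := hwe _ h; rewrite /= sq.2 normc_real gtr0_norm// => /ltW.
rewrite mulrAC ler_pdivrMr// mul1r mulrC -ler_pdivlMr// => /le_trans; apply.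
rewrite le_eqVlt; apply/orP; left; apply/eqP; field.
by rewrite gt_eqF.
Qed.

Lemma unpairing_continuous : continuous unpairing.
Proof.
apply: seminormed_continuous => _ [w [q [hw hq ->]]].
exists (fun b : eps_carrier E F => sup [set normc (eps_fun b z.1 z.2) |
    z in norming (M := M) (eta := eta) (c := c) w `*` polar q]).
  exists (norming (M := M) (eta := eta) (c := c) w), (polar q); split => //.
    exact: norming_equicontinuous.
  by case: hq => sq cq; exact: seminorm_equicontinuous.
exists 1 => // b b'; rewrite mul1r.
have -> : (unpairing b - unpairing b' : V) = unpairing (b - b').
  apply: (can_inj pairing_mapK); rewrite unpairingK.
  by rewrite (lin_B pairing_map_linear) !unpairingK.
apply: (vnorm_le hw hq.1).
move=> s x; rewrite representation_pderivs; apply: representation_bound => // y yq.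
apply: ub_le_sup; last by exists ((w (size s) / eta x)%:C *: evald M eta c s x, y) => //; split => //; exists s, x.
have [m hm] := eps_bounded (b - b') (norming_equicontinuous (eta := eta) hw) hq.
by exists m => _ [[f z] [/= Af zq] <-]; exact: hm.
Qed.

End isomorphism.

Theorem proposition4p9 (R : realType) (d : nat) (c : um_class)
    (M A : nat -> {posnum R}) (eta : cweight R d) (F : lcsType R[i]) :
  (0 < d)%N ->
  (M 0)%:num = 1 -> (M 1)%:num = 1 -> (A 0)%:num = 1 -> (A 1)%:num = 1 ->
  cond_M1 M -> cond_M1 A ->
  (exists c0 H : R, [/\ 1 <= c0, 1 <= H, cond_M2 c0 H M & cond_M2 c0 H A]) ->
  cond_M5 M -> cond_M6 A ->
  class_dagger c A eta ->
  seq_complete F ->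
  lc_isomorphic (vbdot c M eta F) (eps_product (bdot M eta c) F).
Proof.
move=> _ M0 M1 _ _ logconvex _ hM2 hM5 hA hdag Fc.
have hM2' : exists c0 H : R, [/\ 1 <= c0, 1 <= H & cond_M2 c0 H M].
  by have [c0 [H [c01 H1 h _]]] := hM2; exists c0, H.
have hPD := fun p => @projective_description R d M A eta M0 M1 logconvex hM2' hM5 hA c p hdag.
have hSH := fun w a => @factors_shift R M c w a M1 hM2'.
have [Cb [Cb0 eta_box]] := weight_box hA hdag.
pose lin := GRing.isLinear.Build _ _ _ _ _ (pairing_map_linear hPD hSH Cb0 eta_box Fc).
pose T : {linear vbdot c M eta F -> eps_product (bdot M eta c) F} :=
  HB.pack (pairing_map hPD hSH Cb0 eta_box Fc) lin.
exists T, (unpairing hSH Cb0 eta_box (F := F)); split.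
- exact: pairing_mapK.
- exact: unpairingK.
- exact: pairing_map_continuous.
- exact: unpairing_continuous.
Qed.
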